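(* Let $n\ge 2$ and $T>0$, and assume that the coefficient functions $a_i,b_i,c_i,\lambda_i,d_i,K_i$ ($1\le i\le n$), $q_i$ ($1\le i\le n-1$), $\hat q_1,\hat q_2$ and $y_i$ ($1\le i\le n$) satisfy hypotheses (H1), (H2) on $\Omega_T=\mathbb{R}\times[0,T]$, and (H3), as listed in the context. Let $\phi=(\phi_1,\dots,\phi_n)\in L^2(\mathbb{R})^n$. Then there is $T'\in(0,T]$ such that the initial value problem $$u_t+G(t)u=f(t,u),\quad t>0,\qquad u(0)=\phi,$$ has a unique mild solution $u=(u_1,\dots,u_n)\in C([0,T'],L^2(\mathbb{R})^n)$, i.e. there is exactly one $u\in C([0,T'],L^2(\mathbb{R})^n)$ with $$u(t)=U(t,0)\phi+\int_0^tU(t,\tau)f(\tau,u(\tau))\,d\tau,\qquad t\in[0,T'].$$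
   Context: Norm: $\|\psi\|=\max_{1\le i\le n}\|\psi_i\|_{L^2(\mathbb{R})}$ on $L^2(\mathbb{R})^n$. Coefficients: $a_i,b_i,c_i,\lambda_i,d_i,K_i$ ($1\le i\le n$), $q_i$ ($1\le i\le n-1$), $\hat q_1,\hat q_2$ are nonnegative real functions of $x\in\mathbb{R}$; $y_i=y_i(x,t)$ is a given real function; $u_e\in\mathbb{R}$ and $E>0$ are constants; $g(\theta)=e^{-E/\theta}$ for $\theta>0$ and $g(\theta)=0$ for $\theta\le 0$. Hypotheses. (H1): $a_i,b_i,c_i,\lambda_i$ are twice differentiable; there are constants $0<k_1<k_2$ with $a_i(x),\lambda_i(x)\in[k_1,k_2]$ and $b_i(x),c_i(x)\in[0,k_2]$ for all $x\in\mathbb{R}$; and the derivatives of orders $0,1,2$ of $a_i,b_i,c_i,\lambda_i$ belong to $L^\infty(\mathbb{R})$. (H2): $y_i\ge 0$; (i) $y_i$ is twice differentiable in $x$ and differentiable in $t$ on $\Omega_T=\mathbb{R}\times[0,T]$, with $y_i,(y_i)_x,(y_i)_{xx},(y_i)_t\in L^\infty(\Omega_T)$ and $\|y_i\|_{L^\infty(\Omega_T)}\le k_3$ for a constant $k_3>0$; (ii) $t\mapsto (y_i)_t(x,t)$ is integrable on $[0,T]$ for all $x\in\mathbb{R}$; (iii) $(y_i)_t$ is twice differentiable in $x$, $(y_i)_{tx}\in L^\infty(\Omega_T)$, and $x\mapsto (y_i)_{txx}(x,t)$ is in $L^2(\mathbb{R})$ for all $t\in[0,T]$. (H3): $d_i,q_i,K_i\in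 L^\infty(\mathbb{R})$ and $\hat q_1,\hat q_2\in L^2(\mathbb{R})$. Operator: $G(t)u=(G_1(t)u_1,\dots,G_n(t)u_n)$, where $G_i(t)$ is the operator in $L^2(\mathbb{R})$ with domain $H^2(\mathbb{R})$ given by $G_i(t)\psi=-\alpha_i(\cdot,t)\psi''+\beta_i(\cdot,t)\psi'$, with $\alpha_i=\dfrac{\lambda_i}{a_i+b_iy_i}$, $\beta_i=\dfrac{c_i}{a_i+b_iy_i}$. Source: $f(t,w)(x)=(f_1(x,t,w(x)),\dots,f_n(x,t,w(x)))$, where, with $D_i=a_i(x)+b_i(x)y_i(x,t)$ and $w=(w_1,\dots,w_n)$, $f_1=\frac1{D_1}\big[-(c_1)_xw_1+(K_1b_1w_1+d_1)y_1g(w_1)+q_1(w_2-w_1)-\hat q_1(w_1-u_e)\big]$; $f_i=\frac1{D_i}\big[-(c_i)_xw_i+(K_ib_iw_i+d_i)y_ig(w_i)-q_{i-1}(w_i-w_{i-1})+q_i(w_{i+1}-w_i)\big]$ for $2\le i\le n-1$; $f_n=\frac1{D_n}\big[-(c_n)_xw_n+(K_nb_nw_n+d_n)y_ng(w_n)-q_{n-1}(w_n-w_{n-1})-\hat q_2(w_n-u_e)\big]$. Evolution operator: $U(t,s)=(U_1(t,s),\dots,U_n(t,s))$ (acting componentwise), $0\le s\le t\le T$, where $U_i$ is the evolution operator associated (in Kato's sense) with $\{G_i(t)\}$: the unique family $U_i(t,s)\in\mathcal{B}(L^2(\mathbb{R}))$, strongly continuous in $(t,s)$, with $U_i(t,t)=I$,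 $U_i(t,r)=U_i(t,s)U_i(s,r)$ for $r\le s\le t$, mapping $H^2(\mathbb{R})$ into itself and strongly continuous there, and such that for $\psi\in H^2(\mathbb{R})$, in $L^2(\mathbb{R})$, $\partial_tU_i(t,s)\psi=-G_i(t)U_i(t,s)\psi$ and $\partial_sU_i(t,s)\psi=U_i(t,s)G_i(s)\psi$. Under (H1) and (H2) it is known (earlier work) that this family exists, and that there is $\beta>0$ with $\|U(t,s)\psi\|\le e^{\beta t}\|\psi\|$ for all $\psi\in L^2(\mathbb{R})^n$ and $0\le s\le t\le T$. *)

(* Defs.v *)
From HB Require Import structures.
From mathcomp Require Import all_boot all_order all_algebra.
From mathcomp Require Import all_classical all_reals all_analysis.

Set Implicit Arguments.
Unset Strict Implicit.
Unset Printing Implicit Defensive.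
Import Order.TTheory GRing.Theory Num.Theory.
Import numFieldNormedType.Exports.

Local Open Scope classical_set_scope.
Local Open Scope ring_scope.

Section SeminormedCalculus.
Context {R : realType} {V : lmodType R}.
Variable nrm : V -> R.

Definition continuous_on {X : topologicalType} (A : set X) (h : X -> V) : Prop :=
  forall x, A x -> (fun y => nrm (h y - h x)) @ within A (nbhs x) --> (0 : R).

(* The points used in the difference quotient are taken in A, so that the
   derivative is one-sided at an end point of an interval A. *)
Definition has_deriv_on (A : set R) (h : R -> V) (t : R) (l : V) : Prop :=
  (fun s => nrm ((s - t)^-1 *: (h s - h t) - l)) @ within A t^' --> (0 : R).

Record simple_map := SimpleMap {
  sm_card : nat ;
  sm_set : 'I_sm_card -> set (measurableTypeR R) ;
  sm_val : 'I_sm_card -> V ;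
  sm_meas : forall j, measurable (sm_set j) }.

Definition sm_eval (s : simple_map) (x : R) : V :=
  \sum_(j < sm_card s) (\1_(sm_set j) x : R) *: sm_val j.

(* Only used for sets D of finite measure. *)
Definition sm_integral (D : set R) (s : simple_map) : V :=
  \sum_(j < sm_card s)
    fine (lebesgue_measure (D `&` @sm_set s j)) *: sm_val j.

(* h is Bochner integrable on D and v is its integral: h is the limit a.e. of
   simple functions s k (strong measurability), the integral of nrm (h - s k)
   tends to 0, and v is the limit of the integrals of the s k. *)
Definition is_bochner_integral (D : set R) (h : R -> V) (v : V) : Prop :=
  exists s : nat -> simple_map,
  [/\ {ae (@lebesgue_measure R), forall x, D x ->
        (fun k => nrm (h x - sm_eval (s k) x)) @ \oo --> (0 : R)},
      (fun k => \int[lebesgue_measure]_(x in D)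
          (nrm (h x - sm_eval (s k) x))%:E)%E @ \oo --> 0%E &
      (fun k => nrm (v - sm_integral D (s k))) @ \oo --> (0 : R)].

End SeminormedCalculus.

(* Square integrable functions. Elements of the Hilbert space L^2(R) are the
   classes of such functions for equality almost everywhere; a statement about
   classes is written below on representatives, with =L2 for equality. *)
Definition L2 (R : realType) := LfunType (@lebesgue_measure R) (lee1n 2).

Definition L2eq (R : realType) (f g : L2 R) : Prop :=
  ae_eq (@lebesgue_measure R) setT (f : R -> R) (g : R -> R).
Notation "f =L2 g" := (L2eq f g) (at level 70, no associativity).

Definition L2norm (R : realType) (f : L2 R) : R :=
  fine ('N[@lebesgue_measure R]_(2%:E)[EFin \o (f : R -> R)])%E.

Notation state R n := ('I_n -> L2 R).

Definition state_norm (R : realType) (n : nat) (w : state R n) : R :=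
  \big[Num.max/0]_(i < n) L2norm (w i).

Definition is_test_function (R : realType) (phi : R -> R) : Prop :=
  (forall k x, derivable (derive1n k phi) x 1) /\
  (exists M : R, forall x, M < `|x| -> phi x = 0).

Definition is_weak_deriv (R : realType) (f df : L2 R) : Prop :=
  forall phi : R -> R, is_test_function phi ->
    \int[lebesgue_measure]_x (f x * derive1 phi x) =
    - \int[lebesgue_measure]_x (df x * phi x).

Definition is_H2 (R : realType) (psi psi1 psi2 : L2 R) : Prop :=
  is_weak_deriv psi psi1 /\ is_weak_deriv psi1 psi2.

Definition in_H2 (R : realType) (psi : L2 R) : Prop :=
  exists psi1 psi2, is_H2 psi psi1 psi2.

(* Graph of the operator psi |-> - alpha psi'' + beta psi' in L^2 with domain
   H^2. *)
Definition is_G (R : realType) (alpha beta : R -> R) (psi chi : L2 R) : Prop :=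
  exists psi1 psi2, is_H2 psi psi1 psi2 /\
    {ae (@lebesgue_measure R), forall x,
       chi x = - alpha x * psi2 x + beta x * psi1 x}.

Definition triangle (R : realType) (T : R) : set (R * R) :=
  [set p | 0 <= p.2 /\ p.2 <= p.1 /\ p.1 <= T].

(* Kato's evolution operator of the family G(t), 0 <= t <= T. *)
Record is_evolution (R : realType) (T : R) (G : R -> L2 R -> L2 R -> Prop)
    (U : R -> R -> L2 R -> L2 R) : Prop := IsEvolution {
  evol_linear : forall t s, triangle T (t, s) ->
    forall (k : R) (psi chi : L2 R),
      U t s (k *: psi + chi) =L2 k *: U t s psi + U t s chi ;
  evol_bounded : forall t s, triangle T (t, s) ->
    exists C : R, forall psi, L2norm (U t s psi) <= C * L2norm psi ;
  evol_continuous : forall psi,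
    continuous_on (@L2norm R) (triangle T) (fun p => U p.1 p.2 psi) ;
  evol_id : forall (t : R) psi, 0 <= t <= T -> U t t psi =L2 psi ;
  evol_comp : forall (t s r : R) psi, 0 <= r -> r <= s -> s <= t -> t <= T ->
    U t r psi =L2 U t s (U s r psi) ;
  (* U t s maps H^2 into itself, and (t, s) |-> U t s psi is continuous for
     the norm of H^2 *)
  evol_H2 : forall psi, in_H2 psi ->
    exists V1 V2 : R -> R -> L2 R,
    [/\ forall t s, triangle T (t, s) -> is_H2 (U t s psi) (V1 t s) (V2 t s),
        continuous_on (@L2norm R) (triangle T) (fun p => V1 p.1 p.2) &
        continuous_on (@L2norm R) (triangle T) (fun p => V2 p.1 p.2)] ;
  evol_deriv_t : forall t s psi, triangle T (t, s) -> in_H2 psi ->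
    exists2 chi, G t (U t s psi) chi &
      has_deriv_on (@L2norm R) `[s, T] (fun t' => U t' s psi) t (- chi) ;
  evol_deriv_s : forall t s psi, triangle T (t, s) -> in_H2 psi ->
    exists2 chi, G s psi chi &
      has_deriv_on (@L2norm R) `[0, t] (fun s' => U t s' psi) s (U t s chi) }.

(* The layers are numbered from 0 to n - 1; q i couples the layers i and i.+1,
   and q at the last index is never used. *)
Record coefficients (R : realType) (n : nat) := Coefficients {
  ca : 'I_n -> R -> R ;
  cb : 'I_n -> R -> R ;
  cc : 'I_n -> R -> R ;
  clam : 'I_n -> R -> R ;
  cd : 'I_n -> R -> R ;
  cK : 'I_n -> R -> R ;
  cq : 'I_n -> R -> R ;
  cqhat1 : R -> R ;
  cqhat2 : R -> R ;
  cy : 'I_n -> R -> R -> R ;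
  cue : R ;
  cE : R }.

Definition coeff_nonneg (R : realType) (n : nat) (p : coefficients R n) : Prop :=
  (forall i (x : R), 0 <= ca p i x /\ 0 <= cb p i x /\ 0 <= cc p i x /\
     0 <= clam p i x /\ 0 <= cd p i x /\ 0 <= cK p i x) /\
  (forall (i : 'I_n) x, (i.+1 < n)%N -> 0 <= cq p i x) /\
  (forall x : R, 0 <= cqhat1 p x /\ 0 <= cqhat2 p x).

Definition Linf (R : realType) (h : R -> R) : Prop :=
  h \in Lfun (@lebesgue_measure R) +oo%E.

Definition strip (R : realType) (T : R) : set (R * R) :=
  setT `*` `[0, T].

Definition strip_fun (R : realType) (T : R) (h : R -> R -> R) :
    measurableTypeR R * measurableTypeR R -> R :=
  (fun p => h p.1 p.2) \_ (strip T).

(* L^infty(Omega_T), a function on Omega_T being extended by 0. *)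
Definition Linf_strip (R : realType) (T : R) (h : R -> R -> R) : Prop :=
  strip_fun T h \in Lfun (@lebesgue_measure R \x @lebesgue_measure R)%E +oo%E.

Definition Linf_strip_norm (R : realType) (T : R) (h : R -> R -> R) : \bar R :=
  ('N[(@lebesgue_measure R \x @lebesgue_measure R)]_+oo[EFin \o strip_fun T h])%E.

Definition twice_derivable (R : realType) (h : R -> R) : Prop :=
  forall x, derivable h x 1 /\ derivable (derive1 h) x 1.

Definition hypH1 (R : realType) (n : nat) (p : coefficients R n) : Prop :=
  (exists k1 k2 : R, 0 < k1 /\ k1 < k2 /\
     forall i (x : R), k1 <= ca p i x <= k2 /\ k1 <= clam p i x <= k2 /\
       0 <= cb p i x <= k2 /\ 0 <= cc p i x <= k2) /\
  (forall i, forall h, h = ca p i \/ h = cb p i \/ h = cc p i \/ h = clam p i ->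
     twice_derivable h /\ forall k, (k <= 2)%N -> Linf (derive1n k h)).

(* yt i is the derivative of y_i with respect to t on R x [0, T]. *)
Definition hypH2 (R : realType) (n : nat) (T : R) (p : coefficients R n) : Prop :=
  (forall i (x t : R), 0 <= t <= T -> 0 <= cy p i x t) /\
  exists yt : 'I_n -> R -> R -> R,
  [/\ forall i (x t : R), 0 <= t <= T ->
        has_deriv_on (V := R^o) Num.norm `[0, T] (cy p i x) t (yt i x t),
      forall i (t : R), 0 <= t <= T -> twice_derivable (fun x => cy p i x t),
      (forall i, Linf_strip T (cy p i) /\
         Linf_strip T (fun x t => derive1 (cy p i ^~ t) x) /\
         Linf_strip T (fun x t => derive1n 2 (cy p i ^~ t) x) /\
         Linf_strip T (yt i)) /\
      (exists2 k3 : R, 0 < k3 & forall i, (Linf_strip_norm T (cy p i) <= k3%:E)%E),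
      forall i x, (@lebesgue_measure R).-integrable `[0, T] (EFin \o yt i x) &
      forall i,
        (forall t : R, 0 <= t <= T -> twice_derivable (fun x => yt i x t)) /\
        Linf_strip T (fun x t => derive1 (yt i ^~ t) x) /\
        (forall t : R, 0 <= t <= T ->
           derive1n 2 (yt i ^~ t) \in Lfun (@lebesgue_measure R) 2%:E)].

Definition hypH3 (R : realType) (n : nat) (p : coefficients R n) : Prop :=
  (forall i, Linf (cd p i) /\ Linf (cK p i)) /\
  (forall i : 'I_n, (i.+1 < n)%N -> Linf (cq p i)) /\
  cqhat1 p \in Lfun (@lebesgue_measure R) 2%:E /\
  cqhat2 p \in Lfun (@lebesgue_measure R) 2%:E.

Definition denom (R : realType) (n : nat) (p : coefficients R n)
    (i : 'I_n) (x t : R) : R := ca p i x + cb p i x * cy p i x t.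

Definition Gop (R : realType) (n : nat) (p : coefficients R n) (i : 'I_n)
    (t : R) : L2 R -> L2 R -> Prop :=
  is_G (fun x => clam p i x / denom p i x t) (fun x => cc p i x / denom p i x t).

Definition arrhenius (R : realType) (E theta : R) : R :=
  if 0 < theta then expR (- (E / theta)) else 0.

(* For i.+1 < n, ordS i is i + 1; for i != 0, ord_pred i is i - 1. *)
Definition source_fun (R : realType) (n : nat) (p : coefficients R n)
    (i : 'I_n) (x t : R) (w : 'I_n -> R) : R :=
  (denom p i x t)^-1 *
  ( - derive1 (cc p i) x * w i
    + (cK p i x * cb p i x * w i + cd p i x) * cy p i x t * arrhenius (cE p) (w i)
    + (if (i : nat) == 0%N then - cqhat1 p x * (w i - cue p)
       else - cq p (ord_pred i) x * (w i - w (ord_pred i)))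
    + (if i.+1 == n then - cqhat2 p x * (w i - cue p)
       else cq p i x * (w (ordS i) - w i))).

(* v is the element f(t, w) of L^2(R)^n. *)
Definition is_source (R : realType) (n : nat) (p : coefficients R n) (t : R)
    (w v : state R n) : Prop :=
  forall i, {ae (@lebesgue_measure R), forall x,
    v i x = source_fun p i x t (fun j => w j x)}.

Definition evol_state (R : realType) (n : nat)
    (U : 'I_n -> R -> R -> L2 R -> L2 R) (t s : R) (w : state R n) : state R n :=
  fun i => U i t s (w i).

(* As qhat1 and qhat2 are only in L^2, f(tau, w) need not be in L^2(R)^n for
   every w in L^2(R)^n. The integrand U(t, tau) f(tau, u tau) of the Bochner
   integral is therefore asked to be defined for almost every tau only. *)
Definition is_mild_solution (R : realType) (n : nat) (p : coefficients R n)
    (U : 'I_n -> R -> R -> L2 R -> L2 R) (phi : state R n) (T' : R)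
    (u : R -> state R n) : Prop :=
  continuous_on (@state_norm R n) `[0, T'] u /\
  exists F : R -> state R n,
    {ae (@lebesgue_measure R), forall tau : R, 0 <= tau <= T' ->
       is_source p tau (u tau) (F tau)} /\
    forall t : R, 0 <= t <= T' ->
      exists2 v : state R n,
        is_bochner_integral (@state_norm R n) `[0, t]
          (fun tau => evol_state U t tau (F tau)) v &
        forall i, u t i =L2 (evol_state U t 0 phi + v) i.

(* Main.v *)
(* Dividing by alpha, each component of U(t, s) psi solves
   m u_t = u_xx - theta u_x with m = (a + b y) / lambda, Lipschitz in t, and
   theta = c / lambda, independent of t. For psi in H^2, three energy
   inequalities, all in Gronwall form, give smoothing at rate (t - s)^(-1/2):
   - int m u^2 decays at rate |u_x|^2 and |u_x|^2 grows at most exponentially,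
     so |u_x| <= C (t - s)^(-1/2) |psi|; by H^1 -> L^infty the same bound holds
     for |q u|, q = qhat1 + qhat2 in L^2. This is what gives a sense to
     f(t, u(t)), although f is not defined on the whole of L^2;
   - the dual norm of m u in H^-1, computed through the resolvent of
     1 - d^2/dx^2, decays at rate int m u^2, so |u| <= C (t - s)^(-1/2)
     |m psi|_(H^-1).
   Both extend to psi in L^2 by density; multiplication by q is replaced by
   multiplication by the bounded cutoffs min(q, N), with bounds uniform in N.

   Existence is by Picard iteration on the source term: if
   |F(t)| <= M t^(-1/2), then u = U(t, 0) phi + int_0^t U(t, r) F(r) dr has
   |q u(t)| = O(t^(-1/2)), because (t - r)^(-1/2) r^(-1/2) has a bounded
   integral, and F |-> f(t, u) is a contraction for small T'. For uniqueness
   no bound on q u is known, but f(t, .) is Lipschitz from L^2 to H^-1, as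
   |<h, q w>| <= |q| |h|_(L^infty) |w|, so the dual smoothing gives
   |U(t, r) (f(r, u) - f(r, v))| <= C (t - r)^(-1/2) |u - v|. *)

Require Import Defs.
From mathcomp Require Import all_boot all_order all_algebra.
From mathcomp Require Import all_classical all_reals all_analysis.
From mathcomp Require Import measurable_realfun ess_sup_inf ring lra.
Import Order.TTheory GRing.Theory Num.Theory.
Import numFieldNormedType.Exports.
Local Open Scope classical_set_scope.
Local Open Scope ring_scope.
Set Implicit Arguments.
Unset Strict Implicit.
Unset Printing Implicit Defensive.

(** * One-sided derivatives and Gronwall inequalities *)

(** Elements of L^2 are representatives, so every norm is only a seminorm and equalities hold up to
    seminorm 0. Kato's derivatives are limits of difference quotients at each time, and [m] is only
    Lipschitz in t; the energies are therefore controlled through upper difference quotients, for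
    which the Gronwall inequality is stated. The weight [m] is what makes H^-1 usable: u_xx then has
    coefficient 1, the only other factor of a space derivative is theta, which is C^1 in x, and in m
    f the denominator a + b y cancels. Multiplication by q is unbounded on L^2 and cannot be moved
    through a Bochner integral; each cutoff can, and monotone convergence in N gives q back. The
    iteration runs on the source F because F is continuous on ]0, T'] with the weight t^(-1/2): this
    is enough to build the integrals from Riemann steps, the time 0 being negligible. *)

(** Real induction on the supremum of the points where the bound from [a] holds: the left estimate
    shows that the supremum is such a point, the right one that it cannot lie before [b]. *)
Lemma increment_le_local (R : realType) (f : R -> R) (a b K : R) : a <= b ->
  (forall x, a <= x <= b -> exists2 d : R, 0 < d & forall y, a <= y <= b ->
     `|y - x| < d -> (x <= y -> f y - f x <= K * (y - x)) /\
                     (y <= x -> f x - f y <= K * (x - y))) ->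
  f b - f a <= K * (b - a).
Proof.
move=> ab H; pose S := [set x | a <= x <= b /\ f x - f a <= K * (x - a)].
have Sa : S a by split; [rewrite lexx ab | rewrite !subrr mulr0].
have supS : has_sup S by split; [exists a | exists b => x [/andP[_ ->]]].
have sI : a <= sup S <= b.
  have su := ub_le_sup supS.2; apply/andP; split; first exact: su.
  by apply: ge_sup; [exists a | move=> x [/andP[_ ->]]].
have [d d0 Hd] := H _ sI.
have [y [yI fy] sy] := sup_adherent d0 supS.
have ys : y <= sup S by exact: ub_le_sup supS.2 _ _.
have Ss : S (sup S).
  split => //; have [|_ h] := Hd y yI; first by rewrite ler0_norm; lra.
  by have := h ys; lra.
have [sb|] := ltP (sup S) b; last first.
  move=> bs; have -> : b = sup S by apply/eqP; rewrite eq_le bs; case/andP: sI.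
  by case: Ss.
pose z := Num.min b (sup S + d / 2).
have zb : z <= b by rewrite ge_min lexx.
have sz : sup S < z by rewrite lt_min sb/= ltrDl divr_gt0.
have zd : z <= sup S + d / 2 by rewrite ge_min lexx orbT.
have zI : a <= z <= b by rewrite zb andbT; lra.
have Sz : S z.
  split => //; case: (Hd z zI) => [|h _]; first by rewrite gtr0_norm; lra.
  by have := h (ltW sz); case: Ss => _; lra.
have : z <= sup S by exact: ub_le_sup supS.2 _ _.
by lra.
Qed.

(* The upper derivatives of f at t, from both sides and within [s, T], are at
   most c. *)
Definition slope_le (R : realType) (f : R -> R) (s T t c : R) :=
  forall e, 0 < e -> exists2 d : R, 0 < d &
    forall t', s <= t' <= T -> `|t' - t| < d -> t' != t ->
      (f t' - f t) / (t' - t) <= c + e.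

Section Slopes.
Variable R : realType.
Implicit Types (f g : R -> R) (s T t c C : R).

Lemma slope_leW f s T t c c' : c <= c' -> slope_le f s T t c ->
  slope_le f s T t c'.
Proof.
move=> cc' H e /H[d d0 Hd]; exists d => // t' *; apply: le_trans (Hd t' _ _ _) _ => //.
by rewrite lerD2r.
Qed.

Lemma slope_leD f g s T t c c' : slope_le f s T t c -> slope_le g s T t c' ->
  slope_le (f \+ g) s T t (c + c').
Proof.
move=> H1 H2 e e0; have e2 : 0 < e / 2 by rewrite divr_gt0.
have [d d0 Hd] := H1 _ e2; have [d' d'0 Hd'] := H2 _ e2.
exists (Num.min d d'); first by rewrite lt_min d0.
move=> t' tI; rewrite lt_min => /andP[h h'] tt'.
have := Hd _ tI h tt'; have := Hd' _ tI h' tt'.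
rewrite /= (_ : f t' + g t' - (f t + g t) = (f t' - f t) + (g t' - g t)); last by ring.
by rewrite mulrDl; lra.
Qed.

Lemma slope_leZ f s T t c k : 0 < k -> slope_le f s T t c ->
  slope_le (fun x => k * f x) s T t (k * c).
Proof.
move=> k0 H e e0; have [d d0 Hd] := H (e / k) (divr_gt0 e0 k0).
exists d => // t' tI h tt'; have := Hd _ tI h tt'.
rewrite -mulrBr -mulrA -(ler_pM2l k0) mulrDr => /le_trans; apply.
by rewrite lerD2l mulrCA divff ?mulr1 ?gt_eqF.
Qed.

(** Product rule for the weight [x - s]. An upper bound on slopes may be multiplied by [t' - s]
    because this factor is nonnegative on [[s, T]]. *)
Lemma slope_le_mulB f s T t c : s <= t <= T -> slope_le f s T t c ->
  slope_le (fun x => (x - s) * f x) s T t ((t - s) * c + f t).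
Proof.
move=> /andP[st tT] H e e0.
have A0 : 0 < t - s + 1 by lra.
have [d d0 Hd] := H (e / 2 / (t - s + 1)) ltac:(by rewrite !divr_gt0).
pose d' := Num.min (Num.min d 1) (e / 2 / (1 + `|c|)).
have B0 : 0 < 1 + `|c| by rewrite ltr_pwDl.
exists d'; first by rewrite !lt_min d0 ltr01/= !divr_gt0.
move=> t' tI; rewrite !lt_min => /andP[/andP[h h1] h2] tt'.
have tt0 : t' - t != 0 by rewrite subr_eq0.
have st' : 0 <= t' - s by case/andP: tI; lra.
have -> : ((t' - s) * f t' - (t - s) * f t) / (t' - t)
   = (t' - s) * ((f t' - f t) / (t' - t)) + f t by field.
apply: (@le_trans _ _ ((t' - s) * (c + e / 2 / (t - s + 1)) + f t)).
  by rewrite lerD2r ler_wpM2l// Hd.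
have -> : (t' - s) * (c + e / 2 / (t - s + 1)) =
  (t - s) * c + (t' - t) * c + (t' - s) * (e / 2 / (t - s + 1)) by ring.
have h3 : (t' - t) * c <= e / 2.
  apply: le_trans (ler_norm _) _; rewrite normrM.
  apply: (@le_trans _ _ (`|t' - t| * (1 + `|c|))); first by rewrite ler_wpM2l ?lerDr.
  by rewrite -ler_pdivlMr// ltW.
have h4 : (t' - s) * (e / 2 / (t - s + 1)) <= e / 2.
  rewrite mulrCA ger_pMr ?divr_gt0// ler_pdivrMr// mul1r.
  by move: (ler_norm (t' - t)); lra.
by lra.
Qed.

(** The function [E * f], with [E] the decaying exponential, has upper slope at most any [K > 0], so
    its increments are at most 0. As [f] is only known through upper slopes, the product rule is
    replaced by two finite estimates: 1 + Ch <= e^(Ch) to the right of a point, and a quadratic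
    error to the left. *)
Lemma slope_gronwall f s T C : 0 <= C -> (forall t, s <= t <= T -> 0 <= f t) ->
  (forall t, s <= t <= T -> slope_le f s T t (C * f t)) ->
  forall t, s <= t <= T -> f t <= expR (C * (t - s)) * f s.
Proof.
move=> C0 f0 H t /andP[st tT].
pose E x := expR (- (C * (x - s))).
have E0 x : 0 < E x by exact: expR_gt0.
suff key : E t * f t - E s * f s <= 0.
  have Es : E s = 1 by rewrite /E subrr mulr0 oppr0 expR0.
  rewrite Es mul1r subr_le0 in key.
  have -> : expR (C * (t - s)) = (E t)^-1 by rewrite /E expRN invrK.
  by rewrite -ler_pdivrMl ?invr_gt0// invrK.
apply/ler_addgt0Pr => e e0; rewrite add0r.
(* Chosen so that the total increment [K * (t - s)] is at most [e]. *)
pose K := e / (1 + (t - s)).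
have D0 : 0 < 1 + (t - s) by lra.
have K0 : 0 < K by rewrite divr_gt0.
apply: (@le_trans _ _ (K * (t - s))); last first.
  rewrite /K -mulrA ger_pMr// mulrC ler_pdivrMr//; lra.
apply: (@increment_le_local _ (fun x => E x * f x)) => // x /andP[sx xt].
have xI : s <= x <= T by rewrite sx; lra.
have fx0 := f0 x xI.
have E1 y : s <= y -> E y <= 1.
  by move=> sy; rewrite /E -[leRHS]expR0 ler_expR oppr_le0 mulr_ge0// subr_ge0.
have K2 : 0 < K / 2 by rewrite divr_gt0.
have [d d0 Hd] := H x xI (K / 2) K2.
have D1 : 0 < 1 + f x * C ^+ 2 by rewrite ltr_pwDl// mulr_ge0 ?exprn_ge0.
have D2 : 0 < 1 + C by lra.
(* Both extra radii serve the left side: the first gives C h <= 1, the second makes the quadratic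
   error [f x * (C * h) ^+ 2] at most [K / 2 * h]. *)
exists (Num.min d (Num.min (1 + C)^-1 (K / 2 / (1 + f x * C ^+ 2)))).
  by rewrite !lt_min d0 invr_gt0 D2 divr_gt0.
move=> y /andP[sy yt]; rewrite !lt_min => /andP[yd /andP[y1 y2]].
have yI : s <= y <= T by rewrite sy; lra.
have Ey1 := E1 _ sy.
have [->|yx] := eqVneq y x; first by rewrite !subrr mulr0.
have {}Hd := Hd _ yI yd yx.
split=> xy.
  have h0 : 0 < y - x by rewrite subr_gt0 lt_neqAle eq_sym yx.
  rewrite ler_pdivrMr// in Hd.
  set h := y - x in h0 Hd *.
  have : E y * (1 + C * h) <= E x.
    have -> : E x = E y * expR (C * h).
      by rewrite /E -expRD; congr expR; rewrite /h; ring.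
    by rewrite ler_wpM2l ?expR_ge1Dx// ltW.
  move=> /(ler_wpM2r fx0) h1.
  have : E y * f y <= E y * (f x + (C * f x + K / 2) * h).
    by rewrite ler_wpM2l ?(ltW (E0 y))//; lra.
  have : E y * (K / 2 * h) <= K / 2 * h by rewrite ger_pMl// mulr_gt0.
  have : 0 < K * h by rewrite mulr_gt0.
  by move: h1; rewrite !mulrDr !mulrDl; lra.
have h0 : 0 < x - y by rewrite subr_gt0 lt_neqAle yx.
rewrite -opprB -[y - x]opprB mulNr invrN mulrN opprK ler_pdivrMr// in Hd.
rewrite distrC gtr0_norm// in y1; rewrite distrC gtr0_norm// in y2.
set h := x - y in h0 Hd y1 y2 *.
have Ch1 : C * h <= 1.
  have : (1 + C) * h < 1 by rewrite mulrC -ltr_pdivlMr// div1r.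
  by lra.
have Ch0 : 0 <= C * h by rewrite mulr_ge0// ltW.
have fC : f x * C ^+ 2 * h <= K / 2.
  move: y2; rewrite ltr_pdivlMr//; lra.
have eEy : E y = E x * expR (C * h).
  by rewrite /E -expRD; congr expR; rewrite /h; ring.
(* Since [E y] is [E x] times e^(Ch), this comes from e^(Ch) (1 - Ch) >= (1 + Ch) (1 - Ch) = 1 -
   (Ch)^2. *)
have h1 : E x - E y * (1 - C * h) <= (C * h) ^+ 2.
  apply: (@le_trans _ _ (E x * (C * h) ^+ 2)); last first.
    by rewrite ler_piMl ?exprn_ge0// E1.
  rewrite eEy -mulrA -{1}[E x]mulr1 -mulrBr ler_wpM2l ?(ltW (E0 x))//.
  have : (1 + C * h) * (1 - C * h) <= expR (C * h) * (1 - C * h).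
    by rewrite ler_wpM2r ?subr_ge0// expR_ge1Dx.
  by lra.
have h2 : f x * (E x - E y * (1 - C * h)) <= K / 2 * h.
  apply: (@le_trans _ _ (f x * (C * h) ^+ 2)); first by rewrite ler_wpM2l.
  rewrite exprMn mulrA (expr2 h) mulrA ler_wpM2r ?(ltW h0)//.
have h3 : E y * (f x - (C * f x + K / 2) * h) <= E y * f y.
  by rewrite ler_wpM2l ?(ltW (E0 y))//; lra.
have h4 : E y * (K / 2 * h) <= K / 2 * h by rewrite ger_pMl// mulr_gt0.
by move: h2 h3 h4; rewrite !(mulrBr, mulrBl, mulrDr, mulrDl, mulr1, mulrA); clear; lra.
Qed.

(** The functional A / k + (t - s) B grows at rate at most [C]: differentiating the weight t - s
    produces one [B], which is paid for by the dissipation [- k * B] of [A]. *)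
Lemma slope_smoothing (A B : R -> R) s T k C : 0 < k -> 0 <= C ->
  (forall t, s <= t <= T -> 0 <= A t) -> (forall t, s <= t <= T -> 0 <= B t) ->
  (forall t, s <= t <= T -> slope_le A s T t (- k * B t + C * A t)) ->
  (forall t, s <= t <= T -> slope_le B s T t (C * B t)) ->
  forall t, s <= t <= T -> (t - s) * B t <= expR (C * (t - s)) * (k^-1 * A s).
Proof.
move=> k0 C0 A0 B0 HA HB t tI.
pose F x := k^-1 * A x + Num.max 0 (x - s) * B x.
have kV0 : 0 < k^-1 by rewrite invr_gt0.
have F0 x : s <= x <= T -> 0 <= F x.
  by move=> xI; apply: addr_ge0; apply: mulr_ge0; rewrite ?A0 ?B0 ?le_max ?lexx ?(ltW kV0).
have := @slope_gronwall F s T C C0 F0 _ t tI.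
rewrite /F subrr maxxx mul0r addr0 => H.
apply: le_trans (H _); last first.
  move=> x xI; have sx : 0 <= x - s by case/andP: xI; lra.
  have H1 := slope_leD (slope_leZ kV0 (HA x xI)) (slope_le_mulB xI (HB x xI)).
  have {}H1 : slope_le F s T x
      (k^-1 * (- k * B x + C * A x) + ((x - s) * (C * B x) + B x)).
    move=> e /H1[d d0 Hd]; exists d => // y yI yd yx.
    have := Hd y yI yd yx; rewrite /F /=.
    have -> : Num.max 0 (x - s) = x - s by apply: max_r.
    by have -> : Num.max 0 (y - s) = y - s by apply: max_r; case/andP: yI; lra.
  apply: slope_leW H1; rewrite max_r//.
  have -> : k^-1 * (- k * B x + C * A x) = - B x + C * (k^-1 * A x).
    by field; rewrite gt_eqF.
  by lra.
rewrite max_r; last by case/andP: tI; lra.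
by rewrite lerDr mulr_ge0 ?(ltW kV0)//; exact: A0.
Qed.
End Slopes.

(** * Integrals with an inverse square root singularity *)

Section Singular.
Variable R : realType.
Notation mu := (@lebesgue_measure R).


(* The value at 0 is 0^-1 = 0; it is never used as points are negligible. *)
Definition isqrt (x : R) : R := (Num.sqrt x)^-1.

Lemma isqrt_ge0 (x : R) : 0 <= isqrt x.
Proof. by rewrite invr_ge0 sqrtr_ge0. Qed.

Lemma isqrt_le (x y : R) : 0 < y -> y <= x -> isqrt x <= isqrt y.
Proof.
move=> y0 yx; rewrite /isqrt lef_pV2 ?posrE ?sqrtr_gt0//; last exact: lt_le_trans yx.
by rewrite ler_wsqrtr.
Qed.

(** Fundamental theorem for an integrand that may blow up at both ends: compact subintervals exhaust
    []a, b[], monotone convergence applies, and the monotonicity of [H] takes the place of its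
    continuity at [a] and [b]. *)
Lemma integral_le_primitive (h H : R -> R) (a b : R) : a < b ->
  (forall x, a < x < b -> 0 <= h x) ->
  (forall x, a < x < b -> is_derive x 1 H (h x)) ->
  (forall x, a < x < b -> {for x, continuous h}) ->
  (forall x y, a <= x -> x <= y -> y <= b -> H x <= H y) ->
  (\int[mu]_(x in `[a, b]) (h x)%:E <= (H b - H a)%:E)%E.
Proof.
move=> ab h0 dH ch mH.
have mh : measurable_fun `]a, b[ h.
  apply: open_continuous_measurable_fun; first exact: interval_open.
  by move=> x; rewrite inE/= in_itv/=; exact: ch.
rewrite (@integral_itv_bndoo _ _ _ (EFin \o h))//; last exact/measurable_EFinP.
(* One third of the length keeps [a + d n < b - d n] for every [n]. *)
pose d (n : nat) : R := (b - a) / 3 / n.+1%:R.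
have d0 n : 0 < d n by rewrite !divr_gt0 ?subr_gt0.
have d1 n : d n <= (b - a) / 3.
  by rewrite /d ler_pdivrMr// ler_peMr ?ler1n// divr_ge0// subr_ge0 ltW.
have dm n m : (n <= m)%N -> d m <= d n.
  move=> nm; rewrite /d ler_wpM2l ?divr_ge0 ?subr_ge0 ?(ltW ab)//.
  by rewrite lef_pV2 ?posrE// ler_nat ltnS.
pose F n := `[a + d n, b - d n]%classic.
have FU : \bigcup_n F n = `]a, b[%classic.
  apply/seteqP; split => [x [n _]|x].
    by rewrite /F /= !in_itv/= => /andP[x1 x2]; have := d0 n; lra.
  rewrite /= in_itv/= => /andP[ax xb].
  pose e := Num.min (x - a) (b - x).
  have e0 : 0 < e by rewrite lt_min !subr_gt0 ax.
  have [n dn] : exists n, d n <= e.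
    exists (Num.truncn ((b - a) / 3 / e)).
    rewrite /d ler_pdivrMr// [leRHS]mulrC -(ler_pdivrMr _ _ e0).
    by apply: ltW; exact: truncnS_gt.
  exists n => //; rewrite /F /= in_itv/=.
  have e1 : e <= x - a by rewrite ge_min lexx.
  have e2 : e <= b - x by rewrite ge_min lexx orbT.
  by apply/andP; split; lra.
have FI n : F n `<=` `]a, b[%classic by rewrite -FU; exact: bigcup_sup.
have := @ge0_nondecreasing_set_cvg_integral _ (measurableTypeR R) _ F (EFin \o h) mu.
rewrite FU => cv; have {}cv := cv _ _ _ _.
have {}cv : (\int[mu]_(x in F i) (EFin \o h) x)%E @[i --> \oo] -->
    (\int[mu]_(x in `]a, b[) (EFin \o h) x)%E.
  apply: cv.
  - move=> n m nm; apply/subsetPset => x; rewrite /F /= !in_itv/= => /andP[x1 x2].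
    have h1 := dm _ _ nm; change (a + d m <= (x : R) <= b - d m : bool).
    by apply/andP; split; lra.
  - by move=> i; exact: measurable_itv.
  - by move=> i; apply/measurable_EFinP; exact: measurable_funS (FI i) mh.
  - by move=> i x /FI; rewrite /= in_itv/= lee_fin; exact: h0.
rewrite -(cvg_lim _ cv)//; apply: lime_le; first by apply/cvg_ex; eexists; exact: cv.
apply: nearW => n; rewrite /F.
have ab' : a + d n < b - d n by have := d1 n; lra.
have inI x : a + d n <= x <= b - d n -> a < x < b by have := d0 n; lra.
rewrite (@continuous_FTC2 _ h H)//.
- by rewrite -EFinB lee_fin; have := d0 n => ?; apply: lerB; apply: mH; lra.
- apply: continuous_in_subspaceT => x; rewrite inE/= in_itv/= => xI.
  exact/ch/inI.
- have cH x : a + d n <= x <= b - d n -> H y @[y --> x] --> H x.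
    move=> xI; apply: differentiable_continuous; apply/derivable1_diffP.
    by apply: (@ex_derive _ _ _ _ _ _ _ (dH _ (inI _ xI))).
  split.
  + move=> x; rewrite in_itv/= => xI.
    by apply: (@ex_derive _ _ _ _ _ _ _ (dH _ (inI _ _))); lra.
  + by apply: cvg_at_right_filter; apply: cH; lra.
  + by apply: cvg_at_left_filter; apply: cH; lra.
- move=> x; rewrite in_itv/= => xI; rewrite derive1E.
  by apply: (@derive_val _ _ _ _ _ _ _ (dH _ (inI _ _))); lra.
Qed.

Lemma sqrtr_subadd (x y : R) : 0 <= x -> 0 <= y ->
  Num.sqrt (x + y) <= Num.sqrt x + Num.sqrt y.
Proof.
move=> x0 y0; rewrite -ler_sqr ?nnegrE ?addr_ge0 ?sqrtr_ge0//.
rewrite sqr_sqrtr ?addr_ge0// sqrrD !sqr_sqrtr//.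
by rewrite lerD2r lerDl mulrn_wge0// mulr_ge0 ?sqrtr_ge0.
Qed.

(** Subadditivity of the square root weakens 2 (sqrt t - sqrt a) to a bound in the length [t - a]
    alone, the form required on the short intervals of [mild_step]. *)
Lemma integral_isqrt (a t : R) : 0 <= a -> a < t ->
  (\int[mu]_(x in `[a, t]) (isqrt x)%:E <= (2 * Num.sqrt (t - a))%:E)%E.
Proof.
move=> a0 t0.
have dS (x : R) : 0 < x -> is_derive x 1 (fun y => 2 * Num.sqrt y) (isqrt x).
  move=> x0; have := is_derive1_sqrt x0 => dx.
  apply: is_derive_eq; rewrite /isqrt /GRing.scale/= invfM mulrA divff ?mul1r//.
apply: (@le_trans _ _ (2 * Num.sqrt t - 2 * Num.sqrt a)%:E); last first.
  rewrite lee_fin -mulrBr ler_wpM2l// lerBlDr.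
  by rewrite -{1}(subrK a t) sqrtr_subadd// subr_ge0 ltW.
apply: (@integral_le_primitive isqrt (fun y => 2 * Num.sqrt y)); first exact: t0.
- by move=> x _; exact: isqrt_ge0.
- by move=> x xI; apply: dS; lra.
- move=> x xI; apply: cvgV; last exact: sqrt_continuous.
  by rewrite gt_eqF// sqrtr_gt0; lra.
- by move=> x y ax xy yt; rewrite ler_wpM2l// ler_wsqrtr.
Qed.

Lemma integral_isqrt_rev (a t : R) : a < t ->
  (\int[mu]_(x in `[a, t]) (isqrt (t - x))%:E <= (2 * Num.sqrt (t - a))%:E)%E.
Proof.
move=> t0.
pose H y := - (2 * Num.sqrt (t - y)).
apply: (@le_trans _ _ (H t - H a)%:E); last first.
  by rewrite lee_fin /H subrr sqrtr0 mulr0; lra.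
apply: (@integral_le_primitive (fun x => isqrt (t - x)) H); first exact: t0.
- by move=> x _; exact: isqrt_ge0.
- move=> x xI; have tx : 0 < t - x by lra.
  have dS := is_derive1_sqrt tx.
  have dd : is_derive x 1 (fun y : R => t - y) (-1).
    by have := is_deriveB (is_derive_cst t x (1:R)) (is_derive_id x (1:R)); rewrite sub0r.
  have dc := @is_derive1_comp _ Num.sqrt (fun y => t - y) x _ _ dS dd.
  have := is_deriveN (is_deriveZ 2 dc).
  move/is_derive_eq; apply.
  have : Num.sqrt (t - x) != 0 by rewrite gt_eqF// sqrtr_gt0.
  by rewrite /isqrt /GRing.scale/= => ?; field.
- move=> x xI; apply: cvgV; first by rewrite gt_eqF// sqrtr_gt0; lra.
  apply: (@continuous_comp _ _ _ (fun y => t - y) Num.sqrt); last exact: sqrt_continuous.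
  by apply: cvgB; [exact: cvg_cst | exact: cvg_id].
- by move=> x y ax xy yt; rewrite /H lerN2 ler_wpM2l// ler_wsqrtr// lerB.
Qed.

(** After clearing denominators this is sqrt t <= sqrt x + sqrt (t - x). It separates the two
    singularities of the convolution. *)
Lemma isqrt_mul_le (t x : R) : 0 < x -> x < t ->
  isqrt (t - x) * isqrt x <= isqrt t * (isqrt x + isqrt (t - x)).
Proof.
move=> x0 xt; rewrite /isqrt.
have tx : 0 < t - x by lra.
have t0 : 0 < t by lra.
have s1 : 0 < Num.sqrt x by rewrite sqrtr_gt0.
have s2 : 0 < Num.sqrt (t - x) by rewrite sqrtr_gt0.
have s3 : 0 < Num.sqrt t by rewrite sqrtr_gt0.
have h : Num.sqrt t <= Num.sqrt x + Num.sqrt (t - x).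
  by rewrite -{1}(subrKC x t); apply: sqrtr_subadd; lra.
rewrite -(ler_pM2l s3) mulrA [leRHS]mulrA divff ?gt_eqF// mul1r.
rewrite -(ler_pM2r s1) -(ler_pM2r s2).
rewrite [leLHS](_ : _ = Num.sqrt t); last by field; rewrite !gt_eqF.
by rewrite [leRHS](_ : _ = Num.sqrt x + Num.sqrt (t - x)); last by field; rewrite !gt_eqF.
Qed.

Lemma measurable_isqrt : measurable_fun [set: R] isqrt.
Proof.
rewrite (_ : isqrt = (fun y => y `^ (- 1)) \o Num.sqrt); last first.
  by apply/funext => x; rewrite /= powR_inv1// sqrtr_ge0.
apply: measurableT_comp; first exact: measurable_powR.
by apply: continuous_measurable_fun => x; exact: sqrt_continuous.
Qed.

(** The exact value is the beta integral B(1/2, 1/2) = pi for every [t]. What matters is that the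
    bound does not depend on [t]; 4 is 2 + 2, one half from each singularity. *)
Lemma integral_isqrt_conv (t : R) : 0 < t ->
  (\int[mu]_(x in `[0%R, t]) (isqrt (t - x) * isqrt x)%:E <= 4%:E)%E.
Proof.
move=> t0.
have st : 0 < Num.sqrt t by rewrite sqrtr_gt0.
have mr : measurable_fun [set: R] (fun x => isqrt (t - x)).
  by apply: (measurableT_comp measurable_isqrt); exact: measurable_funB.
have i1 := integral_isqrt (lexx 0) t0.
have i2 := integral_isqrt_rev t0.
rewrite !subr0 in i1 i2.
apply: (@le_trans _ _ (\int[mu]_(x in `[0%R, t])
    ((isqrt t)%:E * ((isqrt x)%:E + (isqrt (t - x))%:E)))%E).
  rewrite [leLHS](@integral_itv_bndoo _ _ _ (fun x => (isqrt (t - x) * isqrt x)%:E)); last first.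
    apply/measurable_EFinP; apply: measurable_funTS; apply: measurable_funM => //.
    exact: measurable_isqrt.
  have mg D : measurable_fun D (fun x =>
      ((isqrt t)%:E * ((isqrt x)%:E + (isqrt (t - x))%:E))%E).
    apply: measurable_funTS.
    apply/(@measurable_EFinP _ _ _ _ (fun x => isqrt t * (isqrt x + isqrt (t - x)))).
    apply: measurable_funM => //; apply: measurable_funD => //.
    exact: measurable_isqrt.
  rewrite [leRHS]integral_itv_bndoo//.
  apply: ge0_le_integral => //.
  - by move=> x _; rewrite lee_fin mulr_ge0 ?isqrt_ge0.
  - apply/measurable_EFinP; apply: measurable_funTS; apply: measurable_funM => //.
    exact: measurable_isqrt.
  - exact: mg.
  - move=> x; rewrite /= in_itv/= => /andP[x0 xt].
    by rewrite -EFinD -EFinM lee_fin isqrt_mul_le.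
rewrite ge0_integralZl//; last 3 first.
- apply: measurable_funTS.
  apply/(@measurable_EFinP _ _ _ _ (fun x => (isqrt x + isqrt (t - x)))).
  by apply: measurable_funD => //; exact: measurable_isqrt.
- by move=> x _; rewrite -EFinD lee_fin addr_ge0 ?isqrt_ge0.
- by rewrite lee_fin isqrt_ge0.
rewrite ge0_integralD//; last 4 first.
- by move=> x _; rewrite lee_fin isqrt_ge0.
- by apply/measurable_EFinP; apply: measurable_funTS; exact: measurable_isqrt.
- by move=> x _; rewrite lee_fin isqrt_ge0.
- by apply/measurable_EFinP; apply: measurable_funTS.
apply: (@le_trans _ _ ((isqrt t)%:E * ((2 * Num.sqrt t)%:E + (2 * Num.sqrt t)%:E))%E).
  by apply: lee_wpmul2l; [rewrite lee_fin isqrt_ge0 | exact: leeD].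
by rewrite -EFinD -EFinM lee_fin le_eqVlt; apply/orP; left; apply/eqP; rewrite /isqrt; field; rewrite gt_eqF.
Qed.
End Singular.

(** * Bochner integral in a seminormed space *)

Section Seminorm.
Variables (R : realType) (V : lmodType R) (nrm : V -> R).

Definition seminorm := (forall u v, nrm (u + v) <= nrm u + nrm v) /\
  (forall k u, nrm (k *: u) = `|k| * nrm u).

Hypothesis sn : seminorm.

Lemma snD u v : nrm (u + v) <= nrm u + nrm v. Proof. by case: sn. Qed.
Lemma snZ k u : nrm (k *: u) = `|k| * nrm u. Proof. by case: sn. Qed.

Lemma sn0 : nrm 0 = 0.
Proof. by rewrite -(scale0r 0) snZ normr0 mul0r. Qed.

Lemma snN u : nrm (- u) = nrm u.
Proof. by rewrite -scaleN1r snZ normrN normr1 mul1r. Qed.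

Lemma sn_ge0 u : 0 <= nrm u.
Proof. by have := snD u (- u); rewrite subrr sn0 snN; lra. Qed.

Lemma snB u v : nrm (u - v) <= nrm u + nrm v.
Proof. by rewrite -(snN v) snD. Qed.

Lemma snBC u v : nrm (u - v) = nrm (v - u).
Proof. by rewrite -snN opprB. Qed.

Lemma sn_tri w u v : nrm (u - v) <= nrm (u - w) + nrm (w - v).
Proof. by rewrite -(subrKA w) snD. Qed.

Lemma sn_dist u v : `|nrm u - nrm v| <= nrm (u - v).
Proof.
have := sn_tri v u 0; have := sn_tri u v 0; rewrite !subr0 (snBC v u) ler_norml.
by move=> *; apply/andP; split; lra.
Qed.

Lemma sn_eq0 u v : nrm (u - v) = 0 -> nrm u = nrm v.
Proof.
by move=> uv; have := sn_dist u v; rewrite uv normr_le0 subr_eq0 => /eqP.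
Qed.

Lemma sn_sum (I : Type) (r : seq I) (P : pred I) (F : I -> V) :
  nrm (\sum_(i <- r | P i) F i) <= \sum_(i <- r | P i) nrm (F i).
Proof.
apply: (big_rec2 (fun x y => nrm x <= y)); first by rewrite sn0.
by move=> i y x _ xy; apply: le_trans (snD _ _) _; rewrite lerD2l.
Qed.

End Seminorm.

(** * Almost everywhere statements and monotonicity of integrals *)

Section AlmostEverywhere.
Variables (R : realType).
Notation mu := (@lebesgue_measure R).
Implicit Types P Q S : R -> Prop.

Lemma aeS P Q : (forall x, P x -> Q x) ->
  {ae mu, forall x, P x} -> {ae mu, forall x, Q x}.
Proof. by move=> PQ; apply: filterS; [exact: (ae_filter_ringOfSetsType mu)|exact: PQ]. Qed.

Lemma aeS2 P Q S : (forall x, P x -> Q x -> S x) ->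
  {ae mu, forall x, P x} -> {ae mu, forall x, Q x} -> {ae mu, forall x, S x}.
Proof. by move=> PQ; apply: filterS2; [exact: (ae_filter_ringOfSetsType mu)|exact: PQ]. Qed.

Lemma aeS3 P Q S S' : (forall x, P x -> Q x -> S x -> S' x) ->
  {ae mu, forall x, P x} -> {ae mu, forall x, Q x} -> {ae mu, forall x, S x} ->
  {ae mu, forall x, S' x}.
Proof. by move=> PQ; apply: filterS3; [exact: (ae_filter_ringOfSetsType mu)|exact: PQ]. Qed.

Lemma aeW P : (forall x, P x) -> {ae mu, forall x, P x}.
Proof. by move=> h; apply: (@filterE _ _ (ae_filter_ringOfSetsType mu)). Qed.

End AlmostEverywhere.

Section Monotone.
Variables (d : measure_display) (T : measurableType d) (R : realType).
Variable mu : {measure set T -> \bar R}.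
Local Open Scope ereal_scope.

(** The integral of a nonnegative function is a supremum over the simple functions below it, so
    monotonicity requires no measurability. *)
Lemma le_integral_nonmeas (D : set T) (f g : T -> \bar R) :
  (forall x, D x -> 0 <= f x) -> (forall x, D x -> f x <= g x) ->
  \int[mu]_(x in D) f x <= \int[mu]_(x in D) g x.
Proof.
move=> f0 fg; rewrite integral_mkcond [leRHS]integral_mkcond.
have f0' x : 0 <= (f \_ D) x.
  by rewrite patchE; case: ifPn => //; rewrite inE => /f0.
have fg' x : (f \_ D) x <= (g \_ D) x.
  by rewrite !patchE; case: ifPn => //; rewrite inE => /fg.
rewrite !ge0_integralTE//; last by move=> x; apply: le_trans (fg' x).
by apply: le_ereal_sup => _ [h hf <-]; exists h => // x; apply: le_trans (fg' x).
Qed.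

(** The null set is removed on the smaller side, where measurability makes this harmless; on the
    larger side, possibly not measurable, restriction can only decrease the integral. *)
Lemma ae_le_integral_nonmeas (D : set T) (f g : T -> \bar R) :
  measurable D -> measurable_fun D f -> (forall x, D x -> 0 <= f x) ->
  (forall x, D x -> 0 <= g x) -> {ae mu, forall x, D x -> f x <= g x} ->
  \int[mu]_(x in D) f x <= \int[mu]_(x in D) g x.
Proof.
move=> mD mf f0 g0 [N [mN N0 NH]].
rewrite (@ge0_negligible_integral _ _ _ mu D N)//.
apply: (@le_trans _ _ (\int[mu]_(x in D `\` N) g x)).
  apply: le_integral_nonmeas => [x [Dx _]|x [Dx Nx]]; first exact: f0.
  by apply: contrapT => h; apply: Nx; apply: NH => /= /(_ Dx).
rewrite integral_mkcond [leRHS]integral_mkcond; apply: le_integral_nonmeas => x _.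
  by rewrite patchE; case: ifPn => //; rewrite inE => -[/g0].
rewrite !patchE; case: ifPn; last by case: ifPn => //; rewrite inE => /g0.
by rewrite inE => -[Dx _]; rewrite mem_set.
Qed.

End Monotone.

Section LebesgueIntegral.
Variable R : realType.
Notation mu := (@lebesgue_measure R).
Variables (D : set R) (mD : measurable D).
Implicit Types f g : R -> \bar R.
Local Open Scope ereal_scope.

(* Restatements that fix the measurable structure of R, which is otherwise
   found in two syntactically different forms. *)
Lemma leb_ge0_integralD f g : (forall x, D x -> 0 <= f x) -> measurable_fun D f ->
  (forall x, D x -> 0 <= g x) -> measurable_fun D g ->
  \int[mu]_(x in D) (f x + g x) = \int[mu]_(x in D) f x + \int[mu]_(x in D) g x.
Proof. by move=> f0 mf g0 mg; rewrite (@ge0_integralD _ _ _ mu D mD f g). Qed.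

Lemma leb_ge0_integralZl (k : R) f : (0 <= k)%R -> (forall x, D x -> 0 <= f x) ->
  measurable_fun D f ->
  \int[mu]_(x in D) (k%:E * f x) = k%:E * \int[mu]_(x in D) f x.
Proof. by move=> k0 f0 mf; rewrite ge0_integralZl. Qed.

Lemma leb_ae_le_integral f g : (forall x, D x -> 0 <= f x) -> measurable_fun D f ->
  (forall x, D x -> 0 <= g x) -> {ae mu, forall x, D x -> f x <= g x} ->
  \int[mu]_(x in D) f x <= \int[mu]_(x in D) g x.
Proof. by move=> *; exact: ae_le_integral_nonmeas. Qed.

Lemma leb_le_integral f g : (forall x, D x -> 0 <= f x) ->
  (forall x, D x -> f x <= g x) ->
  \int[mu]_(x in D) f x <= \int[mu]_(x in D) g x.
Proof. by move=> *; exact: le_integral_nonmeas. Qed.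

End LebesgueIntegral.

(** * Simple functions with values in a vector space *)

Section SimpleMaps.
Variables (R : realType) (V : lmodType R).
Notation mu := (@lebesgue_measure R).
Implicit Types (s : @simple_map R V).

(** The sets of a simple map may overlap. The code of a point records which of them contain it; the
    points of a given code form an atom, and the map is constant on these disjoint atoms. *)
Definition sm_type s := {ffun 'I_(sm_card s) -> bool}.

Definition sm_code s (x : measurableTypeR R) : sm_type s :=
  [ffun j => `[< @sm_set _ _ s j x >]].

Definition sm_atom s (J : sm_type s) : set (measurableTypeR R) :=
  [set x | sm_code s x = J].

Definition sm_at s (J : sm_type s) : V :=
  \sum_(j < sm_card s) (J j)%:R *: @sm_val _ _ s j.

Lemma measurable_sm_atom s J : measurable (@sm_atom s J).
Proof.
rewrite (_ : sm_atom J = \bigcap_(j in [set: 'I_(sm_card s)])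
   (if J j then @sm_set _ _ s j else ~` @sm_set _ _ s j)).
  apply: fin_bigcap_measurable => [|j _]; first exact: finite_finset.
  by case: ifP => _; [|apply: measurableC]; exact: sm_meas.
apply/seteqP; split => x.
  move=> <- j _; rewrite ffunE; case: ifPn => /asboolP //.
move=> H; apply/ffunP => j; rewrite ffunE; have := H j I.
by case: ifPn => Jj h; apply/asboolP.
Qed.

Lemma sm_evalE s x : sm_eval s x = sm_at (sm_code s x).
Proof.
by apply: eq_bigr => j _; rewrite ffunE indicE; congr ((nat_of_bool _)%:R *: _).
Qed.

Lemma sum_atoms (A : nmodType) s (F : sm_type s -> A) x :
  F (sm_code s x) = \sum_J (F J *+ (x \in sm_atom J)).
Proof.
rewrite (bigD1 (sm_code s x))//= mem_set//= big1 ?addr0// => J Jx.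
by rewrite memNset//= => h; rewrite h eqxx in Jx.
Qed.

(** Nothing is asked of [f]: the composite takes one value on each of finitely many measurable
    atoms. *)
Lemma measurable_sm_comp s (f : V -> R) :
  measurable_fun [set: measurableTypeR R] (f \o sm_eval s).
Proof.
rewrite (_ : f \o sm_eval s =
   (fun x => \sum_(J : sm_type s) f (sm_at J) * \1_(sm_atom J) x)); last first.
  apply/funext => x; rewrite [LHS]/= sm_evalE.
  rewrite [LHS](sum_atoms (fun J => f (@sm_at s J))).
  by apply: eq_bigr => J _; rewrite indicE mulr_natr.
apply: measurable_sum => J; apply: measurable_funM => //.
exact: measurable_indic (measurable_sm_atom J).
Qed.

Lemma fine_measureI_integral (D A : set R) (c : R) : measurable D ->
  (mu D < +oo)%E -> measurable A -> 0 <= c ->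
  (fine (mu (D `&` A)) * c)%:E = (\int[mu]_(x in D) (c * \1_A x)%:E)%E.
Proof.
move=> mD fD mA c0; rewrite EFinM fineK; last first.
  rewrite ge0_fin_numE//; apply: le_lt_trans fD.
  by apply: le_measure => //; rewrite ?inE//; exact: measurableI.
under eq_integral do rewrite EFinM.
rewrite ge0_integralZl//; last first.
  by apply/measurable_EFinP; apply: measurable_funTS; exact: measurable_indic.
by rewrite integral_indic// muleC setIC.
Qed.

Lemma integral_atoms (D : set R) s (c : sm_type s -> R) : measurable D ->
  (mu D < +oo)%E -> (forall J, 0 <= c J) ->
  (\sum_(J : sm_type s) fine (mu (D `&` sm_atom J)) * c J)%:E =
  (\int[mu]_(x in D) (c (sm_code s x))%:E)%E.
Proof.
move=> mD fD c0; rewrite -sumEFin.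
under [LHS]eq_bigr => J _ do
  rewrite (fine_measureI_integral mD fD (@measurable_sm_atom s J) (c0 J)).
rewrite -ge0_integral_sum//; last 2 first.
- move=> J; apply/measurable_EFinP; apply: measurable_funM => //.
  by apply: measurable_funTS; apply: measurable_indic; exact: measurable_sm_atom.
- by move=> J x _; rewrite lee_fin mulr_ge0.
apply: eq_integral => x _; rewrite sumEFin; congr EFin.
by rewrite (sum_atoms c); apply: eq_bigr => J _; rewrite indicE mulr_natr.
Qed.

Lemma sm_integralE (D : set R) s : measurable D -> (mu D < +oo)%E ->
  sm_integral D s = \sum_(J : sm_type s) fine (mu (D `&` sm_atom J)) *: sm_at J.
Proof.
move=> mD fD.
have E j : fine (mu (D `&` @sm_set _ _ s j)) =
    \sum_(J : sm_type s) fine (mu (D `&` sm_atom J)) * (J j)%:R.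
  apply: EFin_inj; rewrite integral_atoms//.
  have := fine_measureI_integral mD fD (@sm_meas _ _ s j) (@ler01 R).
  rewrite mulr1 => ->; apply: eq_integral => x _.
  by rewrite mul1r ffunE indicE.
rewrite /sm_integral; under eq_bigr => j _ do rewrite E scaler_suml.
rewrite exchange_big/=; apply: eq_bigr => J _.
by rewrite scaler_sumr; apply: eq_bigr => j _; rewrite scalerA.
Qed.

(** The passage to atoms is essential: the triangle inequality over overlapping sets would not be
    bounded by the integral of the norm. *)
Lemma le_sm_integral (nrm : V -> R) (D : set R) s :
  seminorm nrm -> measurable D -> (mu D < +oo)%E ->
  ((nrm (sm_integral D s))%:E <= \int[mu]_(x in D) (nrm (sm_eval s x))%:E)%E.
Proof.
move=> sn mD fD; rewrite sm_integralE//.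
under eq_integral => x _ do rewrite sm_evalE.
rewrite -(integral_atoms (c := nrm \o @sm_at s))//; last by move=> J; exact: sn_ge0.
rewrite lee_fin; apply: le_trans (sn_sum sn _ _ _) _; apply: ler_sum => J _.
by rewrite (snZ sn) ger0_norm// fine_ge0.
Qed.

Definition sm_map (W : lmodType R) (A : V -> W) (s : @simple_map R V) : @simple_map R W :=
  SimpleMap (fun j => A (@sm_val _ _ s j)) (@sm_meas _ _ s).

Definition sm_lin (k : R) (s s' : @simple_map R V) : @simple_map R V :=
  @SimpleMap R V (sm_card s + sm_card s')
   (fun j => match fintype.split j with
             | inl i => @sm_set _ _ s i | inr i => @sm_set _ _ s' i end)
   (fun j => match fintype.split j with
             | inl i => k *: @sm_val _ _ s i | inr i => @sm_val _ _ s' i end)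
   (fun j => match fintype.split j as z return
               measurable (match z with
                           | inl i => @sm_set _ _ s i
                           | inr i => @sm_set _ _ s' i end)
             with inl i => @sm_meas _ _ s i | inr i => @sm_meas _ _ s' i end).

Lemma sm_eval_lin k s s' x :
  sm_eval (sm_lin k s s') x = k *: sm_eval s x + sm_eval s' x.
Proof.
rewrite /sm_eval big_split_ord/= scaler_sumr.
congr (_ + _); apply: eq_bigr => i _.
  have -> : fintype.split (lshift (sm_card s') i) = inl i := unsplitK (inl i).
  by rewrite !scalerA mulrC.
by have -> : fintype.split (rshift (sm_card s) i) = inr i := unsplitK (inr i).
Qed.

Lemma sm_integral_lin (D : set R) k s s' :
  sm_integral D (sm_lin k s s') = k *: sm_integral D s + sm_integral D s'.
Proof.
rewrite /sm_integral big_split_ord/= scaler_sumr.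
congr (_ + _); apply: eq_bigr => i _.
  have -> : fintype.split (lshift (sm_card s') i) = inl i := unsplitK (inl i).
  by rewrite !scalerA mulrC.
by have -> : fintype.split (rshift (sm_card s) i) = inr i := unsplitK (inr i).
Qed.

Definition sm_restrict (D : set R) (mD : measurable D) s : @simple_map R V :=
  SimpleMap (@sm_val _ _ s)
    (fun j => measurableI D (@sm_set _ _ s j) mD (@sm_meas _ _ s j)).

Lemma sm_eval_restrict D mD s x :
  sm_eval (@sm_restrict D mD s) x = (\1_D x : R) *: sm_eval s x.
Proof.
rewrite /sm_eval scaler_sumr; apply: eq_bigr => i _.
by rewrite /= indicI scalerA.
Qed.

Lemma sm_integral_restrict D mD (D' : set R) s : D `<=` D' ->
  sm_integral D' (@sm_restrict D mD s) = sm_integral D s.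
Proof.
by move=> DD'; apply: eq_bigr => i _; rewrite /= setIA (setIidr DD').
Qed.

End SimpleMaps.

(* nrm (h - s k) is not known to be measurable for an abstract seminorm; it is
   bounded here by a measurable function. *)
Definition bochner_approx (R : realType) (V : lmodType R) (nrm : V -> R)
    (D : set R) (h : R -> V) (v : V) : Prop :=
  exists (s : nat -> @simple_map R V) (e : nat -> R -> \bar R),
  [/\ forall k, measurable_fun D (e k), forall k x, D x -> (0 <= e k x)%E,
      forall k, {ae (@lebesgue_measure R), forall x, D x ->
        ((nrm (h x - sm_eval (s k) x))%:E <= e k x)%E},
      (fun k => \int[lebesgue_measure]_(x in D) e k x)%E @ \oo --> 0%E &
      (fun k => nrm (v - sm_integral D (s k))) @ \oo --> (0 : R)].

Section Bochner.
Variables (R : realType) (V : lmodType R) (nrm : V -> R).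
Hypothesis sn : seminorm nrm.
Notation mu := (@lebesgue_measure R).
Implicit Types (D : set R) (h : R -> V) (v : V).

(** The majorant is the upper limit over j of [nrm (s j x - s k x)]. It is measurable, being built
    from simple maps, and it equals [nrm (h x - s k x)] wherever the approximations converge. *)
Lemma bochner_approxP D h v : measurable D ->
  is_bochner_integral nrm D h v -> bochner_approx nrm D h v.
Proof.
move=> mD [s [cv ci cI]].
pose e k (x : R) := limn_esup (fun j => (nrm (sm_eval (s j) x - sm_eval (s k) x))%:E).
have e0 k x : (0 <= e k x)%E.
  rewrite /e limn_esup_lim; apply: lime_ge; first exact: is_cvg_esups.
  apply: nearW => n; apply: (@le_trans _ _ (nrm (sm_eval (s n) x - sm_eval (s k) x))%:E).
    by rewrite lee_fin sn_ge0.
  by apply: ereal_sup_ubound; exists n => //=.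
have me k : measurable_fun D (e k).
  apply: measurable_fun_limn_esup => j; apply/measurable_EFinP.
  apply: measurable_funTS.
  rewrite (_ : (fun x => _) = nrm \o sm_eval (sm_lin (-1) (s k) (s j))).
    exact: measurable_sm_comp.
  by apply/funext => x /=; rewrite sm_eval_lin scaleN1r addrC.
have ee k x : (fun k => nrm (h x - sm_eval (s k) x)) @ \oo --> (0 : R) ->
    e k x = (nrm (h x - sm_eval (s k) x))%:E.
  move=> cx; apply: (cvg_limn_einf_sup _).2.
  apply/cvg_EFin; first by apply: nearW.
  apply/cvgrPdist_le => ep ep0.
  move/cvgrPdist_le : cx => /(_ ep ep0); apply: filterS => j.
  rewrite sub0r normrN ger0_norm ?sn_ge0// /=; apply: le_trans.
  apply: le_trans (sn_dist sn _ _) _.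
  by rewrite opprB addrA subrK.
exists s, e; split => //.
  move=> k; apply: aeS cv => x H Dx; by rewrite ee//; apply: H.
apply: (squeeze_cvge _ _ ci); last exact: (cvg_cst 0%E).
apply: nearW => k; apply/andP; split; first by apply: integral_ge0 => x _; exact: e0.
apply: leb_ae_le_integral => //.
  by move=> x _; rewrite lee_fin sn_ge0.
by apply: aeS cv => x H Dx; rewrite ee//; apply: H.
Qed.

Lemma bochner_approx_lin D k h h' v v' : measurable D ->
  bochner_approx nrm D h v -> bochner_approx nrm D h' v' ->
  bochner_approx nrm D (fun x => k *: h x + h' x) (k *: v + v').
Proof.
move=> mD [s [e [me e0 he ce cv]]] [s' [e' [me' e'0 he' ce' cv']]].
exists (fun j => sm_lin k (s j) (s' j)), (fun j x => (`|k|%:E * e j x + e' j x)%E).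
split.
- move=> j; apply: emeasurable_funD => //; exact: measurable_funeM.
- by move=> j x Dx; rewrite adde_ge0 ?e'0// mule_ge0 ?e0.
- move=> j; apply: aeS2 (he j) (he' j) => x H H' Dx.
  rewrite sm_eval_lin opprD addrACA -scalerBr.
  apply: (@le_trans _ _ (`|k| * nrm (h x - sm_eval (s j) x) +
      nrm (h' x - sm_eval (s' j) x))%:E).
    by rewrite lee_fin -(snZ sn) snD.
  by rewrite EFinD EFinM leeD ?H'// lee_wpmul2l ?H.
- have E j : (\int[mu]_(x in D) (`|k|%:E * e j x + e' j x))%E =
      (`|k|%:E * \int[mu]_(x in D) e j x + \int[mu]_(x in D) e' j x)%E.
    have h1 (x : R) : D x -> (0 <= `|k|%:E * e j x)%E by move=> Dx; rewrite mule_ge0 ?e0.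
    have h2 : measurable_fun D (fun x : R => `|k|%:E * e j x)%E by exact: measurable_funeM.
    have h3 (x : R) : D x -> (0 <= e' j x)%E by exact: e'0.
    have h4 (x : R) : D x -> (0 <= e j x)%E by exact: e0.
    by rewrite leb_ge0_integralD// leb_ge0_integralZl.
  under eq_fun do rewrite E.
  have c1 : (`|k|%:E * \int[mu]_(x in D) e j x)%E @[j --> \oo] --> (`|k|%:E * 0)%E.
    exact: cvgeZl.
  have := cvgeD _ c1 ce'; rewrite mule0 add0e; apply; exact: isT.
- have -> : (0 : R) = `|k| * 0 + 0 by ring.
  apply: (@squeeze_cvgr _ _ _ _ (cst 0) (fun j => `|k| * nrm (v - sm_integral D (s j)) +
      nrm (v' - sm_integral D (s' j)))).
  + apply: nearW => j; rewrite sn_ge0//= sm_integral_lin opprD addrACA -scalerBr.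
    by rewrite -(snZ sn) snD.
  + by rewrite mulr0 addr0; exact: cvg_cst.
  + by apply: cvgD => //; apply: cvgM => //; exact: cvg_cst.
Qed.

(** The integral of [s k] has norm at most the integral of [e k + g], because [s k] is within [e k]
    of [h]; the errors vanish in the limit. An infinite integral of [g] is set apart. *)
Lemma bochner_approx_le D h v (g : R -> \bar R) : measurable D -> (mu D < +oo)%E ->
  bochner_approx nrm D h v -> measurable_fun D g ->
  (forall x, D x -> (0 <= g x)%E) ->
  {ae mu, forall x, D x -> ((nrm (h x))%:E <= g x)%E} ->
  ((nrm v)%:E <= \int[mu]_(x in D) g x)%E.
Proof.
move=> mD fD [s [e [me e0 he ce cv]]] mg g0 hg.
have H k : ((nrm v)%:E <= (nrm (v - sm_integral D (s k)))%:E +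
    (\int[mu]_(x in D) e k x + \int[mu]_(x in D) g x))%E.
  apply: (@le_trans _ _ ((nrm (v - sm_integral D (s k)))%:E +
      (nrm (sm_integral D (s k)))%:E)%E).
    by rewrite -EFinD lee_fin -{1}(subrK (sm_integral D (s k)) v) snD.
  apply: leeD => //; have e0k (x : R) : D x -> (0 <= e k x)%E by exact: e0.
  rewrite -leb_ge0_integralD//.
  apply: le_trans (le_sm_integral _ sn mD fD) _.
  apply: leb_ae_le_integral => //.
  - by move=> x _; rewrite lee_fin sn_ge0.
  - by apply/measurable_EFinP; apply: measurable_funTS; exact: measurable_sm_comp.
  - by move=> x Dx; rewrite adde_ge0 ?e0 ?g0.
  apply: aeS2 (he k) hg => x Hx gx Dx.
  apply: (@le_trans _ _ ((nrm (h x - sm_eval (s k) x))%:E + (nrm (h x))%:E)%E).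
    rewrite -EFinD lee_fin (snBC sn) -{1}(subrK (h x) (sm_eval (s k) x)).
    exact: snD.
  by apply: leeD; [exact: Hx | exact: gx].
have [gy|gfin] := eqVneq (\int[mu]_(x in D) g x)%E +oo%E; first by rewrite gy leey.
have c : ((nrm (v - sm_integral D (s k)))%:E +
    (\int[mu]_(x in D) e k x + \int[mu]_(x in D) g x))%E @[k --> \oo] -->
    (0 + (0 + \int[mu]_(x in D) g x))%E.
  have g0' : (0 <= \int[mu]_(x in D) g x)%E by exact: integral_ge0.
  apply: cvgeD; first by rewrite add0e.
    by apply/cvg_EFin => //; exact: nearW.
  by apply: cvgeD => //; exact: cvg_cst.
rewrite !add0e in c; rewrite -(cvg_lim _ c)//.
by apply: lime_ge; [apply/cvg_ex; eexists; exact: c | exact: nearW].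
Qed.

(** Extension by zero, used to subtract integrals over two intervals of different lengths. *)
Lemma bochner_approx_ext D D' h v : measurable D -> measurable D' -> D `<=` D' ->
  bochner_approx nrm D h v ->
  bochner_approx nrm D' (fun x => (\1_D x : R) *: h x) v.
Proof.
move=> mD mD' DD' [s [e [me e0 he ce cv]]].
exists (fun k => sm_restrict mD (s k)), (fun k => (e k) \_ D); split.
- move=> k; apply: measurable_funTS; apply/(measurable_restrictT _ mD); exact: me.
- by move=> k x _; rewrite patchE; case: ifPn => //; rewrite inE => /e0.
- move=> k; apply: aeS (he k) => x H D'x.
  rewrite sm_eval_restrict -scalerBr patchE indicE.
  case: ifPn => [|_]; first by rewrite inE => /H; rewrite scale1r.
  by rewrite scale0r (sn0 sn).
- under eq_fun do rewrite -integral_mkcondr (setIidr DD').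
  exact: ce.
- by under eq_fun do rewrite sm_integral_restrict//.
Qed.

(** Bounded linear maps commute with the integral. Linearity is asked only up to seminorm 0, as for
    an evolution operator acting on representatives; with [A] the identity the lemma passes to a
    weaker seminorm. *)
Lemma bochner_approx_map (W : lmodType R) (nu : W -> R) (A : V -> W) (C : R) D h v :
  seminorm nu -> (forall k u w, nu (A (k *: u + w) - (k *: A u + A w)) = 0) ->
  0 <= C -> (forall u, nu (A u) <= C * nrm u) -> measurable D ->
  bochner_approx nrm D h v -> bochner_approx nu D (A \o h) (A v).
Proof.
move=> snu lin C0 bd mD [s [e [me e0 he ce cv]]].
have A0 : nu (A 0) = 0.
  have := lin (-1) 0 0; rewrite scaleN1r addNr => h0.
  have := lin 1 0 0; rewrite !scale1r addr0 opprD addrA subrr sub0r (snN snu) => ->.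
  by [].
have sumA n (c : 'I_n -> R) (w : 'I_n -> V) :
    nu (A (\sum_(j < n) c j *: w j) - \sum_(j < n) c j *: A (w j)) = 0.
  elim: n c w => [|n IH] c w; first by rewrite !big_ord0 subr0.
  apply/eqP; rewrite eq_le sn_ge0// andbT !big_ord_recl.
  apply: le_trans (sn_tri snu (c ord0 *: A (w ord0) + A (\sum_(i < n) c (lift ord0 i) *: w (lift ord0 i))) _ _) _.
  rewrite lin add0r [X in nu X](_ : _ = A (\sum_(i < n) c (lift ord0 i) *: w (lift ord0 i)) - \sum_(i < n) c (lift ord0 i) *: A (w (lift ord0 i))); last first.
    by rewrite opprD addrACA subrr add0r.
  by rewrite IH.
have subA u w : nu (A u - A w) <= C * nrm (u - w).
  have := lin 1 (u - w) w; rewrite !scale1r subrK => h0.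
  apply: le_trans (sn_tri snu (A (u - w) + A w) _ _) _.
  by rewrite h0 add0r addrK.
have subS u (w : V) (w' : W) : nu (A w - w') = 0 -> nu (A u - w') <= C * nrm (u - w).
  by move=> h0; apply: le_trans (sn_tri snu (A w) _ _) _; rewrite h0 addr0.
exists (fun k => sm_map A (s k)), (fun k x => (C%:E * e k x)%E); split.
- by move=> k; exact: measurable_funeM.
- by move=> k x Dx; rewrite mule_ge0 ?e0.
- move=> k; apply: aeS (he k) => x H Dx.
  apply: (@le_trans _ _ (C * nrm (h x - sm_eval (s k) x))%:E).
    by rewrite lee_fin /=; apply: subS; exact: sumA.
  by rewrite EFinM lee_wpmul2l ?H.
- have E k : (\int[mu]_(x in D) (C%:E * e k x))%E = (C%:E * \int[mu]_(x in D) e k x)%E.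
    have h4 (x : R) : D x -> (0 <= e k x)%E by exact: e0.
    by rewrite leb_ge0_integralZl.
  under eq_fun do rewrite E.
  by rewrite -(mule0 C%:E); exact: cvgeZl.
- apply: (@squeeze_cvgr _ _ _ _ (cst 0) (fun j => C * nrm (v - sm_integral D (s j)))).
  + by apply: nearW => j; rewrite sn_ge0//=; apply: subS; exact: sumA.
  + exact: cvg_cst.
  + by rewrite -(mulr0 C); apply: cvgM => //; exact: cvg_cst.
Qed.

End Bochner.

Lemma cvge0_ltP (R : realType) (f : nat -> \bar R) : (forall k, 0 <= f k)%E ->
  f @ \oo --> 0%E -> forall e : R, 0 < e ->
  exists N, forall k, (N <= k)%N -> (f k < e%:E)%E.
Proof.
move=> f0 /fine_cvgP[fin cv] e e0.
move/cvgrPdist_lt : cv => /(_ e e0) cv.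
have [N _ HN] : \forall k \near \oo, (f k < e%:E)%E.
  apply: filterS2 fin cv => k kf; rewrite /= sub0r normrN ger0_norm ?fine_ge0//.
  by rewrite -lte_fin fineK.
by exists N.
Qed.

Lemma ae_neq (R : realType) (a : R) :
  {ae (@lebesgue_measure R), forall x : R, x != a}.
Proof.
exists [set a]; split; [exact: measurable_set1|exact: lebesgue_measure_set1|].
by move=> x /= /negP; rewrite negbK => /eqP.
Qed.

Definition seq_complete (R : realType) (V : lmodType R) (nrm : V -> R) : Prop :=
  forall u : nat -> V,
    (forall e, 0 < e -> exists N, forall m n, (N <= m)%N -> (N <= n)%N ->
       nrm (u m - u n) < e) ->
    exists v, (fun k => nrm (v - u k)) @ \oo --> (0 : R).

(** * Existence of the integral of a continuous function with a singularity at 0 *)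

Section BochnerExistence.
Variables (R : realType) (V : lmodType R) (nrm : V -> R).
Hypothesis sn : seminorm nrm.
Hypothesis cpl : seq_complete nrm.
Notation mu := (@lebesgue_measure R).
Variables (t M : R) (h : R -> V).
Hypothesis t0 : 0 < t.
Hypothesis hM : forall x, 0 < x <= t -> nrm (h x) <= M * isqrt x.
Hypothesis hC : forall x, 0 < x <= t -> forall e, 0 < e ->
  exists2 d : R, 0 < d & forall y, 0 < y <= t -> `|y - x| < d -> nrm (h y - h x) < e.

Let mesh (k : nat) : R := t / k.+1%:R.

Let mesh0 k : 0 < mesh k. Proof. by rewrite divr_gt0. Qed.

(** Riemann step function taking the value of [h] at the right end of each cell. There [isqrt] is at
    most its value at any other point of the cell, so the singularity at 0 leaves an integrable
    majorant. *)
Let step (k : nat) : @simple_map R V :=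
  @SimpleMap R V k.+1
    (fun j => `[mesh k * j%:R, mesh k * j.+1%:R[%classic)
    (fun j => h (mesh k * j.+1%:R))
    (fun j => measurable_itv _).

Let step_eval k x : 0 < x < t -> exists y,
  [/\ sm_eval (step k) x = h y, x <= y <= t & y - x <= mesh k].
Proof.
move=> /andP[x0 xt]; have m0 := mesh0 k.
have q0 : 0 <= x / mesh k by rewrite divr_ge0 ?ltW.
pose j := Num.truncn (x / mesh k).
have /andP[j1 j2] := truncn_itv q0.
rewrite -/j ler_pdivlMr// in j1; rewrite -/j ltr_pdivrMr// in j2.
have jk : (j < k.+1)%N.
  rewrite -(ltr_nat R) -(ltr_pM2r m0); apply: le_lt_trans j1 _.
  by rewrite /mesh mulrC divfK.
exists (mesh k * j.+1%:R); split.
- rewrite /sm_eval (bigD1 (Ordinal jk))//= indicE mem_set/=; last first.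
    by rewrite in_itv/= mulrC j1 mulrC j2.
  rewrite scale1r big1 ?addr0// => i ij.
  rewrite indicE memNset ?scale0r//= in_itv/= => /andP[i1 i2].
  case/eqP: ij; apply/val_inj => /=.
  have h1 : (i < j.+1)%N.
    by rewrite -(ltr_nat R) -(ltr_pM2r m0) mulrC; apply: le_lt_trans i1 _.
  have h2 : (j < i.+1)%N.
    by rewrite -(ltr_nat R) -(ltr_pM2r m0); apply: le_lt_trans j1 _; rewrite mulrC.
  by apply/anti_leq; rewrite -ltnS h1 /= -ltnS h2.
- rewrite mulrC ltW//= /mesh mulrCA ger_pMr// ler_pdivrMr// mul1r ler_nat//.
- by rewrite -natr1 mulrDr mulr1; move: j1; rewrite mulrC; lra.
Qed.

Let err k x := nrm (h x - sm_eval (step k) x).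

Let err0 k x : 0 <= err k x. Proof. exact: (sn_ge0 sn). Qed.

Let M0 : 0 <= M.
Proof.
have tI : 0 < t <= t by rewrite t0 lexx.
have := le_trans (sn_ge0 sn _) (hM tI); rewrite pmulr_lge0//.
by rewrite /isqrt invr_gt0 sqrtr_gt0.
Qed.

Let err_le k x : 0 < x < t -> err k x <= 2 * M * isqrt x.
Proof.
move=> xI; rewrite /err; have [y [-> /andP[xy yt] _]] := step_eval k xI.
have x0 : 0 < x by case/andP: xI.
apply: le_trans (snB sn _ _) _.
have h1 : nrm (h x) <= M * isqrt x by apply: hM; case/andP: xI => ->/ltW.
have h2 : nrm (h y) <= M * isqrt y by apply: hM; rewrite yt andbT; lra.
have : M * isqrt y <= M * isqrt x by rewrite ler_wpM2l// isqrt_le.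
by lra.
Qed.

Let mesh_cvg (e : R) : 0 < e -> exists N, forall k, (N <= k)%N -> mesh k < e.
Proof.
move=> e0; exists (Num.truncn (t / e)) => k Nk.
rewrite /mesh ltr_pdivrMr// mulrC -ltr_pdivrMr//.
apply: lt_le_trans (truncnS_gt _) _; by rewrite ler_nat ltnS.
Qed.

Let err_cvg x : 0 < x < t -> (fun k => err k x) @ \oo --> (0 : R).
Proof.
move=> xI; apply/cvgrPdist_lt => e e0.
have xI' : 0 < x <= t by case/andP: xI => -> /ltW.
have [d d0 Hd] := hC xI' e0.
have [N HN] := mesh_cvg d0.
exists N => // k /= /HN kd.
rewrite sub0r normrN (ger0_norm (err0 _ _)) /err.
have [y [-> /andP[xy yt] yx]] := step_eval k xI.
rewrite (snBC sn); apply: Hd.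
  by rewrite yt andbT; case/andP: xI; lra.
by rewrite ger0_norm; lra.
Qed.

Let D := `]0, t[%classic : set R.

Let mD : measurable D. Proof. exact: measurable_itv. Qed.

(** The error is a pointwise limit, as j grows, of norms of the simple maps [step j - step k]. *)
Let measurable_err k : measurable_fun D (err k).
Proof.
have mj j : measurable_fun D (fun x => nrm (sm_eval (step j) x - sm_eval (step k) x)).
  apply: measurable_funTS.
  rewrite (_ : (fun x => _) = nrm \o sm_eval (sm_lin (-1) (step k) (step j))).
    exact: measurable_sm_comp.
  by apply/funext => x /=; rewrite sm_eval_lin scaleN1r addrC.
apply: (measurable_fun_cvg mj) => x; rewrite /D /= in_itv/= => xI.
have := err_cvg xI => cx.
apply/cvgrPdist_le => ep ep0.
move/cvgrPdist_le : cx => /(_ ep ep0); apply: filterS => j.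
rewrite sub0r normrN (ger0_norm (err0 _ _)); apply: le_trans.
by apply: le_trans (sn_dist sn _ _) _; rewrite opprB addrA subrK.
Qed.

Let int_err : (fun k => \int[mu]_(x in D) (err k x)%:E)%E @ \oo --> 0%E.
Proof.
have := @dominated_convergence _ (measurableTypeR R) R mu D mD
  (fun k x => (err k x)%:E) (cst 0%E) (fun x => (2 * M * isqrt x)%:E).
case.
- by move=> k; apply/measurable_EFinP; exact: measurable_err.
- exact: measurable_cst.
- apply: aeW => x; rewrite /D /= in_itv/= => xI.
  by apply/cvg_EFin; [exact: nearW | exact: err_cvg].
- apply/integrableP; split.
    apply/measurable_EFinP; apply: measurable_funTS; apply: measurable_funM => //.
    exact: measurable_isqrt.
  under eq_integral => x _ do
    rewrite gee0_abs ?lee_fin ?mulr_ge0 ?isqrt_ge0// EFinM.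
  rewrite leb_ge0_integralZl//; last 3 first.
  - by rewrite mulr_ge0.
  - by move=> x _; rewrite lee_fin isqrt_ge0.
  - by apply/measurable_EFinP; apply: measurable_funTS; exact: measurable_isqrt.
  have h1 : (\int[mu]_(x in D) (isqrt x)%:E <= (2 * Num.sqrt (t - 0))%:E)%E.
    apply: le_trans (integral_isqrt (lexx 0) t0).
    rewrite [leRHS](@integral_itv_bndoo _ _ _ (EFin \o @isqrt R))//.
    by apply/measurable_EFinP; apply: measurable_funTS; exact: measurable_isqrt.
  apply: le_lt_trans (ltry (2 * M * (2 * Num.sqrt (t - 0)))).
  by rewrite [leRHS]EFinM; apply: lee_wpmul2l => //; rewrite lee_fin mulr_ge0.
- apply: aeW => x k; rewrite /D /= in_itv/= => xI.
  by rewrite lee_fin ger0_norm//; exact: err_le.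
- by move=> _ _; rewrite integral0; exact: cvg_trans.
Qed.

Let fin_D : (mu D < +oo)%E.
Proof. by rewrite /D lebesgue_measure_itv/= lte_fin t0 -EFinB ltry. Qed.

Let I k := sm_integral D (step k).

Let I_cauchy j k : ((nrm (I j - I k))%:E <=
  \int[mu]_(x in D) (err j x)%:E + \int[mu]_(x in D) (err k x)%:E)%E.
Proof.
have -> : I j - I k = sm_integral D (sm_lin (-1) (step k) (step j)).
  by rewrite sm_integral_lin scaleN1r addrC.
apply: le_trans (le_sm_integral _ sn mD fin_D) _.
have p k' x : D x -> (0 <= (err k' x)%:E)%E by rewrite lee_fin.
have m k' : measurable_fun D (fun x => (err k' x)%:E).
  by apply/measurable_EFinP; exact: measurable_err.
rewrite -leb_ge0_integralD//; [|exact: p|exact: p].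
apply: leb_le_integral => // x _; first by rewrite lee_fin sn_ge0.
rewrite -EFinD lee_fin sm_eval_lin scaleN1r addrC /err.
by rewrite (snBC sn (h x)); exact: sn_tri.
Qed.

(** Dominated convergence with majorant [2 * M * isqrt x] sends the errors to 0; the integrals of
    the steps are then Cauchy and completeness supplies the value. The work is done on the open
    interval, whose end points are negligible. *)
Lemma bochner_exists : exists v, is_bochner_integral nrm `[0, t] h v.
Proof.
have [v cv] : exists v, (fun k => nrm (v - I k)) @ \oo --> (0 : R).
  apply: cpl => e e0.
  have e2 : 0 < e / 2 by rewrite divr_gt0.
  have [|N HN] := cvge0_ltP _ int_err e2.
    by move=> k; apply: integral_ge0 => x _; rewrite lee_fin.
  exists N => m n /HN hm /HN hn.
  rewrite -lte_fin; apply: le_lt_trans (I_cauchy _ _) _.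
  by rewrite [e]splitr EFinD; exact: lteD.
exists v, step; split.
- apply: aeS2 (ae_neq 0) (ae_neq t) => x x0 xt; rewrite /= in_itv/= => /andP[x0' xt'].
  by apply: err_cvg; rewrite !lt_neqAle x0' xt' xt eq_sym x0.
- rewrite (_ : (fun k => _) = (fun k => \int[mu]_(x in D) (err k x)%:E)%E)//.
  apply/funext => k.
  rewrite (@integral_itv_bndoo _ _ _ (fun x => (err k x)%:E))//.
  by apply/measurable_EFinP; exact: measurable_err.
- rewrite (_ : (fun k => _) = (fun k => nrm (v - I k)))//.
  apply/funext => k; congr (nrm (v - _)); apply: eq_bigr => j _.
  congr (_ *: _); congr fine.
  rewrite setIC -integral_indic//; last exact: sm_meas.
  rewrite (setIC D) -[RHS]integral_indic//; last exact: sm_meas.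
  rewrite (@integral_itv_bndoo _ _ _ (fun x => (\1_(sm_set j) x)%:E))//.
  apply/measurable_EFinP; apply: measurable_funTS; apply: measurable_indic.
  exact: sm_meas.
Qed.

End BochnerExistence.

(** * The Hilbert space L^2 *)

Section PreHilbert.
Variables (R : realType) (V : lmodType R) (b : V -> V -> R).
Hypothesis bC : forall u v, b u v = b v u.
Hypothesis bl : forall k u v w, b (k *: u + v) w = k * b u w + b v w.
Hypothesis b0 : forall u, 0 <= b u u.

(** The form [b] is only semidefinite. It is instantiated by the scalar product of L^2 and by that
    of H^1 on pairs. *)
Definition bnorm u := Num.sqrt (b u u).

Lemma psdDl u v w : b (u + v) w = b u w + b v w.
Proof. by rewrite -(scale1r u) bl mul1r scale1r. Qed.

Lemma psd0l w : b 0 w = 0.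
Proof. by have := psdDl 0 0 w; rewrite addr0; lra. Qed.

Lemma psdZl k u w : b (k *: u) w = k * b u w.
Proof. by rewrite -[k *: u]addr0 bl psd0l addr0. Qed.

Lemma psdNl u w : b (- u) w = - b u w.
Proof. by rewrite -scaleN1r psdZl mulN1r. Qed.

Lemma psdBl u v w : b (u - v) w = b u w - b v w.
Proof. by rewrite psdDl psdNl. Qed.

Lemma psdDr u v w : b w (u + v) = b w u + b w v.
Proof. by rewrite bC psdDl bC (bC v). Qed.

Lemma psdZr k u w : b w (k *: u) = k * b w u.
Proof. by rewrite bC psdZl bC. Qed.

Lemma psdNr u w : b w (- u) = - b w u.
Proof. by rewrite bC psdNl bC. Qed.

Lemma psdBr u v w : b w (u - v) = b w u - b w v.
Proof. by rewrite psdDr psdNr. Qed.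

Lemma psd_quad u v c : b (u - c *: v) (u - c *: v) = b u u - 2 * c * b u v + c ^+ 2 * b v v.
Proof. by rewrite psdBl !psdBr !psdZl !psdZr (bC v u); ring. Qed.

(** Discriminant of a quadratic polynomial; the sign of the leading coefficient is part of what is
    deduced. *)
Lemma quad_ge0 (p q r : R) : (forall c, 0 <= p - 2 * c * q + c ^+ 2 * r) ->
  q ^+ 2 <= p * r.
Proof.
move=> H; have [r0|r0] := eqVneq r 0.
  rewrite r0 mulr0; have [->|q0] := eqVneq q 0; first by rewrite expr0n.
  (* For this [c] the polynomial, linear as [r = 0], takes the value -1. *)
  have := H ((1 + p) / (2 * q)); rewrite r0 mulr0 addr0.
  have -> : 2 * ((1 + p) / (2 * q)) * q = 1 + p by field.
  by lra.
have rp : 0 < r.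
  rewrite lt_neqAle eq_sym r0/=; rewrite leNgt; apply/negP => rn.
  have p0 : 0 <= p by have := H 0; rewrite expr0n /=; lra.
  (* If [r < 0], adding the values at [c] and [- c] cancels the linear terms, and c^2 r <= c r = r -
     p leaves 0 <= r. *)
  pose c := 1 + p / (- r).
  have c1 : 1 <= c by rewrite lerDl divr_ge0//; lra.
  have h1 := H c; have h2 := H (- c).
  have h3 : c ^+ 2 * r <= c * r.
    by rewrite expr2 ler_nM2r// ler_peMl//; lra.
  have h4 : c * r = r - p by rewrite /c; field.
  by rewrite sqrrN in h2; lra.
have := H (q / r).
have -> : p - 2 * (q / r) * q + (q / r) ^+ 2 * r = p - q ^+ 2 / r by field.
by rewrite subr_ge0 ler_pdivrMr.
Qed.

Lemma psd_CS2 u v : b u v ^+ 2 <= b u u * b v v.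
Proof. by apply: quad_ge0 => c; rewrite -psd_quad. Qed.

Lemma bnorm_ge0 u : 0 <= bnorm u. Proof. exact: sqrtr_ge0. Qed.

Lemma bnorm_sqr u : bnorm u ^+ 2 = b u u.
Proof. by rewrite sqr_sqrtr. Qed.

Lemma psd_CS u v : `|b u v| <= bnorm u * bnorm v.
Proof.
rewrite -ler_sqr ?nnegrE ?mulr_ge0 ?bnorm_ge0// exprMn !bnorm_sqr.
by rewrite -normrX ger0_norm ?sqr_ge0// psd_CS2.
Qed.

Lemma seminorm_bnorm : seminorm bnorm.
Proof.
split=> [u v|k u].
  rewrite -ler_sqr ?nnegrE ?addr_ge0 ?bnorm_ge0// sqrrD !bnorm_sqr.
  rewrite psdDl !psdDr (bC v u).
  by have := psd_CS u v; have := ler_norm (b u v); lra.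
by rewrite /bnorm psdZl psdZr mulrA -expr2 sqrtrM ?sqr_ge0// sqrtr_sqr.
Qed.

Lemma psd_parallelogram u v :
  b (u + v) (u + v) + b (u - v) (u - v) = 2 * b u u + 2 * b v v.
Proof. by rewrite psdDl psdBl !psdDr !psdNr; ring. Qed.

Hypothesis cpl : seq_complete bnorm.

(** The subspace [S] need not be closed: the projection [g] of [z] is a limit of elements of [S],
    obtained from a minimizing sequence. *)
Lemma hilbert_projection (S : V -> Prop) (z : V) : S 0 ->
  (forall k u v, S u -> S v -> S (k *: u + v)) ->
  exists g, (forall e, 0 < e -> exists2 s, S s & bnorm (g - s) < e) /\
            forall s, S s -> b (z - g) s = 0.
Proof.
move=> S0 SL.
have sn := seminorm_bnorm.
pose A := [set r | exists2 s, S s & r = b (z - s) (z - s)].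
have A0 : A !=set0 by exists (b (z - 0) (z - 0)), 0.
have lbA : has_lbound A by exists 0 => _ [s _ ->].
have infA : has_inf A by [].
pose d := inf A.
have dle s : S s -> d <= b (z - s) (z - s).
  by move=> Ss; apply: ge_inf => //; exists s.
have ex k : exists s, S s /\ b (z - s) (z - s) < d + k.+1%:R^-1.
  have k0 : 0 < k.+1%:R^-1 :> R by [].
  by have [_ [s Ss ->] h] := inf_adherent k0 infA; exists s.
pose s_ k := sval (cid (ex k)).
have Ss k : S (s_ k) by rewrite /s_; case: cid => ? [].
have ds k : b (z - s_ k) (z - s_ k) < d + k.+1%:R^-1.
  by rewrite /s_; case: cid => ? [].
(* Parallelogram identity: the midpoint of [s_ m] and [s_ n] lies in [S], so it is at squared
   distance at least [d] from [z]. *)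
have close m n : b (s_ m - s_ n) (s_ m - s_ n) <= 2 * (m.+1%:R^-1 + n.+1%:R^-1).
  have := psd_parallelogram (z - s_ n) (z - s_ m).
  have -> : z - s_ n - (z - s_ m) = s_ m - s_ n.
    by rewrite opprB addrC subrKA.
  have Sm : S (2^-1 *: (s_ m + s_ n)).
    rewrite -[_ *: _]addr0; apply: (SL _ _ _ _ S0).
    by rewrite -(scale1r (s_ m)); apply: (SL _ _ _ (Ss m) (Ss n)).
  have := dle _ Sm.
  have -> : z - s_ n + (z - s_ m) = 2 *: (z - 2^-1 *: (s_ m + s_ n)).
    rewrite scalerBr scalerA divff ?pnatr_eq0// scale1r opprD addrACA.
    by rewrite -mulr2n -scaler_nat (addrC (- s_ n)).
  have -> w : b (2 *: w) (2 *: w) = 4 * b w w by rewrite psdZl psdZr; ring.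
  move: (ds m) (ds n); move: (b _ _) (b _ _) (b _ _) (b _ _) => B1 B2 B3 B4.
  by move: (m.+1%:R^-1) (n.+1%:R^-1) => M N; lra.
have [g cg] : exists g, (fun k => bnorm (g - s_ k)) @ \oo --> (0 : R).
  apply: cpl => e e0.
  have e4 : 0 < e ^+ 2 / 4 by rewrite divr_gt0// exprn_gt0.
  exists (Num.truncn (e ^+ 2 / 4)^-1) => m n hm hn.
  have small k : (Num.truncn (e ^+ 2 / 4)^-1 <= k)%N -> k.+1%:R^-1 < e ^+ 2 / 4.
    move=> hk; rewrite invf_plt ?posrE//.
    by apply: lt_le_trans (truncnS_gt _) _; rewrite ler_nat ltnS.
  rewrite -ltr_sqr ?nnegrE ?bnorm_ge0 ?(ltW e0)// bnorm_sqr.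
  move: (close m n) (small m hm) (small n hn); move: (b _ _) => B.
  by move: (m.+1%:R^-1) (n.+1%:R^-1) (e ^+ 2) => x y z'; lra.
have cz w : (fun k => b (z - s_ k - w) (z - s_ k - w)) @ \oo --> b (z - g - w) (z - g - w).
  rewrite -bnorm_sqr; under eq_fun do rewrite -bnorm_sqr.
  rewrite expr2; under eq_fun do rewrite expr2.
  have c1 : (fun k => bnorm (z - s_ k - w)) @ \oo --> bnorm (z - g - w).
    apply/cvgrPdist_le => e e0; move/cvgrPdist_le : cg => /(_ e e0).
    apply: filterS => k; rewrite sub0r normrN ger0_norm ?bnorm_ge0//; apply: le_trans.
    apply: le_trans (sn_dist sn _ _) _; rewrite (snBC sn).
    by rewrite opprB addrA subrK opprB addrC addrA subrK.
  exact: cvgM.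
have cd : (fun k => d + k.+1%:R^-1) @ \oo --> d.
  rewrite -[X in _ --> X]addr0; apply: cvgD; first exact: cvg_cst.
  exact: cvg_harmonic.
have zg : b (z - g) (z - g) <= d.
  have := cz 0; rewrite subr0; under eq_fun do rewrite subr0.
  move=> h; apply: (ler_cvg_to h cd); apply: nearW => k; exact: ltW.
have dw s : S s -> d <= b (z - g - s) (z - g - s).
  move=> Hs; apply: (ler_cvg_to (cvg_cst d) (cz s)); apply: nearW => k.
  by rewrite -addrA -opprD; apply: (dle _); rewrite -(scale1r (s_ k)); exact: (SL _ _ _ (Ss k) Hs).
exists g; split=> [e e0|s Hs].
  move/cvgrPdist_lt : cg => /(_ e e0)[N _ /(_ N (leqnn N))] /=.
  by rewrite sub0r normrN ger0_norm ?bnorm_ge0//; exists (s_ N).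
(* With [p = 0] the conclusion reads q^2 <= 0; the hypothesis is the minimality of the distance
   along [c *: s]. *)
have := @quad_ge0 0 (b (z - g) s) (b s s); rewrite mul0r => h.
apply/eqP; rewrite -sqrf_eq0 eq_le sqr_ge0 andbT; apply: h => c.
have Hc : S (c *: s) by rewrite -[_ *: _]addr0; apply: (SL _ _ _ Hs S0).
by have := dw _ Hc; rewrite psd_quad; lra.
Qed.

End PreHilbert.

(** * Representatives, scalar product and norm of L^2 *)

Section L2Space.
Variable R : realType.
Notation mu := (@lebesgue_measure R).
Implicit Types (f g h : L2 R).

Lemma L2addE f g x : (f + g : L2 R) x = f x + g x. Proof. by []. Qed.
Lemma L2scaleE k f x : (k *: f : L2 R) x = k * f x. Proof. by []. Qed.
Lemma L2oppE f x : (- f : L2 R) x = - f x. Proof. by []. Qed.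
Lemma L2subE f g x : (f - g : L2 R) x = f x - g x. Proof. by []. Qed.
Lemma L2zeroE x : (0 : L2 R) x = 0. Proof. by []. Qed.
Lemma L2ext f g : (forall x, f x = g x) -> f = g.
Proof. by move=> h; apply/LfuneqP. Qed.

Lemma measurable_L2 f : measurable_fun [set: R] (f : R -> R).
Proof. exact: set_mem (sub_Lfun_mfun (LfunP f)). Qed.

Lemma Lfun2P (h : R -> R) : measurable_fun [set: R] h ->
  (\int[mu]_x (h x ^+ 2)%:E < +oo)%E -> h \in Lfun mu 2%:E.
Proof.
move=> mh fh; rewrite inE; apply/andP; split; rewrite inE//=.
rewrite /finite_norm unlock; apply: poweR_lty.
suff -> : (\int[mu]_x `|(EFin \o h) x| `^ 2 = \int[mu]_x (h x ^+ 2)%:E)%E by [].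
by apply: eq_integral => x _; rewrite /= powR_mulrn// real_normK// num_real.
Qed.

Lemma L2sumE n (F : 'I_n -> L2 R) x : (\sum_(i < n) F i : L2 R) x = \sum_(i < n) F i x.
Proof.
elim: n F => [|n IH] F; first by rewrite !big_ord0 L2zeroE.
by rewrite !big_ord_recr -IH L2addE.
Qed.

(** The default value 0 outside L^2 avoids carrying proofs of square integrability. *)
Definition toL2 (h : R -> R) : L2 R :=
  match pselect (h \in Lfun mu 2%:E) with
  | left H => Lfun_Sub (lee1n 2) H | right _ => 0 end.

Lemma toL2E (h : R -> R) : h \in Lfun mu 2%:E -> (toL2 h : R -> R) = h.
Proof. by rewrite /toL2; case: pselect. Qed.

Lemma L2norm_int f : (\int[mu]_x (f x ^+ 2)%:E)%E = (L2norm f ^+ 2)%:E.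
Proof.
have H := @poweR_Lnorm _ _ _ mu (EFin \o (f : R -> R)) 2 (_ : 2 != 0 :> R).
rewrite pnatr_eq0 in H; have {}H := H isT.
rewrite -(finite_norm_fine f) -/(L2norm f) poweR_EFin powR_mulrn in H; last first.
  by apply: fine_ge0; exact: Lnorm_ge0.
rewrite H; apply: eq_integral => x _.
by rewrite /= powR_mulrn// real_normK// num_real.
Qed.

Lemma L2norm_ge0 f : 0 <= L2norm f.
Proof. by apply: fine_ge0; exact: Lnorm_ge0. Qed.

Lemma L2norm_le f (M : R) : 0 <= M ->
  (\int[mu]_x (f x ^+ 2)%:E <= (M ^+ 2)%:E)%E -> L2norm f <= M.
Proof.
by move=> M0; rewrite L2norm_int lee_fin ler_sqr ?nnegrE ?L2norm_ge0.
Qed.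

Lemma L2mul_int f g : mu.-integrable [set: R] (fun x => (f x * g x)%:E).
Proof. exact/Lfun1_integrable/Lfun2_mul_Lfun1/LfunP/LfunP. Qed.

Definition dot f g : R := \int[mu]_x (f x * g x).

Lemma dotE f g : (dot f g)%:E = (\int[mu]_x (f x * g x)%:E)%E.
Proof. by rewrite /dot /Rintegral fineK//; apply: integrable_fin_num => //; exact: L2mul_int. Qed.

Lemma dotC f g : dot f g = dot g f.
Proof. by apply: eq_Rintegral => x _; rewrite mulrC. Qed.

Lemma dot_lin k f g h : dot (k *: f + g) h = k * dot f h + dot g h.
Proof.
have i1 := L2mul_int (k *: f) h; have i2 := L2mul_int g h.
rewrite -(RintegralZl _ measurableT (L2mul_int f h)).
rewrite -RintegralD//; last first.
  by apply: eq_integrable i1 => // x _; congr EFin; rewrite L2scaleE mulrA.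
by apply: eq_Rintegral => x _; rewrite L2addE L2scaleE; ring.
Qed.

Lemma dotff f : dot f f = L2norm f ^+ 2.
Proof.
apply: EFin_inj; rewrite dotE -L2norm_int.
by apply: eq_integral => x _; rewrite expr2.
Qed.

Lemma dotff_ge0 f : 0 <= dot f f. Proof. by rewrite dotff sqr_ge0. Qed.

Lemma L2norm_bnorm : @L2norm R = bnorm dot.
Proof. by apply/funext => f; rewrite /bnorm dotff sqrtr_sqr ger0_norm// L2norm_ge0. Qed.

Lemma seminorm_L2 : seminorm (@L2norm R).
Proof. by rewrite L2norm_bnorm; exact: seminorm_bnorm dotC dot_lin dotff_ge0. Qed.

Lemma dot_CS f g : `|dot f g| <= L2norm f * L2norm g.
Proof. by rewrite L2norm_bnorm; exact: psd_CS dotC dot_lin dotff_ge0 _ _. Qed.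

Lemma dotDl f g h : dot (f + g) h = dot f h + dot g h.
Proof. exact: psdDl dot_lin _ _ _. Qed.
Lemma dotBl f g h : dot (f - g) h = dot f h - dot g h.
Proof. exact: psdBl dot_lin _ _ _. Qed.
Lemma dotZl k f h : dot (k *: f) h = k * dot f h.
Proof. exact: psdZl dot_lin _ _ _. Qed.
Lemma dotNl f h : dot (- f) h = - dot f h.
Proof. exact: psdNl dot_lin _ _. Qed.
Lemma dotDr f g h : dot h (f + g) = dot h f + dot h g.
Proof. by rewrite dotC dotDl !(dotC h). Qed.
Lemma dotBr f g h : dot h (f - g) = dot h f - dot h g.
Proof. by rewrite dotC dotBl !(dotC h). Qed.
Lemma dotZr k f h : dot h (k *: f) = k * dot h f.
Proof. by rewrite dotC dotZl !(dotC h). Qed.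
Lemma L2eqP f g : f =L2 g <-> L2norm (f - g) = 0.
Proof.
split=> [fg|/fine_Lnormr_eq0]; last first.
  apply: aeS => x H _; move: (H I); change (f x - g x = 0 -> f x = g x).
  by move/eqP; rewrite subr_eq0 => /eqP.
apply/eqP; rewrite -sqrf_eq0; apply/eqP/EFin_inj; rewrite -L2norm_int.
rewrite (ae_eq_integral (cst 0%E))//.
- by rewrite integral0.
- apply/measurable_EFinP; apply: measurable_funX; exact: measurable_L2.
- by apply: aeS fg => x /(_ I) E _; rewrite L2subE E subrr expr0n.
Qed.

Lemma L2eq_refl f : f =L2 f. Proof. exact/ae_eq_refl. Qed.
Lemma L2eq_dot f g h : f =L2 g -> dot f h = dot g h.
Proof.
move/L2eqP => fg; apply/eqP; rewrite -subr_eq0 -dotBl -normr_le0.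
by apply: le_trans (dot_CS _ _) _; rewrite fg mul0r.
Qed.

Lemma L2eq_norm f g : f =L2 g -> L2norm f = L2norm g.
Proof. by move/L2eqP; exact: sn_eq0 seminorm_L2 _ _. Qed.

End L2Space.

(** * Completeness of L^2 *)

Section Completeness.
Variable R : realType.

(** A Cauchy sequence has a subsequence with steps at most 2^-k, and converges as soon as that
    subsequence does. *)
Lemma fast_complete (V : lmodType R) (nrm : V -> R) : seminorm nrm ->
  (forall u : nat -> V, (forall k, nrm (u k.+1 - u k) <= 2^-1 ^+ k) ->
    exists v, (fun k => nrm (v - u k)) @ \oo --> (0 : R)) ->
  seq_complete nrm.
Proof.
move=> sn H u uC.
have p2 k : 0 < 2^-1 ^+ k :> R by rewrite exprn_gt0.
have ex k : exists N, forall m n, (N <= m)%N -> (N <= n)%N ->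
  nrm (u m - u n) < 2^-1 ^+ k by exact: uC.
pose N k := maxn k (sval (cid (ex k))).
have NP k m n : (N k <= m)%N -> (N k <= n)%N -> nrm (u m - u n) < 2^-1 ^+ k.
  rewrite /N !geq_max => /andP[_ h1] /andP[_ h2].
  by case: cid h1 h2 => ? /= h h1 h2; exact: h.
pose s k := \max_(i < k.+1) N i.
have sN k : (N k <= s k)%N by exact: (leq_bigmax (Ordinal (ltnSn k))).
have ss k : (s k <= s k.+1)%N.
  by rewrite /s [X in (_ <= X)%N]big_ord_recr/= leq_maxl.
have [k|v cv] := H (fun k => u (s k)).
  by apply: ltW; apply: NP => //; exact: leq_trans (ss k).
exists v; apply/cvgrPdist_lt => e e0.
have e2 : 0 < e / 2 by rewrite divr_gt0.
have [M HM] := uC _ e2.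
move/cvgrPdist_lt : cv => /(_ _ e2)[K _ HK].
exists M => // n /= hn; rewrite sub0r normrN ger0_norm ?sn_ge0//.
pose k := maxn K M.
have sk : (M <= s k)%N.
  by apply: leq_trans (sN k); rewrite /N leq_max /k leq_maxr.
have := HK k (leq_maxl _ _); rewrite /= sub0r normrN ger0_norm ?sn_ge0// => h1.
have h2 := HM _ _ sk hn.
by apply: le_lt_trans (sn_tri sn (u (s k)) _ _) _; lra.
Qed.

Notation mu := (@lebesgue_measure R).

Lemma sum_half (k : nat) : \sum_(i < k) 2^-1 ^+ i <= 2 :> R.
Proof.
suff -> : \sum_(i < k) 2^-1 ^+ i = 2 - 2 * 2^-1 ^+ k :> R.
  by rewrite gerBl mulr_ge0// exprn_ge0.
elim: k => [|k IH]; first by rewrite big_ord0 expr0; ring.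
by rewrite big_ord_recr/= IH exprS; field.
Qed.

(** The sums of absolute increments [g k] have norm at most 2, so by monotone convergence their
    limit is finite almost everywhere; there [u k x] converges absolutely. Fatou's lemma then bounds
    the distance to the limit. *)
Lemma riesz_fischer (u : nat -> L2 R) :
  (forall k, L2norm (u k.+1 - u k) <= 2^-1 ^+ k) ->
  exists v, (fun k => L2norm (v - u k)) @ \oo --> (0 : R).
Proof.
move=> uk; have sn := @seminorm_L2 R.
pose g k x : R := \sum_(i < k) `|u i.+1 x - u i x|.
have mu_ k : measurable_fun [set: R] (u k : R -> R) by exact: measurable_L2.
have mg k : measurable_fun [set: R] (g k).
  apply: measurable_sum => i; apply: measurableT_comp => //.
  exact: measurable_funB.
have abs_ge0 (f : L2 R) : (fun x => `|f x|) \in Lfun mu 2%:E.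
  apply: Lfun2P.
    by apply: measurableT_comp => //; exact: measurable_L2.
  under eq_integral => x _ do rewrite real_normK ?num_real//.
  by rewrite L2norm_int ltry.
pose G k : L2 R := \sum_(i < k) toL2 (fun x => `|u i.+1 x - u i x|).
have GE k x : G k x = g k x.
  rewrite /G /g L2sumE; apply: eq_bigr => i _.
  by rewrite (toL2E (abs_ge0 (u i.+1 - u i))).
have normabs (f : L2 R) : L2norm (toL2 (fun x => `|f x|)) = L2norm f.
  apply/eqP; rewrite -(@eqrXn2 _ 2) ?L2norm_ge0//; apply/eqP/EFin_inj.
  rewrite -!L2norm_int toL2E//; apply: eq_integral => x _.
  by rewrite real_normK ?num_real.
have G2 k : L2norm (G k) <= 2.
  apply: le_trans (sn_sum sn _ _ _) _; apply: le_trans (sum_half k).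
  by apply: ler_sum => i _; rewrite (normabs (u i.+1 - u i)).
have g0 k x : 0 <= g k x by apply: sumr_ge0.
have gm x : {homo g ^~ x : m n / (m <= n)%N >-> m <= n}.
  apply/nondecreasing_seqP => n; rewrite /g big_ord_recr/=.
  by rewrite lerDl.
have intg k : (\int[mu]_x (g k x ^+ 2)%:E <= 4%:E)%E.
  rewrite (_ : (\int[mu]_x (g k x ^+ 2)%:E)%E = (\int[mu]_x (G k x ^+ 2)%:E)%E).
    rewrite L2norm_int lee_fin (_ : 4 = 2 ^+ 2); last by rewrite -natrX.
    by rewrite ler_sqr ?nnegrE ?L2norm_ge0.
  by apply: eq_integral => x _; rewrite GE.
pose L x := limn (fun k => (g k x ^+ 2)%:E).
have mg2 k : measurable_fun [set: R] (fun x => (g k x ^+ 2)%:E).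
  by apply/measurable_EFinP; exact: measurable_funX.
have g2m x : {homo (fun k => (g k x ^+ 2)%:E) : m n / (m <= n)%N >-> (m <= n)%E}.
  by move=> m n mn; rewrite lee_fin ler_sqr ?nnegrE ?gm.
have gL x : (fun k => (g k x ^+ 2)%:E) @ \oo --> L x.
  by apply/cvg_ex; eexists; exact: ereal_nondecreasing_cvgn (g2m x).
have gLle k x : ((g k x ^+ 2)%:E <= L x)%E.
  rewrite /L (cvg_lim _ (ereal_nondecreasing_cvgn (g2m x)))//.
  by apply: ereal_sup_ubound; exists k.
have mL : measurable_fun [set: R] L.
  by apply: (emeasurable_fun_cvg _ _ mg2) => x _; exact: gL.
have L0 x : (0 <= L x)%E by apply: le_trans (gLle 0%N x); rewrite lee_fin sqr_ge0.
have iL : (\int[mu]_x L x <= 4%:E)%E.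
  have := @cvg_monotone_convergence _ (measurableTypeR R) R mu setT measurableT
    (fun k x => (g k x ^+ 2)%:E) mg2 (fun k x _ => _) (fun x _ => g2m x).
  move=> /(_ (fun k x => sqr_ge0 (g k x))) cv.
  rewrite -(cvg_lim _ cv)//; apply: lime_le; first by apply/cvg_ex; eexists; exact: cv.
  exact: nearW.
have ae_fin : {ae mu, forall x : R, L x \is a fin_num}.
  have : mu.-integrable setT L.
    apply/integrableP; split => //.
    under eq_integral => x _ do rewrite gee0_abs//.
    by apply: le_lt_trans iL _; rewrite ltry.
  by move/(integrable_ae measurableT); apply: aeS => x /(_ I).
have cvu x : L x \is a fin_num -> cvgn (fun k => u k x).
  move=> Lf.
  have cg : cvgn (fun k => g k x).
    apply: nondecreasing_is_cvgn; first exact: gm.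
    exists (1 + fine (L x)) => _ [k _ <-].
    have : g k x ^+ 2 <= fine (L x) by rewrite -lee_fin fineK.
    by have := sqr_ge0 (g k x - 1); have := g0 k x; nra.
  have : cvgn (series (fun i => u i.+1 x - u i x)).
    apply: normed_cvg; move: cg.
    rewrite (_ : (fun k => g k x) = [normed series (fun i => u i.+1 x - u i x)])//.
    transitivity (series (fun i => `|u i.+1 x - u i x|)); last by [].
    by apply/funext => k; rewrite /series /= big_mkord.
  move=> /cvg_ex[l cl]; apply/cvg_ex; exists (l + u 0%N x).
  rewrite (_ : (fun k => u k x) = (fun k => series (fun i => u i.+1 x - u i x) k + u 0%N x)).
    by apply: cvgD => //; exact: cvg_cst.
  by apply/funext => k; rewrite /series/= telescope_sumr// subrK.
(* An upper limit is defined and measurable everywhere, including the null set where the sequence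
   may diverge. *)
pose v x := fine (limn_esup (fun k => (u k x)%:E)).
have mv : measurable_fun [set: R] v.
  apply: measurableT_comp; first exact: fine_measurable.
  by apply: measurable_fun_limn_esup => k; apply/measurable_EFinP.
have vE x : L x \is a fin_num -> (fun k => u k x) @ \oo --> v x.
  move=> /cvu/cvg_ex[l cl]; rewrite /v.
  have -> : limn_esup (fun k => (u k x)%:E) = l%:E.
    by apply: (cvg_limn_einf_sup _).2; apply/cvg_EFin => //; exact: nearW.
  exact: cl.
have udist k j : L2norm (u (j + k)%N - u k) <= 2 * 2^-1 ^+ k.
  have : L2norm (u (j + k)%N - u k) <= 2^-1 ^+ k * \sum_(i < j) 2^-1 ^+ i.
    elim: j => [|j IH]; first by rewrite add0n subrr sn0// big_ord0 mulr0.
    apply: le_trans (sn_tri sn (u (j + k)%N) _ _) _.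
    rewrite addrC big_ord_recr/= mulrDr; apply: lerD => //.
    by apply: le_trans (uk _) _; rewrite -exprD addnC.
  move/le_trans; apply; rewrite mulrC ler_wpM2r ?exprn_ge0//.
  exact: sum_half.
(* Fatou's lemma applied to [u (j + k) - u k] as j grows. *)
have key k : (\int[mu]_x ((v x - u k x) ^+ 2)%:E <= ((2 * 2^-1 ^+ k) ^+ 2)%:E)%E.
  have mj j : measurable_fun [set: R] (fun x => ((u (j + k)%N x - u k x) ^+ 2)%:E).
    by apply/measurable_EFinP; apply: measurable_funX; exact: measurable_funB.
  apply: (@le_trans _ _ (\int[mu]_x limn_einf (fun j => ((u (j + k)%N x - u k x) ^+ 2)%:E))%E).
    apply: leb_ae_le_integral => //.
    - by move=> x _; rewrite lee_fin sqr_ge0.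
    - by apply/measurable_EFinP; apply: measurable_funX; exact: measurable_funB.
    - move=> x _; rewrite limn_einf_lim; apply: lime_ge; first exact: is_cvg_einfs.
      apply: nearW => n; apply: le_ereal_inf_tmp => _ [j _ <-].
      by rewrite lee_fin sqr_ge0.
    apply: aeS ae_fin => x /vE cv _.
    have cj : (fun j => u (j + k)%N x) @ \oo --> v x.
      move=> P /cv [N _ HN]; exists N => // j /= Nj; apply: HN => /=.
      exact: leq_trans (leq_addr _ _).
    have -> : limn_einf (fun j => ((u (j + k)%N x - u k x) ^+ 2)%:E) = ((v x - u k x) ^+ 2)%:E; last by [].
    apply: (cvg_limn_einf_sup _).1; apply/cvg_EFin; first exact: nearW.
    rewrite expr2; under eq_fun do rewrite /= expr2.
    by apply: cvgM; apply: cvgB => //; exact: cvg_cst.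
  apply: le_trans (fatou mu measurableT mj _) _.
    by move=> n x _; rewrite lee_fin sqr_ge0.
  rewrite limn_einf_lim; apply: lime_le; first exact: is_cvg_einfs.
  apply: nearW => n; apply: (@le_trans _ _ (\int[mu]_x ((u (n + k)%N - u k) x ^+ 2)%:E)%E).
    by apply: ereal_inf_lbound; exists n => //=.
  by rewrite L2norm_int lee_fin ler_sqr ?nnegrE ?L2norm_ge0// mulr_ge0 ?exprn_ge0.
(* Square integrability is known for [v - u 0], by the case k = 0 of [key]; the limit is rebuilt
   from this difference. *)
have vL : (fun x => v x - u 0%N x) \in Lfun mu 2%:E.
  apply: Lfun2P; first exact: measurable_funB.
  by apply: le_lt_trans (key 0%N) _; rewrite ltry.
exists (toL2 (fun x => v x - u 0%N x) + u 0%N).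
have bnd k : L2norm (toL2 (fun x => v x - u 0%N x) + u 0%N - u k) <= 2 * 2^-1 ^+ k.
  apply: L2norm_le; first by rewrite mulr_ge0 ?exprn_ge0.
  apply: le_trans (key k); rewrite le_eqVlt; apply/orP; left; apply/eqP.
  by apply: eq_integral => x _; rewrite L2subE L2addE toL2E// subrK.
apply: (@squeeze_cvgr _ _ _ _ (cst 0) (fun k => 2 * 2^-1 ^+ k)).
- by apply: nearW => k; rewrite L2norm_ge0 bnd.
- exact: cvg_cst.
- rewrite -[X in _ --> X](mulr0 2); apply: cvgM; first exact: cvg_cst.
  by apply: cvg_expr; rewrite ger0_norm// invf_lt1// ltr1n.
Qed.

Lemma L2_complete : seq_complete (@L2norm R).
Proof. exact: fast_complete (@seminorm_L2 R) riesz_fischer. Qed.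

End Completeness.

(** * Smooth functions with compact support *)

Section Smooth.
Variable R : realType.
Implicit Types (f g : R -> R).

Definition smooth f := forall k x, derivable (derive1n k f) x 1.

(** Coinduction: smoothness of all members of a class follows from its stability under
    derivation. *)
Lemma smooth_coind (P : (R -> R) -> Prop) :
  (forall f, P f -> (forall x, derivable f x 1) /\ P (derive1 f)) ->
  forall f, P f -> smooth f.
Proof.
move=> HP f Pf k; elim: k f Pf => [|k IH] f Pf x.
  by rewrite derive1n0; apply: (HP _ Pf).1.
by rewrite derive1Sn; apply: IH; exact: (HP _ Pf).2.
Qed.

Lemma smooth_derivable f x : smooth f -> derivable f x 1.
Proof. by move=> /(_ 0%N x); rewrite derive1n0. Qed.

Lemma smooth_derive1 f : smooth f -> smooth (derive1 f).
Proof. by move=> sf k x; rewrite -derive1Sn; exact: sf. Qed.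

Lemma derivable_continuous f : (forall x, derivable f x 1) -> continuous f.
Proof.
by move=> df x; apply: differentiable_continuous; apply/derivable1_diffP; exact: df.
Qed.

Lemma smooth_continuous f : smooth f -> continuous f.
Proof. by move=> sf; apply: derivable_continuous => x; exact: smooth_derivable. Qed.

(* A class containing the products of smooth functions and closed under
   derivation, by the Leibniz rule. *)
Inductive smooth_alg : (R -> R) -> Prop :=
| smooth_alg_mul f g : smooth f -> smooth g -> smooth_alg (f * g)
| smooth_alg_add f g : smooth_alg f -> smooth_alg g -> smooth_alg (f + g).

Lemma smooth_algP f : smooth_alg f -> smooth f.
Proof.
apply: smooth_coind => {}f; elim=> [{}f g sf sg|{}f g _ [df af] _ [dg ag]].
  have df (x : R) := @smooth_derivable f x sf; have dg (x : R) := @smooth_derivable g x sg.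
  split=> [x|]; first exact: derivableM.
  rewrite (_ : derive1 _ = f * derive1 g + g * derive1 f); last first.
    by apply/funext => x; rewrite derive1E (deriveM (df x) (dg x)) -!derive1E.
  exact: (smooth_alg_add (smooth_alg_mul sf (smooth_derive1 sg)) (smooth_alg_mul sg (smooth_derive1 sf))).
split=> [x|]; first exact: derivableD.
rewrite (_ : derive1 _ = derive1 f + derive1 g); last first.
  by apply/funext => x; rewrite derive1E (deriveD (df x) (dg x)) -!derive1E.
exact: smooth_alg_add.
Qed.

Lemma smooth_cst c : smooth (cst c).
Proof.
apply: (@smooth_coind (fun f => exists c, f = cst c)); last by exists c.
move=> _ [{}c ->]; split=> [x|]; first exact: derivable_cst.
by exists 0; apply/funext => x; rewrite derive1_cst.
Qed.

Lemma smoothM f g : smooth f -> smooth g -> smooth (f * g).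
Proof. by move=> sf sg; apply/smooth_algP/smooth_alg_mul. Qed.

Lemma smoothD f g : smooth f -> smooth g -> smooth (f + g).
Proof.
move=> sf sg; have A h : smooth h -> smooth_alg h.
  move=> sh; rewrite -[h]mulr1; apply: smooth_alg_mul; [exact: sh|exact: smooth_cst].
by apply: smooth_algP; apply: smooth_alg_add; exact: A.
Qed.

Lemma is_derive_affine f (a c x : R) : derivable f (a * x + c) 1 ->
  is_derive x 1 (fun y => f (a * y + c)) (a * derive1 f (a * x + c)).
Proof.
move=> df.
have da : is_derive x 1 (fun y => a * y + c) a.
  have := is_deriveD (is_deriveZ a (is_derive_id x (1:R))) (is_derive_cst c x (1:R)).
  by rewrite addr0 /GRing.scale/= mulr1.
have df' : is_derive (a * x + c) 1 f (derive1 f (a * x + c)).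
  by rewrite derive1E; exact: derivableP.
by have := @is_derive1_comp _ f (fun y => a * y + c) x _ _ df' da; rewrite mulrC.
Qed.

Lemma smooth_affine f (a c : R) : smooth f -> smooth (fun x => f (a * x + c)).
Proof.
move=> sf.
apply: (@smooth_coind (fun h => exists g k, smooth g /\ h = (fun x => k * g (a * x + c)))).
  move=> _ [g [k [sg ->]]].
  have D (x : R) : is_derive x 1 (fun x => k * g (a * x + c)) (k * a * derive1 g (a * x + c)).
    have := is_deriveZ k (is_derive_affine (@smooth_derivable g (a * x + c) sg)).
    by rewrite /GRing.scale/= mulrA.
  split=> [x|]; first exact: (@ex_derive _ _ _ _ _ _ _ (D x)).
  exists (derive1 g), (k * a); split; first exact: smooth_derive1.
  by apply/funext => x; rewrite derive1E; exact: (@derive_val _ _ _ _ _ _ _ (D x)).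
by exists f, 1; split => //; apply/funext => x; rewrite mul1r.
Qed.

(** The family p(1/x) e^(-1/x), extended by 0, is stable under derivation: [p] becomes X^2 (p - p').
    Smoothness of e^(-1/x) then follows by coinduction. *)
Definition flat (p : {poly R}) (x : R) : R :=
  if 0 < x then p.[x^-1] * expR (- x^-1) else 0.

Lemma horner_le (p : {poly R}) (z : R) : 1 <= z ->
  `|p.[z]| <= (\sum_(i < size p) `|p`_i|) * z ^+ size p.
Proof.
move=> z1; rewrite horner_coef mulr_suml.
apply: le_trans (ler_norm_sum _ _ _) _; apply: ler_sum => i _.
rewrite normrM ler_wpM2l// normrX ger0_norm; last by lra.
by rewrite ler_weXn2l// ltnW.
Qed.

Lemma pow_le_expR (n : nat) : exists2 K : R, 0 < K &
  forall z, 0 <= z -> z ^+ n <= K * expR z.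
Proof.
case: n => [|n].
  exists 1 => // z z0; rewrite expr0 mul1r; apply: le_trans (expR_ge1Dx z); lra.
have N0 : 0 < n.+1%:R :> R by [].
exists (n.+1%:R ^+ n.+1); first by rewrite exprn_gt0.
move=> z z0; have -> : expR z = expR (z / n.+1%:R) ^+ n.+1.
  by rewrite -expRM_natl mulrC divfK// gt_eqF.
rewrite -exprMn; apply: lerXn2r; rewrite ?nnegrE ?mulr_ge0 ?expR_ge0//.
rewrite mulrC -ler_pdivrMr//.
by apply: le_trans (expR_ge1Dx _); rewrite lerDr.
Qed.

(** The exponential is compared with a power of 1/x exceeding the size of [p] by 2, which leaves
    x^2. This quadratic decay gives the zero derivative at 0. *)
Lemma flat_le (p : {poly R}) : exists C : R, 0 <= C /\
  forall x, 0 < x -> x <= 1 -> `|flat p x| <= C * x ^+ 2.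
Proof.
pose A := \sum_(i < size p) `|p`_i|.
have A0 : 0 <= A by rewrite sumr_ge0.
have [K K0 HK] := pow_le_expR (size p).+2.
exists (A * K); split; first by rewrite mulr_ge0// ltW.
move=> x x0 x1; rewrite /flat x0 normrM (ger0_norm (expR_ge0 _)).
have z1 : 1 <= x^-1 by rewrite invf_ge1.
have z0 : 0 < x^-1 by rewrite invr_gt0.
apply: (@le_trans _ _ (A * x^-1 ^+ size p * expR (- x^-1))).
  by rewrite ler_wpM2r ?expR_ge0//; exact: horner_le.
have h0 := HK _ (ltW z0); rewrite (exprS _ (size p).+1) (exprS _ (size p)) in h0.
rewrite expRN; move: (expR_gt0 x^-1) h0.
move: (x^-1 ^+ size p) (expR x^-1) => Z E E0 h.
rewrite ler_pdivrMr//.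
have -> : A * K * x ^+ 2 * E = A * (x ^+ 2 * (K * E)) by ring.
have -> : A * Z = A * (x ^+ 2 * (x^-1 * (x^-1 * Z))) by field; rewrite gt_eqF.
by rewrite ler_wpM2l// ler_wpM2l// sqr_ge0.
Qed.

Lemma is_derive_eps f (x l : R) :
  (forall e, 0 < e -> exists2 d : R, 0 < d & forall h, h != 0 -> `|h| < d ->
     `|(f (h + x) - f x) / h - l| <= e) -> is_derive x 1 f l.
Proof.
move=> H.
have cv : (fun h : R => h^-1 *: ((f \o shift x) (h *: (1 : R)) - f x)) @ 0^' --> l.
  apply/cvgrPdist_le => e e0; have [d d0 Hd] := H e e0.
  apply: filterS2 (dnbhs0_lt d0) (nbhs_dnbhs_neq (0 : R)) => h hd h0.
  rewrite distrC /GRing.scale/= mulr1 [X in X - l]mulrC; exact: Hd.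
by apply: DeriveDef; [apply/cvg_ex; exists l | exact: cvg_lim].
Qed.

Lemma smooth_flat p : smooth (flat p).
Proof.
apply: (@smooth_coind (fun f => exists p, f = flat p)); last by exists p.
move=> _ [{}p ->].
pose q := 'X ^+ 2 * (p - p^`()).
suff D (x : R) : is_derive x 1 (flat p) (flat q x).
  split=> [x|]; first exact: (@ex_derive _ _ _ _ _ _ _ (D x)).
  exists q; apply/funext => x; rewrite derive1E.
  exact: (@derive_val _ _ _ _ _ _ _ (D x)).
have [x0|x0|->] := ltrgt0P x.
- have E : \forall y \near x, p.[y^-1] * expR (- y^-1) = flat p y.
    by apply: filterS (lt_nbhsr x0) => y y0; rewrite /flat y0.
  apply: (near_eq_is_derive E).
  have xn : id x != 0 by rewrite gt_eqF.
  have dV := is_deriveV xn (is_derive_id x (1:R)).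
  have dp := @is_derive1_comp _ (horner p) (fun y => y^-1) x _ _ (is_derive_poly p x^-1) dV.
  have dE := @is_derive1_comp _ expR (fun y => - y^-1) x _ _ (is_derive_expR _) (is_deriveN dV).
  have := is_deriveM dp dE; move/is_derive_eq; apply.
  rewrite /flat x0 /q !hornerE /GRing.scale/=; by field; rewrite gt_eqF.
- have E : \forall y \near x, cst 0 y = flat p y.
    by apply: filterS (lt_nbhsl x0) => y y0; rewrite /flat ltNge (ltW y0).
  apply: (near_eq_is_derive E); rewrite /flat ltNge (ltW x0)/=; exact: is_derive_cst.
- rewrite /flat ltxx; apply: is_derive_eps => e e0.
  have [C [C0 HC]] := flat_le p.
  exists (Num.min 1 (e / (1 + C))).
    by rewrite lt_min ltr01 divr_gt0// ltr_pwDl.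
  move=> h h0; rewrite lt_min => /andP[h1 h2].
  rewrite addr0 ltxx !subr0; case: ltP => hs; last by rewrite mul0r normr0 ltW.
  rewrite gtr0_norm// in h1; rewrite gtr0_norm// in h2.
  rewrite normrM normfV (gtr0_norm hs) ler_pdivrMr//.
  have := HC h hs (ltW h1); rewrite /flat hs => /le_trans; apply.
  rewrite expr2 mulrA ler_wpM2r ?(ltW hs)//.
  move: h2; rewrite ltr_pdivlMr ?ltr_pwDl//; lra.
Qed.

(* flat 1 x = exp (- 1 / x) for x > 0; for m -> oo the product below tends to
   the indicator function of ]a, b[. *)
Definition plateau (m : nat) (a b x : R) : R :=
  flat 1 (m.+1%:R * x - m.+1%:R * a) * flat 1 (- m.+1%:R * x + m.+1%:R * b).

Lemma smooth_plateau m a b : smooth (plateau m a b).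
Proof.
rewrite (_ : plateau m a b = (fun x => flat 1 (m.+1%:R * x - m.+1%:R * a)) *
  (fun x => flat 1 (- m.+1%:R * x + m.+1%:R * b))); last exact/funext.
by apply: smoothM; apply: smooth_affine; exact: smooth_flat.
Qed.

Lemma flat1_itv x : 0 <= flat 1 x <= 1.
Proof.
rewrite /flat; case: ifPn => [x0|_]; last by rewrite lexx ler01.
rewrite hornerC mul1r expR_ge0 -[leRHS]expR0 ler_expR.
by rewrite oppr_le0 invr_ge0 ltW.
Qed.

Lemma plateau_itv m a b x : 0 <= plateau m a b x <= 1.
Proof.
have /andP[h1 h2] := flat1_itv (m.+1%:R * x - m.+1%:R * a).
have /andP[h3 h4] := flat1_itv (- m.+1%:R * x + m.+1%:R * b).
by rewrite /plateau mulr_ge0//= mulr_ile1.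
Qed.

Lemma plateau_eq0 m a b x : ~~ (a < x < b) -> plateau m a b x = 0.
Proof.
rewrite negb_and -!leNgt => /orP[h|h]; rewrite /plateau /flat.
  by rewrite ifF ?mul0r//; apply/negbTE; rewrite -leNgt -mulrBr pmulr_rle0// subr_le0.
rewrite [X in _ * X]ifF ?mulr0//; apply/negbTE.
by rewrite -leNgt mulNr addrC -mulrBr pmulr_rle0// subr_le0.
Qed.

Lemma plateau_cvg a b x : a < x < b -> (fun m => plateau m a b x) @ \oo --> (1 : R).
Proof.
have F z : 0 < z -> (fun m : nat => flat 1 (m.+1%:R * z)) @ \oo --> (1 : R).
  move=> z0; rewrite (_ : (fun m => _) = (fun m : nat => expR (- (z^-1 * m.+1%:R^-1)))).
    rewrite -[X in _ --> X](_ : expR (- (z^-1 * 0)) = 1); last by rewrite mulr0 oppr0 expR0.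
    apply: continuous_cvg; first exact: continuous_expR.
    by apply: cvgN; apply: cvgM; [exact: cvg_cst | exact: cvg_harmonic].
  by apply/funext => m; rewrite /flat pmulr_rgt0// z0 hornerC mul1r invfM mulrC.
move=> /andP[ax xb]; rewrite -[X in _ --> X]mulr1 /plateau.
apply: cvgM.
  by under eq_fun do rewrite -mulrBr; apply: F; rewrite subr_gt0.
by under eq_fun do rewrite mulNr addrC -mulrBr; apply: F; rewrite subr_gt0.
Qed.

End Smooth.

(** * Test functions: integration by parts, density and uniqueness *)

Section Tests.
Variable R : realType.
Notation mu := (@lebesgue_measure R).
Implicit Types (phi chi : R -> R) (f g : L2 R).

Lemma compact_support_bounded phi (M : R) : continuous phi ->
  (forall x, M < `|x| -> phi x = 0) ->
  exists2 B, 0 <= B & forall x, `|phi x| <= B.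
Proof.
move=> cphi supp; pose b : R := `|M| + 1.
have b0 : - b <= b by have := normr_ge0 M; rewrite /b; lra.
have cn : {within `[- b, b], continuous (fun x => `|phi x|)}.
  apply: continuous_subspaceT => x; apply: continuous_comp; first exact: cphi.
  exact: norm_continuous.
have [c _ Hc] := EVT_max b0 cn.
exists `|phi c| => // x.
have [xb|bx] := leP `|x| b.
  by apply: Hc; rewrite in_itv/= -ler_norml.
rewrite supp ?normr0//; apply: le_lt_trans bx.
by have := ler_norm M; rewrite /b; lra.
Qed.

Lemma lebesgue_itv_lty (a b : R) : (mu `[a, b]%classic < +oo)%E.
Proof.
rewrite lebesgue_measure_itv/=.
by case: ifPn => _; rewrite ?ltry// -EFinN -EFinD ltry.
Qed.

Lemma integral_indic_itv_lty (a b : R) : (\int[mu]_x (\1_`[a, b] x)%:E < +oo)%E.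
Proof.
rewrite (@integral_indic _ _ R mu setT measurableT `[a, b]%classic (measurable_itv _)).
rewrite setIT; exact: lebesgue_itv_lty.
Qed.

Lemma compact_support_Lfun2 phi (M : R) : continuous phi ->
  (forall x, M < `|x| -> phi x = 0) -> phi \in Lfun mu 2%:E.
Proof.
move=> cphi supp; have [B B0 HB] := compact_support_bounded cphi supp.
have mphi : measurable_fun [set: R] phi by exact: continuous_measurable_fun.
apply: Lfun2P => //; pose b : R := `|M| + 1.
have bM x : b < `|x| -> M < `|x|.
  by move=> bx; apply: le_lt_trans bx; have := ler_norm M; rewrite /b; lra.
apply: (@le_lt_trans _ _ (\int[mu]_x ((B ^+ 2)%:E * (\1_`[- b, b] x)%:E))%E).
  apply: leb_le_integral => // x _; first by rewrite lee_fin sqr_ge0.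
  rewrite -EFinM lee_fin indicE.
  case: (boolP (x \in `[- b, b]%classic)) => [_|].
    by rewrite mulr1 -(@real_normK _ (phi x)) ?num_real// ler_sqr ?nnegrE// HB.
  rewrite notin_setE/= in_itv/= -ler_norml => /negP; rewrite -ltNge => bx.
  by rewrite supp ?expr0n ?mulr0//; exact: bM.
rewrite leb_ge0_integralZl ?sqr_ge0//.
- by rewrite lte_mul_pinfty ?lee_fin ?sqr_ge0//; exact: integral_indic_itv_lty.
- by apply/measurable_EFinP; exact: measurable_indic.
Qed.

Lemma test_smooth phi : is_test_function phi -> smooth phi.
Proof. by case. Qed.

Lemma test_continuous phi : is_test_function phi -> continuous phi.
Proof. by move=> [/smooth_continuous]. Qed.

Lemma derive1_outside phi (M x : R) : (forall x, M < `|x| -> phi x = 0) ->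
  M < `|x| -> derive1 phi x = 0.
Proof.
move=> supp Mx; rewrite derive1E.
have E : \forall y \near x, cst 0 y = phi y.
  have : \forall y \near x, M < `|y|.
    exact: (@norm_continuous _ _ x _ (lt_nbhsr Mx)).
  by apply: filterS => y /supp ->.
exact: (@derive_val _ _ _ _ _ _ _ (near_eq_is_derive E (is_derive_cst 0 x 1))).
Qed.

Lemma test_derive1 phi : is_test_function phi -> is_test_function (derive1 phi).
Proof.
move=> [sphi [M supp]]; split; first exact: smooth_derive1.
by exists M => x Mx; apply: derive1_outside supp Mx.
Qed.

Lemma test_Lfun2 phi : is_test_function phi -> phi \in Lfun mu 2%:E.
Proof.
move=> tphi; case: (tphi) => _ [M supp].
exact: compact_support_Lfun2 (test_continuous tphi) supp.
Qed.

Lemma test_lin k phi chi : is_test_function phi -> is_test_function chi ->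
  is_test_function (fun x => k * phi x + chi x).
Proof.
move=> [sphi [M HM]] [schi [N HN]]; split.
  apply: smoothD schi; apply: smoothM sphi; exact: smooth_cst.
exists (Num.max M N) => x; rewrite gt_max => /andP[h1 h2].
by rewrite HM// HN// mulr0 addr0.
Qed.

Lemma derive1_lin k phi chi x : is_test_function phi -> is_test_function chi ->
  derive1 (fun x => k * phi x + chi x) x = k * derive1 phi x + derive1 chi x.
Proof.
move=> tphi tchi; rewrite !derive1E.
have d1 := @smooth_derivable _ phi x (test_smooth tphi).
have d2 := @smooth_derivable _ chi x (test_smooth tchi).
have D := is_deriveD (is_deriveZ k (derivableP d1)) (derivableP d2).
exact: (@derive_val _ _ _ _ _ _ _ D).
Qed.

Lemma test0 : is_test_function (cst 0 : R -> R).
Proof. by split; [exact: smooth_cst | exists 0]. Qed.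

Lemma test_translate phi (a : R) : is_test_function phi ->
  is_test_function (fun x => phi (x - a)).
Proof.
move=> [sphi [M HM]]; split.
  rewrite (_ : (fun x => _) = (fun x => phi (1 * x - a))).
    exact: smooth_affine.
  by apply/funext => x; rewrite mul1r.
exists (M + `|a|) => x h; apply: HM.
by have := ler_normD (x - a) a; rewrite subrK; lra.
Qed.

Lemma derive1_translate phi (a x : R) : is_test_function phi ->
  derive1 (fun x => phi (x - a)) x = derive1 phi (x - a).
Proof.
move=> tphi; rewrite derive1E.
have d1 := @smooth_derivable _ phi (1 * x - a) (test_smooth tphi).
have := is_derive_affine d1; rewrite !mul1r => D.
rewrite (_ : (fun x => phi (x - a)) = (fun x => phi (1 * x - a))).
  exact: (@derive_val _ _ _ _ _ _ _ D).
by apply/funext => y; rewrite mul1r.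
Qed.

Lemma test_plateau m (a b : R) : is_test_function (plateau m a b).
Proof.
split; first exact: smooth_plateau.
exists (`|a| + `|b|) => x h; apply: plateau_eq0; apply/negP => /andP[ax xb].
have := ler_norm a; have := ler_norm b; have := ler_norm (- a).
have := ler_norm (- b); rewrite !normrN.
by move: h; rewrite ltr_normr => /orP[]; lra.
Qed.

Lemma integral_derive1_compact (F : R -> R) (M : R) :
  (forall x, derivable F x 1) -> continuous (derive1 F) ->
  (forall x, M < `|x| -> F x = 0) -> (\int[mu]_x (derive1 F x)%:E)%E = 0%E.
Proof.
move=> dF cF supp; pose b : R := `|M| + 1.
have b0 : - b < b by have := normr_ge0 M; rewrite /b; lra.
have Mb : M < b by have := ler_norm M; rewrite /b; lra.
have nb : `|b| = b by rewrite ger0_norm// addr_ge0.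
rewrite (_ : (\int[mu]_x (derive1 F x)%:E = \int[mu]_(x in `[(- b)%R, b]) (derive1 F x)%:E)%E); last first.
  rewrite [RHS]integral_mkcond; apply: eq_integral => x _; rewrite patchE.
  case: ifPn => //; rewrite notin_setE/= in_itv/= -ler_norml => /negP.
  rewrite -ltNge => bx; rewrite (derive1_outside supp)//.
  exact: lt_trans bx.
rewrite (@continuous_FTC2 _ _ F _ _ b0).
- by rewrite !supp ?normrN ?nb// -EFinB subrr.
- exact: continuous_subspaceT.
- have cf := derivable_continuous dF; split; first by move=> x _; exact: dF.
    by apply: cvg_at_right_filter; exact: cf.
  by apply: cvg_at_left_filter; exact: cf.
- by [].
Qed.

Lemma weak_derivP f g : is_weak_deriv f g <->
  forall phi, is_test_function phi ->
    dot f (toL2 (derive1 phi)) = - dot g (toL2 phi).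
Proof.
split=> H phi tphi; have := H phi tphi; rewrite /dot !toL2E//.
- exact: test_Lfun2.
- exact/test_Lfun2/test_derive1.
- exact: test_Lfun2.
- exact/test_Lfun2/test_derive1.
Qed.

(** Stated for C^1 functions of compact support because it is applied to [th * phi], whose factor
    [th] is only C^1. *)
Lemma weak_deriv_C1 phi (M : R) : (forall x, derivable phi x 1) ->
  continuous (derive1 phi) -> (forall x, M < `|x| -> phi x = 0) ->
  is_weak_deriv (toL2 phi) (toL2 (derive1 phi)).
Proof.
move=> dphi cphi' supp; apply/weak_derivP => chi tchi.
have cphi := derivable_continuous dphi.
have Lphi := compact_support_Lfun2 cphi supp.
have Lphi' : derive1 phi \in Lfun mu 2%:E.
  by apply: (compact_support_Lfun2 (M := M) cphi') => x; exact: derive1_outside.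
have Lchi := test_Lfun2 tchi; have Lchi' := test_Lfun2 (test_derive1 tchi).
have dchi x := @smooth_derivable _ chi x (test_smooth tchi).
have E x : derive1 (phi * chi) x = phi x * derive1 chi x + chi x * derive1 phi x.
  by rewrite derive1E (deriveM (dphi x) (dchi x)) -!derive1E.
apply/eqP; rewrite -subr_eq0 opprK; apply/eqP/EFin_inj.
rewrite EFinD !dotE -integralD//; [|exact: L2mul_int|exact: L2mul_int].
rewrite -[RHS](@integral_derive1_compact (phi * chi) M).
- by apply: eq_integral => x _; rewrite !toL2E// E -EFinD (mulrC (chi x)).
- by move=> x; exact: derivableM.
- rewrite (_ : derive1 _ = (fun x => phi x * derive1 chi x + chi x * derive1 phi x)); last exact/funext.
  move=> x; apply: cvgD; apply: cvgM.
  + exact: cphi.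
  + exact: (test_continuous (test_derive1 tchi)).
  + exact: (test_continuous tchi).
  + exact: cphi'.
- by move=> x /supp h; rewrite /GRing.mul/= h mul0r.
Qed.

Lemma test_weak_deriv phi : is_test_function phi ->
  is_weak_deriv (toL2 phi) (toL2 (derive1 phi)).
Proof.
move=> tphi; case: (tphi) => sphi [M supp].
apply: weak_deriv_C1 supp; first by move=> x; exact: smooth_derivable.
exact: (test_continuous (test_derive1 tphi)).
Qed.

Lemma test_H2 phi : is_test_function phi ->
  is_H2 (toL2 phi) (toL2 (derive1 phi)) (toL2 (derive1 (derive1 phi))).
Proof. by move=> tphi; split; apply: test_weak_deriv => //; exact: test_derive1. Qed.

Lemma itv_indic_Lfun2 (a b : R) : (\1_`[a, b] : R -> R) \in Lfun mu 2%:E.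
Proof.
apply: Lfun2P; first exact: measurable_indic.
rewrite (_ : (\int[mu]_x _)%E = (\int[mu]_x (\1_`[a, b] x)%:E)%E); last first.
  by apply: eq_integral => x _; rewrite indicE; case: (_ \in _); rewrite ?expr1n ?expr0n.
exact: integral_indic_itv_lty.
Qed.

Lemma L2_itv_integrable f (a b : R) : mu.-integrable `[a, b] (EFin \o (f : R -> R)).
Proof.
have := L2mul_int f (toL2 \1_`[a, b]); rewrite toL2E; last exact: itv_indic_Lfun2.
move=> /(@integrableS _ _ _ mu _ `[a, b]) h.
have {}h := h measurableT (measurable_itv _) (@subsetT _ _).
apply: eq_integrable h => // x; rewrite inE => xab.
by rewrite /= indicE mem_set//= mulr1.
Qed.

(** The plateaus are tests bounded by 1 and supported in the interval; they converge to the
    indicator of its interior, and dominated convergence passes to the limit. *)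
Lemma integral_itv_orth f (a b : R) :
  (forall phi, is_test_function phi -> dot f (toL2 phi) = 0) ->
  \int[mu]_(x in `[a, b]) f x = 0.
Proof.
move=> H.
have I1 := itv_indic_Lfun2 a b.
have := @dominated_convergence _ (measurableTypeR R) R mu setT measurableT
  (fun m x => (f x * plateau m a b x)%:E) (fun x => (f x * \1_`]a, b[ x)%:E)
  (fun x => (`|f x| * \1_`[a, b] x)%:E).
have mf := measurable_L2 f.
case.
- move=> m; apply/measurable_EFinP; apply: measurable_funM => //.
  apply: continuous_measurable_fun; exact: test_continuous (test_plateau _ _ _).
- by apply/measurable_EFinP; apply: measurable_funM => //; exact: measurable_indic.
- apply: aeW => x _; apply/cvg_EFin; first exact: nearW.
  rewrite indicE; case: (boolP (x \in `]a, b[%classic)).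
    rewrite inE/= in_itv/= => xab; apply: cvgM; [exact: cvg_cst|exact: plateau_cvg].
  rewrite notin_setE/= in_itv/= => /negP xab.
  rewrite (_ : (fun m => _) = cst 0); last first.
    by apply/funext => m /=; rewrite plateau_eq0// mulr0.
  by rewrite mulr0; exact: cvg_cst.
- have := integrable_abse (L2mul_int f (toL2 \1_`[a, b])).
  apply: eq_integrable => // x _; rewrite /= toL2E// normrM.
  by congr (_ * _)%:E; rewrite ger0_norm.
- apply: aeW => x m _; rewrite lee_fin normrM ler_wpM2l//.
  have /andP[h0 h1] := plateau_itv m a b x.
  rewrite ger0_norm// indicE; case: (boolP (x \in `[a, b]%classic)) => [//|].
  rewrite notin_setE/= in_itv/= => /negP xab.
  rewrite plateau_eq0//; apply: contra xab => /andP[/ltW -> /ltW ->//].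
move=> _ _ cv.
have {}cv : (fun _ : nat => 0%E) @ \oo --> (\int[mu]_x (f x * \1_`]a, b[ x)%:E)%E.
  apply: cvg_trans cv; apply: near_eq_cvg; apply: nearW => m /=.
  have E := dotE f (toL2 (plateau m a b)); rewrite (H _ (test_plateau _ _ _)) in E.
  transitivity (\int[mu]_x (f x * toL2 (plateau m a b) x)%:E)%E; last exact/esym.
  by apply: eq_integral => x _; rewrite toL2E//; exact: test_Lfun2 (test_plateau _ _ _).
have z : (\int[mu]_x (f x * \1_`]a, b[ x)%:E = 0)%E.
  by rewrite -(cvg_lim _ cv)// lim_cst.
rewrite /Rintegral (@integral_itv_bndoo _ _ _ (EFin \o (f : R -> R))); last first.
  by apply/measurable_EFinP; exact: measurable_funTS.
suff -> : (\int[mu]_(x in `]a, b[) (f x)%:E)%E = 0%E by [].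
rewrite -z [LHS]integral_mkcond; apply: eq_integral => x _; rewrite patchE indicE.
by case: ifP => _; rewrite ?mulr1 ?mulr0.
Qed.

Lemma L2_locally_integrable f : locally_integrable [set: R] (f : R -> R).
Proof.
split; [exact: measurable_L2|exact: openT|move=> K _ /compact_bounded[M [_ HM]]].
have KM : K `<=` `[- (M + 1), M + 1].
  by move=> x Kx; rewrite /= in_itv/= -ler_norml; apply: HM => //; rewrite ltrDl.
have /integrableP[_] := L2_itv_integrable f (- (M + 1)) (M + 1).
apply: le_lt_trans; rewrite integral_mkcond [leRHS]integral_mkcond.
apply: leb_le_integral => // x _; rewrite !patchE.
  by case: ifP => _; rewrite ?lee_fin.
case: ifPn => [|_]; first by rewrite inE => /KM Kx; rewrite mem_set.
by case: ifP => _; rewrite ?lee_fin.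
Qed.

(** All integrals of [f] over intervals vanish, so its primitives are constant; at each Lebesgue
    point the derivative of such a primitive is [f x]. *)
Lemma test_orth_eq0 f :
  (forall phi, is_test_function phi -> dot f (toL2 phi) = 0) -> f =L2 0.
Proof.
move=> H; have z a b := integral_itv_orth a b H.
have := lebesgue_differentiation (L2_locally_integrable f).
apply: aeS => x lx _.
have xx : x < x + 1 by rewrite ltrDl.
have := @FTC1_lebesgue_pt _ f (BLeft (x - 1)) x (x + 1) xx (L2_itv_integrable _ _ _).
have a1 : (BLeft (x - 1)%R < BRight x)%E by rewrite lte_fin; lra.
move=> /(_ a1 lx)[_].
rewrite (_ : (fun y => _) = cst 0); last by apply/funext => y; exact: z.
by rewrite derive1_cst => <-.
Qed.

Lemma weak_deriv_unique f g g' : is_weak_deriv f g -> is_weak_deriv f g' -> g =L2 g'.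
Proof.
move=> /weak_derivP H /weak_derivP H'; apply/L2eqP.
have /L2eqP : g - g' =L2 0.
  apply: test_orth_eq0 => phi tphi; rewrite dotBl.
  by have := H _ tphi; rewrite (H' _ tphi); lra.
by rewrite subr0.
Qed.

Lemma toL2_lin k (h h' : R -> R) : h \in Lfun mu 2%:E -> h' \in Lfun mu 2%:E ->
  toL2 (fun x => k * h x + h' x) = k *: toL2 h + toL2 h'.
Proof.
move=> Lh Lh'; have E : (fun x => k * h x + h' x) = (k *: toL2 h + toL2 h' : L2 R).
  by apply/funext => x; rewrite L2addE L2scaleE !toL2E.
apply: L2ext => x; rewrite toL2E; last by rewrite E; exact: LfunP.
by rewrite L2addE L2scaleE !toL2E.
Qed.

Lemma toL2_0 : toL2 (cst 0 : R -> R) = 0 :> L2 R.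
Proof. by apply: L2ext => x; rewrite toL2E//; exact/test_Lfun2/test0. Qed.

(** The residual of the projection onto the tests is orthogonal to every test, hence zero. No
    mollifier enters. *)
Lemma test_dense f e : 0 < e ->
  exists2 phi, is_test_function phi & L2norm (f - toL2 phi) < e.
Proof.
move=> e0; pose S (g : L2 R) := exists2 phi, is_test_function phi & g = toL2 phi.
have cpl : seq_complete (bnorm (@dot R)) by rewrite -L2norm_bnorm; exact: L2_complete.
have := hilbert_projection (@dotC R) (@dot_lin R) (@dotff_ge0 R) cpl (S := S) f.
case.
- by exists (cst 0); [exact: test0 | rewrite toL2_0].
- move=> k u v [phi tphi ->] [chi tchi ->].
  exists (fun x => k * phi x + chi x); first exact: test_lin.
  by rewrite toL2_lin//; exact: test_Lfun2.
move=> g [ap orth].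
have fg : L2norm (f - g) = 0.
  rewrite -[f - g]subr0; apply/L2eqP; apply: test_orth_eq0 => phi tphi.
  by apply: orth; exists phi.
have [_ [phi tphi ->] h] := ap _ e0; exists phi => //.
apply: le_lt_trans (sn_tri (@seminorm_L2 R) g _ _) _.
by rewrite fg add0r L2norm_bnorm.
Qed.

Lemma weak_deriv_lin k f g f' g' : is_weak_deriv f f' -> is_weak_deriv g g' ->
  is_weak_deriv (k *: f + g) (k *: f' + g').
Proof.
move=> /weak_derivP Hf /weak_derivP Hg; apply/weak_derivP => phi tphi.
by rewrite !dot_lin Hf// Hg//; ring.
Qed.

Lemma weak_derivD f g f' g' : is_weak_deriv f f' -> is_weak_deriv g g' ->
  is_weak_deriv (f + g) (f' + g').
Proof. by move=> Hf Hg; have := weak_deriv_lin 1 Hf Hg; rewrite !scale1r. Qed.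

Lemma weak_derivB f g f' g' : is_weak_deriv f f' -> is_weak_deriv g g' ->
  is_weak_deriv (f - g) (f' - g').
Proof.
move=> Hf Hg; have := weak_deriv_lin (-1) Hg Hf.
by rewrite !scaleN1r (addrC (- g)) (addrC (- g')).
Qed.

Lemma weak_deriv_closed f f' :
  (forall e, 0 < e -> exists g g', [/\ is_weak_deriv g g',
     L2norm (f - g) < e & L2norm (f' - g') < e]) -> is_weak_deriv f f'.
Proof.
move=> H; apply/weak_derivP => phi tphi.
apply/eqP; rewrite -subr_eq0 opprK -normr_le0; apply/ler_addgt0Pr => e e0.
rewrite add0r.
pose A := L2norm (toL2 (derive1 phi)) + L2norm (toL2 phi).
have A0 : 0 <= A by rewrite addr_ge0 ?L2norm_ge0.
have A1 : 0 < 1 + A by lra.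
have [g [g' [/weak_derivP Hg h1 h2]]] := H (e / (1 + A)) (divr_gt0 e0 A1).
have -> : dot f (toL2 (derive1 phi)) + dot f' (toL2 phi) =
    dot (f - g) (toL2 (derive1 phi)) + dot (f' - g') (toL2 phi).
  by rewrite !dotBl Hg//; ring.
apply: le_trans (ler_normD _ _) _.
apply: (@le_trans _ _ (e / (1 + A) * A)).
  by rewrite /A mulrDr; apply: lerD; apply: le_trans (dot_CS _ _) _;
     rewrite ler_wpM2r ?L2norm_ge0// ltW.
by rewrite mulrAC ler_pdivrMr// ler_wpM2l ?(ltW e0)// lerDr.
Qed.

Lemma weak_deriv_eq f f' g g' : f =L2 g -> f' =L2 g' -> is_weak_deriv f f' ->
  is_weak_deriv g g'.
Proof.
move=> fg fg' /weak_derivP H; apply/weak_derivP => phi tphi.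
by rewrite -(L2eq_dot _ fg) -(L2eq_dot _ fg') H.
Qed.

Lemma mvt_exists (F dF : R -> R) (a b : R) : (forall x : R, is_derive x 1 F (dF x)) ->
  exists2 c, `|c - a| <= `|b - a| & F b - F a = dF c * (b - a).
Proof.
move=> D.
have cF x : {for x, continuous F}.
  apply: differentiable_continuous; apply/derivable1_diffP.
  exact: (@ex_derive _ _ _ _ _ _ _ (D x)).
have K (x y : R) : x < y -> exists2 c, x < c < y & F y - F x = dF c * (y - x).
  move=> xy; have [|c] := @MVT _ F dF _ _ xy (fun x _ => D x).
    by apply: continuous_subspaceT => z; exact: cF.
  by rewrite in_itv/= => cI E; exists c.
have [ab|ba|->] := ltgtP a b.
- have [c cI E] := K _ _ ab; exists c => //.
  by rewrite !ger0_norm; lra.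
- have [c cI E] := K _ _ ba; exists c; last by lra.
  by rewrite !ler0_norm; lra.
- by exists b => //; rewrite !subrr mulr0.
Qed.

Lemma smooth_is_derive phi (x : R) : smooth phi -> is_derive x 1 phi (derive1 phi x).
Proof. by move=> sphi; rewrite derive1E; apply: derivableP; exact: smooth_derivable. Qed.

Lemma taylor1 phi (B : R) : smooth phi ->
  (forall x, `|derive1 (derive1 phi) x| <= B) ->
  forall x h, `|phi (x + h) - phi x - h * derive1 phi x| <= B * h ^+ 2.
Proof.
move=> sphi HB x h.
have D1 y := smooth_is_derive y sphi.
have D2 y := smooth_is_derive y (smooth_derive1 sphi).
have [c hc ->] := mvt_exists x (x + h) D1.
have [d _ hd] := mvt_exists x c D2.
rewrite addrAC subrr add0r in hc *.
have -> : derive1 phi c * h - h * derive1 phi x = derive1 (derive1 phi) d * (c - x) * h.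
  by rewrite -hd; ring.
rewrite !normrM -(@real_normK _ h) ?num_real// expr2 mulrA ler_wpM2r//.
by apply: ler_pM.
Qed.

Lemma L2norm_local f (a M B : R) : 0 <= M -> 0 <= B -> (forall x, `|f x| <= B) ->
  (forall x, M < `|x - a| -> f x = 0) -> L2norm f <= B * (2 * M + 1).
Proof.
move=> M0 B0 fB supp; apply: L2norm_le; first by rewrite mulr_ge0// addr_ge0// mulr_ge0.
apply: (@le_trans _ _ (\int[mu]_x ((B ^+ 2)%:E * (\1_`[a - M, a + M] x)%:E))%E).
  apply: leb_le_integral => // x _; first by rewrite lee_fin sqr_ge0.
  rewrite -EFinM lee_fin indicE.
  case: (boolP (x \in `[a - M, a + M]%classic)) => [_|].
    by rewrite mulr1 -(@real_normK _ (f x)) ?num_real// ler_sqr ?nnegrE.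
  rewrite notin_setE/= in_itv/= -ler_distl => /negP; rewrite -ltNge => bx.
  by rewrite supp ?expr0n ?mulr0.
rewrite leb_ge0_integralZl ?sqr_ge0//; last first.
  by apply/measurable_EFinP; exact: measurable_indic.
rewrite (@integral_indic _ _ R mu setT measurableT `[a - M, a + M]%classic (measurable_itv _)).
rewrite setIT exprMn.
have L : (mu `[(a - M)%R, (a + M)%R]%classic <= ((2 * M + 1) ^+ 2)%:E)%E.
  rewrite lebesgue_measure_itv/= lte_fin; case: ifPn => _.
    by rewrite -EFinD lee_fin; nra.
  by rewrite lee_fin sqr_ge0.
have B2 : (0 <= (B ^+ 2)%:E)%E by rewrite lee_fin sqr_ge0.
exact: (@lee_wpmul2l R _ B2 _ _ L).
Qed.

(** The pairing g(a) of [f] with the translate phi(. - a) satisfies g' = s g, so it is a multiple of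
    e^(sa); being bounded in a, it vanishes. *)
Lemma weak_exp_eq0 f (s : R) : s ^+ 2 = 1 -> is_weak_deriv f (s *: f) -> f =L2 0.
Proof.
move=> s2 /weak_derivP H; apply: test_orth_eq0 => phi tphi.
case: (tphi) => sphi [M0 supp0].
pose M := Num.max 0 M0.
have M_ge0 : 0 <= M by rewrite le_max lexx.
have supp x : M < `|x| -> phi x = 0.
  by move=> h; apply: supp0; apply: le_lt_trans h; rewrite le_max lexx orbT.
have [B B0 HB] := compact_support_bounded (test_continuous tphi) supp.
have t1 := test_derive1 tphi; have t2 := test_derive1 t1.
have supp1 x : M < `|x| -> derive1 phi x = 0 by exact: derive1_outside.
have supp2 x : M < `|x| -> derive1 (derive1 phi) x = 0 by exact: derive1_outside.
have [B2 B20 HB2] := compact_support_bounded (test_continuous t2) supp2.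
pose T (a : R) (h : R -> R) : L2 R := toL2 (fun x => h (x - a)).
have TE a h x : is_test_function h -> T a h x = h (x - a).
  by move=> th; rewrite /T toL2E//; exact: test_Lfun2 (test_translate _ th).
pose g a := dot f (T a phi).
have gphi a : dot f (T a (derive1 phi)) = - (s * g a).
  have -> : T a (derive1 phi) = toL2 (derive1 (fun x => phi (x - a))).
    by rewrite /T; congr toL2; apply/funext => x; rewrite derive1_translate.
  by rewrite H; [rewrite dotZl|exact: test_translate].
pose C := B2 * (2 * (M + 1) + 1).
have C0 : 0 <= C by rewrite mulr_ge0//; lra.
have rem a h : `|h| <= 1 ->
    L2norm (T (h + a) phi - T a phi + h *: T a (derive1 phi)) <= C * h ^+ 2.
  move=> h1; rewrite /C mulrAC; apply: (@L2norm_local _ a).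
  - lra.
  - by rewrite mulr_ge0 ?sqr_ge0.
  - move=> x; rewrite L2addE L2scaleE L2subE !TE//.
    have := taylor1 sphi HB2 (x - a) (- h).
    have -> : x - (h + a) = x - a - h by ring.
    by rewrite sqrrN mulNr opprK.
  - move=> x hx; rewrite L2addE L2scaleE L2subE !TE//.
    have xa : M < `|x - a| by lra.
    have xah : M < `|x - (h + a)|.
      have := ler_normD (x - (h + a)) h; have -> : x - (h + a) + h = x - a by ring.
      by lra.
    by rewrite !supp// supp1// mulr0 subrr addr0.
have dg (a : R) : is_derive a 1 g (s * g a).
  apply: is_derive_eps => e e0.
  have D0 : 0 < 1 + L2norm f * C by rewrite ltr_pwDl// mulr_ge0 ?L2norm_ge0.
  exists (Num.min 1 (e / (1 + L2norm f * C))); first by rewrite lt_min ltr01 divr_gt0.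
  move=> h h0; rewrite lt_min => /andP[h1 h2].
  have E : g (h + a) - g a =
      dot f (T (h + a) phi - T a phi + h *: T a (derive1 phi)) + h * (s * g a).
    by rewrite dotDr dotBr dotZr gphi /g; ring.
  rewrite E mulrDl mulrAC divff// mul1r addrK normrM normfV ler_pdivrMr ?normr_gt0//.
  apply: le_trans (dot_CS _ _) _.
  apply: (@le_trans _ _ (L2norm f * (C * h ^+ 2))).
    by rewrite ler_wpM2l ?L2norm_ge0//; apply: rem; exact: ltW.
  rewrite -(@real_normK _ h) ?num_real// expr2 !mulrA ler_wpM2r//.
  move: h2; rewrite ltr_pdivlMr// mulrDr mulr1 mulrC => h2.
  by move: h2 (normr_ge0 h); rewrite /C !mulrA; clear; lra.
have gE a : g a * expR (- (s * a)) = g 0.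
  have dk (x : R) : is_derive x 1 (g * (fun a => expR (- (s * a)))) 0.
    have dl : is_derive x 1 (fun a => - (s * a)) (- s).
      have := is_deriveN (is_deriveZ s (is_derive_id x (1:R))).
      by rewrite /GRing.scale/= mulr1.
    have de := @is_derive1_comp _ expR (fun a => - (s * a)) x _ _ (is_derive_expR _) dl.
    have := is_deriveM (dg x) de; move/is_derive_eq; apply.
    by rewrite /GRing.scale/=; ring.
  have E : g a * expR (- (s * a)) = g 0 * expR (- (s * 0)).
    exact: (is_derive_0_is_cst a 0 dk).
  by rewrite E mulr0 oppr0 expR0 mulr1.
have gB a : `|g a| <= L2norm f * (B * (2 * M + 1)).
  apply: le_trans (dot_CS _ _) _; rewrite ler_wpM2l ?L2norm_ge0//.
  apply: (@L2norm_local _ a) => // x; first by rewrite TE.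
  by move=> hx; rewrite TE// supp.
set K := L2norm f * (B * (2 * M + 1)) in gB.
have g0 : g 0 = 0.
  apply/eqP; rewrite -normr_le0; apply/ler_addgt0Pr => e e0; rewrite add0r.
  have K0 : 0 <= K by exact: le_trans (gB 0).
  have sK : s * (s * (K / e)) = K / e by rewrite mulrA -(expr2 s) s2 mul1r.
  (* At a = s K / e the exponent s a equals K / e, so |g 0| <= K e^(-K/e) <= K / (1 + K/e) <= e. *)
  have := gE (s * (K / e)); rewrite sK => <-.
  rewrite expRN normrM [X in _ * X]ger0_norm ?invr_ge0 ?expR_ge0//.
  rewrite ler_pdivrMr ?expR_gt0//; apply: (le_trans (gB _)).
  apply: (@le_trans _ _ (e * (1 + K / e))).
    by rewrite mulrDr mulr1 mulrCA divff ?mulr1 ?lerDr ?(ltW e0)// gt_eqF.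
  by rewrite ler_wpM2l ?(ltW e0)//; exact: expR_ge1Dx.
rewrite -g0 /g /T; congr (dot f (toL2 _)).
by apply/funext => x; rewrite subr0.
Qed.

End Tests.

(** * Weak derivatives *)

Section Sobolev.
Variable R : realType.
Notation mu := (@lebesgue_measure R).
Implicit Types (phi chi m : R -> R) (f g h : L2 R).

Definition bounded_meas m (B : R) : Prop :=
  measurable_fun [set: R] m /\ forall x, `|m x| <= B.

Definition mulL2 m f : L2 R := toL2 (fun x => m x * f x).

Lemma bounded_meas_ge0 m B : bounded_meas m B -> 0 <= B.
Proof. by move=> [_ /(_ 0)]; exact: le_trans. Qed.

Lemma L2norm_le_ae f g (B : R) : 0 <= B ->
  {ae mu, forall x, `|f x| <= B * `|g x|} -> L2norm f <= B * L2norm g.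
Proof.
move=> B0 H; apply: L2norm_le; first by rewrite mulr_ge0 ?L2norm_ge0.
rewrite exprMn EFinM -L2norm_int -leb_ge0_integralZl ?sqr_ge0//.
- apply: leb_ae_le_integral => //.
  + by move=> x _; rewrite lee_fin sqr_ge0.
  + by apply/measurable_EFinP; apply: measurable_funX; exact: measurable_L2.
  + by move=> x _; rewrite -EFinM lee_fin mulr_ge0 ?sqr_ge0.
  + move: H; apply: aeS => x h _; rewrite -EFinM lee_fin.
    by rewrite -(@real_normK _ (f x)) ?num_real// -(@real_normK _ (g x)) ?num_real//
      -exprMn ler_sqr ?nnegrE// mulr_ge0.
- by move=> x _; rewrite lee_fin sqr_ge0.
- by apply/measurable_EFinP; apply: measurable_funX; exact: measurable_L2.
Qed.

Lemma Lfun2_le (h : R -> R) g (B : R) : measurable_fun [set: R] h ->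
  {ae mu, forall x, `|h x| <= B * `|g x|} -> h \in Lfun mu 2%:E.
Proof.
move=> mh H; apply: Lfun2P => //.
apply: (@le_lt_trans _ _ (\int[mu]_x ((B ^+ 2)%:E * (g x ^+ 2)%:E))%E).
  apply: leb_ae_le_integral => //.
  - by move=> x _; rewrite lee_fin sqr_ge0.
  - by apply/measurable_EFinP; apply: measurable_funX.
  - by move=> x _; rewrite -EFinM lee_fin mulr_ge0 ?sqr_ge0.
  - move: H; apply: aeS => x h0 _; rewrite -EFinM lee_fin.
    rewrite -(@real_normK _ (h x)) ?num_real// -(@real_normK _ (g x)) ?num_real//.
    by rewrite -exprMn ler_sqr ?nnegrE// (le_trans _ h0).
rewrite leb_ge0_integralZl ?sqr_ge0//.
- by rewrite L2norm_int -EFinM ltry.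
- by move=> x _; rewrite lee_fin sqr_ge0.
- by apply/measurable_EFinP; apply: measurable_funX; exact: measurable_L2.
Qed.

Section Mul.
Variables (m : R -> R) (B : R).
Hypothesis bm : bounded_meas m B.

Lemma mul_Lfun2 f : (fun x => m x * f x) \in Lfun mu 2%:E.
Proof.
apply: (@Lfun2_le _ f B).
  by apply: measurable_funM; [case: bm|exact: measurable_L2].
by apply: aeW => x; rewrite normrM ler_wpM2r//; case: bm => _; exact.
Qed.

Lemma mulL2E f x : mulL2 m f x = m x * f x.
Proof. by rewrite /mulL2 toL2E//; exact: mul_Lfun2. Qed.

Lemma mulL2_norm f : L2norm (mulL2 m f) <= B * L2norm f.
Proof.
apply: L2norm_le_ae; first exact: bounded_meas_ge0 bm.
by apply: aeW => x; rewrite mulL2E normrM ler_wpM2r//; case: bm => _; exact.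
Qed.

Lemma mulL2B f g : mulL2 m (f - g) = mulL2 m f - mulL2 m g.
Proof. by apply: L2ext => x; rewrite mulL2E !L2subE !mulL2E mulrBr. Qed.

Lemma dot_mulL2 f g : dot (mulL2 m f) g = dot f (mulL2 m g).
Proof. by apply: eq_Rintegral => x _; rewrite !mulL2E mulrCA mulrA. Qed.

Lemma mulL2_eq f g : f =L2 g -> mulL2 m f =L2 mulL2 m g.
Proof. by apply: aeS => x h _; rewrite !mulL2E h. Qed.

End Mul.

Lemma dot_le f g f' g' : {ae mu, forall x, f x * g x <= f' x * g' x} ->
  dot f g <= dot f' g'.
Proof.
move=> H; rewrite -subr_ge0 -lee_fin EFinB !dotE.
rewrite -integralB//; [|exact: L2mul_int|exact: L2mul_int].
apply: (@le_trans _ _ (\int[mu]_x (Num.max 0 (f' x * g' x - f x * g x))%:E)%E).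
  by apply: integral_ge0 => x _; rewrite lee_fin le_max lexx.
rewrite le_eqVlt; apply/orP; left; apply/eqP.
apply: ae_eq_integral => //.
- apply/measurable_EFinP; apply: measurable_maxr => //.
  by apply: measurable_funB; apply: measurable_funM; exact: measurable_L2.
- apply/measurable_EFinP.
  by apply: measurable_funB; apply: measurable_funM; exact: measurable_L2.
move: H; apply: aeS => x h _; rewrite -EFinB; congr EFin.
by apply/max_idPr; rewrite subr_ge0.
Qed.

Lemma weak_derivN f f' : is_weak_deriv f f' -> is_weak_deriv (- f) (- f').
Proof.
by move=> /weak_derivP H; apply/weak_derivP => phi tphi; rewrite !dotNl H.
Qed.

(** The scalar product of H^1 carried by arbitrary pairs, among which the pairs (f, f') form a
    closed subspace. *)
Definition pdot (u v : (L2 R * L2 R)%type) : R := dot u.1 v.1 + dot u.2 v.2.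

Lemma pdotC u v : pdot u v = pdot v u.
Proof. by rewrite /pdot dotC (dotC u.2). Qed.

Lemma pdot_lin k u v w : pdot (k *: u + v) w = k * pdot u w + pdot v w.
Proof. by rewrite /pdot !dot_lin; ring. Qed.

Lemma pdot_ge0 u : 0 <= pdot u u.
Proof. by rewrite addr_ge0 ?dotff_ge0. Qed.

Lemma pnorm_le u : bnorm pdot u <= L2norm u.1 + L2norm u.2.
Proof.
rewrite -ler_sqr ?nnegrE ?bnorm_ge0 ?addr_ge0 ?L2norm_ge0//.
rewrite (bnorm_sqr pdotC pdot_ge0) /pdot !dotff.
by have := mulr_ge0 (L2norm_ge0 u.1) (L2norm_ge0 u.2); lra.
Qed.

Lemma le_pnorm1 u : L2norm u.1 <= bnorm pdot u.
Proof.
rewrite -ler_sqr ?nnegrE ?bnorm_ge0 ?L2norm_ge0//.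
by rewrite (bnorm_sqr pdotC pdot_ge0) /pdot !dotff lerDl sqr_ge0.
Qed.

Lemma le_pnorm2 u : L2norm u.2 <= bnorm pdot u.
Proof.
rewrite -ler_sqr ?nnegrE ?bnorm_ge0 ?L2norm_ge0//.
by rewrite (bnorm_sqr pdotC pdot_ge0) /pdot !dotff lerDr sqr_ge0.
Qed.

Lemma pnorm_complete : seq_complete (bnorm pdot).
Proof.
move=> u H.
have [v1 h1] : exists v, (fun k => L2norm (v - (u k).1)) @ \oo --> (0 : R).
  apply: L2_complete => e e0; have [N HN] := H e e0; exists N => i j Ni Nj.
  exact: le_lt_trans (le_pnorm1 (u i - u j)) (HN _ _ Ni Nj).
have [v2 h2] : exists v, (fun k => L2norm (v - (u k).2)) @ \oo --> (0 : R).
  apply: L2_complete => e e0; have [N HN] := H e e0; exists N => i j Ni Nj.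
  exact: le_lt_trans (le_pnorm2 (u i - u j)) (HN _ _ Ni Nj).
exists (v1, v2); apply: (@squeeze_cvgr _ _ _ _ (cst 0)
    (fun k => L2norm (v1 - (u k).1) + L2norm (v2 - (u k).2))).
- apply: nearW => k; rewrite bnorm_ge0/=; exact: (pnorm_le ((v1, v2) - u k)).
- exact: cvg_cst.
- by rewrite -[X in _ --> X]addr0; exact: cvgD.
Qed.

Definition test_graph (u : (L2 R * L2 R)%type) : Prop :=
  exists2 phi, is_test_function phi & u = (toL2 phi, toL2 (derive1 phi)).

Lemma test_graph0 : test_graph 0.
Proof.
exists (cst 0); first exact: test0.
have -> : derive1 (cst 0 : R -> R) = cst 0.
  by apply/funext => x; rewrite derive1_cst.
by rewrite toL2_0.
Qed.

Lemma test_graph_lin k u v : test_graph u -> test_graph v -> test_graph (k *: u + v).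
Proof.
move=> [phi tphi ->] [chi tchi ->]; exists (fun x => k * phi x + chi x).
  exact: test_lin.
have -> : derive1 (fun x => k * phi x + chi x) =
    (fun x => k * derive1 phi x + derive1 chi x).
  by apply/funext => x; exact: derive1_lin.
by rewrite !toL2_lin//; apply: test_Lfun2 => //; exact: test_derive1.
Qed.

(* The residual of the projection onto the graph of the tests satisfies
   [rho1' = rho]. *)
Lemma graph_projection z z1 : exists g g1,
  [/\ is_weak_deriv g g1, is_weak_deriv (z1 - g1) (z - g) &
      forall e, 0 < e -> exists2 phi, is_test_function phi &
        L2norm (g - toL2 phi) < e /\ L2norm (g1 - toL2 (derive1 phi)) < e].
Proof.
have [[g g1] [ap orth]] := hilbert_projection pdotC pdot_lin pdot_ge0 pnorm_complete
  (z, z1) test_graph0 test_graph_lin.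
have ap' e : 0 < e -> exists2 phi, is_test_function phi &
    L2norm (g - toL2 phi) < e /\ L2norm (g1 - toL2 (derive1 phi)) < e.
  move=> /ap[_ [phi tphi ->] h]; exists phi => //; split.
    exact: le_lt_trans (le_pnorm1 ((g, g1) - (toL2 phi, toL2 (derive1 phi)))) h.
  exact: le_lt_trans (le_pnorm2 ((g, g1) - (toL2 phi, toL2 (derive1 phi)))) h.
exists g, g1; split => //.
- apply: weak_deriv_closed => e /ap'[phi tphi [h1 h2]].
  by exists (toL2 phi), (toL2 (derive1 phi)); split => //; exact: test_weak_deriv.
- apply/weak_derivP => phi tphi.
  have := orth (toL2 phi, toL2 (derive1 phi)) (ex_intro2 _ _ phi tphi erefl).
  by rewrite /pdot/=; lra.
Qed.

(** The residual (rho, rho1) of the projection onto the graph of the tests satisfies rho' = rho1, as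
    a difference of elements of the graph, and rho1' = rho by orthogonality. Hence rho + rho1 and
    rho - rho1 solve h' = h and h' = - h, and both vanish. *)
Lemma H1_dense f df : is_weak_deriv f df -> forall e, 0 < e ->
  exists2 phi, is_test_function phi &
    L2norm (f - toL2 phi) < e /\ L2norm (df - toL2 (derive1 phi)) < e.
Proof.
move=> H e e0; have [g [g1 [wg wr ap]]] := graph_projection f df.
have wrho := weak_derivB H wg.
have E1 : (df - g1) + (f - g) =L2 0.
  apply: (@weak_exp_eq0 _ _ 1); first by rewrite expr1n.
  by rewrite scale1r [X in is_weak_deriv _ X]addrC; exact: weak_derivD.
have E2 : (df - g1) - (f - g) =L2 0.
  apply: (@weak_exp_eq0 _ _ (-1)); first by rewrite sqrrN expr1n.
  by rewrite scaleN1r -[X in is_weak_deriv _ X]/(- _) [X in is_weak_deriv _ X]opprB; exact: weak_derivB wr wrho.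
have n0 : L2norm (f - g) = 0.
  rewrite -[f - g]subr0; apply/L2eqP; move: E1 E2; apply: aeS2 => x h1 h2 _.
  move: (h1 I) (h2 I); rewrite !(L2addE, L2oppE, L2zeroE); lra.
have n1 : L2norm (df - g1) = 0.
  rewrite -[df - g1]subr0; apply/L2eqP; move: E1 E2; apply: aeS2 => x h1 h2 _.
  move: (h1 I) (h2 I); rewrite !(L2addE, L2oppE, L2zeroE); lra.
have [phi tphi [h1 h2]] := ap e e0; exists phi => //; split.
  by apply: le_lt_trans (sn_tri (@seminorm_L2 R) g _ _) _; rewrite n0 add0r.
by apply: le_lt_trans (sn_tri (@seminorm_L2 R) g1 _ _) _; rewrite n1 add0r.
Qed.

(** Projecting (z, 0) onto the graph of the derivative in H^1: orthogonality of the residual is the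
    weak form of rho - rho'' = z. *)
Lemma resolvent (z : L2 R) : exists rho rho1, is_H2 rho rho1 (rho - z).
Proof.
have [g [g1 [wg wr _]]] := graph_projection z 0; exists g, g1; split => //.
by have := weak_derivN wr; rewrite sub0r opprK opprB.
Qed.

Lemma weak_deriv_ibp f df g dg : is_weak_deriv f df -> is_weak_deriv g dg ->
  dot df g = - dot f dg.
Proof.
move=> wf wg; apply/eqP; rewrite -subr_eq0 opprK -normr_le0; apply/ler_addgt0Pr => e e0.
rewrite add0r; pose A := L2norm df + L2norm f.
have A0 : 0 <= A by rewrite addr_ge0 ?L2norm_ge0.
have A1 : 0 < 1 + A by lra.
have [phi tphi [h1 h2]] := H1_dense wg (divr_gt0 e0 A1).
have /weak_derivP /(_ _ tphi) E := wf.
have -> : dot df g + dot f dg =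
    dot df (g - toL2 phi) + dot f (dg - toL2 (derive1 phi)).
  by rewrite !dotBr E; ring.
apply: le_trans (ler_normD _ _) _.
apply: (@le_trans _ _ (A * (e / (1 + A)))).
  by rewrite /A mulrDl; apply: lerD; apply: le_trans (dot_CS _ _) _;
     rewrite ler_wpM2l ?L2norm_ge0// ltW.
by rewrite mulrA ler_pdivrMr// mulrC ler_wpM2l ?(ltW e0)// lerDr.
Qed.

(** The square phi(x)^2 is twice the integral of phi phi' up to x, so it is at most 2 |phi| |phi'|,
    which is below the square of the sum. *)
Lemma test_sup phi (x : R) : is_test_function phi ->
  `|phi x| <= L2norm (toL2 phi) + L2norm (toL2 (derive1 phi)).
Proof.
move=> tphi; case: (tphi) => sphi [M supp].
have t1 := test_derive1 tphi.
pose b := `|M| + `|x| + 1.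
have b0 : - b < x.
  by have := ler_norm (- x); have := normr_ge0 M; rewrite normrN /b; lra.
have Mb : M < `|- b|.
  rewrite normrN ger0_norm ?addr_ge0// /b.
  by have := ler_norm M; have := normr_ge0 x; lra.
pose F y : R := phi y * phi y.
have dF (y : R) : is_derive y 1 F (2 * phi y * derive1 phi y).
  have d := smooth_is_derive y sphi.
  have := is_deriveM d d; move/is_derive_eq; apply.
  by rewrite /GRing.scale/=; ring.
have cF' : continuous (fun y => 2 * phi y * derive1 phi y).
  move=> y; apply: cvgM; last exact: (test_continuous t1).
  by apply: cvgM; [exact: cvg_cst|exact: (test_continuous tphi)].
have dF1 : derive1 F = (fun y => 2 * phi y * derive1 phi y).
  by apply/funext => y; rewrite derive1E; exact: (@derive_val _ _ _ _ _ _ _ (dF y)).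
have cF : continuous F.
  by move=> y; apply: cvgM; exact: (test_continuous tphi).
pose I : R -> R := \1_`[- b, x].
have bI : bounded_meas I 1.
  split; first exact: measurable_indic.
  by move=> y; rewrite /I indicE; case: (_ \in _); rewrite ?normr1 ?normr0.
have E : F x = 2 * dot (mulL2 I (toL2 phi)) (toL2 (derive1 phi)).
  apply: EFin_inj; rewrite [RHS]EFinM dotE -integralZl//; last exact: L2mul_int.
  have := @continuous_FTC2 _ (fun y => 2 * phi y * derive1 phi y) F _ _ b0.
  have Fb : F (- b) = 0 by rewrite /F supp// mul0r.
  rewrite Fb sube0 => <-.
  - rewrite [LHS]integral_mkcond; apply: eq_integral => y _.
    rewrite (mulL2E bI) !toL2E; [|exact: test_Lfun2|exact: test_Lfun2].
    rewrite patchE /I indicE -EFinM.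
    by case: (_ \in _); rewrite ?mul1r ?mul0r ?mulr0// mulrA.
  - exact: continuous_subspaceT.
  - split; first by move=> y _; exact: (@ex_derive _ _ _ _ _ _ _ (dF y)).
      by apply: cvg_at_right_filter; exact: cF.
    by apply: cvg_at_left_filter; exact: cF.
  - by rewrite dF1.
have h := dot_CS (mulL2 I (toL2 phi)) (toL2 (derive1 phi)).
have h' := mulL2_norm bI (toL2 phi).
rewrite -ler_sqr ?nnegrE ?addr_ge0 ?L2norm_ge0// real_normK ?num_real//.
have -> : phi x ^+ 2 = F x by rewrite expr2.
have n1 := L2norm_ge0 (toL2 phi); have n2 := L2norm_ge0 (toL2 (derive1 phi)).
have h3 := ler_wpM2r n2 h'.
have h4 := ler_norm (dot (mulL2 I (toL2 phi)) (toL2 (derive1 phi))).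
rewrite E; have := sqr_ge0 (L2norm (toL2 phi)); have := sqr_ge0 (L2norm (toL2 (derive1 phi))).
nra.
Qed.

Lemma ae_le_limit f (K : R) :
  (forall c, K < c -> {ae mu, forall x, `|f x| <= c}) -> {ae mu, forall x, `|f x| <= K}.
Proof.
move=> H.
have : {ae mu, forall x, forall k : nat, `|f x| <= K + k.+1%:R^-1}.
  by apply/ae_foralln => k; apply: H; rewrite ltrDl.
apply: aeS => x h; apply/ler_addgt0Pr => e e0.
have [k ke] : exists k : nat, k.+1%:R^-1 < e.
  have [k _ hk] := near_infty_natSinv_lt (PosNum e0).
  by exists k; exact: (hk k (leqnn k)).
by apply: le_trans (h k) _; rewrite lerD2l ltW.
Qed.

(** For [c] above the bound, the excess of |f| over [c] is at most |f - phi| for tests [phi] close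
    to [f] in H^1, because |phi| <= c everywhere. So the excess is zero in L^2, without extracting
    an almost everywhere convergent subsequence. *)
Lemma H1_sup f df : is_weak_deriv f df ->
  {ae mu, forall x, `|f x| <= L2norm f + L2norm df}.
Proof.
move=> wf; apply: ae_le_limit => c Kc.
pose h := fun x => Num.max 0 (`|f x| - c).
have c0 : 0 <= c by apply: le_trans (ltW Kc); rewrite addr_ge0 ?L2norm_ge0.
have mh : measurable_fun [set: R] h.
  apply: measurable_maxr => //; apply: measurable_funB => //.
  apply: measurableT_comp; [exact: normr_measurable|exact: measurable_L2].
have Lh : h \in Lfun mu 2%:E.
  apply: (@Lfun2_le _ f 1) => //; apply: aeW => x; rewrite mul1r /h.
  rewrite ger0_norm ?le_max ?lexx// ge_max normr_ge0/= lerBlDr lerDl//.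
have n0 : L2norm (toL2 h - 0) = 0.
  apply/eqP; rewrite subr0 eq_le L2norm_ge0 andbT; apply/ler_addgt0Pr => e e0.
  rewrite add0r; pose e' := Num.min e ((c - (L2norm f + L2norm df)) / 2).
  have e'0 : 0 < e' by rewrite lt_min e0 divr_gt0 ?subr_gt0.
  have [phi tphi [h1 h2]] := H1_dense wf e'0.
  have he : L2norm (f - toL2 phi) <= e.
    by apply: le_trans (ltW h1) _; rewrite /e' ge_min lexx.
  apply: le_trans he; rewrite -[leRHS]mul1r; apply: L2norm_le_ae => //.
  apply: aeW => x; rewrite mul1r toL2E// /h L2subE toL2E; last exact: test_Lfun2.
  rewrite ger0_norm ?le_max ?lexx// ge_max normr_ge0/=.
  have hs := test_sup x tphi.
  have b1 : L2norm (toL2 phi) <= L2norm f + e'.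
    have := sn_dist (@seminorm_L2 R) (toL2 phi) f.
    rewrite (snBC (@seminorm_L2 R)) => h3; have := le_lt_trans (ler_norm _) (le_lt_trans h3 h1).
    by lra.
  have b2 : L2norm (toL2 (derive1 phi)) <= L2norm df + e'.
    have := sn_dist (@seminorm_L2 R) (toL2 (derive1 phi)) df.
    rewrite (snBC (@seminorm_L2 R)) => h3; have := le_lt_trans (ler_norm _) (le_lt_trans h3 h2).
    by lra.
  have e'c : 2 * e' <= c - (L2norm f + L2norm df).
    by rewrite mulrC -ler_pdivlMr// /e' ge_min lexx orbT.
  have := ler_distD 0 (f x) (phi x); have := ler_normD (f x - phi x) (phi x).
  by rewrite subrK; lra.
have /L2eqP := n0; apply: aeS => x /(_ I); rewrite toL2E// L2zeroE /h.
move=> h0; have : `|f x| - c <= Num.max 0 (`|f x| - c) by rewrite le_max lexx orbT.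
by rewrite h0; lra.
Qed.

Lemma mul_H1_norm (w : R -> R) (q f df : L2 R) (B : R) : bounded_meas w B ->
  (forall x, `|w x| <= `|q x|) -> is_weak_deriv f df ->
  L2norm (mulL2 w f) <= (L2norm f + L2norm df) * L2norm q.
Proof.
move=> bw wq wf; apply: L2norm_le_ae; first by rewrite addr_ge0 ?L2norm_ge0.
have := H1_sup wf; apply: aeS => x h; rewrite (mulL2E bw) normrM mulrC.
exact: ler_pM.
Qed.

(** The derivative is moved from [g] to the product of [th] and [f], which costs one derivative of
    [th]. The function [f] is first replaced by a test, so that the product is C^1 with compact
    support. *)
Lemma dot_commutator f f1 g g1 (th : R -> R) (B : R) :
  is_weak_deriv f f1 -> is_weak_deriv g g1 ->
  (forall x, derivable th x 1) -> continuous (derive1 th) ->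
  (forall x, `|th x| <= B) -> (forall x, `|derive1 th x| <= B) ->
  `|dot f (mulL2 th g1)| <= B * (L2norm f + L2norm f1) * L2norm g.
Proof.
move=> wf wg dth cth bth bth1.
have cth0 := derivable_continuous dth.
have bt : bounded_meas th B by split => //; exact: continuous_measurable_fun.
have bt1 : bounded_meas (derive1 th) B by split => //; exact: continuous_measurable_fun.
have B0 := bounded_meas_ge0 bt.
have P phi : is_test_function phi ->
  `|dot (toL2 phi) (mulL2 th g1)| <=
    B * (L2norm (toL2 phi) + L2norm (toL2 (derive1 phi))) * L2norm g.
  move=> tphi; case: (tphi) => sphi [M supp].
  have dp y := @smooth_derivable _ phi y sphi.
  have E y : derive1 (th * phi) y = th y * derive1 phi y + phi y * derive1 th y.
    by rewrite derive1E (deriveM (dth y) (dp y)) -!derive1E.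
  have w : is_weak_deriv (toL2 (th * phi)) (toL2 (derive1 (th * phi))).
    apply: (@weak_deriv_C1 _ _ M).
    - by move=> y; exact: derivableM.
    - rewrite (_ : derive1 _ = (fun y => th y * derive1 phi y + phi y * derive1 th y)); last exact/funext.
      move=> y; apply: cvgD; apply: cvgM.
      + exact: cth0.
      + exact: (test_continuous (test_derive1 tphi)).
      + exact: (test_continuous tphi).
      + exact: cth.
    - by move=> y /supp h; rewrite /GRing.mul/= h mulr0.
  have E1 : toL2 (th * phi) = mulL2 th (toL2 phi).
    rewrite /mulL2; congr toL2; apply/funext => y.
    by rewrite toL2E//; exact: test_Lfun2.
  have E2 : toL2 (derive1 (th * phi)) =
      mulL2 th (toL2 (derive1 phi)) + mulL2 (derive1 th) (toL2 phi).
    have H : (derive1 (th * phi)) = (mulL2 th (toL2 (derive1 phi)) + mulL2 (derive1 th) (toL2 phi) : L2 R).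
      apply/funext => y; rewrite E L2addE (mulL2E bt) (mulL2E bt1).
      rewrite !toL2E; [|exact: test_Lfun2|exact/test_Lfun2/test_derive1].
      by rewrite (mulrC (phi y)).
    by apply: L2ext => y; rewrite toL2E H//; exact: LfunP.
  have := weak_deriv_ibp w wg; rewrite E1 E2 dotDl (dot_mulL2 bt (toL2 phi)) => h.
  rewrite -[dot (toL2 phi) _]opprK -h.
  rewrite normrN; apply: le_trans (ler_normD _ _) _.
  have n0 := L2norm_ge0 g.
  have a1 := le_trans (dot_CS _ g) (ler_wpM2r n0 (mulL2_norm bt (toL2 (derive1 phi)))).
  have a2 := le_trans (dot_CS _ g) (ler_wpM2r n0 (mulL2_norm bt1 (toL2 phi))).
  apply: le_trans (lerD a1 a2) _; rewrite -mulrDl -mulrDr.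
  by rewrite (addrC (L2norm (toL2 (derive1 phi)))).
apply/ler_addgt0Pr => e e0.
pose A := B * L2norm g1 + 2 * B * L2norm g.
have A0 : 0 <= A by rewrite addr_ge0 ?mulr_ge0 ?L2norm_ge0.
have A1 : 0 < 1 + A by lra.
have [phi tphi [h1 h2]] := H1_dense wf (divr_gt0 e0 A1).
set d := e / (1 + A) in h1 h2.
have b1 : L2norm (toL2 phi) <= L2norm f + d.
  have := sn_dist (@seminorm_L2 R) (toL2 phi) f.
  rewrite (snBC (@seminorm_L2 R)) => h3; have := le_lt_trans (ler_norm _) (le_lt_trans h3 h1).
  by lra.
have b2 : L2norm (toL2 (derive1 phi)) <= L2norm f1 + d.
  have := sn_dist (@seminorm_L2 R) (toL2 (derive1 phi)) f1.
  rewrite (snBC (@seminorm_L2 R)) => h3; have := le_lt_trans (ler_norm _) (le_lt_trans h3 h2).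
  by lra.
have -> : f = (f - toL2 phi) + toL2 phi by rewrite subrK.
rewrite dotDl; apply: le_trans (ler_normD _ _) _; rewrite subrK.
have n0 := L2norm_ge0 g; have n1 := L2norm_ge0 g1.
have c1 : `|dot (f - toL2 phi) (mulL2 th g1)| <= d * (B * L2norm g1).
  apply: le_trans (dot_CS _ _) _; apply: ler_pM; rewrite ?L2norm_ge0//; first exact: ltW.
  exact: mulL2_norm.
have c2 : `|dot (toL2 phi) (mulL2 th g1)| <= B * (L2norm f + L2norm f1 + 2 * d) * L2norm g.
  apply: le_trans (P _ tphi) _; rewrite ler_wpM2r// ler_wpM2l//; lra.
have c3 : d * A <= e.
  by rewrite /d mulrAC ler_pdivrMr// ler_wpM2l ?(ltW e0)// lerDr.
move: c1 c2 c3; rewrite /A; lra.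
Qed.

End Sobolev.

Section LocalForms.
Variables (R : realType) (V : lmodType R) (nrm : V -> R).

Lemma has_deriv_onP (A : set R) (h : R -> V) (t : R) l :
  has_deriv_on nrm A h t l -> forall e, 0 < e -> exists2 d : R, 0 < d &
    forall s, A s -> `|s - t| < d -> s != t ->
      nrm ((s - t)^-1 *: (h s - h t) - l) < e.
Proof.
move=> /cvgrPdist_lt H e /H; rewrite near_withinE => /nbhs_ballP[d /= d0 Hd].
exists d => // s As std st; apply: le_lt_trans (Hd s _ st As).
  by rewrite sub0r normrN ler_norm.
by rewrite /ball/= distrC.
Qed.

Lemma continuous_onP (A : set R) (h : R -> V) (t : R) : A t ->
  continuous_on nrm A h -> forall e, 0 < e -> exists2 d : R, 0 < d &
    forall s, A s -> `|s - t| < d -> nrm (h s - h t) < e.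
Proof.
move=> At /(_ t At)/cvgrPdist_lt H e /H; rewrite near_withinE => /nbhs_ballP[d /= d0 Hd].
exists d => // s As std; apply: le_lt_trans (Hd s _ As).
  by rewrite sub0r normrN ler_norm.
by rewrite /ball/= distrC.
Qed.

Lemma continuous_onP2 (A : set (R * R)) (h : R * R -> V) (t s : R) : A (t, s) ->
  continuous_on nrm A h -> forall e, 0 < e -> exists2 d : R, 0 < d &
    forall t' s', A (t', s') -> `|t' - t| < d -> `|s' - s| < d ->
      nrm (h (t', s') - h (t, s)) < e.
Proof.
move=> At /(_ _ At)/cvgrPdist_lt H e /H; rewrite near_withinE => /nbhs_ballP[d /= d0 Hd].
exists d => // t' s' As td sd; apply: le_lt_trans (Hd (t', s') _ As).
  by rewrite sub0r normrN ler_norm.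
by split; rewrite /ball/= distrC.
Qed.

End LocalForms.

(** * Lipschitz bounds from derivatives bounded almost everywhere *)

Section LipschitzAE.
Variable R : realType.
Notation mu := (@lebesgue_measure R).
Implicit Types (f df : R -> R) (O : set R).

Definition cover_len O (a x : R) : R := fine (mu (O `&` `[a, x]%classic)).

Lemma cover_len_fin O (a x : R) : (mu (O `&` `[a, x]%classic) <= mu `[a, x]%classic)%E ->
  (cover_len O a x)%:E = mu (O `&` `[a, x]%classic).
Proof.
move=> h; rewrite /cover_len fineK// ge0_fin_numE//.
exact: le_lt_trans h (lebesgue_itv_lty a x).
Qed.

Lemma cover_lenE O (a x : R) : open O -> (cover_len O a x)%:E = mu (O `&` `[a, x]%classic).
Proof.
move=> oO; apply: cover_len_fin; apply: le_measure; rewrite ?inE//.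
by apply: measurableI => //; exact: open_measurable.
Qed.

Lemma cover_len_le O (a x y : R) : open O -> x <= y -> cover_len O a x <= cover_len O a y.
Proof.
move=> oO xy; rewrite -lee_fin !cover_lenE//; have mO := open_measurable oO.
apply: le_measure; rewrite ?inE; [exact: measurableI|exact: measurableI|].
by apply: setIS; apply: subset_itvl; rewrite bnd_simp.
Qed.

Lemma cover_len_incr O (a x y : R) : open O -> a <= x -> x <= y -> `[x, y]%classic `<=` O ->
  cover_len O a x + (y - x) <= cover_len O a y.
Proof.
move=> oO ax xy xyO; have mO := open_measurable oO.
have mx : measurable (O `&` `[a, x]%classic) by exact: measurableI.
rewrite -lee_fin EFinD !cover_lenE//.
have <- : mu `]x, y]%classic = (y - x)%:E.
  rewrite lebesgue_measure_itv/= lte_fin; case: ifPn => [_|].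
    by rewrite -EFinD.
  by rewrite -leNgt => yx; congr EFin; lra.
rewrite -measureU//.
- apply: le_measure; rewrite ?inE; [exact: measurableU|exact: measurableI|].
  move=> z [[Oz]|]; rewrite /= !in_itv/=; first by move=> /andP[-> zx]; split => //; lra.
  move=> /andP[xz zy]; split; last by lra.
  by apply: xyO; rewrite /= in_itv/= zy ltW.
- apply/seteqP; split => // z [[_]]; rewrite /= !in_itv/=; lra.
Qed.

Lemma null_cover (N : set R) : mu.-negligible N -> forall e, 0 < e ->
  exists O, [/\ open O, N `<=` O & (mu O <= e%:E)%E].
Proof.
move=> [A [mA A0 NA]] e e0.
have Afin : (mu A < +oo)%E by apply: (@le_lt_trans _ _ 0%E) => //; rewrite le_eqVlt A0 eqxx.
have [G [oG AG h]] := lebesgue_regularity_outer mA Afin e0.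
exists G; split => //; first exact: subset_trans AG.
have mG := open_measurable oG.
have -> : mu G = mu (G `\` A).
  have E : mu (A `|` (G `\` A)) = (mu A + mu (G `\` A))%E.
    by apply: measureU; rewrite ?setDIK//; exact: measurableD.
  by rewrite A0 add0e setDUK in E.
exact: ltW.
Qed.

(** The classical increasing function of small variation with infinite slope at every point of a
    null set: the sum over k of the measures of [[a, x]] within open covers [G k] of [N], of measure
    at most e / 2^(k+1). *)
Lemma null_weight (a b : R) (N : set R) : mu.-negligible N -> forall e, 0 < e ->
  exists2 sg : R -> R, sg b - sg a <= e &
    (forall x y, x <= y -> sg x <= sg y) /\
    forall x (k : nat), N x -> a <= x <= b -> exists2 d, 0 < d &
      forall y z, a <= y -> y <= x <= z -> x - d < y -> z < x + d ->
        sg y + k%:R * (z - y) <= sg z.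
Proof.
move=> N0 e e0.
pose ek (k : nat) := e * 2^-1 ^+ k.+1.
have ek0 k : 0 < ek k by rewrite mulr_gt0// exprn_gt0.
have [G HG] := choice (fun k => null_cover N0 (ek0 k)).
pose S n x := \sum_(k < n) cover_len (G k) a x.
have oG k : open (G k) by case: (HG k).
have Sle n x y : x <= y -> S n x <= S n y.
  by move=> xy; apply: ler_sum => k _; exact: cover_len_le.
have cb k x : cover_len (G k) a x <= ek k.
  rewrite -lee_fin cover_lenE//; case: (HG k) => _ _; apply: le_trans.
  apply: le_measure; rewrite ?inE; [apply: measurableI => //| |exact: subIsetl];
    exact: open_measurable.
have Sb n x : S n x <= e.
  apply: (@le_trans _ _ (\sum_(k < n) ek k)); first exact: ler_sum.
  suff : \sum_(k < n) ek k = e * (1 - 2^-1 ^+ n).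
    by move=> ->; rewrite ger_pMr// gerBl exprn_ge0.
  elim: n => [|n IH]; first by rewrite big_ord0 expr0 subrr mulr0.
  by rewrite big_ord_recr/= IH /ek exprS; field.
have S0 n x : 0 <= S n x by apply: sumr_ge0 => k _; exact: fine_ge0.
have Sn x : nondecreasing_seq (S ^~ x).
  apply/nondecreasing_seqP => n; rewrite /S big_ord_recr/= lerDl; exact: fine_ge0.
have Scv x : cvgn (S ^~ x).
  by apply: nondecreasing_is_cvgn => //; exists e => _ [n _ <-].
exists (fun x => limn (S ^~ x)); last split.
- have h1 : limn (S ^~ b) <= e by apply: limr_le => //; apply: nearW => n.
  have h2 : 0 <= limn (S ^~ a) by apply: limr_ge => //; apply: nearW => n.
  by lra.
- by move=> x y xy; apply: ler_lim => //; apply: nearW => n; exact: Sle.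
- move=> x k Nx xab.
  (* Near a point of [N] the first [k] covers contain a common ball, and each contributes slope
     1. *)
  have : exists2 d, 0 < d & forall j : 'I_k, ball x d `<=` G j.
    elim: k => [|k [d d0 Hd]]; first by exists 1 => // -[].
    have Gk : nbhs x (G k).
      by apply: open_nbhs_nbhs; split => //; case: (HG k) => _ /(_ _ Nx).
    move/nbhs_ballP: Gk => [d' /= d'0 Hd'].
    exists (Num.min d d'); first by rewrite lt_min d0.
    move=> j; have [jk|jk] := ltnP j k.
      apply: subset_trans (Hd (Ordinal jk)); apply: le_ball.
      by rewrite ge_min lexx.
    have -> : j = k :> nat by apply/eqP; rewrite eqn_leq jk andbT -ltnS.
    by apply: subset_trans Hd'; apply: le_ball; rewrite ge_min lexx orbT.
  move=> [d d0 Hd]; exists d => // y z ay /andP[yx xz] yd zd.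
  have E0 : (fun n => S n y + k%:R * (z - y)) @ \oo --> limn (S ^~ y) + k%:R * (z - y).
    by apply: cvgD; [exact: Scv|exact: cvg_cst].
  rewrite -(cvg_lim _ E0)//; apply: ler_lim; [by apply/cvg_ex; exists (limn (S ^~ y) + k%:R * (z - y))|exact: Scv|].
  near=> n.
  have kn : (k <= n)%N by near: n; exact: nbhs_infty_ge.
  rewrite /S.
  have E (F : nat -> R) : \sum_(j < n) F j = \sum_(j < k) F j + \sum_(k <= j < n) F j.
    by rewrite -!(big_mkord xpredT F) (@big_cat_nat _ _ _ k).
  rewrite (E (fun j => cover_len (G j) a y)) (E (fun j => cover_len (G j) a z)).
  rewrite addrAC; apply: lerD; last by apply: ler_sum => j _; apply: cover_len_le => //; lra.
  have -> : k%:R * (z - y) = \sum_(j < k) (z - y) by rewrite sumr_const card_ord mulr_natl.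
  rewrite -big_split/=; apply: ler_sum => j _; apply: cover_len_incr => //; first by lra.
  move=> v; rewrite /= in_itv/= => /andP[yv vz]; apply: (Hd j).
  by rewrite /ball/= ltr_distlC; apply/andP; split; lra.
Unshelve. all: by end_near.
Qed.

(** Subtracting [sg] makes the slope at most [C + e] at every point: where [df x <= C] because [sg]
    is increasing, elsewhere because [df x] is finite and the slope of [sg] as large as desired. *)
Lemma ae_deriv_le f df (a b C : R) : a <= b ->
  (forall t, a <= t <= b -> has_deriv_on (V := R^o) Num.norm `[a, b] f t (df t)) ->
  {ae mu, forall t, a <= t <= b -> df t <= C} ->
  f b - f a <= C * (b - a).
Proof.
move=> ab dfE N0.
apply/ler_addgt0Pr => e0 e00.
pose e := e0 / (1 + (b - a)).
have A1 : 0 < 1 + (b - a) by lra.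
have e_gt0 : 0 < e by rewrite divr_gt0.
have eE : e * (b - a) + e <= e0.
  have -> : e * (b - a) + e = e * (1 + (b - a)) by ring.
  by rewrite /e divfK// gt_eqF.
have [sg sgab [sgmon sgk]] := null_weight a b N0 e_gt0.
have key : (f b - sg b) - (f a - sg a) <= (C + e) * (b - a).
  apply: (@increment_le_local _ (fun x => f x - sg x)) => // x xab.
  have loc l : df x < l -> exists2 d : R, 0 < d & forall y, a <= y <= b ->
     `|y - x| < d -> (x <= y -> f y - f x <= l * (y - x)) /\
                     (y <= x -> f x - f y <= l * (x - y)).
    move=> dl; have dl0 : 0 < l - df x by rewrite subr_gt0.
    have [d d0 Hd] := has_deriv_onP (dfE x xab) dl0.
    exists d => // y yab yd; have yab' : `[a, b]%classic y by rewrite /= in_itv.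
    have [->|yx] := eqVneq y x; first by rewrite !subrr mulr0.
    have /ltr_normlP[_ h] := Hd y yab' yd yx.
    have {h} : (y - x)^-1 * (f y - f x) < l by move: h; rewrite /GRing.scale/=; lra.
    rewrite mulrC => h; split => xy.
      by move/ltW: h; rewrite ler_pdivrMr// subr_gt0 lt_neqAle eq_sym yx.
    have yx0 : y - x < 0 by rewrite subr_lt0 lt_neqAle yx.
    by move/ltW: h; rewrite ler_ndivrMr//; lra.
  have [Nx|Nx] := pselect (df x <= C).
    have [d d0 Hd] := loc (C + e) ltac:(lra).
    exists d => // y yab yd; have [h1 h2] := Hd y yab yd; split => xy.
      have := h1 xy; have := sgmon _ _ xy; lra.
    have := h2 xy; have := sgmon _ _ xy; lra.
  (* The slope [k] of [sg] exceeds the slope bound [df x + 1] of [f] minus [C]. *)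
  pose k := (Num.truncn (df x + 1 - C)).+1.
  have kC : df x + 1 - C < k%:R by exact: truncnS_gt.
  have Nx' : (~` [set t | a <= t <= b -> df t <= C]) x by move=> /= h; apply/Nx/h.
  have [d1 d10 Hd1] := sgk x k Nx' xab.
  have [d2 d20 Hd2] := loc (df x + 1) ltac:(lra).
  exists (Num.min d1 d2); first by rewrite lt_min d10.
  move=> y yab; rewrite lt_min => /andP[yd1 yd2]; have [h1 h2] := Hd2 y yab yd2.
  move: yd1; rewrite ltr_distl => /andP[yl yr].
  split => xy.
    have h3 : sg x + k%:R * (y - x) <= sg y.
      by apply: Hd1 => //; [case/andP: xab|rewrite lexx|lra].
    have := h1 xy; have : (df x + 1 - C) * (y - x) <= k%:R * (y - x).
      by rewrite ler_wpM2r ?subr_ge0// ltW.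
    by have := mulr_ge0 (ltW e_gt0) (_ : 0 <= y - x); rewrite subr_ge0 => /(_ xy); lra.
  have h3 : sg y + k%:R * (x - y) <= sg x.
    by apply: Hd1 => //; [case/andP: yab|rewrite lexx andbT|lra].
  have := h2 xy; have : (df x + 1 - C) * (x - y) <= k%:R * (x - y).
    by rewrite ler_wpM2r ?subr_ge0// ltW.
  by have := mulr_ge0 (ltW e_gt0) (_ : 0 <= x - y); rewrite subr_ge0 => /(_ xy); lra.
by lra.
Qed.

Lemma ae_deriv_lipschitz f df (T C : R) :
  (forall t, 0 <= t <= T -> has_deriv_on (V := R^o) Num.norm `[0, T] f t (df t)) ->
  {ae mu, forall t, 0 <= t <= T -> `|df t| <= C} ->
  forall s t, 0 <= s <= T -> 0 <= t <= T -> `|f t - f s| <= C * `|t - s|.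
Proof.
move=> dfE N0 s t.
wlog st : s t / s <= t => [H sI tI|sI tI].
  have [st|ts] := leP s t; first exact: H.
  by rewrite distrC (distrC t); apply: H => //; exact: ltW.
have sub x : s <= x <= t -> 0 <= x <= T by lra.
have R' (g dg : R -> R) : (forall t, 0 <= t <= T ->
    has_deriv_on (V := R^o) Num.norm `[0, T] g t (dg t)) ->
    forall x, s <= x <= t -> has_deriv_on (V := R^o) Num.norm `[s, t] g x (dg x).
  move=> H x /sub xI; have := H x xI; apply: cvg_trans; apply: cvg_app.
  apply: within_subset => y; rewrite /= !in_itv/=; exact: sub.
have N1 : {ae mu, forall x, s <= x <= t -> `|df x| <= C}.
  by move: N0; apply: aeS => x h /sub; exact: h.
rewrite (ger0_norm (_ : 0 <= t - s)) ?subr_ge0// ler_norml.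
apply/andP; split.
  have : (- f t) - (- f s) <= C * (t - s).
    apply: (@ae_deriv_le (fun x => - f x) (fun x => - df x)) => //.
      apply: (R' (fun x => - f x) (fun x => - df x)) => x xI.
      have := dfE x xI; rewrite /has_deriv_on; apply: cvg_trans.
      apply: near_eq_cvg; apply: nearW => y.
      rewrite /GRing.scale/= -[in RHS]normrN; congr (`|_|); ring.
    by move: N1; apply: aeS => x h /h; rewrite ler_norml; lra.
  by lra.
apply: (@ae_deriv_le f df) => //; first exact: R'.
by move: N1; apply: aeS => x h /h; rewrite ler_norml; lra.
Qed.

End LipschitzAE.

(** * From essential bounds to bounds at every point *)

Section EssentialBounds.
Variable R : realType.
Notation mu := (@lebesgue_measure R).

Lemma Lfun_oo_bound d (X : measurableType d) (nu : {measure set X -> \bar R})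
    (f : X -> R) : f \in Lfun nu +oo%E ->
  exists2 B, 0 <= B & {ae nu, forall x, `|f x| <= B}.
Proof.
rewrite inE => /andP[_]; rewrite inE/= /finite_norm unlock.
case: ifPn => [_ h|].
  have [B0|B0] := leP 0%E (ess_sup nu (abse \o (EFin \o f))); last first.
    exists 0 => //; have := ess_sup_ge nu (abse \o (EFin \o f)).
    apply: filterS => x /= hx; rewrite -lee_fin; apply: (le_trans hx); exact: ltW.
  exists (fine (ess_sup nu (abse \o (EFin \o f)))); first exact: fine_ge0.
  have := ess_sup_ge nu (abse \o (EFin \o f)).
  apply: filterS => x /= hx; rewrite -lee_fin fineK// ge0_fin_numE//.
rewrite -leNgt => h _; exists 0 => //; exists setT; split => //.
by apply/eqP; rewrite eq_le h measure_ge0.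
Qed.

Lemma Lnorm_oo_bound d (X : measurableType d) (nu : {measure set X -> \bar R})
    (f : X -> R) (B : R) : ('N[nu]_+oo[EFin \o f] <= B%:E)%E ->
  {ae nu, forall x, `|f x| <= B}.
Proof.
rewrite unlock; case: ifPn => [_ h|].
  have := ess_sup_ge nu (abse \o (EFin \o f)).
  by apply: filterS => x /= hx; rewrite -lee_fin; exact: le_trans hx h.
rewrite -leNgt => h _; exists setT; split => //.
by apply/eqP; rewrite eq_le h measure_ge0.
Qed.

(** Fubini for null sets: the measures of the sections have integral 0. *)
Lemma ae_prod (P : R -> R -> Prop) :
  {ae (@lebesgue_measure R \x @lebesgue_measure R)%E, forall p, P p.1 p.2} ->
  {ae mu, forall x, {ae mu, forall t, P x t}}.
Proof.
move=> [A [mA A0 PA]].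
have mf := measurable_fun_xsection mu mA.
have : ae_eq mu setT (mu \o xsection A) (cst 0%E).
  apply/(ae_eq_integral_abs _ measurableT mf).
  rewrite -[RHS]A0; apply: eq_integral => x _.
  by rewrite gee0_abs//; exact: measure_ge0.
apply: aeS => x /(_ I)/= h; exists (xsection A x); split => //.
  exact: measurable_xsection.
by move=> t nP; rewrite /xsection/= inE; exact: PA.
Qed.

Lemma ae_continuous_le (f : R -> R) (B : R) : continuous f ->
  {ae mu, forall x, f x <= B} -> forall x, f x <= B.
Proof.
move=> cf [A [mA A0 HA]] x; rewrite leNgt; apply/negP => Bf.
have := cf x _ (lt_nbhsr Bf) => /nbhs_ballP[d /= d0 Hd].
have h : (mu `]x, (x + d)%R[%classic <= mu A)%E.
  apply: le_measure; rewrite ?inE// => y; rewrite /= in_itv/= => /andP[xy yd].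
  apply: HA => /=; apply/negP; rewrite -ltNge; apply: Hd.
  by rewrite /ball/= ltr_distlC; apply/andP; split; lra.
move: h; rewrite A0 lebesgue_measure_itv/= lte_fin ltrDl d0 -EFinD lee_fin; lra.
Qed.

Lemma ae_continuous_itv_le (f : R -> R) (T B : R) : 0 < T ->
  (forall t, 0 <= t <= T -> forall e, 0 < e -> exists2 d, 0 < d &
     forall s, 0 <= s <= T -> `|s - t| < d -> `|f s - f t| < e) ->
  {ae mu, forall t, 0 <= t <= T -> f t <= B} -> forall t, 0 <= t <= T -> f t <= B.
Proof.
move=> T0 cf [A [mA A0 HA]] t tI; rewrite leNgt; apply/negP => Bf.
have Bf0 : 0 < f t - B by rewrite subr_gt0.
have [d d0 Hd] := cf t tI _ Bf0.
pose l := Num.max 0 (t - d); pose r := Num.min T (t + d).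
have lr : l < r by rewrite /l /r lt_min !gt_max; apply/andP; split; apply/andP; split; lra.
have h : (mu `]l, r[%classic <= mu A)%E.
  apply: le_measure; rewrite ?inE// => y.
  rewrite /= in_itv/= /l /r gt_max lt_min => /andP[/andP[y0 yl] /andP[yT yr]].
  apply: HA => /= H; have /H : 0 <= y <= T by lra.
  have := Hd y ltac:(lra) ltac:(by rewrite ltr_distl; apply/andP; split; lra).
  by rewrite ltr_distl; lra.
move: h; rewrite A0 lebesgue_measure_itv/= lte_fin lr -EFinD lee_fin; lra.
Qed.

End EssentialBounds.

(* m = 1 / al and th = be / al: multiplied by m, the equation
   u_t = al u_xx - be u_x becomes m u_t = u_xx - th u_x, where th does not
   depend on t. *)
Record layer_coeffs (R : realType) (T k B : R) (al be m : R -> R -> R) (th : R -> R) : Prop :=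
  LayerCoeffs {
  lc_k : 0 < k ;
  lc_al : forall t, 0 <= t <= T -> bounded_meas (al t) B ;
  lc_be : forall t, 0 <= t <= T -> bounded_meas (be t) B ;
  lc_m : forall t, 0 <= t <= T -> bounded_meas (m t) B ;
  lc_al_ge : forall t x, 0 <= t <= T -> k <= al t x ;
  lc_m_ge : forall t x, 0 <= t <= T -> k <= m t x ;
  lc_m_lip : forall t s x, 0 <= t <= T -> 0 <= s <= T ->
    `|m t x - m s x| <= B * `|t - s| ;
  lc_th_deriv : forall x, derivable th x 1 ;
  lc_th_cont : continuous (derive1 th) ;
  lc_th : forall x, `|th x| <= B ;
  lc_th1 : forall x, `|derive1 th x| <= B ;
  lc_mal : forall t x, 0 <= t <= T -> m t x * al t x = 1 ;
  lc_mbe : forall t x, 0 <= t <= T -> m t x * be t x = th x }.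

(** * Bounds on the coefficients of one layer *)

Section Layers.
Variable R : realType.
Notation mu := (@lebesgue_measure R).

Lemma twice_derivable_bound (h : R -> R) : twice_derivable h -> Linf (derive1 h) ->
  exists2 B, 0 <= B & forall x, `|derive1 h x| <= B.
Proof.
move=> dh /Lfun_oo_bound[B B0 HB]; exists B => //.
apply: ae_continuous_le => //.
have ch : continuous (derive1 h) by apply: derivable_continuous => x; case: (dh x).
by move=> x; apply: continuous_comp; [exact: ch|exact: norm_continuous].
Qed.

Lemma twice_derivable_continuous (h : R -> R) : twice_derivable h ->
  continuous h /\ continuous (derive1 h).
Proof. by move=> dh; split; apply: derivable_continuous => x; case: (dh x). Qed.

Lemma strip_funE T (h : R -> R -> R) x t : 0 <= t <= T -> strip_fun T h (x, t) = h x t.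
Proof.
by move=> tI; rewrite /strip_fun patchE mem_set.
Qed.

(** For almost every x the derivative in t is bounded for almost every t, which makes y Lipschitz in
    t. For fixed times the inequality is between continuous functions of x, so it extends to every
    x. *)
Lemma strip_lipschitz (T : R) (y yt : R -> R -> R) :
  (forall x t, 0 <= t <= T -> has_deriv_on (V := R^o) Num.norm `[0, T] (y x) t (yt x t)) ->
  (forall t, 0 <= t <= T -> continuous (y ^~ t)) -> Linf_strip T yt ->
  exists2 C, 0 <= C & forall x t s, 0 <= t <= T -> 0 <= s <= T ->
    `|y x t - y x s| <= C * `|t - s|.
Proof.
move=> dy cy /Lfun_oo_bound[C C0 HC]; exists C => // x t s tI sI.
have HC' : {ae mu, forall x, {ae mu, forall t, `|strip_fun T yt (x, t)| <= C}}.
  by apply: (@ae_prod R (fun x t => `|strip_fun T yt (x, t)| <= C)); move: HC; apply: filterS => -[].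
have cont : continuous (fun x => `|y x t - y x s|).
  move=> z; apply: (@continuous_comp _ _ _ (fun x => y x t - y x s) Num.norm).
    by apply: cvgB; exact: cy.
  exact: norm_continuous.
apply: (ae_continuous_le (f := fun x => `|y x t - y x s|) cont).
move: HC'; apply: aeS => {}x hx; apply: (ae_deriv_lipschitz (dy x) _ sI tI).
by move: hx; apply: aeS => r h rI; rewrite -(strip_funE yt x rI).
Qed.

Lemma strip_bound (T : R) (y : R -> R -> R) (k C : R) : 0 < T -> 0 <= C ->
  (forall x t s, 0 <= t <= T -> 0 <= s <= T -> `|y x t - y x s| <= C * `|t - s|) ->
  (forall t, 0 <= t <= T -> continuous (y ^~ t)) -> (Linf_strip_norm T y <= k%:E)%E ->
  forall x t, 0 <= t <= T -> y x t <= k.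
Proof.
move=> T0 C0 Hy cy /Lnorm_oo_bound HC x t tI.
have HC' : {ae mu, forall x, {ae mu, forall t, `|strip_fun T y (x, t)| <= k}}.
  by apply: (@ae_prod R (fun x t => `|strip_fun T y (x, t)| <= k)); move: HC; apply: filterS => -[].
apply: (ae_continuous_le (f := y ^~ t)); first exact: cy.
move: HC'; apply: aeS => {}x hx; apply: (ae_continuous_itv_le T0) tI => [{}t tI e e0|].
  exists (e / (1 + C)); first by rewrite divr_gt0//; lra.
  move=> s sI; rewrite ltr_pdivlMr; last by lra.
  by have := Hy x s t sI tI; have := normr_ge0 (s - t); nra.
move: hx; apply: aeS => r h rI; apply: le_trans (ler_norm _) _.
by rewrite -(strip_funE y x rI).
Qed.

Lemma quotient_bounds (x y k B C : R) : 0 < k -> 0 <= x <= B -> k <= y <= C ->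
  0 <= x / y <= B / k.
Proof.
move=> k0 /andP[x0 xB] /andP[ky yC]; have y0 : 0 < y by lra.
rewrite divr_ge0 ?(ltW y0)//=; apply: ler_pM => //; first by rewrite invr_ge0 ltW.
by rewrite lef_pV2.
Qed.

Lemma layer_bounds (T k1 k2 k3 : R) (a b c l : R -> R) (y yt : R -> R -> R) : 0 < T ->
  0 < k1 -> k1 < k2 -> 0 < k3 ->
  (forall x, k1 <= a x <= k2 /\ k1 <= l x <= k2 /\ 0 <= b x <= k2 /\ 0 <= c x <= k2) ->
  twice_derivable a -> twice_derivable b -> twice_derivable c -> twice_derivable l ->
  Linf (derive1 c) -> Linf (derive1 l) ->
  (forall x t, 0 <= t <= T -> 0 <= y x t) ->
  (forall x t, 0 <= t <= T -> has_deriv_on (V := R^o) Num.norm `[0, T] (y x) t (yt x t)) ->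
  (forall t, 0 <= t <= T -> twice_derivable (fun x => y x t)) ->
  Linf_strip T yt -> (Linf_strip_norm T y <= k3%:E)%E ->
  exists k B, [/\ layer_coeffs T k B (fun t x => l x / (a x + b x * y x t))
      (fun t x => c x / (a x + b x * y x t)) (fun t x => (a x + b x * y x t) / l x)
      (fun x => c x / l x), k2 <= B,
    forall x, `|derive1 c x| <= B,
    forall x t, 0 <= t <= T -> 0 <= y x t <= B &
    forall x t s, 0 <= t <= T -> 0 <= s <= T -> `|y x t - y x s| <= B * `|t - s|].
Proof.
move=> T0 k10 k12 k30 bd da db dc dl Lc Ll y0 dy dyx Lyt Ly.
have cy t : 0 <= t <= T -> continuous (y ^~ t).
  by move=> tI; case: (twice_derivable_continuous (dyx t tI)).
have [C C0 HC] := strip_lipschitz dy cy Lyt.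
have yk := strip_bound T0 C0 HC cy Ly.
have [Bc Bc0 HBc] := twice_derivable_bound dc Lc.
have [Bl Bl0 HBl] := twice_derivable_bound dl Ll.
have [ca _] := twice_derivable_continuous da; have [cb _] := twice_derivable_continuous db.
have [cc cc1] := twice_derivable_continuous dc; have [cl cl1] := twice_derivable_continuous dl.
pose D t x := a x + b x * y x t.
pose K := k2 + k2 * k3.
have k20 : 0 < k2 by lra.
have k2K : k2 <= K by rewrite /K lerDl mulr_ge0 ?ltW.
have DI t x : 0 <= t <= T -> k1 <= D t x <= K.
  move=> tI; have [/andP[a1 a2] [_ [/andP[b1 b2] _]]] := bd x.
  have := y0 x t tI; have := yk x t tI => h1 h2.
  rewrite /D /K; have := mulr_ge0 b1 h2; have := ler_pM b1 h2 b2 h1; lra.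
have lI x : k1 <= l x <= k2 by case: (bd x) => _ [].
have cI x : 0 <= c x <= k2 by case: (bd x) => _ [_ []].
have bI x : 0 <= b x <= k2 by case: (bd x) => _ [_ []].
have l0 x : l x != 0 by have := lI x; apply: contraTneq => ->; lra.
have D0 t x : 0 <= t <= T -> D t x != 0.
  by move=> tI; have := DI t x tI; apply: contraTneq => ->; lra.
have cD t : 0 <= t <= T -> continuous (D t).
  move=> tI x; apply: cvgD; first exact: ca.
  by apply: cvgM; [exact: cb|exact: cy].
have th' (x : R) : is_derive x 1 (fun x => c x / l x)
    ((derive1 c x * l x - c x * derive1 l x) / l x ^+ 2).
  have h1 : is_derive x 1 c (derive1 c x).
    by rewrite derive1E; exact: (derivableP (proj1 (dc x))).
  have h2 : is_derive x 1 l (derive1 l x).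
    by rewrite derive1E; exact: (derivableP (proj1 (dl x))).
  have h3 := is_deriveV (l0 x) h2.
  have := is_deriveM h1 h3; move/is_derive_eq; apply.
  by rewrite /GRing.scale/=; field; exact: l0.
have th1 x : derive1 (fun x => c x / l x) x =
    (derive1 c x * l x - c x * derive1 l x) / l x ^+ 2.
  by rewrite derive1E; exact: (@derive_val _ _ _ _ _ _ _ (th' x)).
(* [B1] bounds m, [B2] the derivative of theta through the quotient rule, [B3] the Lipschitz
   constant of m in t; k2 / k1 bounds al, be and theta. *)
pose B1 := K / k1; pose B2 := (Bc * k2 + k2 * Bl) / k1 ^+ 2; pose B3 := k2 * C / k1.
pose B := k2 + Bc + k3 + C + B1 + B2 + B3 + k2 / k1.
have B10 : 0 <= B1 by rewrite divr_ge0// ltW//; lra.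
have B20 : 0 <= B2 by rewrite divr_ge0 ?exprn_ge0 ?addr_ge0 ?mulr_ge0// ltW.
have B30 : 0 <= B3 by rewrite divr_ge0 ?mulr_ge0// ltW.
have B40 : 0 <= k2 / k1 by rewrite divr_ge0 ?ltW.
have k10' := ltW k10.
have k2B : k2 <= B by rewrite /B; clear -k20 Bc0 k30 C0 B10 B20 B30 B40; lra.
have BcB : Bc <= B by rewrite /B; clear -k20 Bc0 k30 C0 B10 B20 B30 B40; lra.
have k3B : k3 <= B by rewrite /B; clear -k20 Bc0 k30 C0 B10 B20 B30 B40; lra.
have CB : C <= B by rewrite /B; clear -k20 Bc0 k30 C0 B10 B20 B30 B40; lra.
have B1B : B1 <= B by rewrite /B; clear -k20 Bc0 k30 C0 B10 B20 B30 B40; lra.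
have B2B : B2 <= B by rewrite /B; clear -k20 Bc0 k30 C0 B10 B20 B30 B40; lra.
have B3B : B3 <= B by rewrite /B; clear -k20 Bc0 k30 C0 B10 B20 B30 B40; lra.
have B4B : k2 / k1 <= B by rewrite /B; clear -k20 Bc0 k30 C0 B10 B20 B30 B40; lra.
have bm (h : R -> R) (M : R) : continuous h -> (forall x, 0 <= h x <= M) -> M <= B -> bounded_meas h B.
  move=> ch hM MB; split; first exact: continuous_measurable_fun.
  by move=> x; have := hM x; move=> /andP[h1 h2]; rewrite ger0_norm//; exact: le_trans MB.
have l0B x : 0 <= l x <= k2 by have := lI x; lra.
have D0B t x : 0 <= t <= T -> 0 <= D t x <= K by move=> tI; have := DI t x tI; lra.
(* Lower bound of al = l / D, since l >= k1 and D <= K, and of m = D / l, since D >= k1 and l <= k2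
   <= K. *)
exists (k1 / K), B; split.
- split.
  + by rewrite divr_gt0//; lra.
  + move=> t tI; apply: (bm _ (k2 / k1)).
    * by move=> x; apply: cvgM; [exact: cl|apply: cvgV; [exact: D0|exact: cD]].
    * by move=> x; apply: quotient_bounds k10 (l0B x) (DI t x tI).
    * exact: B4B.
  + move=> t tI; apply: (bm _ (k2 / k1)).
    * by move=> x; apply: cvgM; [exact: cc|apply: cvgV; [exact: D0|exact: cD]].
    * by move=> x; apply: quotient_bounds k10 (cI x) (DI t x tI).
    * exact: B4B.
  + move=> t tI; apply: (bm _ B1).
    * by move=> x; apply: cvgM; [exact: cD|apply: cvgV; [exact: l0|exact: cl]].
    * by move=> x; apply: quotient_bounds k10 (D0B t x tI) (lI x).
    * exact: B1B.
  + move=> t x tI; have := lI x; have := DI t x tI => /andP[d1 d2] /andP[l1 l2].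
    have K0 := lt_le_trans k20 k2K; have Dp := lt_le_trans k10 d1.
    apply: ler_pM => //; first by rewrite invr_ge0 ltW.
    by rewrite -/(D t x) lef_pV2 ?posrE.
  + move=> t x tI; have := lI x; have := DI t x tI => /andP[d1 d2] /andP[l1 l2].
    have lp := lt_le_trans k10 l1; apply: ler_pM => //.
      by rewrite invr_ge0 ltW// (lt_le_trans k20).
    by rewrite lef_pV2 ?posrE//; [exact: le_trans k2K|exact: lt_le_trans k2K].
  + move=> t s x tI sI; rewrite -mulrBl.
    have -> : D t x - D s x = b x * (y x t - y x s) by rewrite /D; ring.
    rewrite !normrM normfV; have /andP[b1 b2] := bI x; have /andP[l1 l2] := lI x.
    rewrite (ger0_norm b1) (ger0_norm (le_trans k10' l1)).
    apply: (@le_trans _ _ (k2 * (C * `|t - s|) / k1)).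
      have lp := lt_le_trans k10 l1.
      apply: ler_pM; rewrite ?mulr_ge0 ?invr_ge0// ?(ltW lp)//.
        by apply: ler_pM => //; exact: HC.
      by rewrite lef_pV2 ?posrE.
    have -> : k2 * (C * `|t - s|) / k1 = B3 * `|t - s| by rewrite /B3; ring.
    by rewrite ler_wpM2r.
  + by move=> x; exact: (@ex_derive _ _ _ _ _ _ _ (th' x)).
  + rewrite (_ : derive1 _ = (fun x => (derive1 c x * l x - c x * derive1 l x) / l x ^+ 2)); last exact/funext.
    move=> x; apply: cvgM; last apply: cvgV.
    * by apply: cvgB; apply: cvgM; [exact: cc1|exact: cl|exact: cc|exact: cl1].
    * by rewrite expf_neq0.
    * by apply: cvgM; exact: cl.
  + move=> x; have /andP[h1 h2] := quotient_bounds k10 (cI x) (lI x).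
    by rewrite ger0_norm//; exact: le_trans h2 B4B.
  + move=> x; rewrite th1 normrM normfV; have /andP[l1 l2] := lI x.
    have /andP[c1 c2] := cI x.
    have lp := lt_le_trans k10 l1; apply: le_trans B2B.
    apply: ler_pM; rewrite ?invr_ge0//.
      apply: le_trans (ler_normB _ _) _; rewrite !normrM.
      apply: lerD; apply: ler_pM => //; first by rewrite ger0_norm// ltW.
      by rewrite ger0_norm.
    rewrite ger0_norm ?sqr_ge0// lef_pV2 ?posrE ?exprn_gt0//.
    by rewrite ler_sqr ?nnegrE// ltW.
  + by move=> t x tI; rewrite mulrA divfK// divff//; exact: D0.
  + move=> t x tI; rewrite /= -/(D t x) mulrC mulrA divfK//; exact: D0.
- exact: k2B.
- by move=> x; exact: le_trans (HBc x) BcB.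
- by move=> x t tI; rewrite y0//=; exact: le_trans (yk x t tI) k3B.
- by move=> x t s tI sI; apply: le_trans (HC x t s tI sI) _; rewrite ler_wpM2r.
Qed.

End Layers.

(** * Limits in L^2 and slopes of energies *)

Section L2Limits.
Variable R : realType.
Implicit Types (f g : L2 R) (s T t c : R).

Definition L2cvg (s T t : R) (a : R -> L2 R) (l : L2 R) : Prop :=
  (fun x => L2norm (a x - l)) @ within `[s, T] t^' --> (0 : R).

Lemma cvg_dist (X : Type) (F : set_system X) (FF : Filter F) (f b : X -> R) c :
  b @ F --> (0 : R) -> (forall x, `|f x - c| <= b x) -> f @ F --> c.
Proof.
move=> /cvgrPdist_lt cb H; apply/cvgrPdist_lt => e /cb; apply: filterS => x.
rewrite sub0r normrN distrC; apply: le_lt_trans; apply: le_trans (H x) (ler_norm _).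
Qed.

Lemma cvg_dist0 s T t : (fun x => `|x - t|) @ within `[s, T] t^' --> (0 : R).
Proof.
apply/cvgrPdist_lt => e e0; rewrite near_withinE; apply/nbhs_ballP; exists e => // x.
by rewrite /ball/= => xe _ _; rewrite sub0r normrN normr_id distrC.
Qed.

Lemma L2cvgP s T t a l : L2cvg s T t a l <-> forall e, 0 < e -> exists2 d : R, 0 < d &
  forall x, s <= x <= T -> `|x - t| < d -> x != t -> L2norm (a x - l) < e.
Proof.
split=> [/cvgrPdist_lt H e /H|H].
  rewrite near_withinE => /nbhs_ballP[d /= d0 Hd].
  exists d => // x xI xd xt; apply: le_lt_trans (Hd x _ xt _).
  - by rewrite sub0r normrN ler_norm.
  - by rewrite /ball/= distrC.
  - by rewrite /= in_itv.
apply/cvgrPdist_lt => e /H[d d0 Hd]; rewrite near_withinE; apply/nbhs_ballP.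
exists d => // x /= xd xt; rewrite in_itv/= => xI.
by rewrite sub0r normrN ger0_norm ?L2norm_ge0//; apply: Hd => //; rewrite distrC.
Qed.

Lemma L2cvg_bound s T t a l (b : R -> R) : b @ within `[s, T] t^' --> (0 : R) ->
  (forall x, s <= x <= T -> x != t -> L2norm (a x - l) <= b x) -> L2cvg s T t a l.
Proof.
move=> cb H; apply: (@squeeze_cvgr _ _ _ _ (cst 0) b); [|exact: cvg_cst|exact: cb].
rewrite near_withinE; apply/nbhs_ballP; exists 1 => //= x _ xt.
by rewrite in_itv/= => xI; rewrite L2norm_ge0/= H.
Qed.

Lemma L2cvgD s T t a b l k : L2cvg s T t a l -> L2cvg s T t b k ->
  L2cvg s T t (fun x => a x + b x) (l + k).
Proof.
move=> Ha Hb; apply: (L2cvg_bound (b := fun x => L2norm (a x - l) + L2norm (b x - k))).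
  by rewrite -[X in _ --> X]addr0; exact: cvgD.
move=> x _ _; have -> : a x + b x - (l + k) = (a x - l) + (b x - k).
  by rewrite opprD addrACA.
exact: (snD (@seminorm_L2 R)).
Qed.

Lemma L2cvg_cst s T t l : L2cvg s T t (fun=> l) l.
Proof.
apply: (L2cvg_bound (b := fun=> 0)); first exact: cvg_cst.
by move=> x _ _; rewrite subrr (sn0 (@seminorm_L2 R)).
Qed.

Lemma L2cvgN s T t a l : L2cvg s T t a l -> L2cvg s T t (fun x => - a x) (- l).
Proof.
move=> Ha; apply: (L2cvg_bound Ha) => x _ _.
by rewrite -opprD (snN (@seminorm_L2 R)).
Qed.

Lemma L2cvg_mul s T t a l m (B : R) : bounded_meas m B -> L2cvg s T t a l ->
  L2cvg s T t (fun x => mulL2 m (a x)) (mulL2 m l).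
Proof.
move=> bm Ha; apply: (L2cvg_bound (b := fun x => B * L2norm (a x - l))).
  by rewrite -[X in _ --> X](mulr0 B); apply: cvgM => //; exact: cvg_cst.
by move=> x _ _; rewrite -(mulL2B bm); exact: mulL2_norm.
Qed.

Lemma dot_cvg s T t a b l k : L2cvg s T t a l -> L2cvg s T t b k ->
  (fun x => dot (a x) (b x)) @ within `[s, T] t^' --> dot l k.
Proof.
move=> Ha Hb.
apply: (@cvg_dist _ _ _ _ (fun x => L2norm (a x - l) * (L2norm (b x - k) + L2norm k) +
   L2norm l * L2norm (b x - k))).
  rewrite -[X in _ --> X]addr0 -[X in _ --> X + _](mul0r (0 + L2norm k)).
  rewrite -[X in _ --> _ + X](mulr0 (L2norm l)).
  apply: cvgD; apply: cvgM => //; last exact: cvg_cst.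
  by apply: cvgD => //; exact: cvg_cst.
move=> x; have -> : dot (a x) (b x) - dot l k = dot (a x - l) (b x) + dot l (b x - k).
  by rewrite dotBl dotBr; ring.
apply: le_trans (ler_normD _ _) _; apply: lerD; last exact: dot_CS.
apply: le_trans (dot_CS _ _) _; rewrite ler_wpM2l ?L2norm_ge0//.
by rewrite -[in leLHS](subrK k (b x)) (snD (@seminorm_L2 R)).
Qed.

Lemma L2norm_cvg s T t a l : L2cvg s T t a l ->
  (fun x => L2norm (a x)) @ within `[s, T] t^' --> L2norm l.
Proof.
move=> Ha; apply: (@cvg_dist _ _ _ _ _ _ Ha) => x; exact: (sn_dist (@seminorm_L2 R)).
Qed.

Lemma slope_le_cvg s T t (f G : R -> R) c :
  (forall x, s <= x <= T -> x != t -> (f x - f t) / (x - t) <= G x) ->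
  G @ within `[s, T] t^' --> c -> slope_le f s T t c.
Proof.
move=> H /cvgrPdist_lt cG e /cG; rewrite near_withinE => /nbhs_ballP[d /= d0 Hd].
exists d => // x xI xd xt; apply: le_trans (H x xI xt) _.
have := Hd x _ xt _; rewrite /ball/= in_itv/= distrC => /(_ xd xI).
by rewrite ltr_distl; lra.
Qed.

End L2Limits.

(** * Energy inequalities *)

Section Energy.
Variables (R : realType) (T k B : R) (al be m : R -> R -> R) (th : R -> R).
Variable U : R -> R -> L2 R -> L2 R.
Hypothesis LC : layer_coeffs T k B al be m th.
Hypothesis HU : is_evolution T (fun t => is_G (al t) (be t)) U.
Implicit Types (f g psi : L2 R).
Notation sL := (@seminorm_L2 R).

Let k0 : 0 < k. Proof. exact: (lc_k LC). Qed.
Let B0 : 0 <= B. Proof. exact: le_trans (normr_ge0 _) (lc_th LC 0). Qed.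

Lemma th_bounded : bounded_meas th B.
Proof.
split; last exact: (lc_th LC).
by apply: continuous_measurable_fun; apply: derivable_continuous; exact: (lc_th_deriv LC).
Qed.

Section Trajectory.
Variables (s : R) (psi : L2 R) (V1 V2 : R -> L2 R).
Hypothesis sI : 0 <= s <= T.
Hypothesis psiH2 : in_H2 psi.
Notation u t := (U t s psi).
Hypothesis uH2 : forall t, s <= t <= T -> is_H2 (u t) (V1 t) (V2 t).
Hypothesis V2c : forall t, s <= t <= T -> L2cvg s T t V2 (V2 t).

Let tI t : s <= t <= T -> 0 <= t <= T. Proof. by move: sI; lra. Qed.

Definition evol_rate t : L2 R := mulL2 (al t) (V2 t) - mulL2 (be t) (V1 t).
Let w := evol_rate.

(** The derivative of the evolution is given through unnamed weak derivatives of [u t]; uniqueness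
    identifies them with [V1] and [V2], hence the limit with [evol_rate]. *)
Lemma evol_quot t : s <= t <= T ->
  L2cvg s T t (fun x => (x - t)^-1 *: (u x - u t)) (w t).
Proof.
move=> tst; have tT := tI tst.
have tri : triangle T (t, s) by rewrite /triangle/=; move: sI tst; lra.
have [chi [p1 [p2 [[w1 w2] E]]] D] := evol_deriv_t HU tri psiH2.
have [v1 v2] := uH2 tst.
have E1 := weak_deriv_unique w1 v1.
have E2 := weak_deriv_unique (weak_deriv_eq E1 (L2eq_refl _) w2) v2.
apply/L2cvgP => e e0; have [d d0 Hd] := has_deriv_onP D e0.
have wE : - chi =L2 w t.
  move: E E1 E2; apply: aeS3 => y h h1 h2 _.
  rewrite /w /evol_rate L2subE L2oppE (mulL2E (lc_al LC tT)) (mulL2E (lc_be LC tT)).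
  by rewrite h (h1 I) (h2 I); lra.
exists d => // x xI xd xt; apply: le_lt_trans (sn_tri sL (- chi) _ _) _.
move/L2eqP: wE => ->; by rewrite addr0; apply: Hd.
Qed.

Lemma evol_cvg t : s <= t <= T -> L2cvg s T t (fun x => u x) (u t).
Proof.
move=> tst; have := evol_quot tst => /L2norm_cvg cq.
apply: (L2cvg_bound (b := fun x => `|x - t| * L2norm ((x - t)^-1 *: (u x - u t)))).
  rewrite -[X in _ --> X](mul0r (L2norm (w t))); apply: cvgM => //.
  exact: cvg_dist0.
move=> x xI xt; rewrite -(snZ sL) scalerA divff ?scale1r// subr_eq0//.
Qed.

Lemma mass_rate t : s <= t <= T -> mulL2 (m t) (w t) =L2 V2 t - mulL2 th (V1 t).
Proof.
move=> tst; have tT := tI tst; apply: aeW => x _.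
rewrite (mulL2E (lc_m LC tT)) /w /evol_rate !L2subE (mulL2E (lc_al LC tT)) (mulL2E (lc_be LC tT)).
by rewrite mulrBr !mulrA (lc_mal LC)// (lc_mbe LC)// mul1r (mulL2E th_bounded).
Qed.

Definition mass t f : R := dot (mulL2 (m t) f) f.

Lemma mass_ge t f : 0 <= t <= T -> k * L2norm f ^+ 2 <= mass t f.
Proof.
move=> tT; rewrite -dotff -dotZl; apply: dot_le; apply: aeW => x.
rewrite L2scaleE (mulL2E (lc_m LC tT)) -!mulrA ler_wpM2r ?(lc_m_ge LC)//.
by rewrite -expr2 sqr_ge0.
Qed.

Lemma mass_le t f : 0 <= t <= T -> mass t f <= B * L2norm f ^+ 2.
Proof.
move=> tT; apply: le_trans (ler_norm _) _; apply: le_trans (dot_CS _ _) _.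
by rewrite expr2 mulrA ler_wpM2r ?L2norm_ge0//; exact: (mulL2_norm (lc_m LC tT)).
Qed.

Lemma mass_lip t x f g : 0 <= t <= T -> 0 <= x <= T -> x != t ->
  `|(x - t)^-1 * (dot (mulL2 (m x) f) g - dot (mulL2 (m t) f) g)| <= B * L2norm f * L2norm g.
Proof.
move=> tT xT xt; rewrite -dotBl -dotZl; apply: le_trans (dot_CS _ _) _.
rewrite ler_wpM2r ?L2norm_ge0//; apply: L2norm_le_ae => //; apply: aeW => y.
rewrite L2scaleE L2subE (mulL2E (lc_m LC xT)) (mulL2E (lc_m LC tT)) -mulrBl mulrA normrM.
rewrite ler_wpM2r// normrM normfV mulrC ler_pdivrMr ?normr_gt0 ?subr_eq0//.
exact: (lc_m_lip LC).
Qed.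

(** The difference quotient splits into the variation of m, bounded by its Lipschitz constant, and a
    term tending to 2 <m u_t, u> = - 2 |u_x|^2 - 2 <theta u_x, u>. Young's inequality on the drift
    leaves - |u_x|^2. *)
Lemma mass_slope t : s <= t <= T ->
  slope_le (fun x => mass x (u x)) s T t
    (- 1 * L2norm (V1 t) ^+ 2 + (B ^+ 2 + B) / k * mass t (u t)).
Proof.
move=> tst; have tT := tI tst; have [v1 v2] := uH2 tst.
have cu := evol_cvg tst; have cq := evol_quot tst; have bm := lc_m LC tT.
pose q x := (x - t)^-1 *: (u x - u t).
have H : slope_le (fun x => mass x (u x)) s T t
    (B * L2norm (u t) * L2norm (u t) + dot (mulL2 (m t) (w t)) (u t + u t)).
  apply: (slope_le_cvg (G := fun x => B * L2norm (u x) * L2norm (u x) +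
     dot (mulL2 (m t) (q x)) (u x + u t))).
    move=> x xI xt; have xT := tI xI.
    have -> : (mass x (u x) - mass t (u t)) / (x - t) =
        (x - t)^-1 * (dot (mulL2 (m x) (u x)) (u x) - dot (mulL2 (m t) (u x)) (u x)) +
        dot (mulL2 (m t) (q x)) (u x + u t).
      have e1 : dot (mulL2 (m t) (q x)) (u x + u t) =
          (x - t)^-1 * (dot (mulL2 (m t) (u x)) (u x) - dot (mulL2 (m t) (u t)) (u t)).
        rewrite (dot_mulL2 bm) dotZl dotBl -!(dot_mulL2 bm) !dotDr.
        rewrite (dot_mulL2 bm (u t) (u x)) (dotC (u t)); ring.
      by rewrite e1 /mass; ring.
    rewrite lerD2r; apply: le_trans (ler_norm _) _; exact: mass_lip.
  apply: cvgD.
    by apply: cvgM; [apply: cvgM; [exact: cvg_cst|]|]; exact: L2norm_cvg.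
  apply: dot_cvg; first exact: (L2cvg_mul bm cq).
  by apply: L2cvgD => //; exact: L2cvg_cst.
apply: slope_leW H.
rewrite (L2eq_dot _ (mass_rate tst)) dotBl !dotDr.
have e1 : dot (V2 t) (u t) = - L2norm (V1 t) ^+ 2.
  by rewrite (weak_deriv_ibp v2 v1) dotff.
have h2 : `|dot (mulL2 th (V1 t)) (u t)| <= B * L2norm (V1 t) * L2norm (u t).
  apply: le_trans (dot_CS _ _) _; rewrite ler_wpM2r ?L2norm_ge0//.
  exact: (mulL2_norm th_bounded).
have h3 := mass_ge (u t) tT.
have h4 : (B ^+ 2 + B) / k * (k * L2norm (u t) ^+ 2) <= (B ^+ 2 + B) / k * mass t (u t).
  by rewrite ler_wpM2l// divr_ge0 ?(ltW k0)// addr_ge0 ?sqr_ge0.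
rewrite mulrA divfK ?gt_eqF// in h4.
move: h2; rewrite ler_norml e1 => /andP[h2 h2'].
move: h2 h4; set a := L2norm (V1 t); set b := L2norm (u t); set d := dot _ _; move=> h2 h4.
have := sqr_ge0 (a - B * b); lra.
Qed.

(** Integrating by parts at the level of differences gives - <u x - u t, V2 x + V2 t>: no time
    derivative of [V1] occurs, only that of [u] and the continuity of [V2]. In the limit - 2 <u_t,
    u_xx> is bounded by completing the square against al >= k. *)
Lemma grad_slope t : s <= t <= T ->
  slope_le (fun x => L2norm (V1 x) ^+ 2) s T t (B ^+ 2 / (2 * k) * L2norm (V1 t) ^+ 2).
Proof.
move=> tst; have tT := tI tst.
have cq := evol_quot tst.
pose q x := (x - t)^-1 *: (u x - u t).
have H : slope_le (fun x => L2norm (V1 x) ^+ 2) s T t (dot (- w t) (V2 t + V2 t)).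
  apply: (slope_le_cvg (G := fun x => dot (- q x) (V2 x + V2 t))).
    move=> x xI xt; have [a1 a2] := uH2 xI; have [b1 b2] := uH2 tst.
    rewrite le_eqVlt; apply/orP; left; apply/eqP.
    rewrite dotNl dotZl -[RHS]mulrN -(weak_deriv_ibp (weak_derivB a1 b1) (weak_derivD a2 b2)).
    rewrite mulrC -!dotff dotBl !dotDr (dotC (V1 t) (V1 x)).
    by congr (_ * _); ring.
  apply: dot_cvg.
    exact: L2cvgN.
  by apply: L2cvgD; [exact: V2c|exact: L2cvg_cst].
apply: slope_leW H.
rewrite -dotff -dotZl; apply: dot_le; apply: aeW => x.
rewrite L2scaleE L2addE L2oppE /w /evol_rate L2subE (mulL2E (lc_al LC tT)) (mulL2E (lc_be LC tT)).
have h1 := lc_al_ge LC x tT; have [_ /(_ x) h2] := lc_be LC tT.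
set a := al t x in h1 *; set b := be t x in h2 *; set v := V2 t x; set y := V1 t x.
have b2 : b ^+ 2 <= B ^+ 2 by rewrite -(@real_normK _ b) ?num_real// ler_sqr ?nnegrE.
have a0 : 0 < a by exact: lt_le_trans h1.
apply: (@le_trans _ _ (b ^+ 2 / (2 * a) * y ^+ 2)).
  rewrite -subr_ge0.
  have -> : b ^+ 2 / (2 * a) * y ^+ 2 - (- (a * v - b * y)) * (v + v) =
      (2 * a * v - b * y) ^+ 2 / (2 * a) by field; rewrite gt_eqF.
  by rewrite divr_ge0 ?sqr_ge0// mulr_ge0// ltW.
rewrite -[leRHS]mulrA -(expr2 y) ler_wpM2r ?sqr_ge0//.
apply: ler_pM; rewrite ?sqr_ge0 ?invr_ge0//; first by lra.
by rewrite lef_pV2 ?posrE ?mulr_gt0//; lra.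
Qed.

(* r.1 = (1 - d^2/dx^2)^-1 f and r.2 is its derivative. By [resolvent_norm],
   the squared norm of r in H^1 is the one of f in H^-1. *)
Definition resolvent_pair f (r : L2 R * L2 R) := is_H2 r.1 r.2 (r.1 - f).

Lemma resolvent_pairP f r g g1 : resolvent_pair f r -> is_weak_deriv g g1 ->
  dot f g = dot r.1 g + dot r.2 g1.
Proof.
move=> [r1 r2] wg; have := weak_deriv_ibp r2 wg; rewrite dotBl; lra.
Qed.

Lemma resolvent_norm f r : resolvent_pair f r ->
  dot f r.1 = L2norm r.1 ^+ 2 + L2norm r.2 ^+ 2.
Proof. by move=> H; rewrite (resolvent_pairP H (proj1 H)) !dotff. Qed.

Lemma resolvent_pairB f r g r' : resolvent_pair f r -> resolvent_pair g r' ->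
  resolvent_pair (f - g) (r.1 - r'.1, r.2 - r'.2).
Proof.
move=> [a1 a2] [b1 b2]; split => /=; first exact: weak_derivB.
have -> : r.1 - r'.1 - (f - g) = (r.1 - f) - (r'.1 - g) by rewrite !opprD !opprK addrACA.
exact: weak_derivB.
Qed.

Lemma resolvent_le f r : resolvent_pair f r -> L2norm r.1 <= L2norm f.
Proof.
move=> H; have [|r0] := ltP 0 (L2norm r.1); last exact: le_trans r0 (L2norm_ge0 _).
move=> r0; rewrite -(ler_pM2r r0) -expr2.
apply: (@le_trans _ _ (dot f r.1)).
  by rewrite (resolvent_norm H) lerDl sqr_ge0.
exact: le_trans (ler_norm _) (dot_CS _ _).
Qed.

(** Up to the variation of m, the derivative is 2 <m u_t, rho>. The leading term <u_xx, rho> equals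
    <u, rho - m u>, which produces the dissipation, and the drift <theta u_x, rho> is treated by
    [dot_commutator]. *)
Lemma resolvent_slope (rho : R -> L2 R * L2 R) :
  (forall t, s <= t <= T -> resolvent_pair (mulL2 (m t) (u t)) (rho t)) ->
  forall t, s <= t <= T ->
  slope_le (fun x => L2norm (rho x).1 ^+ 2 + L2norm (rho x).2 ^+ 2) s T t
    (- 1 * mass t (u t) +
     2 * (1 + 2 * B) ^+ 2 / k * (L2norm (rho t).1 ^+ 2 + L2norm (rho t).2 ^+ 2)).
Proof.
move=> Hrho t tst; have tT := tI tst; have [v1 v2] := uH2 tst.
have cu := evol_cvg tst; have cq := evol_quot tst; have bm := lc_m LC tT.
pose q x := (x - t)^-1 *: (u x - u t); pose mu x := mulL2 (m x) (u x).
have cmu : L2cvg s T t mu (mu t).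
  apply: (L2cvg_bound (b := fun x => B * `|x - t| * L2norm (u x) + B * L2norm (u x - u t))).
    have z : 0 = B * 0 * L2norm (u t) + B * 0 by rewrite !mulr0 mul0r addr0.
    rewrite [X in _ --> X]z.
    apply: cvgD; apply: cvgM => //; [|exact: L2norm_cvg|exact: cvg_cst].
    by apply: cvgM; [exact: cvg_cst|exact: cvg_dist0].
  move=> x xI xt; have xT := tI xI.
  apply: le_trans (sn_tri sL (mulL2 (m t) (u x)) _ _) _; apply: lerD.
    apply: L2norm_le_ae; first by rewrite mulr_ge0.
    apply: aeW => y; rewrite L2subE (mulL2E (lc_m LC xT)) (mulL2E bm) -mulrBl normrM.
    by rewrite ler_wpM2r//; exact: (lc_m_lip LC).
  by rewrite -(mulL2B bm); exact: (mulL2_norm bm).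
(* The resolvent does not increase the L^2 norm, so the continuity of m u in t passes to [rho],
   whatever representative is chosen at each time. *)
have crho : L2cvg s T t (fun x => (rho x).1) (rho t).1.
  apply: (L2cvg_bound cmu) => x xI xt.
  exact: (resolvent_le (resolvent_pairB (Hrho x xI) (Hrho t tst))).
have H : slope_le (fun x => L2norm (rho x).1 ^+ 2 + L2norm (rho x).2 ^+ 2) s T t
    (B * L2norm (u t) * L2norm ((rho t).1 + (rho t).1) +
     dot (mulL2 (m t) (w t)) ((rho t).1 + (rho t).1)).
  apply: (slope_le_cvg (G := fun x => B * L2norm (u x) * L2norm ((rho x).1 + (rho t).1) +
     dot (mulL2 (m t) (q x)) ((rho x).1 + (rho t).1))).
    move=> x xI xt; have xT := tI xI; have Hx := Hrho x xI; have Ht := Hrho t tst.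
    rewrite -(resolvent_norm Hx) -(resolvent_norm Ht).
    (* Symmetry of the resolvent; it turns a difference of squared norms into <mu x - mu t, rho x +
       rho t>. *)
    have sym : dot (mu x) (rho t).1 = dot (mu t) (rho x).1.
      rewrite (resolvent_pairP Hx (proj1 Ht)) (resolvent_pairP Ht (proj1 Hx)).
      by rewrite dotC (dotC (rho x).2).
    have -> : (dot (mulL2 (m x) (u x)) (rho x).1 - dot (mulL2 (m t) (u t)) (rho t).1) / (x - t) =
        (x - t)^-1 * (dot (mulL2 (m x) (u x)) ((rho x).1 + (rho t).1) -
                      dot (mulL2 (m t) (u x)) ((rho x).1 + (rho t).1)) +
        dot (mulL2 (m t) (q x)) ((rho x).1 + (rho t).1).
      have e1 : dot (mulL2 (m t) (q x)) ((rho x).1 + (rho t).1) =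
          (x - t)^-1 * (dot (mulL2 (m t) (u x)) ((rho x).1 + (rho t).1) -
                        dot (mulL2 (m t) (u t)) ((rho x).1 + (rho t).1)).
        by rewrite (dot_mulL2 bm) dotZl dotBl -!(dot_mulL2 bm).
      rewrite e1 -mulrDr addrA subrK mulrC; congr (_ * _).
      by rewrite !dotDr -/(mu x) -/(mu t) sym; ring.
    rewrite lerD2r; apply: le_trans (ler_norm _) _; exact: mass_lip.
  apply: cvgD.
    apply: cvgM; first by apply: cvgM; [exact: cvg_cst|exact: L2norm_cvg].
    by apply: L2norm_cvg; apply: L2cvgD => //; exact: L2cvg_cst.
  apply: dot_cvg; first exact: (L2cvg_mul bm cq).
  by apply: L2cvgD => //; exact: L2cvg_cst.
apply: slope_leW H.
rewrite (L2eq_dot _ (mass_rate tst)) dotBl !dotDr.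
have Ht := Hrho t tst; have [r1 r2] := Ht.
have e1 : dot (V2 t) (rho t).1 = dot (u t) (rho t).1 - mass t (u t).
  rewrite (weak_deriv_ibp v2 r1) (weak_deriv_ibp v1 r2) opprK dotBr /mass.
  by rewrite (dotC (u t) (mulL2 _ _)).
have e2 : `|dot (rho t).1 (mulL2 th (V1 t))| <=
    B * (L2norm (rho t).1 + L2norm (rho t).2) * L2norm (u t).
  exact: (dot_commutator r1 v1 (lc_th_deriv LC) (lc_th_cont LC) (lc_th LC) (lc_th1 LC)).
have e3 := dot_CS (u t) (rho t).1.
have e4 := mass_ge (u t) tT.
have e5 : L2norm ((rho t).1 + (rho t).1) <= 2 * L2norm (rho t).1.
  by apply: le_trans (snD sL _ _) _; lra.
rewrite (dotC (mulL2 th _)) e1.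
move: e2 e3 e4 e5; rewrite !ler_norml => /andP[e2 _] /andP[_ e3] e4 e5.
have nu := L2norm_ge0 (u t); have n1 := L2norm_ge0 (rho t).1; have n2 := L2norm_ge0 (rho t).2.
have e6 := ler_wpM2l (mulr_ge0 B0 nu) e5.
move: e2 e3 e4 e6 nu n1 n2.
move: (dot (rho t).1 _) (dot (u t) _) (mass _ _) (L2norm (_ + _)).
move: (L2norm (u t)) (L2norm (rho t).1) (L2norm (rho t).2) => a r r' d1 d2 M n e2 e3 e4 e6 a0 r0 r'0.
(* Young's inequality: one half of the dissipation, twice the mass, is spent on [k * a ^+ 2], and
   the other half is kept. *)
have e7 : 2 * a * ((1 + 2 * B) * (r + r')) <= k * a ^+ 2 + ((1 + 2 * B) * (r + r')) ^+ 2 / k.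
  rewrite -subr_ge0; have -> : k * a ^+ 2 + ((1 + 2 * B) * (r + r')) ^+ 2 / k -
      2 * a * ((1 + 2 * B) * (r + r')) = (k * a - (1 + 2 * B) * (r + r')) ^+ 2 / k.
    by field; rewrite gt_eqF.
  by rewrite divr_ge0 ?sqr_ge0// ltW.
have e8 : ((1 + 2 * B) * (r + r')) ^+ 2 / k <= 2 * (1 + 2 * B) ^+ 2 / k * (r ^+ 2 + r' ^+ 2).
  rewrite exprMn mulrAC [leRHS](_ : _ = (1 + 2 * B) ^+ 2 / k * (2 * (r ^+ 2 + r' ^+ 2))); last by ring.
  rewrite ler_wpM2l ?divr_ge0 ?sqr_ge0 ?(ltW k0)//.
  by have := sqr_ge0 (r - r'); lra.
have e9 : 0 <= B * a * r' by rewrite !mulr_ge0.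
have e10 : 0 <= a * r' by rewrite mulr_ge0.
by lra.
Qed.

End Trajectory.

Lemma evol_trajectory s psi : 0 <= s <= T -> in_H2 psi -> exists V1 V2 : R -> L2 R,
  [/\ forall t, s <= t <= T -> is_H2 (U t s psi) (V1 t) (V2 t),
      forall t, s <= t <= T -> L2cvg s T t V1 (V1 t) &
      forall t, s <= t <= T -> L2cvg s T t V2 (V2 t)].
Proof.
move=> sI /(evol_H2 HU)[W1 [W2 [H c1 c2]]].
have tri t : s <= t <= T -> triangle T (t, s) by rewrite /triangle/=; move: sI; lra.
have P (W : R -> R -> L2 R) : continuous_on (@L2norm R) (triangle T) (fun p => W p.1 p.2) ->
    forall t, s <= t <= T -> L2cvg s T t (W ^~ s) (W t s).
  move=> c t tst; apply/L2cvgP => e e0; have [d d0 Hd] := continuous_onP2 (tri t tst) c e0.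
  by exists d => // x xI xd _; apply: (Hd x s (tri x xI) xd); rewrite subrr normr0.
exists (W1 ^~ s), (W2 ^~ s); split; [|exact: P|exact: P].
by move=> t tst; exact: H (tri t tst).
Qed.

(** The sum of the rates of the three energy inequalities, so that one constant serves each pair of
    functionals in [slope_smoothing]. *)
Definition growth_rate : R :=
  (B ^+ 2 + B) / k + B ^+ 2 / (2 * k) + 2 * (1 + 2 * B) ^+ 2 / k.
Definition growth : R := expR (growth_rate * T).

Let r1 : 0 <= (B ^+ 2 + B) / k.
Proof. by rewrite divr_ge0 ?(ltW k0)// addr_ge0 ?sqr_ge0. Qed.
Let r2 : 0 <= B ^+ 2 / (2 * k).
Proof. by rewrite divr_ge0 ?sqr_ge0// mulr_ge0// ltW. Qed.
Let r3 : 0 <= 2 * (1 + 2 * B) ^+ 2 / k.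
Proof. by rewrite divr_ge0 ?(ltW k0)// mulr_ge0// sqr_ge0. Qed.

Lemma growth_rate_ge0 : 0 <= growth_rate.
Proof. by rewrite !addr_ge0. Qed.

Lemma growth_le s t : 0 <= s -> s <= t <= T -> expR (growth_rate * (t - s)) <= growth.
Proof.
move=> s0 tst; rewrite ler_expR ler_wpM2l ?growth_rate_ge0//; lra.
Qed.

Lemma mass_eq t f g : f =L2 g -> 0 <= t <= T -> mass t f = mass t g.
Proof.
move=> fg tT; rewrite /mass (L2eq_dot _ (mulL2_eq (lc_m LC tT) fg)) dotC.
by rewrite (L2eq_dot _ fg) dotC.
Qed.

Lemma mass_ge0 t f : 0 <= t <= T -> 0 <= mass t f.
Proof. by move=> tT; apply: le_trans (mass_ge f tT); rewrite mulr_ge0 ?sqr_ge0// ltW. Qed.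

Lemma mass_decay s t psi : 0 <= s -> s <= t <= T -> in_H2 psi ->
  mass t (U t s psi) <= growth * mass s psi.
Proof.
move=> s0 tst H2; have sI : 0 <= s <= T by lra.
have [V1 [V2 [HV c1 c2]]] := evol_trajectory sI H2.
have ms x : s <= x <= T -> 0 <= mass x (U x s psi) by move=> xI; apply: mass_ge0; lra.
have := @slope_gronwall _ (fun x => mass x (U x s psi)) s T growth_rate growth_rate_ge0 ms.
move=> /(_ _ t tst) h; apply: le_trans (h _) _.
  move=> x xI; apply: slope_leW (mass_slope sI H2 HV xI).
  have : 0 <= L2norm (V1 x) ^+ 2 by exact: sqr_ge0.
  have := mulr_ge0 r2 (ms x xI); have := mulr_ge0 r3 (ms x xI).
  by rewrite /growth_rate; lra.
rewrite (mass_eq (evol_id HU psi sI) sI) ler_wpM2r ?mass_ge0//.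
exact: growth_le.
Qed.

Lemma grad_smoothing s t psi V1 V2 : 0 <= s -> s <= t <= T -> in_H2 psi ->
  is_H2 (U t s psi) V1 V2 -> (t - s) * L2norm V1 ^+ 2 <= growth * mass s psi.
Proof.
move=> s0 tst H2 HVt; have sI : 0 <= s <= T by lra.
have [W1 [W2 [HV c1 c2]]] := evol_trajectory sI H2.
have -> : L2norm V1 = L2norm (W1 t).
  by apply: L2eq_norm; apply: weak_deriv_unique (proj1 HVt) (proj1 (HV t tst)).
have ms x : s <= x <= T -> 0 <= mass x (U x s psi) by move=> xI; apply: mass_ge0; lra.
have n0 x : s <= x <= T -> 0 <= L2norm (W1 x) ^+ 2 by move=> _; exact: sqr_ge0.
have := @slope_smoothing _ (fun x => mass x (U x s psi)) (fun x => L2norm (W1 x) ^+ 2)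
  s T 1 growth_rate ltr01 growth_rate_ge0 ms n0.
move=> /(_ _ _ t tst) h; apply: le_trans (h _ _) _.
- move=> x xI; apply: slope_leW (mass_slope sI H2 HV xI).
  have := mulr_ge0 r2 (ms x xI); have := mulr_ge0 r3 (ms x xI).
  by rewrite /growth_rate; lra.
- move=> x xI; apply: slope_leW (grad_slope sI H2 HV c2 xI).
  have := mulr_ge0 r1 (n0 x xI); have := mulr_ge0 r3 (n0 x xI).
  by rewrite /growth_rate; lra.
rewrite (mass_eq (evol_id HU psi sI) sI) invr1 mul1r ler_wpM2r ?mass_ge0//.
exact: growth_le.
Qed.

Lemma dual_smoothing s t psi r : 0 <= s -> s <= t <= T -> in_H2 psi ->
  resolvent_pair (mulL2 (m s) psi) r ->
  (t - s) * mass t (U t s psi) <= growth * (L2norm r.1 ^+ 2 + L2norm r.2 ^+ 2).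
Proof.
move=> s0 tst H2 Hr; have sI : 0 <= s <= T by lra.
have sst : s <= s <= T by lra.
have [V1 [V2 [HV c1 c2]]] := evol_trajectory sI H2.
have ms x : s <= x <= T -> 0 <= mass x (U x s psi) by move=> xI; apply: mass_ge0; lra.
have ex (f : L2 R) : exists p, resolvent_pair f p.
  by have [p [p1 h]] := resolvent f; exists (p, p1).
have [rho Hrho] := choice (fun x => ex (mulL2 (m x) (U x s psi))).
have n0 x : s <= x <= T -> 0 <= L2norm (rho x).1 ^+ 2 + L2norm (rho x).2 ^+ 2.
  by move=> _; rewrite addr_ge0 ?sqr_ge0.
have := @slope_smoothing _ (fun x => L2norm (rho x).1 ^+ 2 + L2norm (rho x).2 ^+ 2)
  (fun x => mass x (U x s psi)) s T 1 growth_rate ltr01 growth_rate_ge0 n0 ms.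
move=> /(_ _ _ t tst) h; apply: le_trans (h _ _) _.
- move=> x xI; apply: slope_leW (resolvent_slope sI H2 HV (fun x _ => Hrho x) xI).
  have := mulr_ge0 r1 (n0 x xI); have := mulr_ge0 r2 (n0 x xI).
  by rewrite /growth_rate; lra.
- move=> x xI; apply: slope_leW (mass_slope sI H2 HV xI).
  have := mulr_ge0 r2 (ms x xI); have := mulr_ge0 r3 (ms x xI); have := n0 x xI.
  by have := sqr_ge0 (L2norm (V1 x)); rewrite /growth_rate; lra.
have E : mulL2 (m s) (U s s psi) =L2 mulL2 (m s) psi.
  exact: (mulL2_eq (lc_m LC sI) (evol_id HU psi sI)).
rewrite invr1 mul1r -(resolvent_norm Hr) -(resolvent_norm (Hrho s)).
have -> : dot (mulL2 (m s) (U s s psi)) (rho s).1 = dot (mulL2 (m s) psi) r.1.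
  rewrite (L2eq_dot _ E) (resolvent_pairP Hr (proj1 (Hrho s))).
  rewrite -(L2eq_dot _ E) (resolvent_pairP (Hrho s) (proj1 Hr)).
  by rewrite dotC (dotC r.2).
rewrite ler_wpM2r ?growth_le// (resolvent_norm Hr) addr_ge0 ?sqr_ge0//.
Qed.

End Energy.

(** * Smoothing bounds for the evolution operator on L^2 *)

Section EvolutionBounds.
Variables (R : realType) (T k B : R) (al be m : R -> R -> R) (th : R -> R).
Variable U : R -> R -> L2 R -> L2 R.
Hypothesis LC : layer_coeffs T k B al be m th.
Hypothesis HU : is_evolution T (fun t => is_G (al t) (be t)) U.
Implicit Types (f g psi : L2 R) (s t : R).
Notation sL := (@seminorm_L2 R).

Let k0 : 0 < k. Proof. exact: (lc_k LC). Qed.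
Let B0 : 0 <= B. Proof. exact: le_trans (normr_ge0 _) (lc_th LC 0). Qed.
Let grow := growth T k B.
Let grow0 : 0 < grow. Proof. exact: expR_gt0. Qed.

Lemma isqrt_bound (x a v p : R) : 0 < x -> 0 <= a -> 0 <= v -> 0 <= p ->
  x * v ^+ 2 <= a * p ^+ 2 -> v <= Num.sqrt a * isqrt x * p.
Proof.
move=> x0 a0 v0 p0 H; have sx : 0 < Num.sqrt x by rewrite sqrtr_gt0.
rewrite mulrAC /isqrt ler_pdivlMr//.
rewrite -ler_sqr ?nnegrE ?mulr_ge0 ?sqrtr_ge0//.
by rewrite !exprMn !sqr_sqrtr ?(ltW x0)// mulrC.
Qed.

Lemma evol_linB t s f g : triangle T (t, s) -> U t s (f - g) =L2 U t s f - U t s g.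
Proof.
move=> tri; have := evol_linear HU tri (-1) g f; rewrite !scaleN1r.
by rewrite addrC (addrC (- U t s g)).
Qed.

Lemma test_in_H2 phi : is_test_function phi -> in_H2 (toL2 phi : L2 R).
Proof. by move=> /test_H2 h; exists (toL2 (derive1 phi)), (toL2 (derive1 (derive1 phi))). Qed.

Lemma evol_bounded_ge0 t s : triangle T (t, s) ->
  exists2 C, 0 <= C & forall psi, L2norm (U t s psi) <= C * L2norm psi.
Proof.
move=> /(evol_bounded HU)[C HC]; exists `|C| => // psi.
by apply: le_trans (HC psi) _; rewrite ler_wpM2r ?L2norm_ge0// ler_norm.
Qed.

(** The constant [c] may be large and leaves no trace in the conclusion: a qualitative bound, such
    as that of [evol_bounded] or the height of a cutoff, is only used to pass from H^2 to L^2. *)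
Lemma dense_le (N : L2 R -> R) (a c : R) : 0 <= a -> 0 <= c ->
  (forall f g, N f <= N g + c * L2norm (f - g)) ->
  (forall psi, in_H2 psi -> N psi <= a * L2norm psi) ->
  forall psi, N psi <= a * L2norm psi.
Proof.
move=> a0 c0 HN H psi; apply/ler_addgt0Pr => e e0.
have D0 : 0 < 1 + (a + c) by lra.
have [phi tphi h] := test_dense psi (divr_gt0 e0 D0).
have h1 := H _ (test_in_H2 tphi); have h2 := HN psi (toL2 phi).
have h3 := sn_dist sL (toL2 phi) psi.
rewrite (snBC sL) in h3; have {}h3 := le_trans (ler_norm _) h3.
have h4 : a * L2norm (toL2 phi) <= a * (L2norm psi + L2norm (psi - toL2 phi)).
  by rewrite ler_wpM2l//; lra.
have h5 : (a + c) * L2norm (psi - toL2 phi) <= e.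
  have : L2norm (psi - toL2 phi) * (1 + (a + c)) < e by rewrite -ltr_pdivlMr.
  by have := L2norm_ge0 (psi - toL2 phi); lra.
by lra.
Qed.

Lemma mass_initial s psi : 0 <= s <= T -> grow * mass m s psi <= grow * B * L2norm psi ^+ 2.
Proof.
by move=> sI; rewrite -mulrA ler_wpM2l ?(ltW grow0)//; exact: (mass_le LC).
Qed.

Lemma evol_le t s psi : 0 <= s -> s <= t <= T ->
  L2norm (U t s psi) <= Num.sqrt (grow * B / k) * L2norm psi.
Proof.
move=> s0 tst; have tri : triangle T (t, s) by rewrite /triangle/=; lra.
have [C C0 HC] := evol_bounded_ge0 tri.
apply: (@dense_le (fun f => L2norm (U t s f)) _ C _ _ _ _ psi) => //.
  move=> f g; rewrite addrC -lerBlDr.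
  have := sn_dist sL (U t s f) (U t s g).
  rewrite -(L2eq_norm (evol_linB f g tri)) => h.
  by apply: le_trans (le_trans (ler_norm _) h) (HC _).
move=> {}psi H2; rewrite -ler_sqr ?nnegrE ?mulr_ge0 ?sqrtr_ge0 ?L2norm_ge0//.
rewrite exprMn sqr_sqrtr; last by rewrite divr_ge0 ?mulr_ge0 ?(ltW grow0) ?(ltW k0).
have tT : 0 <= t <= T by lra.
have h1 := mass_ge LC (U t s psi) tT.
have h2 := mass_decay LC HU s0 tst H2.
have h3 := @mass_initial s psi ltac:(lra).
rewrite mulrAC ler_pdivlMr// mulrC.
exact: le_trans h1 (le_trans h2 h3).
Qed.

(** Bound of the H^1 norm at rate (t - s)^(-1/2). The second term comes from the gradient; in the
    first, [Num.sqrt T] converts the plain L^2 bound to that rate. *)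
Definition mul_rate : R := Num.sqrt (grow * B / k) * Num.sqrt T + Num.sqrt (grow * B).

Lemma mul_rate_ge0 : 0 <= mul_rate.
Proof. by rewrite addr_ge0 ?mulr_ge0 ?sqrtr_ge0. Qed.

Lemma sqrt_isqrt_ge1 s t : 0 <= s -> s < t <= T -> 1 <= Num.sqrt T * isqrt (t - s).
Proof.
move=> s0 tst; rewrite /isqrt ler_pdivlMr ?mul1r ?sqrtr_gt0; last by lra.
by rewrite ler_wsqrtr//; lra.
Qed.

(* The bound does not depend on b, so it is uniform for w = min(q, N). *)
Lemma evol_mul_le t s (q : L2 R) (w : R -> R) (b : R) psi : 0 <= s -> s < t <= T ->
  bounded_meas w b -> (forall x, `|w x| <= `|q x|) ->
  L2norm (mulL2 w (U t s psi)) <= mul_rate * isqrt (t - s) * L2norm q * L2norm psi.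
Proof.
move=> s0 tst bw wq; have tst' : s <= t <= T by lra.
have tri : triangle T (t, s) by rewrite /triangle/=; lra.
have [C C0 HC] := evol_bounded_ge0 tri.
have b0 := bounded_meas_ge0 bw.
apply: (@dense_le (fun f => L2norm (mulL2 w (U t s f))) _ (b * C) _ _ _ _ psi) => //.
- by rewrite !mulr_ge0 ?isqrt_ge0 ?L2norm_ge0// mul_rate_ge0.
- exact: mulr_ge0.
- move=> f g; rewrite addrC -lerBlDr.
  have := sn_dist sL (mulL2 w (U t s f)) (mulL2 w (U t s g)).
  rewrite -(mulL2B bw) => h.
  apply: le_trans (le_trans (ler_norm _) h) _; apply: le_trans (mulL2_norm bw _) _.
  rewrite -mulrA ler_wpM2l//; apply: le_trans (HC _).
  by rewrite (L2eq_norm (evol_linB f g tri)).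
move=> {}psi H2.
have [V1 [V2 [HV _ _]]] := evol_trajectory HU (ltac:(lra) : 0 <= s <= T) H2.
have Ht := HV t tst'.
apply: le_trans (mul_H1_norm bw wq (proj1 Ht)) _.
rewrite mulrAC ler_wpM2r ?L2norm_ge0//.
have h1 := evol_le psi s0 tst'.
have h2 := grad_smoothing LC HU s0 tst' H2 Ht.
have h3 := le_trans h2 (@mass_initial s psi ltac:(lra)).
have ts0 : 0 < t - s by lra.
have h4 := isqrt_bound ts0 (mulr_ge0 (ltW grow0) B0) (L2norm_ge0 _) (L2norm_ge0 _) h3.
have h5 := sqrt_isqrt_ge1 s0 tst.
rewrite /mul_rate mulrDl mulrDl; apply: lerD h4; apply: le_trans h1 _.
rewrite ler_wpM2r ?L2norm_ge0// -[leRHS]mulrA.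
by rewrite ler_peMr ?sqrtr_ge0.
Qed.

(** The radius is uniform in [w]. For a test function the trajectory is continuous in H^1, which
    controls the product with any [w] below [q]; the distance from [psi] to the test is controlled
    by smoothing, uniformly for [t' - s >= (t - s) / 2]. *)
Lemma evol_mul_continuous t s (q : L2 R) psi e : 0 <= s -> s < t <= T -> 0 < e ->
  exists2 d : R, 0 < d & forall t', s < t' <= T -> `|t' - t| < d ->
    forall w b, bounded_meas w b -> (forall x, `|w x| <= `|q x|) ->
    L2norm (mulL2 w (U t' s psi - U t s psi)) <= e.
Proof.
move=> s0 tst e0; have tst' : s <= t <= T by lra.
have sI : 0 <= s <= T by lra.
pose A := mul_rate * isqrt ((t - s) / 2) * L2norm q.
have A0 : 0 <= A by rewrite !mulr_ge0 ?isqrt_ge0 ?L2norm_ge0// mul_rate_ge0.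
have D1 : 0 < 1 + 2 * A by lra.
have [phi tphi h] := test_dense psi (divr_gt0 (divr_gt0 e0 (ltr0n R 2)) D1).
have [V1 [V2 [HV c1 _]]] := evol_trajectory HU sI (test_in_H2 tphi).
have cu := evol_cvg LC HU sI (test_in_H2 tphi) HV tst'.
pose e1 := e / 4 / (1 + L2norm q).
have q1 : 0 < 1 + L2norm q by have := L2norm_ge0 q; lra.
have e10 : 0 < e1 by rewrite !divr_gt0.
have [d1 d10 Hd1] := proj1 (L2cvgP _ _ _ _ _) cu _ e10.
have [d2 d20 Hd2] := proj1 (L2cvgP _ _ _ _ _) (c1 t tst') _ e10.
exists (Num.min (Num.min d1 d2) ((t - s) / 2)).
  by rewrite !lt_min d10 d20 divr_gt0// subr_gt0; case/andP: tst.
move=> t' tst2; rewrite !lt_min => /andP[/andP[h1 h2] h3] w b bw wq.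
have [->|t't] := eqVneq t' t.
  rewrite subrr; have := mulL2_norm bw 0; rewrite (sn0 sL) mulr0 => /le_trans; apply.
  exact: ltW.
have tst2' : s <= t' <= T by lra.
have tri : triangle T (t, s) by rewrite /triangle/=; lra.
have tri' : triangle T (t', s) by rewrite /triangle/=; lra.
set ph := toL2 phi in h HV cu Hd1.
have hs : (t - s) / 2 <= t - s by lra.
have hs' : (t - s) / 2 <= t' - s.
  by move: h3; rewrite ltr_distl; lra.
have hp : 0 < (t - s) / 2 by rewrite divr_gt0// subr_gt0; case/andP: tst.
have E : mulL2 w (U t' s psi - U t s psi) =L2
    (mulL2 w (U t' s (psi - ph)) + mulL2 w (U t' s ph - U t s ph)) - mulL2 w (U t s (psi - ph)).
  have E1 := evol_linB psi ph tri; have E2 := evol_linB psi ph tri'.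
  move: E1 E2; apply: aeS2 => x a1 a2 _.
  rewrite L2subE L2addE !(mulL2E bw) (a1 I) (a2 I) !L2subE; ring.
rewrite (L2eq_norm E); apply: le_trans (snB sL _ _) _.
apply: le_trans (lerD (snD sL _ _) (lexx _)) _.
have b1 : L2norm (mulL2 w (U t' s (psi - ph))) <= A * L2norm (psi - ph).
  apply: le_trans (evol_mul_le _ s0 tst2 bw wq) _; rewrite ler_wpM2r ?L2norm_ge0//.
  by rewrite /A ler_wpM2r ?L2norm_ge0// ler_wpM2l ?mul_rate_ge0//; exact: isqrt_le.
have b2 : L2norm (mulL2 w (U t s (psi - ph))) <= A * L2norm (psi - ph).
  apply: le_trans (evol_mul_le _ s0 tst bw wq) _; rewrite ler_wpM2r ?L2norm_ge0//.
  by rewrite /A ler_wpM2r ?L2norm_ge0// ler_wpM2l ?mul_rate_ge0//; exact: isqrt_le.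
have b3 : L2norm (mulL2 w (U t' s ph - U t s ph)) <= e / 2.
  apply: le_trans (mul_H1_norm bw wq (weak_derivB (proj1 (HV t' tst2')) (proj1 (HV t tst')))) _.
  apply: (@le_trans _ _ (2 * e1 * L2norm q)).
    rewrite ler_wpM2r ?L2norm_ge0//.
    by move: (Hd1 t' tst2' h1 t't) (Hd2 t' tst2' h2 t't); lra.
  rewrite /e1; have -> : 2 * (e / 4 / (1 + L2norm q)) * L2norm q = e / 2 * (L2norm q / (1 + L2norm q)).
    by field; rewrite gt_eqF.
  by rewrite ger_pMr ?divr_gt0// ler_pdivrMr// mul1r lerDr.
have b4 : 2 * A * L2norm (psi - ph) <= e / 2.
  have : L2norm (psi - ph) * (1 + 2 * A) < e / 2 by rewrite -ltr_pdivlMr.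
  by have := L2norm_ge0 (psi - ph); clear b1 b2 b3 HV Hd1 Hd2; lra.
by clear HV Hd1 Hd2 h1 h2 h3; lra.
Qed.

(** The hypothesis bounds the H^-1 norm of m psi without requiring [psi] in H^2. Approximation by
    tests changes [K] by at most [B] times the distance in L^2, which tends to 0. *)
Lemma evol_dual_le t s psi (K : R) : 0 <= s -> s < t <= T -> 0 <= K ->
  (forall f df, is_weak_deriv f df ->
     `|dot f (mulL2 (m s) psi)| <= K * (L2norm f + L2norm df)) ->
  L2norm (U t s psi) <= Num.sqrt (2 * grow / k) * isqrt (t - s) * K.
Proof.
move=> s0 tst K0 HK; have tst' : s <= t <= T by lra.
have sI : 0 <= s <= T by lra.
have tri : triangle T (t, s) by rewrite /triangle/=; lra.
have [C C0 HC] := evol_bounded_ge0 tri.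
pose A := Num.sqrt (2 * grow / k) * isqrt (t - s).
have A0 : 0 <= A by rewrite mulr_ge0 ?sqrtr_ge0 ?isqrt_ge0.
have key f (L : R) : in_H2 f -> 0 <= L ->
    (forall g dg, is_weak_deriv g dg ->
       `|dot g (mulL2 (m s) f)| <= L * (L2norm g + L2norm dg)) ->
    L2norm (U t s f) <= A * L.
  move=> H2 L0 HL; have [r [r1 Hr]] := resolvent (mulL2 (m s) f).
  have h := @dual_smoothing _ _ _ _ _ _ _ _ _ LC HU s t f (r, r1) s0 tst' H2 Hr.
  have tT : 0 <= t <= T by lra.
  have hm := mass_ge LC (U t s f) tT.
  (* The bound is tested on the resolvent itself: |r|^2 + |r1|^2 <= L (|r| + |r1|), which gives the
     factor 2 under the square root of the conclusion. *)
  have J : L2norm r ^+ 2 + L2norm r1 ^+ 2 <= 2 * L ^+ 2.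
    have := HL r r1 (proj1 Hr); rewrite dotC (@resolvent_norm _ _ (r, r1) Hr)/=.
    move=> /(le_trans (ler_norm _)); have := L2norm_ge0 r; have := L2norm_ge0 r1.
    move: (L2norm r) (L2norm r1) => x y y0 x0 h1.
    have [S0|S0] := eqVneq (x + y) 0.
      by have := sqr_ge0 L; move: h1; rewrite S0 mulr0; lra.
    have Sp : 0 < x + y by rewrite lt_neqAle eq_sym S0 addr_ge0.
    have h2 : (x + y) * (x + y) <= 2 * L * (x + y).
      by have := sqr_ge0 (x - y); lra.
    rewrite ler_pM2r// in h2.
    have := ler_wpM2l L0 h2; lra.
  apply: isqrt_bound => //; [lra|by rewrite divr_ge0 ?mulr_ge0// ltW|exact: L2norm_ge0|].
  rewrite [leRHS](_ : _ = grow * (2 * L ^+ 2) / k); last by ring.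
  rewrite ler_pdivlMr// -mulrA (mulrC _ k).
  apply: (@le_trans _ _ ((t - s) * mass m t (U t s f))).
    by rewrite ler_wpM2l//; lra.
  apply: le_trans h _; rewrite ler_wpM2l//; exact: ltW.
apply/ler_addgt0Pr => e e0.
have D0 : 0 < 1 + (A * B + C) by have := mulr_ge0 A0 B0; lra.
have [phi tphi h] := test_dense psi (divr_gt0 e0 D0).
set ph := toL2 phi in h.
have n0 := L2norm_ge0 (psi - ph).
have h1 : L2norm (U t s ph) <= A * (K + B * L2norm (psi - ph)).
  apply: key; [exact: test_in_H2|by rewrite addr_ge0 ?mulr_ge0|move=> g dg wg].
  have -> : dot g (mulL2 (m s) ph) = dot g (mulL2 (m s) psi) - dot g (mulL2 (m s) (psi - ph)).
    by rewrite (mulL2B (lc_m LC sI)) !dotBr; ring.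
  apply: le_trans (ler_normB _ _) _; rewrite mulrDl; apply: lerD; first exact: HK.
  apply: le_trans (dot_CS _ _) _; rewrite mulrC; apply: ler_pM; rewrite ?L2norm_ge0//.
    exact: (mulL2_norm (lc_m LC sI)).
  by rewrite lerDl L2norm_ge0.
have h2 : L2norm (U t s psi) <= L2norm (U t s ph) + C * L2norm (psi - ph).
  rewrite addrC -lerBlDr; have := sn_dist sL (U t s psi) (U t s ph).
  rewrite -(L2eq_norm (evol_linB psi ph tri)) => h3.
  by apply: le_trans (le_trans (ler_norm _) h3) (HC _).
have h3 : (A * B + C) * L2norm (psi - ph) <= e.
  have : L2norm (psi - ph) * (1 + (A * B + C)) < e by rewrite -ltr_pdivlMr.
  by lra.
by move: h1; rewrite -/A mulrDr; lra.
Qed.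

End EvolutionBounds.

(** * Mild solutions in an abstract setting *)

Section ApproxBound.
Variables (R : realType) (V : lmodType R) (nu : V -> R).
Hypothesis snu : seminorm nu.
Notation mu := (@lebesgue_measure R).

(** The integrand is negligible before [a], as for the difference between a solution and its restart
    from time [a]; the bound then only involves [[a, t]]. *)
Lemma bochner_approx_bound (a t K I : R) (g : R -> R) h v : 0 <= a -> a < t -> 0 <= K ->
  measurable_fun [set: R] g -> (forall x, 0 <= g x) ->
  (\int[mu]_(x in `[a, t]) (g x)%:E <= I%:E)%E ->
  bochner_approx nu `[0, t] h v ->
  {ae mu, forall x, 0 < x < t -> nu (h x) <= if a <= x then K * g x else 0} ->
  nu v <= K * I.
Proof.
move=> a0 at0 K0 mg g0 gI Hv Hh.
pose G x : \bar R := (\1_`[a, t] x * (K * g x))%:E.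
have G0 x : (0 <= G x)%E by rewrite /G lee_fin !mulr_ge0// indicE.
have mG : measurable_fun [set: R] G.
  apply/measurable_EFinP; apply: measurable_funM; first exact: measurable_indic.
  exact: measurable_funM.
have t0 : 0 < t by lra.
have : ((nu v)%:E <= \int[mu]_(x in `[0%R, t]) G x)%E.
  apply: (bochner_approx_le snu _ _ Hv) => //.
  - by rewrite lebesgue_measure_itv/=; case: ifPn => _; rewrite ?ltry// -EFinD ltry.
  - exact: measurable_funTS.
  have := ae_neq (0 : R); have := ae_neq t; move: Hh; apply: aeS3 => x Hx xt x0.
  rewrite /= in_itv/= => /andP[h1 h2]; rewrite /G lee_fin.
  have xI : 0 < x < t by rewrite lt_neqAle eq_sym x0 h1 lt_neqAle xt h2.
  apply: le_trans (Hx xI) _; rewrite indicE; case: ifPn => ax.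
    by rewrite mem_set ?mul1r//= in_itv/= ax.
  by rewrite !mulr_ge0.
move=> /le_trans H; rewrite -lee_fin; apply: H.
have -> : (\int[mu]_(x in `[0%R, t]) G x = \int[mu]_(x in `[a, t]) (K%:E * (g x)%:E))%E.
  rewrite integral_mkcond [RHS]integral_mkcond; apply: eq_integral => x _.
  rewrite !patchE /G indicE; case: (boolP (x \in `[a, t]%classic)) => [xat|_].
    move: (xat); rewrite inE/= in_itv/= => /andP[h1 h2].
    by rewrite mem_set/= ?in_itv/= ?h2 ?(le_trans a0)// mul1r EFinM.
  by rewrite mul0r; case: ifP.
rewrite leb_ge0_integralZl//; last first.
- by apply/measurable_EFinP; exact: measurable_funTS.
- by move=> x _; rewrite lee_fin.
by rewrite EFinM lee_wpmul2l.
Qed.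

End ApproxBound.

Section MildSolution.
Variables (R : realType) (V : lmodType R) (nrm : V -> R) (T C L : R).
(* In the application, nu N v is the norm of min(q, N) v. The function f is
   total and is the source at v only if nu N v is bounded in N; src t v w says
   that w is the source at v and requires no such bound. *)
Variables (W : R -> R -> V -> V) (nu : nat -> V -> R).
Variables (f : R -> V -> V) (src : R -> V -> V -> Prop) (phi : V).
Implicit Types (F : R -> V) (s t : R).

Hypotheses (sn : seminorm nrm) (cpl : seq_complete nrm).
Hypotheses (T0 : 0 < T) (C0 : 0 <= C) (L0 : 0 <= L).
Hypothesis Wlin : forall t s k u v, 0 <= s -> s <= t <= T ->
  nrm (W t s (k *: u + v) - (k *: W t s u + W t s v)) = 0.
Hypothesis Wle : forall t s v, 0 <= s -> s <= t <= T -> nrm (W t s v) <= C * nrm v.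
Hypothesis Wcont : forall v, continuous_on nrm (triangle T) (fun p => W p.1 p.2 v).
Hypothesis Wid : forall t v, 0 <= t <= T -> nrm (W t t v - v) = 0.
Hypothesis Wcomp : forall t s r v, 0 <= r -> r <= s -> s <= t -> t <= T ->
  nrm (W t r v - W t s (W s r v)) = 0.
Hypothesis snu : forall N, seminorm (nu N).
Hypothesis nu_nrm : forall N, exists2 c, 0 <= c & forall v, nu N v <= c * nrm v.
Hypothesis nuW : forall N t s v, 0 <= s -> s < t <= T ->
  nu N (W t s v) <= C * isqrt (t - s) * nrm v.
Hypothesis nuWcont : forall t s v e, 0 <= s -> s < t <= T -> 0 < e ->
  exists2 d : R, 0 < d & forall t', s < t' <= T -> `|t' - t| < d ->
    forall N, nu N (W t' s v - W t s v) <= e.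
Hypothesis src_f : forall t v K, 0 <= t <= T -> (forall N, nu N v <= K) -> src t v (f t v).
Hypothesis f_lip : forall t v v' K K', 0 <= t <= T -> (forall N, nu N v <= K') ->
  (forall N, nu N (v - v') <= K) -> nrm (f t v - f t v') <= L * (nrm (v - v') + K).
Hypothesis f_growth : forall t v K, 0 <= t <= T -> (forall N, nu N v <= K) ->
  nrm (f t v) <= L * (1 + nrm v + K).
Hypothesis f_time : forall t t' v K, 0 <= t <= T -> 0 <= t' <= T ->
  (forall N, nu N v <= K) -> nrm (f t v - f t' v) <= L * `|t - t'| * (1 + nrm v + K).
Hypothesis src_eq : forall t v w w', src t v w -> nrm (w - w') = 0 -> src t v w'.
Hypothesis src_dual : forall t s v v' w w', 0 <= s -> s < t <= T ->
  src s v w -> src s v' w' -> nrm (W t s (w - w')) <= C * isqrt (t - s) * nrm (v - v').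

Lemma nu_eq0 N u : nrm u = 0 -> nu N u = 0.
Proof.
move=> u0; have [c c0 Hc] := nu_nrm N; apply/eqP; rewrite eq_le (sn_ge0 (snu N)) andbT.
by apply: le_trans (Hc u) _; rewrite u0 mulr0.
Qed.

Lemma WB t s u v : 0 <= s -> s <= t <= T -> nrm (W t s (u - v) - (W t s u - W t s v)) = 0.
Proof.
move=> s0 tst; have := Wlin (-1) v u s0 tst; rewrite !scaleN1r.
by rewrite addrC (addrC (- v)) (addrC (- W t s v)) addrC.
Qed.

Lemma nuWB N t s u v : 0 <= s -> s <= t <= T ->
  nu N (W t s u - W t s v) = nu N (W t s (u - v)).
Proof.
move=> s0 tst; apply: (sn_eq0 (snu N)); apply: nu_eq0; rewrite (snBC sn).
exact: WB.
Qed.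

Lemma nrmWB t s u v : 0 <= s -> s <= t <= T ->
  nrm (W t s u - W t s v) = nrm (W t s (u - v)).
Proof. by move=> s0 tst; apply: (sn_eq0 sn); rewrite (snBC sn) WB. Qed.

(** Continuity away from 0 makes the Bochner integral exist and the weight makes it converge;
    nothing is said about the time 0. *)
Definition admissible (S M : R) F :=
  (forall x, 0 < x <= S -> nrm (F x) <= M * isqrt x) /\
  (forall x, 0 < x <= S -> forall e, 0 < e -> exists2 d : R, 0 < d &
     forall y, 0 < y <= S -> `|y - x| < d -> nrm (F y - F x) < e).

Lemma isqrt_gt0 (x : R) : 0 < x -> 0 < isqrt x.
Proof. by move=> x0; rewrite invr_gt0 sqrtr_gt0. Qed.

Lemma admissible_ge0 S M F : 0 < S -> admissible S M F -> 0 <= M.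
Proof.
move=> S0 [H _]; have := H S; rewrite S0 lexx => /(_ isT) h.
by rewrite -(pmulr_lge0 _ (isqrt_gt0 S0)); apply: le_trans h; exact: (sn_ge0 sn).
Qed.

Lemma integrand_exists S M F t : 0 < S <= T -> admissible S M F -> 0 < t <= S ->
  exists v, is_bochner_integral nrm `[0, t] (fun x => W t x (F x)) v.
Proof.
move=> ST [FM Fc] tS.
apply: (@bochner_exists _ _ _ sn cpl t (C * M)) => [|x xt|x xt e e0]; first by lra.
- rewrite -mulrA; have := Wle (F x) (_ : 0 <= x) (_ : x <= t <= T).
  move=> /(_ ltac:(lra) ltac:(lra)) h; apply: le_trans h _; rewrite ler_wpM2l//.
  by apply: FM; lra.
- have C1 : 0 < 1 + C by rewrite ltr_pwDl.
  have D0 : 0 < e / 2 / (1 + C) by rewrite !divr_gt0.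
  have [d1 d10 Hd1] := Fc x ltac:(lra) _ D0.
  have tri : triangle T (t, x) by rewrite /triangle/=; lra.
  have e2 : 0 < e / 2 by rewrite divr_gt0.
  have [d2 d20 Hd2] := continuous_onP2 tri (@Wcont (F x)) e2.
  exists (Num.min d1 d2); first by rewrite lt_min d10.
  move=> y yt; rewrite lt_min => /andP[y1 y2].
  apply: le_lt_trans (sn_tri sn (W t y (F x)) _ _) _.
  have h1 : nrm (W t y (F y) - W t y (F x)) <= e / 2.
    rewrite nrmWB; [|lra|lra]; apply: le_trans (Wle _ _ _) _; [lra|lra|].
    have h := Hd1 y ltac:(lra) y1.
    apply: (@le_trans _ _ (C * (e / 2 / (1 + C)))); first by rewrite ler_wpM2l// ltW.
    by rewrite mulrCA ger_pMr// ler_pdivrMr// mul1r lerDr.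
  have h2 : nrm (W t y (F x) - W t x (F x)) < e / 2.
    have tri' : triangle T (t, y) by rewrite /triangle/=; lra.
    by apply: (Hd2 t y tri'); rewrite ?subrr ?normr0.
  by lra.
Qed.

(** A value of the integral is chosen, with default 0 when there is none. *)
Definition duhamel F t : V :=
  match pselect (exists v, is_bochner_integral nrm `[0, t] (fun x => W t x (F x)) v) with
  | left H => projT1 (cid H) | right _ => 0 end.

Lemma bochner_point (h : R -> V) : is_bochner_integral nrm `[0, 0] h 0.
Proof.
exists (fun=> @SimpleMap R V 1 (fun=> set0) (fun=> 0) (fun=> measurable0)); split.
- by have := ae_neq (0 : R); apply: aeS => x x0; rewrite set_itv1 => /= xE; rewrite xE eqxx in x0.
- rewrite set_itv1 (_ : (fun k => _) = (fun=> 0%E)); first exact: cvg_cst.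
  by apply/funext => k; rewrite integral_set1.
- rewrite (_ : (fun k => _) = (fun=> 0)); first exact: cvg_cst.
  apply/funext => k; rewrite /sm_integral big1 ?subrr ?(sn0 sn)// => j _.
  by rewrite scaler0.
Qed.

Lemma duhamelP S M F t : 0 < S <= T -> admissible S M F -> 0 <= t <= S ->
  is_bochner_integral nrm `[0, t] (fun x => W t x (F x)) (duhamel F t).
Proof.
move=> ST FA tS; rewrite /duhamel; case: pselect => [H|[]]; first exact: (projT2 (cid H)).
have [->|t0] := eqVneq t 0; first by exists 0; exact: bochner_point.
by apply: (integrand_exists ST FA); move: tS; rewrite lt_neqAle eq_sym t0.
Qed.

Lemma duhamel_approx S M F t : 0 < S <= T -> admissible S M F -> 0 <= t <= S ->
  bochner_approx nrm `[0, t] (fun x => W t x (F x)) (duhamel F t).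
Proof. by move=> ST FA tS; apply: (bochner_approxP sn) => //; exact: duhamelP FA tS. Qed.

(** Each [nu N] is bounded by a multiple of [nrm], so the same element is the integral for [nu N].
    This is the reason for cutting q off. *)
Lemma approx_nu N (D : set R) h v : measurable D -> bochner_approx nrm D h v ->
  bochner_approx (nu N) D h v.
Proof.
move=> mD H; have [c c0 Hc] := nu_nrm N.
apply: (bochner_approx_map (A := id) (snu N) _ c0 Hc mD H).
by move=> k u w; rewrite subrr (sn0 (snu N)).
Qed.

Lemma approxB (D : set R) h h' v v' : measurable D -> bochner_approx nrm D h v ->
  bochner_approx nrm D h' v' -> bochner_approx nrm D (fun x => h x - h' x) (v - v').
Proof.
move=> mD H H'; have := bochner_approx_lin sn (-1) mD H' H.
rewrite scaleN1r addrC (_ : (fun x => -1 *: h' x + h x) = (fun x => h x - h' x))//.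
by apply/funext => x; rewrite scaleN1r addrC.
Qed.

Lemma measurable_isqrt_rev (t : R) : measurable_fun [set: R] (fun x => isqrt (t - x)).
Proof.
apply: measurableT_comp; first exact: measurable_isqrt.
by apply: measurable_funB.
Qed.

(** In [nrm] a factor sqrt t remains. In [nu N] the singularities at both ends compensate exactly,
    and the bound 4 C K is small only relative to the weight t^(-1/2), as exploited in
    [picard_dist]. *)
Lemma duhamel_dist S M M' F F' K t : 0 < S <= T -> admissible S M F -> admissible S M' F' ->
  0 <= K -> (forall x, 0 < x <= S -> nrm (F x - F' x) <= K * isqrt x) -> 0 < t <= S ->
  nrm (duhamel F t - duhamel F' t) <= 2 * C * K * Num.sqrt t /\
  forall N, nu N (duhamel F t - duhamel F' t) <= 4 * C * K.
Proof.
move=> ST FA FA' K0 FK tS; have tS' : 0 <= t <= S by lra.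
have A := approxB (measurable_itv _) (duhamel_approx ST FA tS') (duhamel_approx ST FA' tS').
have t0 : 0 < t by lra.
split.
  have I : (\int[lebesgue_measure]_(x in `[0%R, t]) (isqrt x)%:E <= (2 * Num.sqrt t)%:E)%E.
    by have := integral_isqrt (lexx 0) t0; rewrite subr0.
  have := bochner_approx_bound sn (lexx 0) t0 (mulr_ge0 C0 K0) (@measurable_isqrt R)
    (@isqrt_ge0 R) I A.
  rewrite (_ : C * K * (2 * Num.sqrt t) = 2 * C * K * Num.sqrt t); last by ring.
  apply; apply: aeW => x xt; rewrite (ltW (proj1 (andP xt))) nrmWB; [|lra|lra].
  apply: le_trans (Wle _ _ _) _; [lra|lra|].
  by rewrite -mulrA ler_wpM2l//; apply: FK; lra.
move=> N; have A' := approx_nu N (measurable_itv _) A.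
have := bochner_approx_bound (snu N) (lexx 0) t0 (mulr_ge0 C0 K0)
  (g := fun x => isqrt (t - x) * isqrt x) _ _ (integral_isqrt_conv t0) A'.
rewrite (_ : C * K * 4 = 4 * C * K); last by ring.
apply.
- by apply: measurable_funM; [exact: measurable_isqrt_rev|exact: measurable_isqrt].
- by move=> x; rewrite mulr_ge0 ?isqrt_ge0.
apply: aeW => x xt; rewrite (ltW (proj1 (andP xt))) nuWB; [|lra|lra].
apply: le_trans (nuW _ _ _ _) _; [lra|lra|].
rewrite (_ : C * K * _ = C * isqrt (t - x) * (K * isqrt x)); last by ring.
by rewrite ler_wpM2l ?mulr_ge0 ?isqrt_ge0//; apply: FK; lra.
Qed.

Lemma admissible0 S M : 0 <= M -> admissible S M (fun=> 0).
Proof.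
move=> M0; split=> [x _|x _ e e0]; first by rewrite (sn0 sn) mulr_ge0 ?isqrt_ge0.
by exists 1 => // y _ _; rewrite subrr (sn0 sn).
Qed.

Lemma duhamel_bound S M F t : 0 < S <= T -> admissible S M F -> 0 < t <= S ->
  nrm (duhamel F t) <= 2 * C * M * Num.sqrt t /\
  forall N, nu N (duhamel F t) <= 4 * C * M.
Proof.
move=> ST FA tS; have S0 : 0 < S by lra.
have M0 := admissible_ge0 S0 FA; have tS' : 0 <= t <= S by lra.
have t0 : 0 < t by lra.
have A := duhamel_approx ST FA tS'; case: FA => FM _.
split.
  have I : (\int[lebesgue_measure]_(x in `[0%R, t]) (isqrt x)%:E <= (2 * Num.sqrt t)%:E)%E.
    by have := integral_isqrt (lexx 0) t0; rewrite subr0.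
  have := bochner_approx_bound sn (lexx 0) t0 (mulr_ge0 C0 M0) (@measurable_isqrt R)
    (@isqrt_ge0 R) I A.
  rewrite (_ : C * M * (2 * Num.sqrt t) = 2 * C * M * Num.sqrt t); last by ring.
  apply; apply: aeW => x xt; rewrite (ltW (proj1 (andP xt))).
  apply: le_trans (Wle _ _ _) _; [lra|lra|].
  by rewrite -mulrA ler_wpM2l//; apply: FM; lra.
move=> N; have A' := approx_nu N (measurable_itv _) A.
have := bochner_approx_bound (snu N) (lexx 0) t0 (mulr_ge0 C0 M0)
  (g := fun x => isqrt (t - x) * isqrt x) _ _ (integral_isqrt_conv t0) A'.
rewrite (_ : C * M * 4 = 4 * C * M); last by ring.
apply.
- by apply: measurable_funM; [exact: measurable_isqrt_rev|exact: measurable_isqrt].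
- by move=> x; rewrite mulr_ge0 ?isqrt_ge0.
apply: aeW => x xt; rewrite (ltW (proj1 (andP xt))).
apply: le_trans (nuW _ _ _ _) _; [lra|lra|].
rewrite (_ : C * M * _ = C * isqrt (t - x) * (M * isqrt x)); last by ring.
by rewrite ler_wpM2l ?mulr_ge0 ?isqrt_ge0//; apply: FM; lra.
Qed.

Definition mild F t : V := W t 0 phi + duhamel F t.

(** The left side is the integral over [[t0, t]]. It is obtained by subtracting from the integral
    over [[0, t]] the transported integral over [[0, t0]], extended by 0; by the composition law the
    integrands agree on [[0, t0]] up to seminorm 0. *)
Lemma mild_step S M F t0 t : 0 < S <= T -> admissible S M F -> 0 <= t0 -> t0 < t <= S ->
  nrm (mild F t - W t t0 (mild F t0)) <= 2 * C * M * Num.sqrt (t - t0) /\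
  (0 < t0 -> forall N, nu N (mild F t - W t t0 (mild F t0)) <=
     2 * C * M * isqrt t0 * Num.sqrt (t - t0)).
Proof.
move=> ST FA t00 tt; have S0 : 0 < S by lra.
have M0 := admissible_ge0 S0 FA.
have ttT : t0 <= t <= T by lra.
have t0t : t0 < t by lra.
have m1 : measurable (`[0, t0]%classic : set R) by [].
have m2 : measurable (`[0, t]%classic : set R) by [].
have s12 : `[0, t0]%classic `<=` (`[0, t]%classic : set R).
  by move=> x; rewrite /= !in_itv/=; lra.
have A1 := duhamel_approx ST FA (ltac:(lra) : 0 <= t0 <= S).
have A2 := duhamel_approx ST FA (ltac:(lra) : 0 <= t <= S).
have lin k u w : nrm (W t t0 (k *: u + w) - (k *: W t t0 u + W t t0 w)) = 0 by exact: Wlin.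
have bd u : nrm (W t t0 u) <= C * nrm u by exact: Wle.
have A3 := bochner_approx_ext sn m1 m2 s12 (bochner_approx_map sn lin C0 bd m1 A1).
have A := approxB m2 A2 A3.
have E : nrm ((mild F t - W t t0 (mild F t0)) - (duhamel F t - W t t0 (duhamel F t0))) = 0.
  rewrite /mild.
  have e1 := Wcomp phi (lexx 0) t00 (ltW t0t) (ltac:(lra) : t <= T).
  have e2 := Wlin 1 (W t0 0 phi) (duhamel F t0) t00 ttT.
  rewrite !scale1r in e2.
  set a := W t 0 phi in e1 *; set b := W t t0 (W t0 0 phi) in e1 e2 *.
  set c := W t t0 (_ + _) in e2 *; set d := W t t0 (duhamel F t0) in e2 *.
  set z := duhamel F t.
  have -> : a + z - c - (z - d) = (a - b) - (c - (b + d)).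
    rewrite !opprD !opprK !addrA; congr (_ + d).
    by rewrite (addrAC a z) addrK (addrAC a (- b)) subrK.
  apply/eqP; rewrite eq_le (sn_ge0 sn) andbT.
  by apply: le_trans (snB sn _ _) _; rewrite e1 e2 addr0.
have H0 x : 0 < x < t -> x <= t0 ->
    nrm (W t x (F x) - (\1_`[0, t0] x : R) *: (W t t0 \o (fun x => W t0 x (F x))) x) = 0.
  move=> xt xt0; rewrite indicE mem_set ?scale1r/=; first by apply: Wcomp; lra.
  by rewrite in_itv/=; lra.
have H1 x : 0 < x < t -> t0 < x ->
    W t x (F x) - (\1_`[0, t0] x : R) *: (W t t0 \o (fun x => W t0 x (F x))) x = W t x (F x).
  move=> xt xt0; rewrite indicE memNset ?scale0r ?subr0//= in_itv/=; lra.
have FM : forall x, 0 < x <= S -> nrm (F x) <= M * isqrt x by case: FA.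
split=> [|t0p N].
  rewrite (sn_eq0 sn E).
  have := bochner_approx_bound sn t00 t0t (mulr_ge0 C0 M0) (@measurable_isqrt R)
    (@isqrt_ge0 R) (integral_isqrt t00 t0t) A.
  rewrite (_ : C * M * (2 * Num.sqrt (t - t0)) = 2 * C * M * Num.sqrt (t - t0)); last by ring.
  apply; apply: aeW => x xt; case: ifPn => [t0x|]; last first.
    by rewrite -ltNge => xt0; rewrite H0// ltW.
  have [xt0|xt0] := leP x t0; first by rewrite H0// !mulr_ge0 ?isqrt_ge0.
  rewrite H1//; apply: le_trans (Wle _ _ _) _; [lra|lra|].
  by rewrite -mulrA ler_wpM2l//; apply: FM; lra.
rewrite (sn_eq0 (snu N) (nu_eq0 N E)).
have A' := approx_nu N m2 A.
(* Past [t0] the source is at most [M * isqrt t0], so only the singularity at [t] is integrated. *)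
have := bochner_approx_bound (snu N) t00 t0t (mulr_ge0 (mulr_ge0 C0 M0) (isqrt_ge0 t0))
  (measurable_isqrt_rev t) (fun x => isqrt_ge0 (t - x)) (integral_isqrt_rev t0t) A'.
rewrite (_ : C * M * isqrt t0 * (2 * Num.sqrt (t - t0)) =
  2 * C * M * isqrt t0 * Num.sqrt (t - t0)); last by ring.
apply; apply: aeW => x xt; case: ifPn => [t0x|]; last first.
  by rewrite -ltNge => xt0; rewrite (nu_eq0 N (H0 x xt (ltW xt0))).
have [xt0|xt0] := leP x t0.
  by rewrite (nu_eq0 N (H0 x xt xt0)) !mulr_ge0 ?isqrt_ge0.
rewrite H1//; apply: le_trans (nuW _ _ _ _) _; [lra|lra|].
rewrite (_ : C * M * isqrt t0 * _ = C * isqrt (t - x) * (M * isqrt t0)); last by ring.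
rewrite ler_wpM2l ?mulr_ge0 ?isqrt_ge0//.
apply: le_trans (FM x _) _; first by lra.
by rewrite ler_wpM2l//; apply: isqrt_le => //; exact: ltW.
Qed.

Lemma mild_step_le S M F t0 t : 0 < S <= T -> admissible S M F -> 0 <= t0 -> t0 <= t <= S ->
  nrm (mild F t - W t t0 (mild F t0)) <= 2 * C * M * Num.sqrt (t - t0).
Proof.
move=> ST FA t00 tt; have [E|tn] := eqVneq t0 t.
  rewrite E (snBC sn) Wid; last by lra.
  by rewrite !mulr_ge0 ?sqrtr_ge0// (admissible_ge0 _ FA); lra.
have tt' : t0 < t <= S by rewrite lt_neqAle tn.
by have [] := mild_step ST FA t00 tt'.
Qed.

Lemma mild_bound S M F t : 0 < S <= T -> admissible S M F -> 0 < t <= S ->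
  nrm (mild F t) <= C * nrm phi + 2 * C * M * Num.sqrt t /\
  forall N, nu N (mild F t) <= C * isqrt t * nrm phi + 4 * C * M.
Proof.
move=> ST FA tS; have [h1 h2] := duhamel_bound ST FA tS; split=> [|N].
  apply: le_trans (snD sn _ _) _; apply: lerD h1.
  by apply: Wle; lra.
apply: le_trans (snD (snu N) _ _) _; apply: lerD (h2 N).
by have := nuW N phi (lexx 0) (_ : 0 < t <= T); rewrite subr0; apply; lra.
Qed.

(** The factor 2 is there because the restart time lies up to [d] before [t], and [t'] up to [d]
    after it. *)
Lemma sqrt_small (K e : R) : 0 <= K -> 0 < e -> exists2 d : R, 0 < d &
  forall x, x <= 2 * d -> K * Num.sqrt x <= e.
Proof.
move=> K0 e0; have K1 : 0 < 1 + K by lra.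
exists ((e / (1 + K)) ^+ 2 / 2); first by rewrite divr_gt0// exprn_gt0// divr_gt0.
move=> x; rewrite mulrC divfK// => h.
apply: (@le_trans _ _ (K * (e / (1 + K)))).
  rewrite ler_wpM2l// -[leRHS]ger0_norm ?divr_ge0 ?(ltW e0) ?(ltW K1)//.
  by rewrite -sqrtr_sqr; exact: ler_wsqrtr.
by rewrite mulrCA ger_pMr// ler_pdivrMr//; lra.
Qed.

(** Both [t] and [t'] are compared with the free evolution restarted at a time [t0] slightly before
    them; the source has little effect since [t0], and the free evolution is strongly continuous. *)
Lemma mild_continuous S M F t e : 0 < S <= T -> admissible S M F -> 0 <= t <= S -> 0 < e ->
  exists2 d : R, 0 < d & forall t', 0 <= t' <= S -> `|t' - t| < d ->
    nrm (mild F t' - mild F t) < e.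
Proof.
move=> ST FA tS e0; have M0 : 0 <= M by apply: (admissible_ge0 _ FA); lra.
have tri4 (a b c d' : R) : a <= b + d' -> c <= e / 4 -> b <= e / 4 -> d' <= e / 4 -> a + c < e.
  by lra.
have K0 : 0 <= 2 * C * M by rewrite !mulr_ge0.
have e4 : 0 < e / 4 by rewrite divr_gt0.
have [d1 d10 Hd1] := sqrt_small K0 e4.
pose t0 := Num.max 0 (t - d1).
have t00 : 0 <= t0 by rewrite le_max lexx.
have t0d : t - d1 <= t0 by rewrite le_max lexx orbT.
have t0t : t0 <= t by rewrite ge_max; apply/andP; split; lra.
have tri : triangle T (t, t0) by rewrite /triangle/=; lra.
have [d2 d20 Hd2] := continuous_onP2 tri (@Wcont (mild F t0)) e4.
exists (Num.min d1 d2); first by rewrite lt_min d10.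
move=> t' tS'; rewrite lt_min => /andP[h1 h2].
have t0t' : t0 <= t'.
  by rewrite ge_max; apply/andP; split; [lra|move: h1; rewrite ltr_distl; lra].
have tri' : triangle T (t', t0) by rewrite /triangle/=; lra.
have s1 := mild_step_le ST FA t00 (_ : t0 <= t <= S); have {}s1 := s1 ltac:(lra).
have s2 := mild_step_le ST FA t00 (_ : t0 <= t' <= S); have {}s2 := s2 ltac:(lra).
have s3 := Hd2 t' t0 tri' h2; rewrite subrr normr0 in s3; have {}s3 := s3 d20.
have {}s1 := le_trans s1 (Hd1 (t - t0) ltac:(lra)).
have {}s2 := le_trans s2 (Hd1 (t' - t0) ltac:(move: h1; rewrite ltr_distl; lra)).
apply: le_lt_trans (sn_tri sn (W t t0 (mild F t0)) _ _) _.
rewrite (snBC sn _ (mild F t)).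
have := sn_tri sn (W t' t0 (mild F t0)) (mild F t') (W t t0 (mild F t0)).
by move=> h; exact: tri4 h s1 s2 (ltW s3).
Qed.

(** As in [mild_continuous], uniformly in N. The restart time stays above [t / 2], which keeps
    [isqrt t0] bounded, and strictly before [t] and [t'], where smoothing acts. *)
Lemma mild_nu_continuous S M F t e : 0 < S <= T -> admissible S M F -> 0 < t <= S -> 0 < e ->
  exists2 d : R, 0 < d & forall t', 0 < t' <= S -> `|t' - t| < d ->
    forall N, nu N (mild F t' - mild F t) <= e.
Proof.
move=> ST FA tS e0; have M0 : 0 <= M by apply: (admissible_ge0 _ FA); lra.
have tri4 (a b c d' : R) : a <= b + d' -> c <= e / 4 -> b <= e / 4 -> d' <= e / 4 -> a + c <= e.
  by lra.
have K0 : 0 <= 2 * C * M * isqrt (t / 2) by rewrite !mulr_ge0 ?isqrt_ge0.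
have e4 : 0 < e / 4 by rewrite divr_gt0.
have [d1 d10 Hd1] := sqrt_small K0 e4.
pose d := Num.min d1 (t / 2).
have dd1 : d <= d1 by rewrite ge_min lexx.
have dt : d <= t / 2 by rewrite ge_min lexx orbT.
have d0 : 0 < d by rewrite lt_min d10/=; lra.
pose t0 := t - d.
have t00 : 0 < t0 by rewrite /t0; lra.
have ht0 : t / 2 <= t0 by rewrite /t0; lra.
have t0t : t0 < t <= T by rewrite /t0; lra.
have [d2 d20 Hd2] := nuWcont (mild F t0) (ltW t00) t0t e4.
exists (Num.min d d2); first by rewrite lt_min d0.
move=> t' tS'; rewrite lt_min => /andP[h1 h2] N.
have h1' : t - d < t' < t + d by rewrite -ltr_distl.
have t0t' : t0 < t' <= T by rewrite /t0; lra.
have st x : t0 < x <= S -> x - t0 <= 2 * d1 ->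
    nu N (mild F x - W x t0 (mild F t0)) <= e / 4.
  move=> xI xd; have [_ h] := mild_step ST FA (ltW t00) xI.
  apply: le_trans (h t00 N) _; apply: le_trans (Hd1 _ xd).
  rewrite ler_wpM2r ?sqrtr_ge0// ler_wpM2l ?mulr_ge0//; apply: isqrt_le => //; lra.
have s1 := st t ltac:(lra) ltac:(rewrite /t0; lra).
have s2 := st t' ltac:(lra) ltac:(rewrite /t0; lra).
have s3 := Hd2 t' t0t' h2 N.
apply: le_trans (sn_tri (snu N) (W t t0 (mild F t0)) _ _) _.
rewrite (snBC (snu N) _ (mild F t)).
have := sn_tri (snu N) (W t' t0 (mild F t0)) (mild F t') (W t t0 (mild F t0)).
by move=> h; exact: tri4 h s1 s2 s3.
Qed.

Definition picard F t : V := f t (mild F t).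

Lemma sqrt_mul_isqrt_ge1 (S t : R) : 0 < t <= S -> 1 <= Num.sqrt S * isqrt t.
Proof.
move=> tS; rewrite /isqrt ler_pdivlMr ?mul1r ?sqrtr_gt0; last by lra.
by rewrite ler_wsqrtr//; lra.
Qed.

(** No invariant ball is sought: the Lipschitz constant of [f] is global, so it is enough that every
    iterate be admissible for some constant. *)
Lemma picard_admissible S M F : 0 < S <= T -> admissible S M F ->
  exists M', admissible S M' (picard F).
Proof.
move=> ST FA; have M0 : 0 <= M by apply: (admissible_ge0 _ FA); lra.
have p0 := sn_ge0 sn phi.
pose A := 1 + C * nrm phi + 2 * C * M * Num.sqrt T + 4 * C * M.
exists (L * (A * Num.sqrt T + C * nrm phi)); split=> [t tS|t tS e e0].
  have [b1 b2] := mild_bound ST FA tS.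
  have tT : 0 <= t <= T by lra.
  apply: le_trans (f_growth tT b2) _; rewrite -[leRHS]mulrA ler_wpM2l// mulrDl.
  have h := @sqrt_mul_isqrt_ge1 T t ltac:(lra).
  have A0 : 0 <= A by rewrite /A !addr_ge0 ?mulr_ge0 ?sqrtr_ge0.
  have h2 : A <= A * Num.sqrt T * isqrt t by rewrite -mulrA ler_peMr.
  have h3 : 2 * C * M * Num.sqrt t <= 2 * C * M * Num.sqrt T.
    by rewrite ler_wpM2l ?mulr_ge0// ler_wsqrtr//; lra.
  by move: h2; rewrite {1}/A; lra.
have [b1 b2] := mild_bound ST FA tS.
pose K := C * isqrt t * nrm phi + 4 * C * M.
pose Q := 1 + nrm (mild F t) + K.
have K0 : 0 <= K by rewrite /K addr_ge0 ?mulr_ge0 ?isqrt_ge0.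
have Q0 : 0 < Q by rewrite /Q; have := sn_ge0 sn (mild F t); lra.
have L1 : 0 < 1 + L by rewrite ltr_pwDl.
have D0 : 0 < e / 4 / (1 + L) by rewrite !divr_gt0.
have D1 : 0 < e / 4 / ((1 + L) * Q) by rewrite !divr_gt0// mulr_gt0.
have [d1 d10 Hd1] := mild_continuous ST FA (ltac:(lra) : 0 <= t <= S) D0.
have [d2 d20 Hd2] := mild_nu_continuous ST FA tS D0.
exists (Num.min (Num.min d1 d2) (e / 4 / ((1 + L) * Q))).
  by rewrite !lt_min d10 d20.
move=> t' tS'; rewrite !lt_min => /andP[/andP[h1 h2] h3].
have tT : 0 <= t <= T by lra. have tT' : 0 <= t' <= T by lra.
apply: le_lt_trans (sn_tri sn (f t' (mild F t)) _ _) _.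
have [_ b2'] := mild_bound ST FA tS'.
have c1 := f_lip tT' b2' (Hd2 t' tS' h2).
have c2 := f_time tT' tT b2.
have c3 := Hd1 t' ltac:(lra) h1.
have c4 : L * (e / 4 / (1 + L)) <= e / 4.
  by rewrite mulrCA ger_pMr ?divr_gt0// ler_pdivrMr// mul1r lerDr.
have c5 : L * `|t' - t| * Q <= e / 4.
  move: h3; rewrite ltr_pdivlMr; last by rewrite mulr_gt0.
  have : 0 <= `|t' - t| * Q by rewrite mulr_ge0// ltW.
  lra.
have c6 : L * (nrm (mild F t' - mild F t) + e / 4 / (1 + L)) <= e / 2.
  apply: (@le_trans _ _ (L * (e / 4 / (1 + L) + e / 4 / (1 + L)))).
    by rewrite ler_wpM2l// lerD2r ltW.
  by rewrite mulrDr; lra.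
by move: c2; rewrite -/K -/Q; rewrite /picard; lra.
Qed.

(** Bounds without weight become weighted through 1 <= sqrt S t^(-1/2); this is the source of the
    small factor sqrt S of the contraction. *)
Lemma picard_dist S M M' F F' K t : 0 < S <= T -> admissible S M F -> admissible S M' F' ->
  0 <= K -> (forall x, 0 < x <= S -> nrm (F x - F' x) <= K * isqrt x) -> 0 < t <= S ->
  nrm (picard F t - picard F' t) <= L * C * (2 * Num.sqrt S + 4) * Num.sqrt S * K * isqrt t.
Proof.
move=> ST FA FA' K0 FK tS; have tT : 0 <= t <= T by lra.
have [h1 h2] := duhamel_dist ST FA FA' K0 FK tS.
have E : mild F t - mild F' t = duhamel F t - duhamel F' t.
  by rewrite /mild opprD addrACA subrr add0r.
have [_ b] := mild_bound ST FA tS.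
rewrite -E in h1 h2; apply: le_trans (f_lip tT b h2) _.
have h := sqrt_mul_isqrt_ge1 tS.
have ts : Num.sqrt t <= Num.sqrt S by rewrite ler_wsqrtr//; lra.
rewrite (_ : L * C * _ * _ * K * _ =
  L * (C * K * (2 * Num.sqrt S + 4) * (Num.sqrt S * isqrt t))); last by ring.
rewrite ler_wpM2l//; apply: (@le_trans _ _ (C * K * (2 * Num.sqrt S + 4))).
  have := ler_wpM2l (mulr_ge0 C0 K0) ts; lra.
by rewrite ler_peMr// !mulr_ge0// addr_ge0 ?mulr_ge0 ?sqrtr_ge0.
Qed.

Lemma half_small (a e : R) : 0 < e -> exists k : nat, a * 2^-1 ^+ k < e.
Proof.
move=> e0; have : (fun k : nat => a * 2^-1 ^+ k) @ \oo --> a * 0.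
  apply: cvgM; first exact: cvg_cst.
  by apply: cvg_expr; rewrite ger0_norm// invf_lt1// ltr1n.
rewrite mulr0 => /cvgrPdist_lt/(_ e e0)[k _ /(_ k (leqnn k))] /=.
by rewrite sub0r normrN => h; exists k; apply: le_lt_trans h; exact: ler_norm.
Qed.

Lemma half_le0 (x a : R) : (forall k : nat, x <= a * 2^-1 ^+ k) -> x <= 0.
Proof.
move=> H; apply/ler_addgt0Pr => e /(half_small a)[k /ltW h]; rewrite add0r.
exact: le_trans (H k) h.
Qed.

(** The iterates from 0 converge geometrically in the weighted norm, hence uniformly on each
    [[x / 2, S]], which makes the limit continuous on []0, S]]. *)
Lemma picard_fixpoint S : 0 < S <= T ->
  L * C * (2 * Num.sqrt S + 4) * Num.sqrt S <= 2^-1 ->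
  exists M F, admissible S M F /\
    forall t, 0 < t <= S -> nrm (picard F t - F t) = 0.
Proof.
move=> ST cS; have S0 : 0 < S by lra.
pose G k := iter k picard (fun=> 0).
have adm k : exists M, admissible S M (G k).
  elim: k => [|k [M HM]]; first by exists 0; exact: admissible0.
  exact: picard_admissible HM.
have [M HM] := choice adm.
pose M1 := M 1; have M10 : 0 <= M1 by exact: (admissible_ge0 S0 (HM 1)).
have step k t : 0 < t <= S -> nrm (G k.+1 t - G k t) <= M1 * 2^-1 ^+ k * isqrt t.
  elim: k t => [|k IH] t tS.
    by rewrite subr0 expr0 mulr1; case: (HM 1) => + _; exact.
  have := picard_dist ST (HM k.+1) (HM k) (_ : 0 <= M1 * 2^-1 ^+ k) IH tS.
  move=> /(_ (mulr_ge0 M10 (exprn_ge0 _ _))) h; apply: le_trans (h _) _ => //.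
  rewrite ler_wpM2r ?isqrt_ge0// exprS [leRHS]mulrCA ler_wpM2r//.
  by rewrite mulr_ge0 ?exprn_ge0.
have far k j t : 0 < t <= S ->
    nrm (G (k + j)%N t - G k t) <= M1 * 2^-1 ^+ k * isqrt t * (2 - 2 * 2^-1 ^+ j).
  move=> tS; elim: j => [|j IH]; first by rewrite addn0 subrr (sn0 sn) expr0 mulr1 subrr mulr0.
  rewrite addnS; apply: le_trans (sn_tri sn (G (k + j)%N t) _ _) _.
  apply: le_trans (lerD (step (k + j)%N t tS) IH) _.
  by rewrite exprD exprS le_eqVlt; apply/orP; left; apply/eqP; field.
have far2 k j t : 0 < t <= S -> nrm (G (k + j)%N t - G k t) <= 2 * M1 * isqrt t * 2^-1 ^+ k.
  move=> tS; apply: le_trans (far k j t tS) _.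
  rewrite [leRHS](_ : _ = M1 * 2^-1 ^+ k * isqrt t * 2); last by ring.
  rewrite ler_wpM2l ?mulr_ge0 ?isqrt_ge0 ?exprn_ge0// gerBl mulr_ge0// exprn_ge0//.
have lim t : exists v, 0 < t <= S -> forall k, nrm (v - G k t) <= 2 * M1 * isqrt t * 2^-1 ^+ k.
  have [tS|tS] := boolP (0 < t <= S); last by exists 0.
  have [|v Hv] := cpl (u := fun k => G k t).
    move=> e e0; have [k Hk] := half_small (2 * M1 * isqrt t) (divr_gt0 e0 (ltr0n R 2)).
    exists k => m n km kn; apply: le_lt_trans (sn_tri sn (G k t) _ _) _.
    rewrite (snBC sn (G k t)) -(subnKC km) -(subnKC kn).
    have := far2 k (m - k)%N t tS; have := far2 k (n - k)%N t tS; lra.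
  exists v => _ k; apply/ler_addgt0Pr => e e0.
  move/cvgrPdist_lt: Hv => /(_ e e0)[j _ Hj].
  have := Hj (k + j)%N (leq_addl k j); rewrite /= sub0r normrN.
  move=> /(le_lt_trans (ler_norm _)) h.
  apply: le_trans (sn_tri sn (G (k + j)%N t) _ _) _.
  by have := far2 k j t tS; lra.
have [F HF] := choice lim.
have FA : admissible S (2 * M1) F.
  split=> [t tS|x xS e e0].
    by have := HF t tS 0%N; rewrite subr0 expr0 mulr1.
  have x2 : 0 < x / 2 by lra.
  have e4 : 0 < e / 4 by lra.
  have [k Hk] := half_small (2 * M1 * isqrt (x / 2)) e4.
  have [_ /(_ x xS _ e4)[d d0 Hd]] := HM k.
  exists (Num.min d (x / 2)); first by rewrite lt_min d0.
  move=> y yS; rewrite lt_min => /andP[yd yx].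
  have near z : 0 < z <= S -> x / 2 <= z -> nrm (F z - G k z) < e / 4.
    move=> zS xz; apply: le_lt_trans (HF z zS k) _; apply: le_lt_trans Hk.
    rewrite ler_wpM2r ?exprn_ge0// ler_wpM2l ?mulr_ge0//; exact: isqrt_le.
  have h1 := near x xS ltac:(lra).
  have h2 := near y yS ltac:(move: yx; rewrite ltr_distl; lra).
  have h3 := Hd y yS yd.
  apply: le_lt_trans (sn_tri sn (G k x) _ _) _; rewrite (snBC sn (G k x)).
  have := sn_tri sn (G k y) (F y) (G k x); lra.
exists (2 * M1), F; split => // t tS; apply/eqP; rewrite eq_le (sn_ge0 sn) andbT.
apply: (@half_le0 _ (2 * M1 * isqrt t)) => k.
apply: le_trans (sn_tri sn (G k.+1 t) _ _) _; rewrite (snBC sn (G k.+1 t)).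
have h1 := HF t tS k.+1.
have FG x : 0 < x <= S -> nrm (F x - G k x) <= 2 * M1 * 2^-1 ^+ k * isqrt x.
  by move=> xS; rewrite mulrAC; exact: HF.
have P0 : 0 <= 2 * M1 * 2^-1 ^+ k by rewrite !mulr_ge0 ?exprn_ge0.
have h2 := picard_dist ST FA (HM k) P0 FG tS.
have h3 := ler_wpM2r (mulr_ge0 P0 (isqrt_ge0 t)) cS.
move: h1 h2 h3; rewrite exprS; rewrite /G iterS -/(G k); lra.
Qed.

Definition mild_solution S (u : R -> V) : Prop :=
  continuous_on nrm (`[0%R, S]%classic : set R) u /\
  exists F : R -> V,
    {ae (@lebesgue_measure R), forall x : R, 0 <= x <= S -> src x (u x) (F x)} /\
    forall t : R, 0 <= t <= S ->
      exists2 v : V, is_bochner_integral nrm `[0, t] (fun x => W t x (F x)) v &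
        nrm (u t - (W t 0 phi + v)) = 0.

Lemma attains_max (S : R) (g : R -> R) : 0 <= S ->
  (forall x, 0 <= x <= S -> forall e, 0 < e -> exists2 d : R, 0 < d &
     forall y, 0 <= y <= S -> `|y - x| < d -> `|g y - g x| < e) ->
  exists2 c, 0 <= c <= S & forall x, 0 <= x <= S -> g x <= g c.
Proof.
move=> S0 H; have cg : {within `[0, S], continuous g}.
  apply/subspace_continuousP => x; rewrite /= in_itv/= => xS.
  apply/cvgrPdist_lt => e e0; have [d d0 Hd] := H x xS e e0.
  rewrite near_withinE; apply/nbhs_ballP; exists d => // y; rewrite /ball/= => yd.
  by rewrite in_itv/= => yS; rewrite distrC Hd// distrC.
have [c cS Hc] := EVT_max S0 cg.
by exists c => [|x xS]; [rewrite in_itv in cS|apply: Hc; rewrite in_itv].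
Qed.

Lemma mild_solution_unique S u v : 0 < S <= T -> 2 * C * Num.sqrt S <= 2^-1 ->
  mild_solution S u -> mild_solution S v ->
  forall t, 0 <= t <= S -> nrm (u t - v t) = 0.
Proof.
move=> ST cS [cu [F [HF Hu]]] [cv [F' [HF' Hv]]].
have S0 : 0 <= S by lra.
have [|c cI Hc] := @attains_max S (fun t => nrm (u t - v t)) S0.
  move=> x xS e e0; have xS' : `[0, S]%classic x by rewrite /= in_itv.
  have e2 : 0 < e / 2 by rewrite divr_gt0.
  have [d1 d10 Hd1] := continuous_onP xS' cu e2.
  have [d2 d20 Hd2] := continuous_onP xS' cv e2.
  exists (Num.min d1 d2); first by rewrite lt_min d10.
  move=> y yS; rewrite lt_min => /andP[y1 y2]; have yS' : `[0, S]%classic y by rewrite /= in_itv.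
  apply: le_lt_trans (sn_dist sn _ _) _.
  have -> : u y - v y - (u x - v x) = (u y - u x) - (v y - v x).
    by rewrite !opprD !opprK addrACA.
  apply: le_lt_trans (snB sn _ _) _.
  by have := Hd1 y yS' y1; have := Hd2 y yS' y2; lra.
set G := nrm (u c - v c) in Hc.
have G0 : 0 <= G by exact: (sn_ge0 sn).
have key t : 0 <= t <= S -> nrm (u t - v t) <= 2 * C * Num.sqrt S * G.
  move=> tS; have [v1 B1 E1] := Hu t tS; have [v2 B2 E2] := Hv t tS.
  have A := approxB (measurable_itv _) (bochner_approxP sn (measurable_itv _) B1)
    (bochner_approxP sn (measurable_itv _) B2).
  have E : nrm ((u t - v t) - (v1 - v2)) = 0.
    have -> : (u t - v t) - (v1 - v2) =
        (u t - (W t 0 phi + v1)) - (v t - (W t 0 phi + v2)).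
      have <- : (W t 0 phi + v1) - (W t 0 phi + v2) = v1 - v2.
        by rewrite opprD addrACA subrr add0r.
      by move: (W t 0 phi + v1) (W t 0 phi + v2) => X Y; rewrite !opprD addrACA.
    apply/eqP; rewrite eq_le (sn_ge0 sn) andbT.
    by apply: le_trans (snB sn _ _) _; rewrite E1 E2 addr0.
  rewrite (sn_eq0 sn E); have [t0|tn0] := eqVneq t 0.
    have : ((nrm (v1 - v2))%:E <= \int[lebesgue_measure]_(x in `[0%R, t]) (cst 0%E x))%E.
      apply: (bochner_approx_le sn _ _ A) => //; first by rewrite t0 set_itv1 lebesgue_measure_set1.
      by have := ae_neq (0 : R); apply: aeS => x x0; rewrite t0 set_itv1 => /= xE; rewrite xE eqxx in x0.
    rewrite integral0 lee_fin => /le_trans; apply.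
    by rewrite !mulr_ge0 ?sqrtr_ge0.
  have t0 : 0 < t by move: tS; rewrite lt_neqAle eq_sym tn0 => /andP[].
  have I : (\int[lebesgue_measure]_(x in `[0%R, t]) (isqrt (t - x))%:E <= (2 * Num.sqrt t)%:E)%E.
    by have := integral_isqrt_rev t0; rewrite subr0.
  have := bochner_approx_bound sn (lexx 0) t0 (mulr_ge0 C0 G0) (measurable_isqrt_rev t)
    (fun x => isqrt_ge0 (t - x)) I A.
  move=> h; apply: le_trans (h _) _; last first.
    rewrite [leRHS](_ : _ = C * G * (2 * Num.sqrt S)); last by ring.
    by rewrite ler_wpM2l ?mulr_ge0// ler_wpM2l// ler_wsqrtr//; lra.
  move: HF HF'; apply: aeS2 => x s1 s2 xt; rewrite (ltW (proj1 (andP xt))).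
  have [x0 [xT xS]] : 0 <= x /\ x < t <= T /\ 0 <= x <= S by lra.
  rewrite nrmWB//; last by case/andP: xT => /ltW-> ->.
  apply: le_trans (src_dual x0 xT (s1 xS) (s2 xS)) _.
  by rewrite mulrAC ler_wpM2r ?isqrt_ge0// ler_wpM2l//; exact: Hc.
have G1 : G = 0.
  have := key c cI; rewrite -/G => h; have := ler_wpM2r G0 cS; lra.
by move=> t tS; apply/eqP; rewrite eq_le (sn_ge0 sn) andbT -G1; exact: Hc.
Qed.

Lemma mild_solution_exists_unique : exists S, 0 < S <= T /\
  exists u, mild_solution S u /\
    forall v, mild_solution S v -> forall t, 0 <= t <= S -> nrm (v t - u t) = 0.
Proof.
(* The sum of the factors of contraction and uniqueness, taken at [T]; with sqrt S <= 1 / (2 (1 +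
   A)) both are at most 1/2. *)
pose A := L * C * (2 * Num.sqrt T + 4) + 2 * C.
have A0 : 0 <= A by rewrite addr_ge0 ?mulr_ge0// addr_ge0 ?mulr_ge0 ?sqrtr_ge0.
have A1 : 0 < 2 * (1 + A) by lra.
pose r := (2 * (1 + A))^-1; have r0 : 0 < r by rewrite invr_gt0.
pose S := Num.min T (r ^+ 2).
have S0 : 0 < S by rewrite lt_min T0 exprn_gt0.
have ST : S <= T by rewrite ge_min lexx.
have sS : Num.sqrt S <= r.
  rewrite -[leRHS]ger0_norm ?(ltW r0)// -sqrtr_sqr; apply: ler_wsqrtr.
  by rewrite ge_min lexx orbT.
have Ar : A * r <= 2^-1.
  by rewrite /r ler_pdivrMr//; lra.
have AS : A * Num.sqrt S <= 2^-1 by apply: le_trans Ar; rewrite ler_wpM2l.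
have ST' : 0 < S <= T by rewrite S0.
have c1 : L * C * (2 * Num.sqrt S + 4) * Num.sqrt S <= 2^-1.
  apply: le_trans AS; rewrite ler_wpM2r ?sqrtr_ge0//.
  have : L * C * (2 * Num.sqrt S + 4) <= L * C * (2 * Num.sqrt T + 4).
    by rewrite ler_wpM2l ?mulr_ge0// lerD2r ler_wpM2l// ler_wsqrtr.
  by move=> h; apply: le_trans h _; rewrite /A lerDl mulr_ge0.
have c2 : 2 * C * Num.sqrt S <= 2^-1.
  by apply: le_trans AS; rewrite ler_wpM2r ?sqrtr_ge0// /A lerDr !mulr_ge0.
have [M [F [FA HF]]] := picard_fixpoint ST' c1.
exists S; split=> //; exists (mild F).
have MS : mild_solution S (mild F).
  split.
    move=> x; rewrite /= in_itv/= => xS; apply/cvgrPdist_lt => e e0.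
    have [d d0 Hd] := mild_continuous ST' FA xS e0.
    rewrite near_withinE; apply/nbhs_ballP; exists d => // y; rewrite /ball/= => yd.
    rewrite in_itv/= => yS; rewrite sub0r normrN ger0_norm ?(sn_ge0 sn)//.
    by apply: Hd => //; rewrite distrC.
  exists F; split.
    have := ae_neq (0 : R); apply: aeS => x x0 xS.
    have xS' : 0 < x <= S by move: xS; rewrite lt_neqAle eq_sym x0.
    have [_ b] := mild_bound ST' FA xS'.
    have xT : 0 <= x <= T by lra.
    exact: src_eq (src_f xT b) (HF x xS').
  move=> t tS; exists (duhamel F t); first exact: duhamelP FA tS.
  by rewrite /mild subrr (sn0 sn).
split=> // v Hv t tS; exact: (mild_solution_unique ST' c2 Hv MS tS).
Qed.

End MildSolution.

(** * The source term *)

Section Arrhenius.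
Variables (R : realType) (E : R).
Hypothesis E0 : 0 < E.
Notation g := (arrhenius E).

Lemma arrhenius_pos (a : R) : 0 < a -> g a = expR (- (E / a)).
Proof. by rewrite /arrhenius => ->. Qed.

Lemma arrhenius_npos (a : R) : a <= 0 -> g a = 0.
Proof. by rewrite /arrhenius leNgt => /negbTE ->. Qed.

Lemma arrhenius_ge0 (a : R) : 0 <= g a.
Proof. by rewrite /arrhenius; case: ifP => // _; exact: expR_ge0. Qed.

Lemma arrhenius_le1 (a : R) : g a <= 1.
Proof.
have [a0|a0] := ltP 0 a; last by rewrite arrhenius_npos.
by rewrite arrhenius_pos// -[leRHS]expR0 ler_expR oppr_le0 divr_ge0 ?ltW.
Qed.

Lemma mul_expRN_le (z : R) : 0 <= z -> z * expR (- z) <= 1.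
Proof.
move=> z0; rewrite expRN ler_pdivrMr ?expR_gt0// mul1r.
by have := expR_ge1Dx z; lra.
Qed.

Lemma sqr_mul_expRN_le (z : R) : 0 <= z -> z ^+ 2 * expR (- z) <= 4.
Proof.
move=> z0; have z2 : 0 <= z / 2 by lra.
have := mul_expRN_le z2; set c := expR _ => h.
have -> : expR (- z) = c ^+ 2.
  by rewrite /c expr2 -expRD; congr expR; field.
have c0 : 0 <= c by exact: expR_ge0.
have h0 : 0 <= z / 2 * c by rewrite mulr_ge0.
have : (z / 2 * c) ^+ 2 <= 1 by rewrite expr_le1.
rewrite exprMn; lra.
Qed.

Lemma arrhenius_le (a : R) : 0 < a -> g a <= a / E.
Proof.
move=> a0; have z0 : 0 <= E / a by rewrite divr_ge0 ?ltW.
have := mul_expRN_le z0; rewrite arrhenius_pos// => h.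
have -> : expR (- (E / a)) = E / a * expR (- (E / a)) * (a / E).
  by field; rewrite !gt_eqF.
by rewrite ler_piMl// divr_ge0 ?ltW.
Qed.

(** With y = E/b and z = E/a, the increment is e^(-z) (1 - e^(z-y)), and e^x >= 1 + x. *)
Lemma arrhenius_incr (a b : R) : 0 < b -> b <= a ->
  0 <= g a - g b <= expR (- (E / a)) * (E / b - E / a).
Proof.
move=> b0 ba; have a0 : 0 < a by exact: lt_le_trans ba.
rewrite !arrhenius_pos//; set y := E / b; set z := E / a.
have zy : z <= y by rewrite /z /y ler_pM2l// lef_pV2.
rewrite subr_ge0 ler_expR lerN2 zy/=.
have -> : expR (- y) = expR (- z) * expR (z - y).
  by rewrite -expRD; congr expR; ring.
rewrite -{1}[expR (- z)]mulr1 -mulrBr ler_wpM2l ?expR_ge0//.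
by have := expR_ge1Dx (z - y); lra.
Qed.

(** For b > 0 and a <= 2 b the constant is 4 * 2 / E, from z^2 e^(-z) <= 4 and a / b <= 2. If b <= 0
    or a > 2 b, then a <= 2 (a - b), and g(a) <= a / E suffices. *)
Lemma arrhenius_lip_sorted (a b : R) : b <= a -> 0 <= g a - g b <= 8 / E * (a - b).
Proof.
move=> ba; have EV0 : 0 < E^-1 by rewrite invr_gt0.
have [b0|b0] := ltP 0 b; last first.
  rewrite (arrhenius_npos b0) subr0 arrhenius_ge0/=.
  have [a0|a0] := ltP 0 a; last first.
    by rewrite arrhenius_npos// mulr_ge0 ?subr_ge0// mulr_ge0// ltW.
  apply: le_trans (arrhenius_le a0) _.
  have : 0 <= E^-1 * (8 * (a - b) - a) by rewrite mulr_ge0 ?(ltW EV0)//; lra.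
  lra.
have a0 : 0 < a by exact: lt_le_trans ba.
have /andP[-> h] := arrhenius_incr b0 ba; rewrite /=.
have [ab2|ab2] := leP a (2 * b); last first.
  have := arrhenius_ge0 b; have := arrhenius_le a0 => h1 h2.
  have : 0 <= E^-1 * (8 * (a - b) - a) by rewrite mulr_ge0 ?(ltW EV0)//; lra.
  lra.
apply: le_trans h _.
have z0 : 0 <= E / a by rewrite divr_ge0 ?ltW.
have h4 := sqr_mul_expRN_le z0.
have -> : expR (- (E / a)) * (E / b - E / a) =
    (E / a) ^+ 2 * expR (- (E / a)) * (a / b / E * (a - b)).
  by field; rewrite !gt_eqF.
have h5 : a / b <= 2 by rewrite ler_pdivrMr.
have h6 : 0 <= a / b by rewrite divr_ge0 ?ltW.
have -> : 8 / E * (a - b) = 4 * (2 / E * (a - b)) by ring.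
have ab0 : 0 <= a - b by rewrite subr_ge0.
apply: ler_pM => //.
- by rewrite mulr_ge0 ?expR_ge0// exprn_ge0.
- by rewrite !mulr_ge0// ?invr_ge0 ltW.
- by rewrite ler_wpM2r// ler_wpM2r// ltW.
Qed.

(** The reaction term contains w g(w), whose derivative g(w) + z e^(-z), with z = E/w, is at most 2.
    The proof is its discrete form, splitting the increment as for a product. *)
Lemma mul_arrhenius_lip_sorted (a b : R) : b <= a ->
  0 <= a * g a - b * g b <= 2 * (a - b).
Proof.
move=> ba; have [b0|b0] := ltP 0 b; last first.
  rewrite (arrhenius_npos b0) mulr0 subr0; have [a0|a0] := ltP 0 a; last first.
    by rewrite arrhenius_npos// mulr0 lexx/=; lra.
  rewrite mulr_ge0 ?arrhenius_ge0 ?(ltW a0)//=.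
  have := arrhenius_le1 a; nra.
have a0 : 0 < a by exact: lt_le_trans ba.
have /andP[h1 h2] := arrhenius_incr b0 ba.
have g0 := arrhenius_ge0 a; have g1 := arrhenius_le1 a.
have -> : a * g a - b * g b = (a - b) * g a + b * (g a - g b) by ring.
have ab0 : 0 <= a - b by lra.
apply/andP; split; first by rewrite addr_ge0 ?mulr_ge0// ltW.
have z0 : 0 <= E / a by rewrite divr_ge0 ?ltW.
have h3 : b * (g a - g b) <= a - b.
  apply: le_trans (ler_wpM2l (ltW b0) h2) _.
  have -> : b * (expR (- (E / a)) * (E / b - E / a)) = E / a * expR (- (E / a)) * (a - b).
    by field; rewrite !gt_eqF.
  by rewrite ler_piMl// mul_expRN_le.
have h4 : (a - b) * g a <= a - b by rewrite ler_piMr.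
lra.
Qed.

Lemma arrhenius_lip (a b : R) : `|g a - g b| <= 8 / E * `|a - b|.
Proof.
wlog ba : a b / b <= a => [H|].
  have [|ab] := leP b a; first exact: H.
  by rewrite distrC (distrC a); apply: H; exact: ltW.
have /andP[h1 h2] := arrhenius_lip_sorted ba.
by rewrite (ger0_norm h1) ger0_norm ?subr_ge0.
Qed.

Lemma mul_arrhenius_lip (a b : R) : `|a * g a - b * g b| <= 2 * `|a - b|.
Proof.
wlog ba : a b / b <= a => [H|].
  have [|ab] := leP b a; first exact: H.
  by rewrite distrC (distrC a); apply: H; exact: ltW.
have /andP[h1 h2] := mul_arrhenius_lip_sorted ba.
by rewrite (ger0_norm h1) ger0_norm ?subr_ge0.
Qed.

Lemma measurable_arrhenius : measurable_fun [set: R] g.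
Proof.
apply: continuous_measurable_fun => a; apply/cvgrPdist_lt => e e0.
apply/nbhs_ballP; exists (e / (8 / E)); first by rewrite /= !divr_gt0.
move=> b; rewrite /ball/= ltr_pdivlMr ?divr_gt0// mulrC.
by apply: le_lt_trans; exact: arrhenius_lip.
Qed.

End Arrhenius.

(** * Estimates of the source at one point of space *)

Section SourcePoint.
Variables (R : realType) (n : nat) (p : coefficients R n) (i : 'I_n) (x T M : R).
Notation q := (cqhat1 p x + cqhat2 p x).
Notation dist1 w w' := (\sum_j `|w j - w' j|).
Implicit Types (w : 'I_n -> R) (t : R).
Hypothesis E0 : 0 < cE p.
Hypothesis q10 : 0 <= cqhat1 p x.
Hypothesis q20 : 0 <= cqhat2 p x.
Hypothesis M1 : 1 <= M.
Hypothesis M2 : 2 <= M.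
Hypothesis M8 : 8 / cE p <= M.
Hypothesis Dpos : forall t, 0 <= t <= T -> 0 < denom p i x t.
Hypothesis DM : forall t, 0 <= t <= T -> (denom p i x t)^-1 <= M.
Hypothesis Dlip : forall t t', 0 <= t <= T -> 0 <= t' <= T ->
  `|(denom p i x t)^-1 - (denom p i x t')^-1| <= M * `|t - t'|.
Hypothesis yM : forall t, 0 <= t <= T -> 0 <= cy p i x t <= M.
Hypothesis ylip : forall t t', 0 <= t <= T -> 0 <= t' <= T ->
  `|cy p i x t - cy p i x t'| <= M * `|t - t'|.
Hypothesis cM : `|derive1 (cc p i) x| <= M.
Hypothesis KM : `|cK p i x * cb p i x| <= M.
Hypothesis dM : `|cd p i x| <= M.
Hypothesis qM : (i.+1 < n)%N -> `|cq p i x| <= M.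
Hypothesis qM' : (i : nat) != 0%N -> `|cq p (ord_pred i) x| <= M.

Definition source_transfer w : R :=
  (if (i : nat) == 0%N then - cqhat1 p x * (w i - cue p)
     else - cq p (ord_pred i) x * (w i - w (ord_pred i)))
  + (if i.+1 == n then - cqhat2 p x * (w i - cue p)
     else cq p i x * (w (ordS i) - w i)).

Definition source_reaction w : R :=
  (cK p i x * cb p i x * w i + cd p i x) * arrhenius (cE p) (w i).

Definition source_num t w : R :=
  - derive1 (cc p i) x * w i + source_reaction w * cy p i x t + source_transfer w.

Lemma source_funE t w : source_fun p i x t w = (denom p i x t)^-1 * source_num t w.
Proof. by rewrite /source_fun /source_num /source_reaction /source_transfer; ring. Qed.

Lemma ler_sum_term (F : 'I_n -> R) (j : 'I_n) : (forall j, 0 <= F j) -> F j <= \sum_k F k.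
Proof. by move=> F0; rewrite (bigD1 j)//= lerDl sumr_ge0. Qed.

Let M0 : 0 <= M. Proof. exact: le_trans ler01 M1. Qed.

Lemma dist1_ge w w' j : `|w j - w' j| <= dist1 w w'.
Proof. by apply: (ler_sum_term (F := fun j => `|w j - w' j|)) => k; exact: normr_ge0. Qed.

Lemma transfer_lip w w' : `|source_transfer w - source_transfer w'| <=
  4 * M * dist1 w w' + q * `|w i - w' i|.
Proof.
set S := dist1 w w'; have hS j : `|w j - w' j| <= S by exact: dist1_ge.
have S0 : 0 <= S by exact: le_trans (hS i).
have d0 := normr_ge0 (w i - w' i).
have tr (c : R) j k : `|c| <= M ->
    `|c * (w j - w k) - c * (w' j - w' k)| <= 2 * M * S.
  move=> h; have -> : c * (w j - w k) - c * (w' j - w' k) =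
      c * ((w j - w' j) - (w k - w' k)) by ring.
  rewrite normrM (_ : 2 * M * S = M * (2 * S)); last by ring.
  apply: ler_pM => //; apply: le_trans (ler_normB _ _) _.
  by have := hS j; have := hS k; lra.
have hq (c : R) : 0 <= c ->
    `|- c * (w i - cue p) - - c * (w' i - cue p)| = c * `|w i - w' i|.
  move=> c0; have -> : - c * (w i - cue p) - - c * (w' i - cue p) = - c * (w i - w' i) by ring.
  by rewrite normrM normrN (ger0_norm c0).
have MS : 0 <= 2 * M * S by rewrite !mulr_ge0.
rewrite /source_transfer opprD addrACA; apply: le_trans (ler_normD _ _) _.
have -> : 4 * M * S + q * `|w i - w' i| =
    (2 * M * S + cqhat1 p x * `|w i - w' i|) + (2 * M * S + cqhat2 p x * `|w i - w' i|) by ring.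
apply: lerD.
  case: ifPn => [_|i0]; first by rewrite hq// lerDr.
  by apply: le_trans (tr _ _ _ _) _; rewrite ?normrN ?qM'// lerDl mulr_ge0.
case: ifPn => [_|i0]; first by rewrite hq// lerDr.
apply: le_trans (tr _ _ _ _) _; last by rewrite lerDl mulr_ge0.
by apply: qM; rewrite ltn_neqAle i0 ltn_ord.
Qed.

Lemma reaction_lip w w' : `|source_reaction w - source_reaction w'| <=
  2 * M ^+ 2 * `|w i - w' i|.
Proof.
rewrite /source_reaction; set g := arrhenius _; set K := _ * cb p i x.
have -> : (K * w i + cd p i x) * g (w i) - (K * w' i + cd p i x) * g (w' i) =
  K * (w i * g (w i) - w' i * g (w' i)) + cd p i x * (g (w i) - g (w' i)) by ring.
have d0 := normr_ge0 (w i - w' i).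
apply: le_trans (ler_normD _ _) _; rewrite normrM [X in _ + X]normrM.
have -> : 2 * M ^+ 2 * `|w i - w' i| = M * (M * `|w i - w' i|) + M * (M * `|w i - w' i|) by ring.
apply: lerD; apply: ler_pM => //.
  apply: le_trans (mul_arrhenius_lip E0 _ _) _; exact: ler_wpM2r.
apply: le_trans (arrhenius_lip E0 _ _) _; exact: ler_wpM2r.
Qed.

(** The term 1 is for the exchange with coefficient q; 5 M is M for the derivative of c and 4 M for
    the transfer between layers; 2 M^3 is the reaction, 2 M^2 times the bound of y. *)
Definition source_const : R := 1 + 5 * M + 2 * M ^+ 3.

Lemma num_lip t w w' : 0 <= t <= T ->
  `|source_num t w - source_num t w'| <= source_const * (dist1 w w' + q * `|w i - w' i|).
Proof.
move=> tI; set S := dist1 w w'; have hS : `|w i - w' i| <= S by exact: dist1_ge.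
have d0 := normr_ge0 (w i - w' i).
have h1 := transfer_lip w w'; rewrite -/S in h1.
have h2 := reaction_lip w w'.
have /andP[y0 yM1] := yM tI.
have -> : source_num t w - source_num t w' = - derive1 (cc p i) x * (w i - w' i) +
    (source_reaction w - source_reaction w') * cy p i x t +
    (source_transfer w - source_transfer w') by rewrite /source_num; ring.
apply: le_trans (ler_normD _ _) _; apply: le_trans (lerD (ler_normD _ _) h1) _.
have e1 : `|- derive1 (cc p i) x * (w i - w' i)| <= M * S.
  by rewrite normrM normrN; exact: ler_pM.
have e2 : `|(source_reaction w - source_reaction w') * cy p i x t| <= 2 * M ^+ 3 * S.
  rewrite normrM (ger0_norm y0).
  rewrite (_ : 2 * M ^+ 3 * S = 2 * M ^+ 2 * S * M); last by ring.
  apply: ler_pM => //; apply: le_trans h2 _.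
  by rewrite ler_wpM2l ?mulr_ge0 ?exprn_ge0.
have S0 : 0 <= S by exact: le_trans hS.
have Q0 : 0 <= q * `|w i - w' i| by rewrite mulr_ge0// addr_ge0.
have M30 : 0 <= 2 * M ^+ 3 by rewrite mulr_ge0 ?exprn_ge0.
have e3 : 0 <= (5 * M + 2 * M ^+ 3) * (q * `|w i - w' i|).
  by rewrite mulr_ge0// addr_ge0// mulr_ge0.
rewrite /source_const; lra.
Qed.

(** The reaction vanishes at 0 with the Arrhenius factor. What remains is the exchange with the
    outer temperature, which is in L^2 because q is. *)
Lemma num_zero t : `|source_num t (fun=> 0)| <= q * `|cue p|.
Proof.
have h (c : R) : 0 <= c -> `|- c * (0 - cue p)| = c * `|cue p|.
  by move=> c0; rewrite sub0r mulNr mulrN opprK normrM ger0_norm.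
rewrite /source_num /source_reaction arrhenius_npos// !mulr0 mul0r !add0r.
rewrite /source_transfer subrr !mulr0; apply: le_trans (ler_normD _ _) _.
rewrite mulrDl; apply: lerD; case: ifPn => _.
- by rewrite h.
- by rewrite normr0 mulr_ge0.
- by rewrite h.
- by rewrite normr0 mulr_ge0.
Qed.

Lemma num_growth t w : 0 <= t <= T ->
  `|source_num t w| <= source_const * (\sum_j `|w j| + q * `|w i|) + q * `|cue p|.
Proof.
move=> tI; have := num_lip w (fun=> 0) tI; have := num_zero t.
rewrite subr0; under eq_bigr do rewrite subr0; move=> h1 h2.
have := ler_normD (source_num t w - source_num t (fun=> 0)) (source_num t (fun=> 0)).
rewrite subrK; lra.
Qed.

Lemma num_time t t' w : 0 <= t <= T -> 0 <= t' <= T ->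
  `|source_num t w - source_num t' w| <= 2 * M ^+ 3 * `|t - t'| * \sum_j `|w j|.
Proof.
move=> tI tI'; have -> : source_num t w - source_num t' w =
    source_reaction w * (cy p i x t - cy p i x t') by rewrite /source_num; ring.
have h : `|source_reaction w| <= 2 * M ^+ 2 * \sum_j `|w j|.
  have := reaction_lip w (fun=> 0); rewrite {2}/source_reaction arrhenius_npos// mulr0 !subr0.
  move=> h; apply: le_trans h _; rewrite ler_wpM2l ?mulr_ge0 ?exprn_ge0//.
  exact: (ler_sum_term (F := fun j => `|w j|)).
rewrite normrM (_ : 2 * M ^+ 3 * `|t - t'| * _ =
  2 * M ^+ 2 * (\sum_j `|w j|) * (M * `|t - t'|)); last by ring.
by apply: ler_pM => //; exact: ylip.
Qed.

(** The outer [M] bounds 1 / D, its Lipschitz constant in t, and 1 / lambda; inside are the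
    Lipschitz constant in w, the value at w = 0 and the Lipschitz constant in t of the numerator. *)
Definition source_lip_const : R := M * (source_const + `|cue p| + 2 * M ^+ 3).

Lemma source_const_ge0 : 0 <= source_const.
Proof. by rewrite !addr_ge0 ?mulr_ge0 ?exprn_ge0. Qed.

Lemma source_const_le : source_const * M <= source_lip_const.
Proof.
by rewrite mulrC ler_wpM2l// -addrA lerDl addr_ge0 ?mulr_ge0 ?exprn_ge0.
Qed.

Lemma source_lip t w w' : 0 <= t <= T -> `|source_fun p i x t w - source_fun p i x t w'| <=
  source_lip_const * (dist1 w w' + q * `|w i - w' i|).
Proof.
move=> tI; rewrite !source_funE -mulrBr normrM.
have D0 := Dpos tI; rewrite ger0_norm ?invr_ge0 ?(ltW D0)//.
apply: (@le_trans _ _ (M * (source_const * (dist1 w w' + q * `|w i - w' i|)))).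
  apply: ler_pM => //; [by rewrite invr_ge0 ltW|exact: DM|exact: num_lip].
rewrite mulrA (mulrC M) ler_wpM2r ?source_const_le//.
by rewrite addr_ge0 ?sumr_ge0// mulr_ge0// addr_ge0.
Qed.

(** The weight m = D / l cancels the denominator of the source and leaves the numerator divided by
    l. *)
Lemma source_dual t w w' (l : R) : 0 <= t <= T -> 0 < l -> l^-1 <= M ->
  `|denom p i x t / l * (source_fun p i x t w - source_fun p i x t w')| <=
  source_lip_const * (dist1 w w' + q * `|w i - w' i|).
Proof.
move=> tI l0 lM; have D0 := Dpos tI; rewrite !source_funE -mulrBr.
have -> : denom p i x t / l * ((denom p i x t)^-1 * (source_num t w - source_num t w')) =
    l^-1 * (source_num t w - source_num t w') by field; rewrite !gt_eqF.
rewrite normrM ger0_norm ?invr_ge0 ?(ltW l0)//.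
apply: (@le_trans _ _ (M * (source_const * (dist1 w w' + q * `|w i - w' i|)))).
  apply: ler_pM => //; [by rewrite invr_ge0 ltW|exact: num_lip].
rewrite mulrA (mulrC M) ler_wpM2r ?source_const_le//.
by rewrite addr_ge0 ?sumr_ge0// mulr_ge0// addr_ge0.
Qed.

Lemma num_growth_le t w : 0 <= t <= T ->
  `|source_num t w| <= (source_const + `|cue p|) * (\sum_j `|w j| + q * `|w i| + q).
Proof.
move=> tI; apply: le_trans (num_growth w tI) _.
have S0 : 0 <= \sum_j `|w j| + q * `|w i|.
  by rewrite addr_ge0 ?sumr_ge0// mulr_ge0// addr_ge0.
have := mulr_ge0 (normr_ge0 (cue p)) S0.
by have := mulr_ge0 source_const_ge0 (addr_ge0 q10 q20); lra.
Qed.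

Lemma source_growth t w : 0 <= t <= T -> `|source_fun p i x t w| <=
  source_lip_const * (\sum_j `|w j| + q * `|w i| + q).
Proof.
move=> tI; rewrite source_funE normrM.
have D0 := Dpos tI; rewrite ger0_norm ?invr_ge0 ?(ltW D0)//.
have S0 : 0 <= \sum_j `|w j| + q * `|w i| + q.
  by rewrite !addr_ge0 ?sumr_ge0// mulr_ge0// addr_ge0.
rewrite /source_lip_const -mulrA; apply: ler_pM => //; [by rewrite invr_ge0 ltW|exact: DM|].
apply: le_trans (num_growth_le w tI) _; rewrite ler_wpM2r// lerDl.
by rewrite mulr_ge0 ?exprn_ge0.
Qed.

Lemma source_time t t' w : 0 <= t <= T -> 0 <= t' <= T ->
  `|source_fun p i x t w - source_fun p i x t' w| <=
  source_lip_const * `|t - t'| * (\sum_j `|w j| + q * `|w i| + q).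
Proof.
move=> tI tI'; rewrite !source_funE; set a := _^-1; set b := _^-1.
set N := \sum_j `|w j| + q * `|w i| + q.
have S0 : 0 <= \sum_j `|w j| by rewrite sumr_ge0.
have Q0 : 0 <= q * `|w i| + q by rewrite !addr_ge0// mulr_ge0// addr_ge0.
have N0 : 0 <= N by rewrite /N -addrA addr_ge0.
have SN : \sum_j `|w j| <= N by rewrite /N -addrA lerDl.
have -> : a * source_num t w - b * source_num t' w =
  a * (source_num t w - source_num t' w) + (a - b) * source_num t' w by ring.
have D0 := Dpos tI; have a0 : 0 <= a by rewrite invr_ge0 ltW.
apply: le_trans (ler_normD _ _) _; rewrite !normrM (ger0_norm a0).
have -> : source_lip_const * `|t - t'| * N = M * (2 * M ^+ 3 * `|t - t'| * N) +
    M * `|t - t'| * ((source_const + `|cue p|) * N) by rewrite /source_lip_const; ring.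
apply: lerD; apply: ler_pM => //.
- exact: DM.
- apply: le_trans (num_time w tI tI') _; rewrite ler_wpM2l//.
  by rewrite !mulr_ge0 ?exprn_ge0.
- exact: Dlip.
- exact: num_growth_le.
Qed.

End SourcePoint.

(** * Products with q: pairings in H^1 and cutoffs *)

Section L2Tools.
Variable R : realType.
Notation mu := (@lebesgue_measure R).
Notation sL := (@seminorm_L2 R).
Implicit Types (f g h : L2 R).

Definition absL2 g : L2 R := toL2 (fun x => `|g x|).

Lemma absL2E g x : absL2 g x = `|g x|.
Proof.
rewrite /absL2 toL2E//; apply: (@Lfun2_le _ _ g 1).
  apply: measurableT_comp; [exact: normr_measurable|exact: measurable_L2].
by apply: aeW => y; rewrite mul1r normr_id.
Qed.

Lemma absL2_norm g : L2norm (absL2 g) <= L2norm g.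
Proof.
rewrite -[leRHS]mul1r; apply: L2norm_le_ae => //.
by apply: aeW => y; rewrite mul1r absL2E normr_id.
Qed.

Lemma dot_leD f g f1 g1 f2 g2 :
  {ae mu, forall x, f x * g x <= f1 x * g1 x + f2 x * g2 x} ->
  dot f g <= dot f1 g1 + dot f2 g2.
Proof.
move=> H; have mM (a b : L2 R) : measurable_fun [set: R] (fun x => a x * b x).
  by apply: measurable_funM; exact: measurable_L2.
have iM := integrableD measurableT (L2mul_int f1 g1) (L2mul_int f2 g2).
rewrite -subr_ge0 -lee_fin EFinB EFinD !dotE.
rewrite -integralD//; [|exact: L2mul_int|exact: L2mul_int].
rewrite -(integralB measurableT iM (L2mul_int f g)).
pose G x := f1 x * g1 x + f2 x * g2 x - f x * g x.
apply: (@le_trans _ _ (\int[mu]_x (Num.max 0 (G x))%:E)%E).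
  by apply: integral_ge0 => x _; rewrite lee_fin le_max lexx.
rewrite le_eqVlt; apply/orP; left; apply/eqP; apply: ae_eq_integral => //.
- apply/measurable_EFinP; apply: measurable_maxr => //.
  by apply: measurable_funB; [apply: measurable_funD|]; exact: mM.
- apply/measurable_EFinP; apply: measurable_funB; last exact: mM.
  by apply: measurable_funD; exact: mM.
move: H; apply: aeS => x h _.
have -> : Num.max 0 (G x) = G x by apply/max_idPr; rewrite subr_ge0.
by [].
Qed.

(** In the term with q the factor [f] is taken in L^infty, so the product |q| |w| enters through its
    L^1 norm only: no L^2 bound on q w appears. The absolute value follows by applying the estimate
    to [f] and [- f]. *)
Lemma dot_H1_bound (f df v q w h : L2 R) (B : R) : is_weak_deriv f df -> 0 <= B ->
  {ae mu, forall x, `|h x| <= B * (`|v x| + `|q x| * `|w x|)} ->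
  `|dot f h| <= B * (L2norm f + L2norm df) * (L2norm v + L2norm q * L2norm w).
Proof.
move=> wf B0 H.
have S := H1_sup wf; set K := L2norm f + L2norm df in S *.
have K0 : 0 <= K by rewrite addr_ge0 ?L2norm_ge0.
have fK : L2norm f <= K by rewrite lerDl L2norm_ge0.
have G f0 : {ae mu, forall x, `|f0 x| <= K} -> L2norm f0 <= K ->
    dot f0 h <= B * K * (L2norm v + L2norm q * L2norm w).
  move=> S0 n0; apply: (@le_trans _ _ (dot (B *: absL2 f0) (absL2 v) +
      dot (B * K *: absL2 q) (absL2 w))).
    apply: dot_leD; move: S0 H; apply: aeS2 => x a1 a2.
    apply: le_trans (ler_norm _) _; rewrite normrM !L2scaleE !absL2E.
    apply: le_trans (ler_wpM2l (normr_ge0 _) a2) _.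
    have h1 : 0 <= B * (`|q x| * `|w x|) by rewrite !mulr_ge0.
    have := ler_wpM2r h1 a1; lra.
  rewrite !dotZl [leRHS]mulrDr; apply: lerD.
    rewrite -[leRHS]mulrA ler_wpM2l//.
    apply: le_trans (ler_norm _) (le_trans (dot_CS _ _) _).
    apply: ler_pM; rewrite ?L2norm_ge0//; last exact: absL2_norm.
    exact: le_trans (absL2_norm _) n0.
  rewrite ler_wpM2l ?mulr_ge0//; apply: le_trans (ler_norm _) (le_trans (dot_CS _ _) _).
  by apply: ler_pM; rewrite ?L2norm_ge0// absL2_norm.
rewrite ler_norml G// andbT lerNl -dotNl G ?(snN sL)//.
by move: S; apply: aeS => x; rewrite L2oppE normrN.
Qed.

Definition cutoff (q : R -> R) (N : nat) (x : R) : R := Num.min (q x) N%:R.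

Section Cutoff.
Variable q : R -> R.
Hypotheses (mq : measurable_fun [set: R] q) (q0 : forall x, 0 <= q x).

Lemma cutoff_ge0 N x : 0 <= cutoff q N x.
Proof. by rewrite le_min q0 ler0n. Qed.

Lemma cutoff_bounded N : bounded_meas (cutoff q N) N%:R.
Proof.
split; first exact: measurable_minr.
by move=> x; rewrite ger0_norm ?cutoff_ge0// ge_min lexx orbT.
Qed.

Lemma cutoff_le N x : `|cutoff q N x| <= `|q x|.
Proof. by rewrite !ger0_norm ?cutoff_ge0// ge_min lexx. Qed.

(** Monotone convergence in N; at each point the cutoff equals q from some N on. *)
Lemma cutoff_limit f (K : R) : (forall N, L2norm (mulL2 (cutoff q N) f) <= K) ->
  (fun x => q x * f x) \in Lfun mu 2%:E /\ L2norm (toL2 (fun x => q x * f x)) <= K.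
Proof.
move=> H; have K0 : 0 <= K by exact: le_trans (L2norm_ge0 _) (H 0%N).
pose g N x : \bar R := ((cutoff q N x * f x) ^+ 2)%:E.
have mg N : measurable_fun [set: R] (g N).
  apply/measurable_EFinP; apply: measurable_funX; apply: measurable_funM.
    by case: (cutoff_bounded N).
  exact: measurable_L2.
have cut_mono x (a b : nat) : (a <= b)%N -> cutoff q a x <= cutoff q b x.
  move=> ab; rewrite le_min ge_min lexx/= ge_min; apply/orP; right.
  by rewrite ler_nat.
have nd x : [set: R] x -> nondecreasing_seq (g ^~ x).
  move=> _ a b ab; rewrite lee_fin !exprMn ler_wpM2r ?sqr_ge0//.
  by rewrite ler_sqr ?nnegrE ?cutoff_ge0// cut_mono.
have g0 N x : [set: R] x -> (0 <= g N x)%E by move=> _; rewrite lee_fin sqr_ge0.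
have cv := @cvg_monotone_convergence _ (measurableTypeR R) R mu setT measurableT g mg g0 nd.
have lim x : limn (g ^~ x) = ((q x * f x) ^+ 2)%:E.
  apply/cvg_lim => //; apply: cvg_near_cst.
  have qx : q x < (Num.truncn (q x)).+1%:R by exact: truncnS_gt.
  exists (Num.truncn (q x)).+1 => // N /= hN; rewrite /g /cutoff.
  rewrite min_l//; apply: le_trans (ltW qx) _; by rewrite ler_nat.
have I : (\int[mu]_x ((q x * f x) ^+ 2)%:E <= (K ^+ 2)%:E)%E.
  rewrite (_ : (\int[mu]_x _)%E = (\int[mu]_x (limn (g ^~ x)))%E); last first.
    by apply: eq_integral => x _; rewrite lim.
  rewrite -(cvg_lim _ cv)//; apply: lime_le; first by apply/cvg_ex; eexists; exact: cv.
  apply: nearW => N.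
  rewrite (_ : (\int[mu]_x g N x)%E = (L2norm (mulL2 (cutoff q N) f) ^+ 2)%:E).
    by rewrite lee_fin ler_sqr ?nnegrE ?L2norm_ge0.
  rewrite -L2norm_int; apply: eq_integral => x _.
  by rewrite (mulL2E (cutoff_bounded N)).
have L : (fun x => q x * f x) \in Lfun mu 2%:E.
  apply: Lfun2P; last by apply: le_lt_trans I _; rewrite ltry.
  by apply: measurable_funM => //; exact: measurable_L2.
by split=> //; apply: L2norm_le => //; rewrite toL2E.
Qed.

End Cutoff.
End L2Tools.

(** * States: vectors of square integrable functions *)

Section States.
Variables (R : realType) (n : nat).
Notation sL := (@seminorm_L2 R).
Implicit Types (u v w : state R n).

Lemma le_state_norm w i : L2norm (w i) <= state_norm w.
Proof. exact: (le_bigmax _ (fun i => L2norm (w i))). Qed.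

Lemma state_norm_le w (M : R) : 0 <= M -> (forall i, L2norm (w i) <= M) -> state_norm w <= M.
Proof. by move=> M0 H; apply: bigmax_le. Qed.

Lemma state_norm_ge0 w : 0 <= state_norm w.
Proof. exact: bigmax_ge_id. Qed.

Lemma state_norm0P u v : state_norm (u - v) = 0 <-> forall i, u i =L2 v i.
Proof.
split=> [h i|h].
  by apply/L2eqP/eqP; rewrite eq_le L2norm_ge0 andbT -h; exact: (le_state_norm (u - v)).
apply/eqP; rewrite eq_le state_norm_ge0 andbT; apply: state_norm_le => // i.
by have /L2eqP := h i => e; rewrite -e.
Qed.

Lemma seminorm_state : seminorm (@state_norm R n).
Proof.
have Zle k w : state_norm (k *: w) <= `|k| * state_norm w.
  apply: state_norm_le => [|i]; first by rewrite mulr_ge0 ?state_norm_ge0.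
  by rewrite (snZ sL) ler_wpM2l// le_state_norm.
split=> [u v|k u].
  apply: state_norm_le => [|i]; first by rewrite addr_ge0 ?state_norm_ge0.
  by apply: le_trans (snD sL _ _) _; rewrite lerD ?le_state_norm.
apply/eqP; rewrite eq_le Zle/=; have [->|k0] := eqVneq k 0.
  by rewrite normr0 mul0r state_norm_ge0.
rewrite mulrC -ler_pdivlMr ?normr_gt0// mulrC -normfV.
by have := Zle k^-1 (k *: u); rewrite scalerA mulVf// scale1r.
Qed.

Lemma state_complete : seq_complete (@state_norm R n).
Proof.
move=> u H.
have ex i : exists f : L2 R, (fun k => L2norm (f - u k i)) @ \oo --> (0 : R).
  apply: L2_complete => e e0; have [N HN] := H e e0; exists N => a b Na Nb.
  exact: le_lt_trans (le_state_norm (u a - u b) i) (HN _ _ Na Nb).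
have [v Hv] := choice ex; exists v; apply/cvgrPdist_lt => e e0.
have e2 : 0 < e / 2 by rewrite divr_gt0.
have : \forall k \near \oo, forall i, L2norm (v i - u k i) < e / 2.
  apply: filter_forall => i; have /cvgrPdist_lt/(_ _ e2) := Hv i; apply: filterS => k.
  by rewrite sub0r normrN; apply: le_lt_trans; exact: ler_norm.
apply: filterS => k Hk; rewrite sub0r normrN ger0_norm ?state_norm_ge0//.
apply: (@le_lt_trans _ _ (e / 2)); last by lra.
by apply: state_norm_le => [|i]; [exact: ltW|exact/ltW/Hk].
Qed.

Definition sum_abs w : L2 R := \sum_j absL2 (w j).

Lemma sum_absE w x : sum_abs w x = \sum_j `|w j x|.
Proof. by rewrite /sum_abs L2sumE; apply: eq_bigr => j _; rewrite absL2E. Qed.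

Lemma sum_abs_norm w : L2norm (sum_abs w) <= n%:R * state_norm w.
Proof.
apply: le_trans (sn_sum sL _ _ _) _.
apply: (@le_trans _ _ (\sum_(j < n) state_norm w)).
  by apply: ler_sum => j _; apply: le_trans (absL2_norm _) (le_state_norm _ _).
by rewrite sumr_const card_ord mulr_natl.
Qed.

(** The inverse of 1 plus the sum of the inverses lies below every radius, and is positive for an
    empty index set too. *)
Lemma common_radius (P : 'I_n -> R -> Prop) :
  (forall i d d', d' <= d -> P i d -> P i d') ->
  (forall i, exists2 d, 0 < d & P i d) -> exists2 d, 0 < d & forall i, P i d.
Proof.
move=> mono H; have H' i : exists d, 0 < d /\ P i d by have [d] := H i; exists d.
have [d Hd] := choice H'.
have S0 : 0 <= \sum_i (d i)^-1 by apply: sumr_ge0 => i _; rewrite invr_ge0 ltW//; case: (Hd i).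
exists (1 + \sum_i (d i)^-1)^-1; first by rewrite invr_gt0 ltr_pwDl.
move=> i; have [d0 Pd] := Hd i; apply: mono Pd.
rewrite -[leRHS]invrK lef_pV2 ?posrE ?invr_gt0 ?ltr_pwDl//.
apply: (@le_trans _ _ (\sum_i (d i)^-1)); last by rewrite lerDr.
apply: (ler_sum_term (F := fun i => (d i)^-1)) => j.
by rewrite invr_ge0 ltW//; case: (Hd j).
Qed.

End States.

(** * The system of layers *)

Section Application.
Variables (R : realType) (n : nat) (T : R) (p : coefficients R n).
Variable U : 'I_n -> R -> R -> L2 R -> L2 R.
Notation mu := (@lebesgue_measure R).
Notation sL := (@seminorm_L2 R).
Notation sS := (@seminorm_state R n).
Hypothesis hT : 0 < T.
Hypothesis hp : coeff_nonneg p.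
Hypothesis hE : 0 < cE p.
Hypothesis h1 : hypH1 p.
Hypothesis h2 : hypH2 T p.
Hypothesis h3 : hypH3 p.
Hypothesis hU : forall i, is_evolution T (Gop p i) (U i).
Implicit Types (u v w : state R n) (i : 'I_n).

Let q (x : R) : R := cqhat1 p x + cqhat2 p x.

Let q0 x : 0 <= q x.
Proof. by have [_ [_ /(_ x)[a b]]] := hp; rewrite addr_ge0. Qed.

Lemma measurable_Lfun (r : \bar R) (h : R -> R) : h \in Lfun mu r -> measurable_fun [set: R] h.
Proof. by move=> H; exact: set_mem (sub_Lfun_mfun H). Qed.

Let Lq1 : cqhat1 p \in Lfun mu 2%:E. Proof. by have [_ [_ []]] := h3. Qed.
Let Lq2 : cqhat2 p \in Lfun mu 2%:E. Proof. by have [_ [_ []]] := h3. Qed.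

Let mq : measurable_fun [set: R] q.
Proof. by apply: measurable_funD; [exact: measurable_Lfun Lq1|exact: measurable_Lfun Lq2]. Qed.

Let qL : L2 R := toL2 (cqhat1 p) + toL2 (cqhat2 p).

Let qLE x : qL x = q x.
Proof. by rewrite /qL L2addE !toL2E. Qed.

Let cut N := cutoff q N.

Let cut_le N x : `|cut N x| <= `|qL x|.
Proof. by rewrite qLE; exact: cutoff_le. Qed.

Let cut_bd N : bounded_meas (cut N) N%:R.
Proof. exact: cutoff_bounded. Qed.

Lemma layer_at i : exists k B k1,
  layer_coeffs T k B (fun t x => clam p i x / denom p i x t)
    (fun t x => cc p i x / denom p i x t) (fun t x => denom p i x t / clam p i x)
    (fun x => cc p i x / clam p i x) /\
  [/\ 0 < k1, forall x, k1 <= ca p i x /\ k1 <= clam p i x /\ 0 <= cb p i x <= B,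
      forall x, `|derive1 (cc p i) x| <= B,
      forall x t, 0 <= t <= T -> 0 <= cy p i x t <= B &
      forall x t s, 0 <= t <= T -> 0 <= s <= T ->
        `|cy p i x t - cy p i x s| <= B * `|t - s|] /\
  [/\ forall t, 0 <= t <= T -> continuous (fun x => denom p i x t),
      forall t, 0 <= t <= T -> continuous (fun x => cy p i x t),
      continuous (cb p i) & continuous (derive1 (cc p i))].
Proof.
have [[k1 [k2 [k10 [k12 bd]]]] der] := h1.
have [y0 [yt [dy dyx [Ly [k3 k30 yk3]] _ _]]] := h2.
have [da La] := der i (ca p i) (or_introl erefl).
have [db Lb] := der i (cb p i) (or_intror (or_introl erefl)).
have [dc Lc] := der i (cc p i) (or_intror (or_intror (or_introl erefl))).
have [dl Ll] := der i (clam p i) (or_intror (or_intror (or_intror erefl))).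
have [_ [_ [_ Lyt]]] := Ly i.
have [k [B [LC k2B HB Hy Hyl]]] := @layer_bounds R T k1 k2 k3 (ca p i) (cb p i) (cc p i)
  (clam p i) (cy p i) (yt i) hT k10 k12 k30 (bd i) da db dc dl (Lc 1%N isT) (Ll 1%N isT)
  (y0 i) (dy i) (dyx i) Lyt (yk3 i).
have [ca' _] := twice_derivable_continuous da; have [cb' _] := twice_derivable_continuous db.
have [_ cc'] := twice_derivable_continuous dc.
have cy' t : 0 <= t <= T -> continuous (fun x => cy p i x t).
  by move=> tI; have [] := twice_derivable_continuous (dyx i t tI).
exists k, B, k1; split; first exact: LC.
split; split=> //.
  move=> x; have [/andP[a1 _] [/andP[l1 _] [/andP[b1 b2] _]]] := bd i x.
  by rewrite a1 l1 b1; split=> //; split=> //; exact: le_trans k2B.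
move=> t tI x; apply: cvgD; first exact: ca'.
by apply: cvgM; [exact: cb'|exact: cy'].
Qed.

Lemma Linf_bound (h : R -> R) : Linf h -> exists2 B, 0 <= B & {ae mu, forall x, `|h x| <= B}.
Proof. exact: Lfun_oo_bound. Qed.

Lemma ord_predS i : (i : nat) != 0%N -> (ord_pred i).+1 = i :> nat.
Proof.
case: i => -[//|k] Hk _ /=; congr _.+1.
by rewrite modnDr modn_small//; exact: ltn_trans Hk.
Qed.

Definition source_spec i (L0 x : R) : Prop := forall (t : R) (w w' : 'I_n -> R), 0 <= t <= T ->
  [/\ `|source_fun p i x t w - source_fun p i x t w'| <=
        L0 * (\sum_j `|w j - w' j| + q x * `|w i - w' i|),
      `|denom p i x t / clam p i x * (source_fun p i x t w - source_fun p i x t w')| <=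
        L0 * (\sum_j `|w j - w' j| + q x * `|w i - w' i|),
      `|source_fun p i x t w| <= L0 * (\sum_j `|w j| + q x * `|w i| + q x) &
      forall t', 0 <= t' <= T -> `|source_fun p i x t w - source_fun p i x t' w| <=
        L0 * `|t - t'| * (\sum_j `|w j| + q x * `|w i| + q x)].

Lemma source_estimate i : exists2 L0, 0 <= L0 & {ae mu, forall x, source_spec i L0 x}.
Proof.
have [k [B [k1 [LC [[k10 bd cB yB ylip] _]]]]] := layer_at i.
have B0 : 0 <= B by exact: le_trans (normr_ge0 _) (cB 0).
have [hdK [hq _]] := h3; have [Ld LK] := hdK i.
have [Bd Bd0 HBd] := Linf_bound Ld; have [BK BK0 HBK] := Linf_bound LK.
have [Bq Bq0 HBq] : exists2 B, 0 <= B &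
    {ae mu, forall x, (i.+1 < n)%N -> `|cq p i x| <= B}.
  have [ilt|ilt] := boolP (i.+1 < n)%N; last by exists 0 => //; apply: aeW.
  by have [C C0 HC] := Linf_bound (hq i ilt); exists C => //; move: HC; apply: aeS.
have [Br Br0 HBr] : exists2 B, 0 <= B &
    {ae mu, forall x, (i : nat) != 0%N -> `|cq p (ord_pred i) x| <= B}.
  have [i0|i0] := boolP ((i : nat) != 0%N); last by exists 0 => //; apply: aeW.
  have ilt : ((ord_pred i).+1 < n)%N by rewrite (ord_predS i0) ltn_ord.
  by have [C C0 HC] := Linf_bound (hq _ ilt); exists C => //; move: HC; apply: aeS.
(* A sum dominating every constant at once: [8 / cE p] is the Lipschitz constant of the Arrhenius
   factor, [k1^-1] bounds 1 / D and 1 / lambda, [B * B / k1 ^+ 2] is the Lipschitz constant of 1 / D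
   in t, and [BK * B] bounds K b. *)
pose M := 2 + 8 / cE p + k1^-1 + B * B / k1 ^+ 2 + B + BK * B + Bd + Bq + Br.
have e1 : 0 <= 8 / cE p by rewrite divr_ge0// ltW.
have e2 : 0 <= k1^-1 by rewrite invr_ge0 ltW.
have e3 : 0 <= B * B / k1 ^+ 2 by apply: divr_ge0; [exact: mulr_ge0|exact/exprn_ge0/ltW].
have e4 : 0 <= BK * B by rewrite mulr_ge0.
have M2 : 2 <= M by rewrite /M; lra.
have M8 : 8 / cE p <= M by rewrite /M; lra.
have kM : k1^-1 <= M by rewrite /M; lra.
have B2M : B * B / k1 ^+ 2 <= M by rewrite /M; lra.
have BM : B <= M by rewrite /M; lra.
have BKM : BK * B <= M by rewrite /M; lra.
have BdM : Bd <= M by rewrite /M; lra.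
have BqM : Bq <= M by rewrite /M; lra.
have BrM : Br <= M by rewrite /M; lra.
have M0 : 0 <= M by exact: le_trans M2.
have M1 : 1 <= M by apply: le_trans M2; rewrite ler1n.
exists (source_lip_const p M).
  by rewrite /source_lip_const mulr_ge0// !addr_ge0 ?mulr_ge0 ?exprn_ge0.
have Hae : {ae mu, forall x, [/\ `|cd p i x| <= Bd, `|cK p i x| <= BK,
    ((i.+1 < n)%N -> `|cq p i x| <= Bq) & ((i : nat) != 0%N -> `|cq p (ord_pred i) x| <= Br)]}.
  have H2 : {ae mu, forall x, ((i.+1 < n)%N -> `|cq p i x| <= Bq) /\
      ((i : nat) != 0%N -> `|cq p (ord_pred i) x| <= Br)}.
    by move: HBq HBr; apply: aeS2.
  by move: HBd HBK H2; apply: aeS3 => x a b [c d].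
move: Hae; apply: aeS => x [hd hK hqq hqr] t w w' tI.
have [_ [_ /(_ x)[q10 q20]]] := hp.
have [a1 [l1 /andP[b1 b2]]] := bd x.
have Dge r : 0 <= r <= T -> k1 <= denom p i x r.
  move=> rI; have /andP[y0 _] := yB x r rI; rewrite /denom.
  by apply: le_trans a1 _; rewrite lerDl mulr_ge0.
have Dpos r : 0 <= r <= T -> 0 < denom p i x r by move=> /Dge; exact: lt_le_trans.
have DM r : 0 <= r <= T -> (denom p i x r)^-1 <= M.
  move=> rI; apply: le_trans kM; rewrite lef_pV2 ?posrE//; [exact: Dge|exact: Dpos].
have Dlip r s : 0 <= r <= T -> 0 <= s <= T ->
    `|(denom p i x r)^-1 - (denom p i x s)^-1| <= M * `|r - s|.
  move=> rI sI; have r0 := Dpos r rI; have s0 := Dpos s sI.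
  have -> : (denom p i x r)^-1 - (denom p i x s)^-1 =
      (denom p i x s - denom p i x r) / (denom p i x r * denom p i x s).
    by field; rewrite !gt_eqF.
  rewrite normrM normfV (ger0_norm (mulr_ge0 (ltW r0) (ltW s0))).
  apply: (@le_trans _ _ (B * B / k1 ^+ 2 * `|r - s|)); last first.
    by rewrite ler_wpM2r.
  rewrite ler_pdivrMr ?mulr_gt0//.
  have -> : denom p i x s - denom p i x r = cb p i x * (cy p i x s - cy p i x r).
    by rewrite /denom; ring.
  apply: (@le_trans _ _ (B * (B * `|r - s|))).
    rewrite normrM (ger0_norm b1) (distrC r); apply: ler_pM => //; exact: ylip.
  rewrite (_ : B * B / k1 ^+ 2 * `|r - s| * (denom p i x r * denom p i x s) =
    B * (B * `|r - s|) * (denom p i x r * denom p i x s / k1 ^+ 2)); last by ring.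
  rewrite ler_peMr ?mulr_ge0// ler_pdivlMr ?exprn_gt0// mul1r expr2.
  by apply: ler_pM; rewrite ?(ltW k10)//; exact: Dge.
have yM r : 0 <= r <= T -> 0 <= cy p i x r <= M.
  by move=> rI; have /andP[-> h] := yB x r rI; exact: le_trans h BM.
have yl r s : 0 <= r <= T -> 0 <= s <= T -> `|cy p i x r - cy p i x s| <= M * `|r - s|.
  by move=> rI sI; apply: le_trans (ylip x r s rI sI) _; rewrite ler_wpM2r.
have cM : `|derive1 (cc p i) x| <= M by exact: le_trans (cB x) BM.
have KM : `|cK p i x * cb p i x| <= M.
  by rewrite normrM (ger0_norm b1); apply: le_trans BKM; exact: ler_pM.
have dM : `|cd p i x| <= M by exact: le_trans hd BdM.
have qM : (i.+1 < n)%N -> `|cq p i x| <= M.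
  by move=> /hqq h; exact: le_trans h BqM.
have qM' : (i : nat) != 0%N -> `|cq p (ord_pred i) x| <= M.
  by move=> /hqr h; exact: le_trans h BrM.
split.
- by apply: (@source_lip _ _ p i x T M).
- apply: (@source_dual _ _ p i x T M) => //; first exact: lt_le_trans l1.
  by apply: le_trans kM; rewrite lef_pV2 ?posrE//; exact: lt_le_trans l1.
- by apply: (@source_growth _ _ p i x T M).
- by move=> t' tI'; apply: (@source_time _ _ p i x T M).
Qed.

Lemma measurable_source i t w : 0 <= t <= T ->
  measurable_fun [set: R] (fun x => source_fun p i x t (fun j => w j x)).
Proof.
move=> tI; have [k [B [k1 [LC [[k10 bd cB yB ylip] [cD cyt cbc ccc]]]]]] := layer_at i.
have [hdK [hq _]] := h3; have [Ld LK] := hdK i.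
have mw j : measurable_fun [set: R] (w j : R -> R) by exact: measurable_L2.
have mD : measurable_fun [set: R] (fun x => (denom p i x t)^-1).
  apply: continuous_measurable_fun => x; apply: cvgV; last exact: cD.
  have [a1 [_ /andP[b1 _]]] := bd x; have /andP[y0 _] := yB x t tI.
  by rewrite gt_eqF// /denom; have := mulr_ge0 b1 y0; lra.
have mc : measurable_fun [set: R] (derive1 (cc p i)) by exact: continuous_measurable_fun.
have mb : measurable_fun [set: R] (cb p i) by exact: continuous_measurable_fun.
have my : measurable_fun [set: R] (fun x => cy p i x t).
  by apply: continuous_measurable_fun; exact: cyt.
have mg : measurable_fun [set: R] (fun x => arrhenius (cE p) (w i x)).
  by apply: measurableT_comp; [exact: measurable_arrhenius|exact: mw].
have mKK := measurable_Lfun LK; have md := measurable_Lfun Ld.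
have m1 := measurable_Lfun Lq1; have m2 := measurable_Lfun Lq2.
rewrite /source_fun; apply: measurable_funM => //.
apply: measurable_funD; first apply: measurable_funD; first apply: measurable_funD.
- by apply: measurable_funM => //; exact: measurableT_comp.
- apply: measurable_funM => //; apply: measurable_funM => //.
  apply: measurable_funD => //; apply: measurable_funM => //; exact: measurable_funM.
- have [i0|i0] := boolP ((i : nat) == 0%N).
    apply: measurable_funM; first exact: measurableT_comp.
    exact: measurable_funB.
  have ilt : ((ord_pred i).+1 < n)%N by rewrite (ord_predS i0) ltn_ord.
  apply: measurable_funM; last exact: measurable_funB.
  by apply: measurableT_comp => //; exact: measurable_Lfun (hq _ ilt).
have [ilast|ilast] := boolP (i.+1 == n).
  apply: measurable_funM; first exact: measurableT_comp.
  exact: measurable_funB.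
have ilt : (i.+1 < n)%N by rewrite ltn_neqAle ilast ltn_ord.
apply: measurable_funM; last exact: measurable_funB.
exact: measurable_Lfun (hq _ ilt).
Qed.

(** A total function: a component that is not square integrable is replaced by 0. [source_stateE]
    shows that this does not happen when the weighted norms are bounded in N. *)
Definition source_state t w : state R n :=
  fun i => toL2 (fun x => source_fun p i x t (fun j => w j x)).

Definition weighted_norm N w : R := state_norm (fun i => mulL2 (cut N) (w i)).

Lemma seminorm_weighted N : seminorm (weighted_norm N).
Proof.
split=> [u v|k u].
  apply: le_trans (snD sS (fun i => mulL2 (cut N) (u i)) (fun i => mulL2 (cut N) (v i))).
  rewrite /weighted_norm le_eqVlt; apply/orP; left; apply/eqP; congr state_norm.
  apply/funext => i; apply: L2ext => x.
  by rewrite (mulL2E (cut_bd N)) !L2addE !(mulL2E (cut_bd N)) mulrDr.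
rewrite /weighted_norm -(snZ sS); congr state_norm.
apply/funext => i; apply: L2ext => x.
by rewrite (mulL2E (cut_bd N)) !L2scaleE (mulL2E (cut_bd N)) mulrCA.
Qed.

Lemma weighted_bound N w K i : weighted_norm N w <= K -> L2norm (mulL2 (cut N) (w i)) <= K.
Proof. by apply: le_trans; exact: (le_state_norm (fun i => mulL2 (cut N) (w i))). Qed.

Definition mulq (f : L2 R) : L2 R := toL2 (fun x => q x * f x).

Lemma mulqP w K i : (forall N, weighted_norm N w <= K) ->
  (forall x, mulq (w i) x = q x * w i x) /\ L2norm (mulq (w i)) <= K.
Proof.
move=> H; have [L nK] := cutoff_limit mq q0 (fun N => weighted_bound i (H N)).
by split=> // x; rewrite /mulq toL2E.
Qed.

Lemma source_stateE t w K i : 0 <= t <= T -> (forall N, weighted_norm N w <= K) ->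
  forall x, source_state t w i x = source_fun p i x t (fun j => w j x).
Proof.
move=> tI H x; have [mE _] := mulqP i H; have [L0 L00 HL] := source_estimate i.
rewrite /source_state toL2E//.
apply: (@Lfun2_le _ _ (sum_abs w + absL2 (mulq (w i)) + absL2 qL) L0).
  exact: measurable_source.
move: HL; apply: aeS => {}x Hx; have [_ _ h _] := Hx t (fun j => w j x) (fun j => w j x) tI.
apply: le_trans h _; rewrite ler_wpM2l//; apply: le_trans (ler_norm _).
rewrite !L2addE sum_absE !absL2E mE qLE normrM (ger0_norm (q0 x)).
exact: lexx.
Qed.

Lemma source_exists t w K : 0 <= t <= T -> (forall N, weighted_norm N w <= K) ->
  is_source p t w (source_state t w).
Proof. by move=> tI H i; apply: aeW => x; exact: source_stateE H x. Qed.

Lemma weighted_norm_fin w w' K K' : (forall N, weighted_norm N w <= K') ->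
  (forall N, weighted_norm N (w - w') <= K) -> forall N, weighted_norm N w' <= K' + K.
Proof.
move=> H H' N; have -> : w' = w - (w - w') by rewrite opprB addrC subrK.
by apply: le_trans (snB (seminorm_weighted N) _ _) _; apply: lerD.
Qed.

Lemma source_state_lip : exists2 L, 0 <= L &
  [/\ forall t w w' K K', 0 <= t <= T -> (forall N, weighted_norm N w <= K') ->
        (forall N, weighted_norm N (w - w') <= K) ->
        state_norm (source_state t w - source_state t w') <= L * (state_norm (w - w') + K),
      forall t w K, 0 <= t <= T -> (forall N, weighted_norm N w <= K) ->
        state_norm (source_state t w) <= L * (1 + state_norm w + K) &
      forall t t' w K, 0 <= t <= T -> 0 <= t' <= T -> (forall N, weighted_norm N w <= K) ->
        state_norm (source_state t w - source_state t' w) <=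
        L * `|t - t'| * (1 + state_norm w + K)].
Proof.
have ex i : exists L0, 0 <= L0 /\ {ae mu, forall x, source_spec i L0 x}.
  by have [L0] := source_estimate i; exists L0.
have [L0 HL] := choice ex.
(* [n] bounds the sum over the layers, 1 the product of q with the layer at hand, and the norm of q
   the inhomogeneous term. *)
pose A : R := n%:R + 1 + L2norm qL.
have n0 : 0 <= n%:R :> R by exact: ler0n.
have nq := L2norm_ge0 qL.
have A0 : 0 <= A by rewrite !addr_ge0.
pose L := (\sum_i L0 i) * A.
have L0le i : L0 i <= \sum_i L0 i.
  by apply: (ler_sum_term (F := L0)) => j; case: (HL j).
have L00 i : 0 <= L0 i by case: (HL i).
have S0 : 0 <= \sum_i L0 i by apply: sumr_ge0.
have Lle i (a : R) X : 0 <= X -> a <= A * X -> L0 i * a <= L * X.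
  move=> X0 aX; rewrite /L -mulrA; apply: (@le_trans _ _ (L0 i * (A * X))).
    by rewrite ler_wpM2l.
  by rewrite ler_wpM2r ?mulr_ge0.
have pos w K : (forall N, weighted_norm N w <= K) -> 0 <= K.
  by move=> H; apply: le_trans (H 0%N); exact: state_norm_ge0.
have grow w K i : (forall N, weighted_norm N w <= K) ->
    L2norm (sum_abs w + absL2 (mulq (w i)) + absL2 qL) <= A * (1 + state_norm w + K).
  move=> H; have [_ nK] := mulqP i H; have K0 := pos w K H.
  apply: le_trans (snD sL _ _) _; apply: le_trans (lerD (snD sL _ _) (lexx _)) _.
  have a1 := sum_abs_norm w; have a2 := absL2_norm (mulq (w i)); have a3 := absL2_norm qL.
  have s0 := state_norm_ge0 w.
  have c1 : 0 <= n%:R * K by rewrite mulr_ge0.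
  have c2 : 0 <= L2norm qL * (state_norm w + K) by rewrite mulr_ge0// addr_ge0.
  rewrite /A; lra.
exists L; first by rewrite mulr_ge0.
split.
- move=> t w w' K K' tI Hw Hd; have K0 := pos _ _ Hd.
  have Hw' := weighted_norm_fin Hw Hd.
  have s0 := state_norm_ge0 (w - w').
  apply: state_norm_le => [|i]; first by rewrite !mulr_ge0// addr_ge0.
  have [mE nK] := mulqP i Hd.
  apply: (@le_trans _ _ (L0 i * L2norm (sum_abs (w - w') + absL2 (mulq ((w - w') i))))).
    apply: L2norm_le_ae => //; have [_] := HL i; apply: aeS => x Hx.
    have [h _ _ _] := Hx t (fun j => w j x) (fun j => w' j x) tI.
    rewrite (L2subE (source_state t w i) (source_state t w' i)).
    rewrite (source_stateE i tI Hw) (source_stateE i tI Hw').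
    apply: le_trans h _; rewrite ler_wpM2l//; apply: le_trans (ler_norm _).
    rewrite !L2addE sum_absE !absL2E mE normrM (ger0_norm (q0 x)).
    exact: lexx.
  apply: Lle; first by rewrite addr_ge0.
  apply: le_trans (snD sL _ _) _.
  have a1 := sum_abs_norm (w - w'); have a2 := absL2_norm (mulq ((w - w') i)).
  have c1 : 0 <= n%:R * K by rewrite mulr_ge0.
  have c2 : 0 <= L2norm qL * (state_norm (w - w') + K) by rewrite mulr_ge0// addr_ge0.
  rewrite /A; lra.
- move=> t w K tI Hw; have K0 := pos _ _ Hw; have s0 := state_norm_ge0 w.
  have X0 : 0 <= 1 + state_norm w + K by lra.
  apply: state_norm_le => [|i]; first by rewrite !mulr_ge0.
  have [mE nK] := mulqP i Hw.
  apply: le_trans (Lle i _ _ X0 (grow w K i Hw)).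
  apply: L2norm_le_ae => //; have [_] := HL i; apply: aeS => x Hx.
  have [_ _ h _] := Hx t (fun j => w j x) (fun j => w j x) tI.
  rewrite (source_stateE i tI Hw).
  apply: le_trans h _; rewrite ler_wpM2l//; apply: le_trans (ler_norm _).
  rewrite !L2addE sum_absE !absL2E mE qLE normrM (ger0_norm (q0 x)).
  exact: lexx.
move=> t t' w K tI tI' Hw; have K0 := pos _ _ Hw; have s0 := state_norm_ge0 w.
have X0 : 0 <= 1 + state_norm w + K by lra.
apply: state_norm_le => [|i]; first by rewrite !mulr_ge0.
have [mE nK] := mulqP i Hw.
rewrite mulrAC; apply: le_trans (ler_wpM2r (normr_ge0 (t - t')) (Lle i _ _ X0 (grow w K i Hw))).
rewrite mulrAC; apply: L2norm_le_ae; first by rewrite mulr_ge0.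
have [_] := HL i; apply: aeS => x Hx.
have [_ _ _ h] := Hx t (fun j => w j x) (fun j => w j x) tI.
rewrite (L2subE (source_state t w i) (source_state t' w i)).
rewrite (source_stateE i tI Hw) (source_stateE i tI' Hw).
apply: le_trans (h t' tI') _; rewrite ler_wpM2l ?mulr_ge0//; apply: le_trans (ler_norm _).
rewrite !L2addE sum_absE !absL2E mE qLE normrM (ger0_norm (q0 x)).
exact: lexx.
Qed.

Lemma evol_state_bounds : exists2 C, 0 <= C &
  [/\ forall i t s f, 0 <= s -> s <= t <= T -> L2norm (U i t s f) <= C * L2norm f,
      forall i N t s f, 0 <= s -> s < t <= T ->
        L2norm (mulL2 (cut N) (U i t s f)) <= C * isqrt (t - s) * L2norm f &
      forall i t s w w' (v v' : state R n), 0 <= s -> s < t <= T ->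
        is_source p s w v -> is_source p s w' v' ->
        L2norm (U i t s (v i - v' i)) <= C * isqrt (t - s) * state_norm (w - w')].
Proof.
have n0 : 0 <= n%:R :> R by exact: ler0n.
have nq := L2norm_ge0 qL.
have ex i : exists C, 0 <= C /\
  [/\ forall t s f, 0 <= s -> s <= t <= T -> L2norm (U i t s f) <= C * L2norm f,
      forall N t s f, 0 <= s -> s < t <= T ->
        L2norm (mulL2 (cut N) (U i t s f)) <= C * isqrt (t - s) * L2norm f &
      forall t s w w' (v v' : state R n), 0 <= s -> s < t <= T ->
        is_source p s w v -> is_source p s w' v' ->
        L2norm (U i t s (v i - v' i)) <= C * isqrt (t - s) * state_norm (w - w')].
  have [k [B [k1 [LC _]]]] := layer_at i; have [L0 L00 HL] := source_estimate i.
  have HU := hU i.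
  pose C1 := Num.sqrt (growth T k B * B / k).
  pose C2 := mul_rate T k B * L2norm qL.
  (* The dual smoothing constant times the Lipschitz constant of m f from L^2 to H^-1, which is
     [L0 * (n%:R + L2norm qL)] by [dot_H1_bound]. *)
  pose C3 := Num.sqrt (2 * growth T k B / k) * (L0 * (n%:R + L2norm qL)).
  have C10 : 0 <= C1 by exact: sqrtr_ge0.
  have C20 : 0 <= C2 by rewrite mulr_ge0// mul_rate_ge0.
  have C30 : 0 <= C3 by rewrite !mulr_ge0 ?sqrtr_ge0// addr_ge0.
  exists (C1 + C2 + C3); split; first by rewrite !addr_ge0.
  split=> [t s f s0 tI|N t s f s0 tI|t s w w' v v' s0 tI Hv Hv'].
  - apply: le_trans (evol_le LC HU f s0 tI) _; rewrite ler_wpM2r ?L2norm_ge0//.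
    by rewrite -/C1; lra.
  - apply: le_trans (evol_mul_le LC HU f s0 tI (cut_bd N) (cut_le N)) _.
    rewrite ler_wpM2r ?L2norm_ge0// mulrAC ler_wpM2r ?isqrt_ge0//.
    by rewrite -/C2; lra.
  have sI : 0 <= s <= T by lra.
  pose K := L0 * ((n%:R + L2norm qL) * state_norm (w - w')).
  have K0 : 0 <= K by rewrite !mulr_ge0 ?addr_ge0 ?state_norm_ge0.
  have h := @evol_dual_le _ _ _ _ _ _ _ _ _ LC HU t s (v i - v' i) K s0 tI K0.
  apply: le_trans (h _) _ => [f df wf|]; last first.
    rewrite (_ : _ * K = C3 * (isqrt (t - s) * state_norm (w - w'))); last by rewrite /C3 /K; ring.
    rewrite -mulrA ler_wpM2r ?mulr_ge0 ?isqrt_ge0 ?state_norm_ge0//; lra.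
  have lm := lc_m LC sI.
  apply: le_trans (dot_H1_bound (v := sum_abs (w - w')) (q := qL) (w := (w - w') i) wf L00 _) _.
    move: (Hv i) (Hv' i) HL; apply: aeS3 => x e1 e2 Hx.
    have [_ h' _ _] := Hx s (fun j => w j x) (fun j => w' j x) sI.
    rewrite (mulL2E lm) L2subE e1 e2; apply: le_trans h' _; rewrite ler_wpM2l//.
    by rewrite sum_absE qLE (ger0_norm (q0 x)); apply: lerD; [exact: ler_norm|exact: lexx].
  rewrite /K mulrAC -[leRHS]mulrA; rewrite -mulrA ler_wpM2l//.
  rewrite ler_wpM2r ?addr_ge0 ?L2norm_ge0// mulrDl; apply: lerD; first exact: sum_abs_norm.
  by rewrite ler_wpM2l// (le_state_norm (w - w')).
have [C HC] := choice ex.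
have C0 i : 0 <= C i by case: (HC i).
have Cle i : C i <= \sum_i C i by apply: (ler_sum_term (F := C)).
exists (\sum_i C i); first exact: sumr_ge0.
split=> [i t s f s0 tI|i N t s f s0 tI|i t s w w' v v' s0 tI Hv Hv'].
- have [_ [h _ _]] := HC i; apply: le_trans (h t s f s0 tI) _.
  by rewrite ler_wpM2r ?L2norm_ge0.
- have [_ [_ h _]] := HC i; apply: le_trans (h N t s f s0 tI) _.
  by rewrite ler_wpM2r ?L2norm_ge0// ler_wpM2r ?isqrt_ge0.
have [_ [_ _ h]] := HC i; apply: le_trans (h t s w w' v v' s0 tI Hv Hv') _.
by rewrite ler_wpM2r ?state_norm_ge0// ler_wpM2r ?isqrt_ge0.
Qed.

Lemma mild_local (phi : state R n) : exists S, 0 < S <= T /\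
  exists u : R -> state R n, mild_solution (@state_norm R n) (evol_state U) (is_source p) phi S u /\
    forall v : R -> state R n, mild_solution (@state_norm R n) (evol_state U) (is_source p) phi S v ->
      forall t, 0 <= t <= S -> state_norm (v t - u t) = 0.
Proof.
have [L L0 [Llip Lgrow Ltime]] := source_state_lip.
have [C C0 [Cle Cmul Cdual]] := evol_state_bounds.
have tri t s : 0 <= s -> s <= t <= T -> triangle T (t, s) by rewrite /triangle/=; lra.
apply: (@mild_solution_exists_unique R _ (@state_norm R n) T C L (evol_state U)
  weighted_norm source_state (is_source p) phi sS (@state_complete R n) hT C0 L0).
- move=> t s k u v s0 tI; apply/state_norm0P => i.
  exact: (evol_linear (hU i) (tri t s s0 tI)).
- move=> t s v s0 tI; apply: state_norm_le => [|i].
    by rewrite mulr_ge0 ?state_norm_ge0.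
  by apply: le_trans (Cle i t s (v i) s0 tI) _; rewrite ler_wpM2l// le_state_norm.
- move=> v pt At; apply/cvgrPdist_lt => e e0.
  have e2 : 0 < e / 2 by rewrite divr_gt0.
  have : \forall y \near within (triangle T) (nbhs pt), forall i,
      L2norm (U i y.1 y.2 (v i) - U i pt.1 pt.2 (v i)) < e / 2.
    apply: filter_forall => i.
    have /cvgrPdist_lt/(_ _ e2) := evol_continuous (hU i) (v i) At.
    by apply: filterS => y; rewrite sub0r normrN; apply: le_lt_trans; exact: ler_norm.
  apply: filterS => y Hy; rewrite sub0r normrN ger0_norm ?state_norm_ge0//.
  apply: (@le_lt_trans _ _ (e / 2)); last by lra.
  by apply: state_norm_le => [|i]; [exact: ltW|exact/ltW/Hy].
- move=> t v tI; apply/state_norm0P => i; exact: (evol_id (hU i) _ tI).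
- move=> t s r v r0 rs st tT; apply/state_norm0P => i.
  exact: (evol_comp (hU i) _ r0 rs st tT).
- exact: seminorm_weighted.
- move=> N; exists N%:R => // v; apply: state_norm_le => [|i].
    by rewrite mulr_ge0 ?state_norm_ge0.
  apply: le_trans (mulL2_norm (cut_bd N) _) _.
  by rewrite ler_wpM2l// le_state_norm.
- move=> N t s v s0 tI; apply: state_norm_le => [|i].
    by rewrite !mulr_ge0 ?isqrt_ge0 ?state_norm_ge0.
  apply: le_trans (Cmul i N t s (v i) s0 tI) _.
  by rewrite ler_wpM2l ?mulr_ge0 ?isqrt_ge0// le_state_norm.
- move=> t s v e s0 tI e0.
  pose P i d := forall t', s < t' <= T -> `|t' - t| < d -> forall N,
      L2norm (mulL2 (cut N) (U i t' s (v i) - U i t s (v i))) <= e.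
  have [||d d0 Hd] := @common_radius _ _ P.
  + by move=> i d d' dd' H t' tI' td' N; apply: H => //; exact: lt_le_trans dd'.
  + move=> i; have [k [B [k1 [LC _]]]] := layer_at i.
    have [d d0 Hd] := evol_mul_continuous LC (hU i) qL (v i) s0 tI e0.
    by exists d => // t' tI' td' N; exact: Hd tI' td' _ _ (cut_bd N) (cut_le N).
  exists d => // t' tI' td' N; apply: state_norm_le => [|i]; first exact: ltW.
  exact: Hd.
- by move=> t v K tI H; exact: source_exists H.
- by move=> t v v' K K' tI H H'; exact: Llip H H'.
- by move=> t v K tI H; exact: Lgrow.
- by move=> t t' v K tI tI' H; exact: Ltime.
- move=> t v w w' Hv /state_norm0P H i; move: (Hv i) (H i); apply: aeS2 => x e1 e2.
  by rewrite -(e2 I) e1.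
- move=> t s v v' w w' s0 tI Hw Hw'; apply: state_norm_le => [|i].
    by rewrite !mulr_ge0 ?isqrt_ge0 ?state_norm_ge0.
  exact: (Cdual i t s v v' w w' s0 tI Hw Hw').
Qed.

Lemma mild_solutionP (phi : state R n) S (u : R -> state R n) :
  is_mild_solution p U phi S u <->
  mild_solution (@state_norm R n) (evol_state U) (is_source p) phi S u.
Proof.
split=> -[cu [F [HF H]]]; split=> //; exists F; split=> // t tI.
  have [v Hv E] := H t tI; exists v => //; exact/state_norm0P.
by have [v Hv /state_norm0P E] := H t tI; exists v.
Qed.

End Application.

Theorem theorem1p2 (R : realType) (n : nat) (hn : (2 <= n)%N)
    (T : R) (hT : 0 < T) (p : coefficients R n)
    (hp : coeff_nonneg p) (hE : 0 < cE p)
    (h1 : hypH1 p) (h2 : hypH2 T p) (h3 : hypH3 p)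
    (U : 'I_n -> R -> R -> L2 R -> L2 R)
    (hU : forall i, is_evolution T (Gop p i) (U i))
    (phi : state R n) :
  exists T' : R, 0 < T' <= T /\
    exists u : R -> state R n,
      is_mild_solution p U phi T' u /\
      forall v : R -> state R n, is_mild_solution p U phi T' v ->
        forall t : R, 0 <= t <= T' -> forall i, v t i =L2 u t i.
Proof.
have [S [ST [u [Hu uniq]]]] := mild_local hT hp hE h1 h2 h3 hU phi.
exists S; split=> //; exists u; split; first exact/mild_solutionP.
move=> v /mild_solutionP Hv t tS; apply/state_norm0P; exact: uniq.
Qed.
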